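(* Let $h\ge 0$ be an integer and let $\{u_n\}$ be an increasing sequence of positive numbers such that $$\lim_{n\to\infty}u_n=\lim_{n\to\infty}n\overline F(u_n)=+\infty ,$$ and such that there exists $\eta>0$ with $\lim_{n\to\infty}\log^{1+\eta}(n)\,\overline F(u_n)=0$. Suppose that the drift assumption (D) defined in the context holds, with this sequence $\{u_n\}$. Let $q\ge 0$ and assume moreover that either $q=0$, or there exists $\delta>0$ such that $q(2+\delta)\le q_0$ and $$\lim_{n\to\infty}\frac{\log^{1+\eta}(n)}{\{n\overline F(u_n)\}^{\delta/2}}=0 .$$ Then $\mathbb M_n\to\mathbb M$ in the sense of finite-dimensional distributions on $\mathcal L_q$, i.e. for every $m\ge1$ and all $\phi_1,\dots,\phi_m\in\mathcal L_q$, $(\mathbb M_n(\phi_1),\dots,\mathbb M_n(\phi_m))$ converges in distribution to $(\mathbb M(\phi_1),\dots,\mathbb M(\phi_m))$, where $\mathbb M$ is the centered Gaussian process with covariance function $C$ defined in the context.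
   Context: **Notation.** For a sequence $\boldsymbol x=(x_j)_{j\in\mathbb Z}$ and $a\le b$, $\boldsymbol x_{a,b}=(x_a,\dots,x_b)$. $|\cdot|$ is a norm on $\mathbb R^{h+1}$. $F$ is the distribution function of $X_0$ and $\overline F=1-F$. **Regular variation.** A strictly stationary real sequence $\{X_j,j\in\mathbb Z\}$ is regularly varying with tail index $\alpha>0$ if for each integer $i\ge0$ there is a nonzero Radon measure $\boldsymbol\nu_{0,i}$ on $\overline{\mathbb R}^{i+1}\setminus\{\boldsymbol 0\}$ (the exponent measure of $(X_0,\dots,X_i)$), with $\boldsymbol\nu_{0,i}(\overline{\mathbb R}^{i+1}\setminus\mathbb R^{i+1})=0$, such that $\lim_{x\to\infty}\mathbb P((X_0,\dots,X_i)\in xA)/\mathbb P(X_0>x)=\boldsymbol\nu_{0,i}(A)$ for all relatively compact sets $A\subset\overline{\mathbb R}^{i+1}\setminus\{\boldsymbol 0\}$ with $\boldsymbol\nu_{0,i}(\partial A)=0$; $\boldsymbol\nu_{0,i}$ is homogeneous of index $-\alpha$: $\boldsymbol\nu_{0,i}(tA)=t^{-\alpha}\boldsymbol\nu_{0,i}(A)$. **Drift assumption (D).** $\{\mathbb Y_j\}$ is a Markov chain with values in a measurable space $(E,\mathcal E)$, $g:E\to\mathbb R$ is measurable, $X_j=g(\mathbb Y_j)$, and: (i) $\{\mathbb Y_j,j\in\mathbb Z\}$ is strictly stationary under $\mathbb P$; (ii) $\{X_j,j\in\mathbb Z\}$ is regularly varying with tail index $\alpha>0$; (iii) there exist a measurable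 $V:E\to[1,\infty)$, $\gamma\in(0,1)$ and $b>0$ such that $\mathbb E[V(\mathbb Y_1)\mid\mathbb Y_0=y]\le\gamma V(y)+b$ for all $y\in E$; (iv) there exist an integer $m\ge1$ and $x_0\ge1$ such that for all $x\ge x_0$ there exist a probability measure $\nu$ on $(E,\mathcal E)$ and $\epsilon>0$ such that $\mathbb P(\mathbb Y_m\in B\mid\mathbb Y_0=y)\ge\epsilon\nu(B)$ for all $y\in\{V\le x\}$ and all $B\in\mathcal E$; (v) there exist $q_0\in(0,\alpha)$ and $c>0$ such that $|g|^{q_0}\le cV$; (vi) for every $s>0$, $\limsup_{n\to\infty}\frac{1}{u_n^{q_0}\overline F(u_n)}\mathbb E\left[V(\mathbb Y_0)\mathbf 1\{|g(\mathbb Y_0)|>u_ns\}\right]<\infty$. **The spaces $\mathcal L_q$.** For $q\ge0$, $\mathcal L_q$ is the space of measurable $\phi:\mathbb R^{h+1}\to\mathbb R$ such that (a) there is $\epsilon>0$ with $|\phi(\boldsymbol x)|\le\epsilon^{-1}(|\boldsymbol x|^q\vee1)\mathbf 1\{|\boldsymbol x|>\epsilon\}$ for all $\boldsymbol x\in\mathbb R^{h+1}$; (b) for all $j\ge0$, the function $\boldsymbol x_{0,j+h}\mapsto\phi(\boldsymbol x_{j,j+h})$ is almost surely continuous with respect to $\boldsymbol\nu_{0,j+h}$. **Processes.** $M_n(\phi)=\frac1{n\overline F(u_n)}\sum_{j=1}^n\phi((X_j,\dots,X_{j+h})/u_n)$ and $\mathbb M_n(\phi)=\sqrt{n\overline F(u_n)}\{M_n(\phi)-\mathbb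 E[M_n(\phi)]\}$. For $\phi,\phi'\in\mathcal L_{q_0/2}$, $$\sigma^2(\phi)=\int_{\mathbb R^{h+1}}\phi^2(\boldsymbol x)\boldsymbol\nu_{0,h}(\mathrm d\boldsymbol x)+2\sum_{j=1}^\infty\int_{\mathbb R^{j+h+1}}\phi(\boldsymbol x_{0,h})\phi(\boldsymbol x_{j,j+h})\boldsymbol\nu_{0,j+h}(\mathrm d\boldsymbol x),$$ $$C(\phi,\phi')=\tfrac12\{\sigma^2(\phi+\phi')-\sigma^2(\phi)-\sigma^2(\phi')\}$$ (the series converge absolutely under (D)), and $\mathbb M$ is a centered Gaussian process indexed by $\mathcal L_{q_0/2}$ with covariance function $C$. *)

(* Defs.v *)
From HB Require Import structures.
From mathcomp Require Import all_boot all_order all_algebra.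
From mathcomp Require Import all_classical all_reals all_analysis.

Set Implicit Arguments.
Unset Strict Implicit.
Unset Printing Implicit Defensive.

Import Order.TTheory GRing.Theory Num.Theory.
Import numFieldNormedType.Exports.

Local Open Scope classical_set_scope.
Local Open Scope ring_scope.

Definition borel_rV (R : realType) (n : nat) :=
  g_sigma_algebraType (@open 'rV[R]_n).

Record is_norm (R : realType) (n : nat) (N : 'rV[R]_n -> R) : Prop := IsNorm {
  norm_separated : forall x, N x = 0 -> x = 0;
  norm_homogeneous : forall (a : R) x, N (a *: x) = `|a| * N x;
  norm_triangle : forall x y, N (x + y) <= N x + N y }.

(* [window a h x] is (x_a, ..., x_{a+h}); it is used only when a + h <= i. *)
Definition window (R : realType) (i a h : nat) (x : 'rV[R]_i.+1) :
  'rV[R]_h.+1 := \row_(k < h.+1) x 0 (inord (a + k)).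

(* \bar R^{i+1} \ {0}, the space on which exponent measures live. *)
Definition punctured (R : realType) (i : nat) : Type :=
  set_type [set x : 'rV[\bar R]_i.+1 | exists k, x 0 k != 0%E].

HB.instance Definition _ (R : realType) (i : nat) :=
  Topological.copy (punctured R i)
    (set_type [set x : 'rV[\bar R]_i.+1 | exists k, x 0 k != 0%E]).

Lemma punctured_point_subproof (R : realType) (i : nat) :
  (const_mx 1%E : 'rV[\bar R]_i.+1) \in
    [set x : 'rV[\bar R]_i.+1 | exists k, x 0 k != 0%E].
Proof. by apply/mem_set; exists ord0; rewrite mxE onee_neq0. Qed.

HB.instance Definition _ (R : realType) (i : nat) :=
  isPointed.Build (punctured R i)
    (exist _ (const_mx 1%E) (punctured_point_subproof R i)).

Definition coords (R : realType) (i : nat) (x : punctured R i) :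
  'rV[\bar R]_i.+1 := set_val x.

Definition borel_punctured (R : realType) (i : nat) :=
  g_sigma_algebraType (@open (punctured R i)).

Definition finite_points (R : realType) (i : nat) : set (punctured R i) :=
  [set x | forall k, coords x ord0 k \is a fin_num].

(* Meaningful on [finite_points] only: [fine] sends infinities to 0. *)
Definition real_coords (R : realType) (i : nat) (x : punctured R i) :
  'rV[R]_i.+1 := map_mx fine (coords x).

Definition dilation (R : realType) (i : nat) (t : R) (A : set (punctured R i)) :
  set (punctured R i) :=
  [set y | exists2 a, A a & forall k, coords y ord0 k = (t%:E * coords a ord0 k)%E].

Definition radon (R : realType) (i : nat)
    (nu : {measure set (borel_punctured R i) -> \bar R}) : Prop :=
  forall K : set (punctured R i), compact K -> (nu K < +oo)%E.

Definition strictly_stationary (R : realType) (dO : measure_display)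
    (Omega : measurableType dO) (P : probability Omega R)
    (dT : measure_display) (T : measurableType dT)
    (Z : int -> {RV P >-> T}) : Prop :=
  forall (n : nat) (j : n.-tuple int) (t : int) (B : set (n.-tuple T)),
    measurable B ->
    P [set w | B [tuple Z (tnth j k + t) w | k < n]] =
    P [set w | B [tuple Z (tnth j k) w | k < n]].

Definition markov_chain (R : realType) (dO : measure_display)
    (Omega : measurableType dO) (P : probability Omega R)
    (dE : measure_display) (E : measurableType dE)
    (Pi : R.-pker E ~> E) (Y : int -> {RV P >-> E}) : Prop :=
  forall (n : int) (A : set Omega) (B : set E),
    <<s \bigcup_(j in [set j : int | j <= n])
          preimage_set_system setT (Y j) measurable >> A ->
    measurable B ->
    P (A `&` Y (n + 1) @^-1` B) = (\int[P]_(w in A) Pi (Y n w) B)%E.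

(* P(Y_m \in B | Y_0 = y), taken from the transition kernel so that it is
   defined for every y and not only almost everywhere. *)
Fixpoint kernel_iter (R : realType) (dE : measure_display)
    (E : measurableType dE) (Pi : R.-pker E ~> E) (m : nat) (y : E)
    (B : set E) : \bar R :=
  if m is m'.+1 then (\int[Pi y]_z kernel_iter Pi m' z B)%E else \d_y B.

Definition survival (R : realType) (dO : measure_display)
    (Omega : measurableType dO) (P : probability Omega R)
    (X : int -> {RV P >-> R}) (x : R) : R := fine (ccdf (X 0) x).

Definition block (R : realType) (dO : measure_display)
    (Omega : measurableType dO) (P : probability Omega R)
    (X : int -> {RV P >-> R}) (h : nat) (j : int) (w : Omega) : 'rV[R]_h.+1 :=
  \row_(k < h.+1) X (j + (k : nat)%:Z) w.

(* [nu i] is the exponent measure of (X_0, ..., X_i). *)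
Record regularly_varying (R : realType) (dO : measure_display)
    (Omega : measurableType dO) (P : probability Omega R)
    (X : int -> {RV P >-> R}) (alpha : R)
    (nu : forall i, {measure set (borel_punctured R i) -> \bar R}) : Prop :=
  RegularlyVarying {
  rv_stationary : strictly_stationary X;
  rv_index_gt0 : 0 < alpha;
  rv_radon : forall i, radon (nu i);
  rv_nonzero : forall i, nu i setT <> 0%E;
  rv_infinity : forall i, nu i (~` @finite_points R i) = 0%E;
  rv_limit : forall (i : nat) (A : set (borel_punctured R i)),
    measurable A -> precompact (A : set (punctured R i)) ->
    nu i (closure (A : set (punctured R i)) `\`
          interior (A : set (punctured R i))) = 0%E ->
    (fine (P [set w | exists2 y, dilation x A y &
                coords y = map_mx EFin (block X i 0 w)])
       / survival X x)%:E @[x --> +oo] --> nu i A;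
  rv_homogeneous : forall (i : nat) (A : set (borel_punctured R i)) (t : R),
    measurable A -> 0 < t ->
    nu i (dilation t A) = ((t `^ (- alpha))%:E * nu i A)%E }.

Record drift_assumption (R : realType) (dO : measure_display)
    (Omega : measurableType dO) (P : probability Omega R)
    (dE : measure_display) (E : measurableType dE)
    (Pi : R.-pker E ~> E) (Y : int -> {RV P >-> E}) (g : {mfun E >-> R})
    (X : int -> {RV P >-> R}) (alpha : R)
    (nu : forall i, {measure set (borel_punctured R i) -> \bar R})
    (V : {mfun E >-> R}) (q0 : R) (u : nat -> R) : Prop := DriftAssumption {
  drift_markov : markov_chain Pi Y;
  drift_observable : forall j w, X j w = g (Y j w);
  drift_stationary : strictly_stationary Y;
  drift_regvar : regularly_varying X alpha nu;
  drift_V_ge1 : forall y, 1 <= V y;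
  drift_condition : exists gamma b : R, [/\ 0 < gamma < 1, 0 < b &
    forall y, (\int[Pi y]_z (V z)%:E <= (gamma * V y + b)%:E)%E];
  drift_small_sets : exists (m : nat) (x0 : R), [/\ (1 <= m)%N, 1 <= x0 &
    forall x, x0 <= x -> exists (mu : probability E R) (eps : R), 0 < eps /\
      forall (y : E) (B : set E), V y <= x -> measurable B ->
        (eps%:E * mu B <= kernel_iter Pi m y B)%E];
  drift_q0 : 0 < q0 < alpha;
  drift_domination : exists2 c : R, 0 < c &
    forall y, `|g y| `^ q0 <= c * V y;
  drift_limsup : forall s : R, 0 < s ->
    (limn_esup (fun n => ((u n `^ q0 * survival X (u n))^-1)%:E *
       'E_P[fun w => (V (Y 0 w) *
               \1_[set y | (`|g y| > u n * s)%R] (Y 0 w))%R]) < +oo)%E }.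

(* Condition (b): the discontinuity set of x_{0,j+h} |-> phi(x_{j,j+h}) on
   R^{j+h+1} is null for the exponent measure of (X_0, ..., X_{j+h}). *)
Record calL (R : realType) (h : nat)
    (nu : forall i, {measure set (borel_punctured R i) -> \bar R})
    (N : 'rV[R]_h.+1 -> R) (q : R) (phi : 'rV[R]_h.+1 -> R) : Prop :=
  InCalL {
  calL_measurable : measurable_fun setT (phi : borel_rV R h.+1 -> R);
  calL_growth : exists2 eps : R, 0 < eps &
    forall x, `|phi x| <=
      eps^-1 * Num.max (N x `^ q) 1 * (if eps < N x then 1 else 0);
  calL_continuity : forall j : nat,
    {ae nu (j + h)%N, forall x : punctured R (j + h), finite_points x ->
      {for real_coords x,
        continuous (fun z : 'rV[R]_(j + h).+1 => phi (window j h z))}} }.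

Definition tail_average (R : realType) (dO : measure_display)
    (Omega : measurableType dO) (P : probability Omega R)
    (X : int -> {RV P >-> R}) (u : nat -> R) (h : nat)
    (phi : 'rV[R]_h.+1 -> R) (n : nat) (w : Omega) : R :=
  (n%:R * survival X (u n))^-1 *
  \sum_(1 <= j < n.+1) phi ((u n)^-1 *: block X h j%:Z w).

Definition tail_process (R : realType) (dO : measure_display)
    (Omega : measurableType dO) (P : probability Omega R)
    (X : int -> {RV P >-> R}) (u : nat -> R) (h : nat)
    (phi : 'rV[R]_h.+1 -> R) (n : nat) (w : Omega) : R :=
  Num.sqrt (n%:R * survival X (u n)) *
  (tail_average X u phi n w - fine 'E_P[tail_average X u phi n]).

Definition sigma2 (R : realType) (h : nat)
    (nu : forall i, {measure set (borel_punctured R i) -> \bar R})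
    (phi : 'rV[R]_h.+1 -> R) : R :=
  (\int[nu h]_(x in @finite_points R h) (phi (real_coords x)) ^+ 2) +
  2 * \big[+%R/0]_(1 <= j <oo)
    (\int[nu (j + h)%N]_(x in @finite_points R (j + h)%N)
       (phi (window 0 h (real_coords x)) * phi (window j h (real_coords x)))).

Definition limit_cov (R : realType) (h : nat)
    (nu : forall i, {measure set (borel_punctured R i) -> \bar R})
    (phi psi : 'rV[R]_h.+1 -> R) : R :=
  2^-1 * (sigma2 nu (phi \+ psi) - sigma2 nu phi - sigma2 nu psi).

(* [normal_prob m 0] is not the Dirac mass at m in the library, hence the
   separate treatment of degenerate Gaussian variables. *)
Definition gaussian (R : realType) (dO : measure_display)
    (Omega : measurableType dO) (P : probability Omega R) (Z : Omega -> R) :=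
  exists m s : R, 0 <= s /\ forall A : set R, measurable A ->
    P (Z @^-1` A) = if s == 0 then \d_m A else normal_prob m s A.

Record centered_gaussian_process (R : realType) (dO : measure_display)
    (Omega : measurableType dO) (P : probability Omega R) (T : Type)
    (L : set T) (C : T -> T -> R) (M : T -> {RV P >-> R}) : Prop :=
  CenteredGaussianProcess {
  cgp_gaussian : forall (m : nat) (t : 'I_m -> T) (a : 'I_m -> R),
    (forall k, L (t k)) -> gaussian P (fun w => \sum_k a k * M (t k) w);
  cgp_centered : forall t, L t -> 'E_P[M t]%E = 0%E;
  cgp_covariance : forall s t, L s -> L t ->
    covariance P (M s) (M t) = (C s t)%:E }.

Definition cvg_in_distribution (R : realType)
    (dO : measure_display) (Omega : measurableType dO)
    (P : probability Omega R) (dO' : measure_display)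
    (Omega' : measurableType dO') (P' : probability Omega' R) (m : nat)
    (Z : nat -> Omega -> 'rV[R]_m) (Zlim : Omega' -> 'rV[R]_m) : Prop :=
  forall f : 'rV[R]_m -> R, continuous f ->
    (exists K : R, forall x, `|f x| <= K) ->
    'E_P[f \o Z n]%E @[n --> \oo] --> 'E_P'[f \o Zlim]%E.

(* Main.v *)
Require Import Defs.
From HB Require Import structures.
From mathcomp Require Import all_boot all_order all_algebra.
From mathcomp Require Import all_classical all_reals all_analysis.
From mathcomp Require Import measurable_realfun zify ring lra.

(** The proof is Lindeberg's: it follows characteristic functions along the sum,
    one term at a time.

    Put [F n = P (X_0 > u n)], and let [xi j] be the test function at the scaled
    block that starts at time [j + 1]. Three facts about the array [xi] carry
    the theorem.

    First, exceedances cluster geometrically: [E |xi i xi j|] is of order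
    [rho ^ |i - j| F n + F n ^ 2] ([EE_block_phi_prod]), and the squares of the
    [xi j] are uniformly integrable relative to [F n]
    ([block_phi_uniform_integrability]); the growth of the test functions, of
    order [q] with [q (2 + delta) <= q0], together with the moment bound on the
    weight above the level [u n], gives moments of order [2 + delta].

    Secondly, the array is mixing at a geometric rate, uniformly in [n]
    ([single_mixing], [pair_mixing]). Drift and minorization imply, by the
    argument of Hairer and Mattingly, that the transition operator contracts
    oscillations weighted by [V] ([harris_contraction]); by Jensen's inequality
    the same holds for the square root of [V], which is the weight suited to a
    single block. The Markov property then makes a function of the future
    almost independent of a function of the past. The mixing error over a gap
    of length [K log n] is below any given power of [n], while [K log n * F n]
    tends to 0 by assumption.

    Thirdly, [E (xi 0 * xi d) / F n] converges to the [d]-th term of the series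
    that defines the limit variance ([pair_limit]). For level sets with null
    boundary this is regular variation; layer cakes, null levels and uniform
    integrability extend it to functions that are almost everywhere continuous
    ([exponent_expectation]). The discontinuities of the first block of a longer
    vector are negligible because exponent measures have consistent marginals
    ([marginal_measure]).

    Let [S k] be the normalized sum of [k] terms. Expanding [cos (S (k + 1) + c)]
    around a sum that stops before a gap, the first order term is a mixing error
    and the second order term factorizes, so that [E cos (S (k + 1) + c)] is
    [(1 - t n / n) * E cos (S k + c)] up to [o (1 / n)], where [t n] tends to half
    of the limit variance ([cos_psum_recursion], [sequential_clt]). Hence
    [E cos (S n + c)] tends to [expR (- sigma2 / 2) * cos c]. The same limit for
    linear combinations of test functions, and the value of the Gaussian
    characteristic function, found by integration by parts, give convergence
    of all cosines of linear forms. Second moments are bounded, and on a box a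
    continuous function is approximated by trigonometric polynomials of
    Bernstein type, so this is convergence in distribution
    ([cvg_expectation_of_cos]). *)

Set Implicit Arguments.
Unset Strict Implicit.
Unset Printing Implicit Defensive.

Import Order.TTheory GRing.Theory Num.Theory.
Import numFieldNormedType.Exports.

Local Open Scope classical_set_scope.
Local Open Scope ring_scope.

(** * Expectations of real random variables *)

Section expectation_toolkit.
Context {d} {T : measurableType d} {R : realType} (P : probability T R).
Implicit Types f g : T -> R.

(** Integrability of a real function; the operator [E] of the proofs is the
    real-valued integral [Rintegral], linear on such functions. *)
Definition intg f := P.-integrable setT (EFin \o f).

Lemma intg_measurable f : intg f -> measurable_fun setT f.
Proof. by move/measurable_int/measurable_EFinP. Qed.

Lemma intg_le f g : measurable_fun setT f -> (forall w, `|f w| <= `|g w|) ->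
  intg g -> intg f.
Proof.
move=> mf fg; apply: le_integrable => //; first exact/measurable_EFinP.
by move=> w _; rewrite /= lee_fin.
Qed.

Lemma intg_le0 f g : measurable_fun setT f -> (forall w, `|f w| <= g w) ->
  intg g -> intg f.
Proof.
by move=> mf fg; apply: intg_le => // w; exact: le_trans (fg w) (ler_norm _).
Qed.

Lemma intg_bounded f M : measurable_fun setT f -> (forall w, `|f w| <= M) ->
  intg f.
Proof.
move=> mf fM; apply: (@intg_le0 f (cst M)) => //.
exact: finite_measure_integrable_cst.
Qed.

Lemma intg_cst (c : R) : intg (fun=> c).
Proof. exact: finite_measure_integrable_cst. Qed.

Lemma intgD f g : intg f -> intg g -> intg (fun w => f w + g w).
Proof.
move=> h1 h2; apply: eq_integrable (integrableD measurableT h1 h2) => //.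
Qed.

Lemma intgB f g : intg f -> intg g -> intg (fun w => f w - g w).
Proof.
move=> h1 h2; apply: eq_integrable (integrableB measurableT h1 h2) => //.
Qed.

Lemma intgZ c f : intg f -> intg (fun w => c * f w).
Proof.
move=> h; rewrite /intg.
apply: (eq_integrable _ (fun x => c%:E * (EFin \o f) x)%E) => //.
exact: integrableZl.
Qed.

Lemma intg_norm f : intg f -> intg (fun w => `|f w|).
Proof. by move=> h; exact: integrable_norm. Qed.

Lemma intg_sum (I : Type) (s : seq I) (Q : pred I) (F : I -> T -> R) :
  (forall i, intg (F i)) -> intg (fun w => \sum_(i <- s | Q i) F i w).
Proof.
move=> h; elim: s => [|i s ih].
  by under [X in intg X]funext => w do rewrite big_nil; exact: intg_cst.
under [X in intg X]funext => w do rewrite big_cons.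
by case: (Q i) => //; apply: intgD.
Qed.

Lemma intgM_bounded f g M : measurable_fun setT f -> (forall w, `|f w| <= M) ->
  intg g -> intg (fun w => f w * g w).
Proof.
move=> mf fM ig; apply: (@intg_le0 _ (fun w => M * `|g w|)).
- by apply: measurable_funM => //; exact: intg_measurable.
- by move=> w; rewrite normrM ler_wpM2r.
- exact/intgZ/intg_norm.
Qed.

Lemma intgM_sqr f g : measurable_fun setT f -> measurable_fun setT g ->
  intg (fun w => f w ^+ 2) -> intg (fun w => g w ^+ 2) ->
  intg (fun w => f w * g w).
Proof.
move=> mf mg if2 ig2; apply: (@intg_le0 _ (fun w => f w ^+ 2 + g w ^+ 2)).
- exact: measurable_funM.
- move=> w; rewrite normrM -(real_normK (num_real (f w))).
  rewrite -(real_normK (num_real (g w))); nra.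
- exact: intgD.
Qed.

Lemma intg_of_sqr f : measurable_fun setT f -> intg (fun w => f w ^+ 2) -> intg f.
Proof.
move=> mf if2; apply: (@intg_le0 _ (fun w => 1 + f w ^+ 2)) => //.
  move=> w; rewrite -(real_normK (num_real (f w))); nra.
by apply: intgD => //; exact: intg_cst.
Qed.

Lemma EE_D f g : intg f -> intg g ->
  \int[P]_w (f w + g w) = \int[P]_w f w + \int[P]_w g w.
Proof. by move=> h1 h2; rewrite RintegralD. Qed.

Lemma EE_B f g : intg f -> intg g ->
  \int[P]_w (f w - g w) = \int[P]_w f w - \int[P]_w g w.
Proof. by move=> h1 h2; rewrite RintegralB. Qed.

Lemma EE_Z c f : intg f -> \int[P]_w (c * f w) = c * \int[P]_w f w.
Proof. by move=> h; rewrite RintegralZl. Qed.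

Lemma EE_cst (c : R) : \int[P]_w c = c.
Proof.
rewrite Rintegral_cst//= -[RHS]mulr1; congr (_ * _).
by rewrite -[RHS]/(fine 1%E); congr fine; exact: probability_setT.
Qed.

Lemma EE_sum (I : Type) (s : seq I) (Q : pred I) (F : I -> T -> R) :
  (forall i, intg (F i)) ->
  \int[P]_w (\sum_(i <- s | Q i) F i w) = \sum_(i <- s | Q i) \int[P]_w F i w.
Proof.
move=> h; elim: s => [|i s ih].
  by under eq_Rintegral => w _ do rewrite big_nil; rewrite EE_cst big_nil.
rewrite big_cons; under eq_Rintegral => w _ do rewrite big_cons.
case: (Q i) => //; rewrite EE_D ?ih//.
exact: intg_sum.
Qed.

Lemma EE_le f g : intg f -> intg g -> (forall w, f w <= g w) ->
  \int[P]_w f w <= \int[P]_w g w.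
Proof. by move=> h1 h2 fg; apply: le_Rintegral. Qed.

Lemma EE_ge0 f : (forall w, 0 <= f w) -> 0 <= \int[P]_w f w.
Proof. by move=> f0; apply: Rintegral_ge0. Qed.

Lemma EE_norm f : intg f -> `|\int[P]_w f w| <= \int[P]_w `|f w|.
Proof. by move=> h; apply: le_normr_Rintegral. Qed.

Lemma EE_norm_le f g : measurable_fun setT f -> intg g ->
  (forall w, `|f w| <= g w) -> `|\int[P]_w f w| <= \int[P]_w g w.
Proof.
move=> mf ig fg; have h := intg_le0 mf fg ig.
by apply: le_trans (EE_norm h) _; apply: EE_le => //; exact: intg_norm.
Qed.

Lemma EE_le0 f g : measurable_fun setT f -> intg g ->
  (forall w, 0 <= f w) -> (forall w, f w <= g w) -> \int[P]_w f w <= \int[P]_w g w.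
Proof.
move=> mf ig f0 fg; apply: le_trans (ler_norm _) _; apply: EE_norm_le => // w.
by rewrite ger0_norm.
Qed.

Lemma EE_norm_bounded f M : measurable_fun setT f -> (forall w, `|f w| <= M) ->
  `|\int[P]_w f w| <= M.
Proof.
move=> mf fM; rewrite -[leRHS]EE_cst; apply: EE_norm_le => //; exact: intg_cst.
Qed.

Lemma EE_dist_le f g k : intg f -> intg g -> intg k ->
  (forall w, `|f w - g w| <= k w) -> `|\int[P]_w f w - \int[P]_w g w| <= \int[P]_w k w.
Proof.
move=> h1 h2 h3 fg; rewrite -EE_B//; apply: EE_norm_le => //.
by apply: measurable_funB; exact: intg_measurable.
Qed.

Lemma integral_EFin_EE f : intg f -> (\int[P]_w (f w)%:E = (\int[P]_w f w)%:E)%E.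
Proof.
by move=> h; rewrite /Rintegral fineK//; exact: integrable_fin_num.
Qed.

Lemma intg_lty f : measurable_fun setT f -> (forall w, 0 <= f w) ->
  (\int[P]_w (f w)%:E < +oo)%E -> intg f.
Proof.
move=> mf f0 h; apply/integrableP; split; first exact/measurable_EFinP.
by under eq_integral => w _ do rewrite /= ger0_norm//.
Qed.

Lemma measurable_cosD (f : T -> R) c : measurable_fun setT f ->
  measurable_fun setT (fun w => cos (f w + c)).
Proof.
move=> mf; apply: (measurableT_comp (f := @cos R)).
  by apply: continuous_measurable_fun; exact: continuous_cos.
exact: measurable_funD.
Qed.
End expectation_toolkit.

(** * Taylor bounds for sine and cosine *)

Section cosine_taylor.
Context {R : realType}.
Implicit Types x y c : R.

Lemma ler_of_deriv_ge0 (f f' : R -> R) : f 0 = 0 ->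
  (forall x, is_derive x 1 f (f' x)) -> (forall x, 0 <= x -> 0 <= f' x) ->
  forall x, 0 <= x -> 0 <= f x.
Proof.
move=> f0 df f'0 x; rewrite le_eqVlt => /predU1P[<-|x0]; first by rewrite f0.
have cf : {within `[0, x], continuous f}.
  apply: derivable_within_continuous => y _.
  exact: (@ex_derive _ _ _ _ _ _ _ (df y)).
have [y] := MVT x0 (fun y _ => df y) cf.
rewrite in_itv/= => /andP[y0 _]; rewrite f0 !subr0 => ->.
by apply: mulr_ge0; [exact/f'0/ltW|exact: ltW].
Qed.

Lemma sin_le_id x : 0 <= x -> sin x <= x.
Proof.
move=> x0; rewrite -subr_ge0.
apply: (@ler_of_deriv_ge0 (id - @sin R) (fun t => 1 - cos t)) x0.
- by rewrite !fctE sin0 subr0.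
- by move=> t _; rewrite subr_ge0 cos_le1.
Qed.

Lemma cos_ge_quadratic x : 0 <= x -> 1 - x ^+ 2 / 2 <= cos x.
Proof.
move=> x0.
suff : 0 <= (@cos R - (cst 1 - 2^-1 *: (id ^+ 2))) x.
  by rewrite !fctE /GRing.scale/= subr_ge0 mulrC.
apply: (@ler_of_deriv_ge0 _ (fun t => t - sin t)) x0.
- by rewrite !fctE /GRing.scale/= cos0 expr0n/= mulr0 subr0 subrr.
- by move=> t; apply: is_derive_eq; rewrite /GRing.scale/=; field.
- by move=> t t0; rewrite subr_ge0 sin_le_id.
Qed.

Lemma sin_ge_cubic x : 0 <= x -> x - x ^+ 3 / 6 <= sin x.
Proof.
move=> x0.
suff : 0 <= (@sin R - (id - 6^-1 *: (id ^+ 3))) x.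
  by rewrite !fctE /GRing.scale/= subr_ge0 mulrC.
apply: (@ler_of_deriv_ge0 _ (fun t => cos t - (1 - t ^+ 2 / 2))) x0.
- by rewrite !fctE /GRing.scale/= sin0 expr0n/= mulr0 !subr0.
- by move=> t; apply: is_derive_eq; rewrite /GRing.scale/=; field.
- by move=> t t0; rewrite subr_ge0 cos_ge_quadratic.
Qed.

Lemma one_sub_cos_le_id x : 0 <= x -> 1 - cos x <= x.
Proof.
move=> x0; rewrite -subr_ge0.
suff : 0 <= (id - (cst 1 - @cos R)) x by [].
apply: (@ler_of_deriv_ge0 _ (fun t => 1 - sin t)) x0.
- by rewrite !fctE cos0 !subrr.
- by move=> t; apply: is_derive_eq; rewrite sub0r opprK.
- by move=> t t0; rewrite subr_ge0 sin_le1.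
Qed.

Lemma sin_ge_quadratic x : 0 <= x -> x - x ^+ 2 / 2 <= sin x.
Proof.
move=> x0.
suff : 0 <= (@sin R - (id - 2^-1 *: (id ^+ 2))) x.
  by rewrite !fctE /GRing.scale/= subr_ge0 mulrC.
apply: (@ler_of_deriv_ge0 _ (fun t => t - (1 - cos t))) x0.
- by rewrite !fctE /GRing.scale/= sin0 expr0n/= mulr0 !subr0.
- by move=> t; apply: is_derive_eq; rewrite /GRing.scale/=; field.
- by move=> t t0; rewrite subr_ge0 one_sub_cos_le_id.
Qed.

Lemma cos_le_cubic x : 0 <= x -> cos x <= 1 - x ^+ 2 / 2 + x ^+ 3 / 6.
Proof.
move=> x0.
have [g gE dg] : exists2 g : R -> R, (forall t, g t = cos t - (1 - 2^-1 * t ^+ 2)) &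
    forall t : R, is_derive t (1 : R) g (t - sin t).
  exists (@cos R - (cst 1 - 2^-1 *: (id ^+ 2))); first by [].
  by move=> t; apply: is_derive_eq; rewrite /GRing.scale/=; field.
suff : 0 <= (6^-1 *: (id ^+ 3) - g) x.
  by rewrite !fctE /GRing.scale/= gE; lra.
apply: (@ler_of_deriv_ge0 _ (fun t => sin t - (t - t ^+ 2 / 2))) x0.
- by rewrite !fctE /GRing.scale/= gE cos0 !expr0n/= !mulr0 subr0 subrr subr0.
- by move=> t; have dgt := dg t; apply: is_derive_eq; rewrite /GRing.scale/=; field.
- by move=> t t0; rewrite subr_ge0 sin_ge_quadratic.
Qed.

Lemma norm_sin_le x : `|sin x| <= `|x|.
Proof.
wlog x0 : x / 0 <= x.
  move=> h; have [|/ltW x0] := leP 0 x; first exact: h.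
  by have := h (- x); rewrite sinN !normrN oppr_ge0; apply.
rewrite (ger0_norm x0) ler_norml sin_le_id// andbT.
have [x1|x1] := leP x 1; last by have := sin_geN1 x; lra.
have x2 : x ^+ 2 <= 1 by rewrite expr_le1.
have x3 : x ^+ 3 <= x by rewrite exprS ler_piMr.
by have := sin_ge_cubic x0; lra.
Qed.

Lemma sin_sub_id_le x : `|sin x - x| <= 2 * x ^+ 2 * Num.min 1 `|x|.
Proof.
wlog x0 : x / 0 <= x.
  move=> h; have [|/ltW x0] := leP 0 x; first exact: h.
  have := h (- x); rewrite sinN sqrrN (normrN x) opprK oppr_ge0.
  by rewrite [- sin x + x]addrC distrC; apply.
rewrite (ger0_norm x0) ler_norml; have := sin_le_id x0.
have := sin_ge_cubic x0; have := sin_geN1 x.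
have x3 : x ^+ 3 = x ^+ 2 * x by rewrite exprSr.
have x20 : 0 <= x ^+ 2 by exact: sqr_ge0.
have x30 : 0 <= x ^+ 3 by exact: exprn_ge0.
move=> h1 h2 h3; case: (leP 1 x) => x1.
  have h4 : x <= x ^+ 2 by rewrite expr2 ler_peMr.
  by rewrite mulr1; apply/andP; split; lra.
by rewrite -mulrA -x3; apply/andP; split; lra.
Qed.

Lemma cos_sub_le x : `|cos x - 1 + x ^+ 2 / 2| <= x ^+ 2 * Num.min 1 `|x|.
Proof.
wlog x0 : x / 0 <= x.
  move=> h; have [|/ltW x0] := leP 0 x; first exact: h.
  by have := h (- x); rewrite cosN sqrrN (normrN x) oppr_ge0; apply.
rewrite (ger0_norm x0) ler_norml; have := cos_ge_quadratic x0.
have := cos_le_cubic x0; have := cos_le1 x.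
have x20 : 0 <= x ^+ 2 by exact: sqr_ge0.
have x30 : 0 <= x ^+ 3 by exact: exprn_ge0.
have x3 : x ^+ 3 = x ^+ 2 * x by rewrite exprSr.
move=> h1 h2 h3; case: (leP 1 x) => x1; first by rewrite mulr1; apply/andP; split; lra.
by rewrite -x3; apply/andP; split; lra.
Qed.

Lemma one_sub_cos_le x : 0 <= 1 - cos x <= x ^+ 2 / 2.
Proof.
rewrite subr_ge0 cos_le1/= -cos_norm -(real_normK (num_real x)).
have := cos_ge_quadratic (normr_ge0 x); lra.
Qed.

(** Second order expansion of the cosine, with a remainder that is both
    quadratic (for large increments) and cubic (for small ones): this is what
    Lindeberg's condition asks for. *)
Lemma cos_taylor2 x y :
  `|cos (x + y) - cos x + y * sin x + y ^+ 2 / 2 * cos x| <=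
     3 * (y ^+ 2 * Num.min 1 `|y|).
Proof.
have -> : cos (x + y) - cos x + y * sin x + y ^+ 2 / 2 * cos x =
  cos x * (cos y - 1 + y ^+ 2 / 2) - sin x * (sin y - y) by rewrite cosD; ring.
apply: le_trans (ler_normB _ _) _; rewrite !normrM.
have := cos_sub_le y; have := sin_sub_id_le y.
have := cos_max x; have := sin_max x.
set a := `|sin x|; set b := `|cos x|; set c := `|cos y - 1 + _|; set e := `|sin y - y|.
set m := y ^+ 2 * _; rewrite -mulrA -/m => a1 b1 e1 c1.
have : b * c <= c by apply: ler_piMl b1; exact: normr_ge0.
have : a * e <= e by apply: ler_piMl a1; exact: normr_ge0.
lra.
Qed.

Lemma sin_taylor1 x y :
  `|sin (x + y) - sin x - y * cos x| <= 4 * (`|y| * Num.min 1 `|y|).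
Proof.
have -> : sin (x + y) - sin x - y * cos x =
  sin x * (cos y - 1) + cos x * (sin y - y) by rewrite sinD; ring.
apply: le_trans (ler_normD _ _) _; rewrite !normrM.
have h1 : `|cos y - 1| <= 2 * (`|y| * Num.min 1 `|y|).
  rewrite distrC ger0_norm; last by have/andP[] := one_sub_cos_le y.
  have/andP[_] := one_sub_cos_le y; rewrite -(real_normK (num_real y)).
  have := cos_geN1 y; move: (normr_ge0 y); case: (leP 1 `|y|) => /= y1; nra.
have h2 : `|sin y - y| <= 2 * (`|y| * Num.min 1 `|y|).
  have [y1|y1] := leP `|y| 1.
    apply: le_trans (sin_sub_id_le y) _; rewrite -(real_normK (num_real y)).
    rewrite (min_r y1); move: (normr_ge0 y); nra.
  apply: le_trans (ler_normB _ _) _; have := norm_sin_le y.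
  lra.
have := cos_max x; have := sin_max x; move: h1 h2.
set a := `|sin x|; set b := `|cos x|; set c := `|cos y - 1|; set e := `|sin y - y|.
set m := `|y| * _ => h1 h2 a1 b1.
have : a * c <= c by apply: ler_piMl a1; exact: normr_ge0.
have : b * e <= e by apply: ler_piMl b1; exact: normr_ge0.
lra.
Qed.

Lemma cos_lipschitz x y : `|cos x - cos y| <= 2 * Num.min 1 `|x - y|.
Proof.
have [z1|z1] := leP 1 `|x - y|.
  rewrite mulr1; apply: le_trans (ler_normB _ _) _.
  have := cos_max x; have := cos_max y; lra.
have -> : cos x - cos y = cos y * (cos (x - y) - 1) - sin y * sin (x - y).
  by have := cosD (x - y) y; rewrite subrK => ->; ring.
move: z1; move: (x - y) => z z1.
apply: le_trans (ler_normB _ _) _; rewrite !normrM.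
have h1 : `|cos z - 1| <= 2^-1 * z ^+ 2.
  rewrite distrC ger0_norm; last by have/andP[] := one_sub_cos_le z.
  have/andP[_] := one_sub_cos_le z; lra.
have h2 := norm_sin_le z.
move: h1; rewrite -(real_normK (num_real z)).
move=> h1.
have : `|cos y| * `|cos z - 1| <= `|cos z - 1| by apply: ler_piMl; rewrite ?cos_max.
have : `|sin y| * `|sin z| <= `|sin z| by apply: ler_piMl; rewrite ?sin_max.
have : `|z| ^+ 2 <= `|z| by rewrite expr2 ler_piMl// ltW.
have := normr_ge0 z; lra.
Qed.
End cosine_taylor.

(** * One step of the sequential method *)

Section cosine_step.
Context {R : realType}.

(** The increment [z] is expanded around [x + D' + D]. The linear term is then
    moved back over the recent past [D], and the quadratic terms over [D'] as
    well, so that each product pairs a recent factor with a cosine of the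
    remote past. The remainders are small unless the recent past is large. *)
Lemma cos_step_bound (x z D D' A1 A2 : R) : `|D| <= A1 -> `|D'| <= A2 ->
  `|cos (x + D' + D + z) - cos (x + D' + D) + z * sin (x + D')
    + (z ^+ 2 / 2 + z * D) * cos x|
    <= 10 * ((`|z| * A1 + z ^+ 2) * Num.min 1 (A2 + A1 + `|z|)).
Proof.
move=> DA D'A; set W := A2 + A1 + `|z|; set M := Num.min 1 W.
have A10 : 0 <= A1 by exact: le_trans (normr_ge0 _) DA.
have A20 : 0 <= A2 by exact: le_trans (normr_ge0 _) D'A.
have z0 := normr_ge0 z.
have minM t : t <= W -> Num.min 1 t <= M by move=> tW; rewrite le_min2.
have M0 : 0 <= M by rewrite le_min ler01/= /W !addr_ge0.
set y2 := x + D'; set y1 := y2 + D.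
have -> : cos (y1 + z) - cos y1 + z * sin y2 + (z ^+ 2 / 2 + z * D) * cos x =
  (cos (y1 + z) - cos y1 + z * sin y1 + z ^+ 2 / 2 * cos y1)
  + (- z * (sin (y2 + D) - sin y2 - D * cos y2)
  + (z ^+ 2 / 2 * (cos x - cos y1) + z * D * (cos x - cos y2))).
  by rewrite -/y1; ring.
have h1 : `|cos (y1 + z) - cos y1 + z * sin y1 + z ^+ 2 / 2 * cos y1| <= 3 * (z ^+ 2 * M).
  apply: le_trans (cos_taylor2 y1 z) _; rewrite ler_pM2l// ler_wpM2l ?sqr_ge0// minM// /W; lra.
have h2 : `|- z * (sin (y2 + D) - sin y2 - D * cos y2)| <= 4 * (`|z| * A1 * M).
  rewrite normrM normrN -mulrA mulrCA ler_wpM2l//.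
  apply: le_trans (sin_taylor1 y2 D) _; rewrite ler_pM2l// ler_pM//.
  by rewrite minM// /W; lra.
have h3 : `|z ^+ 2 / 2 * (cos x - cos y1)| <= z ^+ 2 * M.
  rewrite normrM (ger0_norm (_ : 0 <= z ^+ 2 / 2)); last by rewrite divr_ge0 ?sqr_ge0.
  rewrite -mulrA ler_wpM2l ?sqr_ge0// mulrC ler_pdivrMr// mulrC.
  apply: le_trans (cos_lipschitz _ _) _; rewrite ler_pM2l// minM//.
  have -> : x - y1 = - (D' + D) by rewrite /y1 /y2; ring.
  rewrite normrN; have := ler_normD D' D; rewrite /W; lra.
have h4 : `|z * D * (cos x - cos y2)| <= 2 * (`|z| * A1 * M).
  rewrite (_ : 2 * (`|z| * A1 * M) = `|z| * (A1 * (2 * M))); last by ring.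
  rewrite 2!normrM -mulrA; apply: ler_wpM2l => //; apply: ler_pM => //.
  apply: le_trans (cos_lipschitz _ _) _; rewrite ler_pM2l// minM//.
  have -> : x - y2 = - D' by rewrite /y2; ring.
  rewrite normrN /W; lra.
apply: le_trans (ler_normD _ _) _.
apply: le_trans (lerD (lexx _) (ler_normD _ _)) _.
apply: le_trans (lerD (lexx _) (lerD (lexx _) (ler_normD _ _))) _.
have p1 : 0 <= z ^+ 2 * M by rewrite mulr_ge0 ?sqr_ge0.
have p2 : 0 <= `|z| * A1 * M by rewrite !mulr_ge0.
rewrite mulrDl; lra.
Qed.
End cosine_step.

Section one_step.
Context {d} {T : measurableType d} {R : realType} (P : probability T R).
Variables (Z : nat -> T -> R) (r k : nat) (c : R).
Hypothesis mZ : forall j, measurable_fun setT (Z j).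
Hypothesis iZ : forall j, intg P (fun w => Z j w ^+ 2).

Definition psum (Z : nat -> T -> R) (j : nat) (w : T) : R := \sum_(0 <= i < j) Z i w.

Lemma measurable_psum (X : nat -> T -> R) j :
  (forall i, measurable_fun setT (X i)) -> measurable_fun setT (psum X j).
Proof. by move=> mX; apply: measurable_sum. Qed.

(** The step from [S k] to [S k.+1] is expanded with two gaps of length [r].
    [near_quad] is its second order part, [near_prod] bounds the second order
    quantities and [near_abs] the increments over both gaps. *)
Definition near_prod (w : T) : R := \sum_(k - r <= i < k.+1) `|Z k w| * `|Z i w|.
Definition near_abs (w : T) : R := \sum_(k - r - r <= i < k.+1) `|Z i w|.
Definition near_quad (w : T) : R :=
  Z k w ^+ 2 / 2 + \sum_(k - r <= i < k) Z k w * Z i w.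

Local Notation S := (psum Z).

Let iZZ i j : intg P (fun w => Z i w * Z j w).
Proof. exact: intgM_sqr. Qed.

Let iZ1 i : intg P (Z i).
Proof. exact: intg_of_sqr. Qed.

Lemma intg_near_quad : intg P near_quad.
Proof.
apply: intgD; last by apply: intg_sum => i; exact: iZZ.
by under [X in intg _ X]funext => w do rewrite mulrC; exact: intgZ.
Qed.

Lemma intg_near_prod : intg P near_prod.
Proof.
apply: intg_sum => i.
by under [X in intg _ X]funext => w do rewrite -normrM; exact/intg_norm/iZZ.
Qed.

Lemma intg_near_abs : intg P near_abs.
Proof. by apply: intg_sum => i; exact/intg_norm. Qed.

Lemma near_abs_ge0 w : 0 <= near_abs w.
Proof. exact: sumr_ge0. Qed.

Lemma measurable_min1 (f : T -> R) : measurable_fun setT f ->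
  measurable_fun setT (fun w => Num.min 1 (f w)).
Proof. by move=> mf; apply: measurable_minr. Qed.

Let mS j x : measurable_fun setT (fun w => cos (S j w + x)).
Proof. exact/measurable_cosD/measurable_psum. Qed.

Lemma intg_near_prod_min : intg P (fun w => near_prod w * Num.min 1 (near_abs w)).
Proof.
under [X in intg _ X]funext => w do rewrite mulrC.
apply: (@intgM_bounded _ _ _ _ _ _ 1); last exact: intg_near_prod.
  exact/measurable_min1/intg_measurable/intg_near_abs.
move=> w; rewrite ger0_norm; first by rewrite ge_min lexx.
by rewrite le_min ler01 near_abs_ge0.
Qed.

Lemma cos_psum_step w :
  `|cos (S k.+1 w + c) - cos (S k w + c) + Z k w * cos (S (k - r) w + (c - pi / 2))
    + near_quad w * cos (S (k - r - r) w + c)|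
    <= 10 * (near_prod w * Num.min 1 (near_abs w)).
Proof.
set z := Z k w; pose D := \sum_(k - r <= i < k) Z i w.
pose D' := \sum_(k - r - r <= i < k - r) Z i w.
have SD : S k w = S (k - r) w + D.
  by rewrite /S/psum /D -big_cat_nat //= leq_subr.
have SD' : S (k - r) w = S (k - r - r) w + D'.
  by rewrite /S/psum /D' -big_cat_nat //= leq_subr.
have Sz : S k.+1 w = S k w + z by rewrite /S/psum big_nat_recr.
have absE : near_abs w = \sum_(k - r - r <= i < k - r) `|Z i w|
    + \sum_(k - r <= i < k) `|Z i w| + `|z|.
  rewrite /near_abs big_nat_recr /=; last by rewrite -subnDA leq_subr.
  by rewrite -big_cat_nat //= leq_subr.
have DA : `|D| <= \sum_(k - r <= i < k) `|Z i w| by exact: ler_norm_sum.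
have D'A : `|D'| <= \sum_(k - r - r <= i < k - r) `|Z i w| by exact: ler_norm_sum.
have prodE : near_prod w = `|z| * \sum_(k - r <= i < k) `|Z i w| + z ^+ 2.
  rewrite /near_prod -mulr_sumr big_nat_recr ?leq_subr//= mulrDr -/z.
  by rewrite -expr2 real_normK// num_real.
have quadE : near_quad w = z ^+ 2 / 2 + z * D by rewrite /near_quad mulr_sumr.
have := @cos_step_bound R (S (k - r - r) w + c) z D D' _ _ DA D'A.
rewrite quadE prodE absE Sz addrA cosBpihalf SD SD'.
have -> : S (k - r - r) w + c + D' + D + z = S (k - r - r) w + D' + D + z + c by ring.
have -> : S (k - r - r) w + c + D' + D = S (k - r - r) w + D' + D + c by ring.
by have -> : S (k - r - r) w + c + D' = S (k - r - r) w + D' + c by ring.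
Qed.

Local Notation E f := (\int[P]_w f w).

(** In expectation the linear term and the covariance of [near_quad] with the
    remote past are mixing errors. What is left is the multiplication of the
    characteristic function by [1 - E near_quad]; going back from
    [S (k - r - r)] to [S k] costs a first order term. *)
Lemma cos_psum_recursion :
  `|\int[P]_w cos (S k.+1 w + c) -
    (1 - \int[P]_w near_quad w) * \int[P]_w cos (S k w + c)| <=
  10 * \int[P]_w (near_prod w * Num.min 1 (near_abs w))
  + `|\int[P]_w (Z k w * cos (S (k - r) w + (c - pi / 2)))|
  + `|\int[P]_w (near_quad w * cos (S (k - r - r) w + c))
      - \int[P]_w near_quad w * \int[P]_w cos (S (k - r - r) w + c)|
  + 2 * `|\int[P]_w near_quad w| * \int[P]_w near_abs w.
Proof.
have icos j x : intg P (fun w => cos (S j w + x)).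
  by apply: (@intg_bounded _ _ _ _ _ 1) => // w; exact: cos_max.
have imul f j x : intg P f -> intg P (fun w => f w * cos (S j w + x)).
  move=> i; under [X in intg _ X]funext => w do rewrite mulrC.
  by apply: (@intgM_bounded _ _ _ _ _ _ 1) => // w; exact: cos_max.
have i1 := icos k.+1 c. have i2 := icos k c.
have i3 := imul _ (k - r)%N (c - pi / 2) (iZ1 k).
have i4 := imul _ (k - r - r)%N c intg_near_quad.
have i5 := intgB i1 i2. have i6 := intgD i5 i3. have i7 := intgD i6 i4.
have main : `|\int[P]_w cos (S k.+1 w + c) - \int[P]_w cos (S k w + c)
   + \int[P]_w (Z k w * cos (S (k - r) w + (c - pi / 2)))
   + \int[P]_w (near_quad w * cos (S (k - r - r) w + c))| <=
   10 * \int[P]_w (near_prod w * Num.min 1 (near_abs w)).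
  rewrite -EE_B// -EE_D// -EE_D// -EE_Z; last exact: intg_near_prod_min.
  apply: EE_norm_le; first exact: intg_measurable i7.
    exact/intgZ/intg_near_prod_min.
  exact: cos_psum_step.
have dif : `|\int[P]_w cos (S (k - r - r) w + c) - \int[P]_w cos (S k w + c)| <=
    2 * \int[P]_w near_abs w.
  rewrite -EE_Z; last exact: intg_near_abs.
  apply: EE_dist_le => //; first exact/intgZ/intg_near_abs.
  move=> w; apply: le_trans (cos_lipschitz _ _) _; rewrite ler_pM2l//.
  rewrite ge_min; apply/orP; right.
  have -> : S k w = S (k - r - r) w + \sum_(k - r - r <= i < k) Z i w.
    by rewrite /S/psum -big_cat_nat //= -subnDA leq_subr.
  rewrite (_ : _ - _ = - \sum_(k - r - r <= i < k) Z i w); last by ring.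
  rewrite normrN /near_abs big_nat_recr/=; last by rewrite -subnDA leq_subr.
  by apply: le_trans (ler_norm_sum _ _ _) _; rewrite lerDl.
move: main dif.
set e1 := \int[P]_w cos (S k.+1 w + c); set e0 := \int[P]_w cos (S k w + c).
set f1 := \int[P]_w (Z k w * _); set f2 := \int[P]_w (near_quad w * _).
set t := \int[P]_w near_quad w; set e2 := \int[P]_w cos (S (k - r - r) w + c).
set g := 10 * _; set a := \int[P]_w near_abs w => main dif.
have -> : e1 - (1 - t) * e0 = (e1 - e0 + f1 + f2) - f1 - (f2 - t * e2) - t * (e2 - e0).
  by ring.
apply: le_trans (ler_normB _ _) _; apply: lerD; last first.
  by rewrite normrM -mulrA mulrCA; apply: ler_wpM2l.
apply: le_trans (ler_normB _ _) _; apply: lerD => //.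
by apply: le_trans (ler_normB _ _) _; apply: lerD.
Qed.
End one_step.

(** * Solving the recursion of characteristic functions *)

Section recursion.
Context {R : realType}.

Lemma expR_quadratic (t : R) : `|t| <= 2^-1 -> `|1 - t - expR (- t)| <= 2 * t ^+ 2.
Proof.
move=> /ler_normlP[t1 t2]; have h1 := expR_ge1Dx (- t).
have h2 := expR_ge1Dx t; have e0 := expR_gt0 t; have e1 := expR_gt0 (- t).
have ee : expR t * expR (- t) = 1 by rewrite -expRD subrr expR0.
have t20 := sqr_ge0 t.
rewrite distrC ger0_norm; last by lra.
rewrite lerBlDr.
have [y0|y0] := leP (expR (- t)) (2 * t ^+ 2 + (1 - t)) => //.
have : (1 + t) * (2 * t ^+ 2 + (1 - t)) < 1.
  rewrite -[ltRHS]ee; apply: ltr_pM => //; nra.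
nra.
Qed.

(** Replacing the factor [1 - tau] by [expR (- tau)] costs [2 tau ^ 2] at each
    step, and the errors are propagated by factors at most [expR `|tau|]. *)
Lemma recursion_bound (x : nat -> R) (tau e : R) (k0 n : nat) : (k0 <= n)%N ->
  `|tau| <= 2^-1 -> 0 <= e ->
  (forall k, (k0 <= k < n)%N -> `|x k.+1 - (1 - tau) * x k| <= e) ->
  (forall k, `|x k| <= 1) ->
  `|x n - expR (- ((n - k0)%:R * tau)) * x k0| <=
     (n - k0)%:R * (e + 2 * tau ^+ 2) * expR ((n - k0)%:R * `|tau|).
Proof.
move=> k0n tau2 e0 step x1.
have t0 : 0 <= e + 2 * tau ^+ 2 by rewrite addr_ge0// mulr_ge0// sqr_ge0.
suff h j : (j <= n - k0)%N ->
  `|x (k0 + j)%N - expR (- (j%:R * tau)) * x k0| <=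
     j%:R * (e + 2 * tau ^+ 2) * expR (j%:R * `|tau|).
  by have := h (n - k0)%N (leqnn _); rewrite subnKC.
elim: j => [|j ih] jn.
  by rewrite addn0 !mul0r oppr0 expR0 mul1r subrr normr0.
have {}ih := ih (ltnW jn).
have st : `|x (k0 + j).+1 - (1 - tau) * x (k0 + j)%N| <= e.
  by apply: step; rewrite leq_addr/= -ltn_subRL.
have ex : expR (- (j.+1%:R * tau)) = expR (- tau) * expR (- (j%:R * tau)).
  by rewrite -expRD -natr1; congr expR; ring.
rewrite addnS ex.
have -> : x (k0 + j).+1 - expR (- tau) * expR (- (j%:R * tau)) * x k0 =
   (x (k0 + j).+1 - (1 - tau) * x (k0 + j)%N)
   + ((1 - tau - expR (- tau)) * x (k0 + j)%N
   + expR (- tau) * (x (k0 + j)%N - expR (- (j%:R * tau)) * x k0)) by ring.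
apply: le_trans (ler_normD _ _) _.
apply: le_trans (lerD st (ler_normD _ _)) _.
rewrite addrA.
have a1 : `|(1 - tau - expR (- tau)) * x (k0 + j)%N| <= 2 * tau ^+ 2.
  rewrite normrM; apply: le_trans (expR_quadratic tau2).
  by rewrite ler_piMr.
have a2 : `|expR (- tau) * (x (k0 + j)%N - expR (- (j%:R * tau)) * x k0)| <=
    j%:R * (e + 2 * tau ^+ 2) * expR (j.+1%:R * `|tau|).
  rewrite normrM ger0_norm ?expR_ge0//.
  have -> : expR (j.+1%:R * `|tau|) = expR `|tau| * expR (j%:R * `|tau|).
    by rewrite -expRD -natr1; congr expR; ring.
  rewrite mulrCA; apply: ler_pM; rewrite ?expR_ge0//.
  by rewrite ler_expR -normrN ler_norm.
apply: le_trans (lerD (lerD (lexx e) a1) a2) _.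
set ee := expR (j.+1%:R * _).
have -> : j.+1%:R = j%:R + 1 :> R by rewrite natr1.
have : e + 2 * tau ^+ 2 <= (e + 2 * tau ^+ 2) * ee.
  by rewrite ler_peMr// /ee -expR0 ler_expR mulr_ge0.
lra.
Qed.
End recursion.

(** * Moments and correlations of normalized arrays *)

Section geometric_sums.
Context {R : realType}.

Lemma sum_nat_rev (f : nat -> R) a k : (a <= k.+1)%N ->
  \sum_(a <= i < k.+1) f (k - i)%N = \sum_(0 <= d < k.+1 - a) f d.
Proof.
move=> ak; rewrite [RHS]big_nat_rev/= add0n -{1}(add0n a) big_addn.
by apply: eq_big_nat => i /andP[_ ik]; congr f; lia.
Qed.

Lemma sum_geometric_tail (rho : R) L D : 0 <= rho < 1 ->
  \sum_(0 <= d < D) (if (L <= d)%N then rho ^+ d else 0) <= rho ^+ L / (1 - rho).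
Proof.
move=> /andP[r0 r1]; rewrite ler_pdivlMr ?subr_gt0//.
suff : (\sum_(0 <= d < D) (if (L <= d)%N then rho ^+ d else 0)) * (1 - rho) +
    (if (L <= D)%N then rho ^+ D else rho ^+ L) <= rho ^+ L.
  by apply: le_trans; rewrite lerDl; case: ifP => _; exact: exprn_ge0.
elim: D => [|D ih].
  by rewrite big_nil mul0r add0r leqn0; case: eqP => [->|].
rewrite big_nat_recr//= mulrDl; case: leqP ih => [LD|DL] ih.
  rewrite leqW//; apply: le_trans ih; rewrite exprSr; lra.
case: leqP => DL'; last by rewrite mul0r addr0.
have <- : L = D.+1 by apply/eqP; rewrite eqn_leq DL' DL.
by rewrite mul0r addr0.
Qed.

Lemma sum_geometric (rho : R) D : 0 <= rho < 1 ->
  \sum_(0 <= d < D) rho ^+ d <= (1 - rho)^-1.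
Proof.
move=> r01; have := sum_geometric_tail 0 D r01; rewrite expr0 mul1r.
by [].
Qed.

Lemma sum_geometric_past (rho : R) a k : 0 <= rho < 1 ->
  \sum_(a <= i < k.+1) rho ^+ (k - i) <= (1 - rho)^-1.
Proof.
move=> r01; have [ak|ka] := leqP a k.+1.
  by rewrite (sum_nat_rev (fun d => rho ^+ d)) ?sum_geometric.
by rewrite big_geq ?invr_ge0 ?subr_ge0; [case/andP: r01 => _ /ltW|exact: ltnW].
Qed.

Lemma sum_initial_const (b : R) L D : 0 <= b ->
  \sum_(0 <= d < D) (if (d < L)%N then b else 0) <= L%:R * b.
Proof.
move=> b0; suff : \sum_(0 <= d < D) (if (d < L)%N then b else 0) <= (minn D L)%:R * b.
  by move/le_trans; apply; rewrite ler_wpM2r// ler_nat geq_minr.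
elim: D => [|D ih]; first by rewrite big_nil mulr_ge0.
rewrite big_nat_recr//=; case: ltnP => DL; last first.
  by rewrite addr0; apply: le_trans ih _; rewrite ler_wpM2r// ler_nat; lia.
have -> : minn D.+1 L = (minn D L).+1 by lia.
by rewrite -natr1 mulrDl mul1r lerD2r.
Qed.

Lemma sum_geometric_future (rho : R) a k : 0 <= rho < 1 ->
  \sum_(a <= i < k) rho ^+ (i - a) <= (1 - rho)^-1.
Proof.
move=> r01; rewrite -{1}(add0n a) big_addn.
under eq_bigr do rewrite addnK.
exact: sum_geometric.
Qed.

End geometric_sums.

Section fixed_n.
Context {d} {T : measurableType d} {R : realType} (P : probability T R).
Variables (xi : nat -> T -> R) (n r : nat) (F C rho e m : R).
Hypothesis mxi : forall j, measurable_fun setT (xi j).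
Hypothesis ixi : forall j, intg P (fun w => xi j w ^+ 2).
Hypothesis n0 : (0 < n)%N.
Hypothesis F01 : 0 < F <= 1.
Hypothesis C0 : 0 <= C.
Hypothesis rho01 : 0 <= rho < 1.
Hypothesis CF1 : C * F <= 1.
Hypothesis xi_mean : forall j, \int[P]_w xi j w = m.
Hypothesis xi_b1 : forall j, \int[P]_w `|xi j w| <= C * F.
Hypothesis xi_b2 : forall i j, (i <= j)%N ->
  \int[P]_w (`|xi i w| * `|xi j w|) <= C * (rho ^+ (j - i) * F + F ^+ 2).

Local Notation sa := (Num.sqrt (n%:R * F)).
Definition normalized (xi : nat -> T -> R) (m s : R) (j : nat) (w : T) : R :=
  s^-1 * (xi j w - m).
Local Notation Z := (normalized xi m sa).
Local Notation q := (1 - rho)^-1.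
Local Notation C2 := (C + 3 * C ^+ 2).

Let F0 : 0 < F. Proof. by case/andP: F01. Qed.
Let F1 : F <= 1. Proof. by case/andP: F01. Qed.
Let a0 : 0 < n%:R * F. Proof. by rewrite mulr_gt0// ltr0n. Qed.
Let sa0 : 0 < sa. Proof. by rewrite sqrtr_gt0. Qed.
Let q0 : 0 <= q.
Proof. by rewrite invr_ge0 subr_ge0; case/andP: rho01 => _ /ltW. Qed.
Let C20 : 0 <= C2. Proof. by rewrite addr_ge0// mulr_ge0// sqr_ge0. Qed.

Let ixi1 j : intg P (xi j). Proof. exact: intg_of_sqr. Qed.
Let ixixi i j : intg P (fun w => xi i w * xi j w).
Proof. exact: intgM_sqr. Qed.
Let ixixia i j : intg P (fun w => `|xi i w| * `|xi j w|).
Proof.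
by under [X in intg _ X]funext => w do rewrite -normrM; exact/intg_norm.
Qed.

Lemma norm_mean_le : `|m| <= C * F.
Proof. by rewrite -(xi_mean 0%N); apply: le_trans (EE_norm _) _. Qed.

Lemma measurable_normalized j : measurable_fun setT (Z j).
Proof. by apply: measurable_funM => //; apply: measurable_funB. Qed.

Lemma intg_normalized_sqr j : intg P (fun w => Z j w ^+ 2).
Proof.
rewrite (_ : (fun w => _) = fun w => sa^-1 ^+ 2 *
   (xi j w * xi j w - 2 * m * xi j w + m ^+ 2)); last first.
  by apply/funext => w; rewrite /normalized; ring.
apply/intgZ/intgD; last exact: intg_cst.
by apply: intgB => //; exact: intgZ.
Qed.

Let iZZ i j : intg P (fun w => `|Z i w| * `|Z j w|).
Proof.
under [X in intg _ X]funext => w do rewrite -normrM.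
by apply/intg_norm/intgM_sqr; try exact: measurable_normalized;
  exact: intg_normalized_sqr.
Qed.

Let iZ j : intg P (Z j).
Proof. by apply: intg_of_sqr; [exact: measurable_normalized|exact: intg_normalized_sqr]. Qed.

Lemma normalized_le j w : `|Z j w| <= sa^-1 * (`|xi j w| + C * F).
Proof.
rewrite normrM ger0_norm ?invr_ge0 ?sqrtr_ge0// ler_wpM2l ?invr_ge0 ?sqrtr_ge0//.
by apply: le_trans (ler_normB _ _) _; rewrite lerD2l norm_mean_le.
Qed.

(** The mean of [xi] is at most [C F], hence its square contributes [F ^ 2] only
    and the bound on products of [xi] survives centering. *)
Lemma EE_normalized_prod i j : (i <= j)%N ->
  n%:R * \int[P]_w (`|Z i w| * `|Z j w|) <= C2 * (rho ^+ (j - i) + F).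
Proof.
move=> ij; rewrite -ler_pdivlMl ?ltr0n//.
pose k w := sa^-1 ^+ 2 * (`|xi i w| * `|xi j w| + C * F * `|xi i w| + C * F * `|xi j w|
   + (C * F) ^+ 2).
have ik : intg P k.
  apply/intgZ/intgD; last exact: intg_cst.
  apply: intgD; last exact/intgZ/intg_norm.
  by apply: intgD => //; exact/intgZ/intg_norm.
apply: (@le_trans _ _ (\int[P]_w k w)).
  apply: EE_le => // w.
  apply: (@le_trans _ _ (sa^-1 * (`|xi i w| + C * F) * (sa^-1 * (`|xi j w| + C * F)))).
    by apply: ler_pM => //; exact: normalized_le.
  by rewrite /k le_eqVlt; apply/orP; left; apply/eqP; ring.
rewrite /k EE_Z; last first.
  apply/intgD; last exact: intg_cst.
  apply: intgD; last exact/intgZ/intg_norm.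
  by apply: intgD => //; exact/intgZ/intg_norm.
rewrite EE_D; [|apply: intgD; [apply: intgD => //|]; exact/intgZ/intg_norm|exact: intg_cst].
rewrite EE_D; [|apply: intgD => //; exact/intgZ/intg_norm|exact/intgZ/intg_norm].
rewrite EE_D//; last exact/intgZ/intg_norm.
rewrite (EE_Z (C * F) (intg_norm (ixi1 i))) (EE_Z (C * F) (intg_norm (ixi1 j))).
have -> : \int[P]_w (C * F) ^+ 2 = (C * F) ^+ 2 := EE_cst P _.
have b2 := xi_b2 ij; have b1 := xi_b1 i; have b1' := xi_b1 j.
rewrite exprVn sqr_sqrtr; last exact: ltW.
rewrite invfM -(mulrA n%:R^-1) ler_wpM2l ?invr_ge0// ler_pdivrMl//.
have CF0 : 0 <= C * F by rewrite mulr_ge0// ltW.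
have h1 := ler_wpM2l CF0 b1; have h2 := ler_wpM2l CF0 b1'.
have rj : 0 <= rho ^+ (j - i) by rewrite exprn_ge0//; case/andP: rho01.
have : 0 <= C ^+ 2 * rho ^+ (j - i) * F by rewrite !mulr_ge0// ?sqr_ge0// ltW.
move: b2 h1 h2; rewrite !expr2; lra.
Qed.

Lemma EE_near_abs k : \int[P]_w near_abs Z r k w <= (r.*2.+1)%:R * (2 * C * F / sa).
Proof.
rewrite /near_abs EE_sum; last by move=> i; exact/intg_norm.
apply: (@le_trans _ _ (\sum_(k - r - r <= i < k.+1) (2 * C * F / sa))).
  apply: ler_sum => i _.
  apply: (@le_trans _ _ (\int[P]_w (sa^-1 * (`|xi i w| + C * F)))).
    apply: EE_le; [exact/intg_norm| |exact: normalized_le].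
    by apply/intgZ/intgD; [exact: intg_norm|exact: intg_cst].
  rewrite EE_Z; last by apply/intgD; [exact: intg_norm|exact: intg_cst].
  rewrite EE_D ?EE_cst; [|exact: intg_norm|exact: intg_cst].
  rewrite mulrC ler_wpM2r ?invr_ge0 ?sqrtr_ge0//; have := xi_b1 i; lra.
rewrite sumr_const_nat -[leLHS]mulr_natl ler_wpM2r//.
  by rewrite !mulr_ge0// ?invr_ge0 ?sqrtr_ge0// ltW.
by rewrite ler_nat -subnDA addnn leq_subLR addnS ltnS addnC -leq_subLR.
Qed.

Lemma EE_near_quad k : (r <= k)%N ->
  n%:R * `|\int[P]_w near_quad Z r k w| <= C2 * (q + r.+1%:R * F).
Proof.
move=> rk; have ip := @intg_near_prod _ _ _ P Z r k measurable_normalized intg_normalized_sqr.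
apply: (@le_trans _ _ (n%:R * \int[P]_w near_prod Z r k w)).
  rewrite ler_wpM2l//; apply: EE_norm_le => //.
    exact/(intg_measurable (P := P))/intg_near_quad/intg_normalized_sqr/measurable_normalized.
  move=> w; rewrite /near_quad /near_prod [leRHS]big_nat_recr ?leq_subr//=.
  apply: le_trans (ler_normD _ _) _; rewrite addrC; apply: lerD.
    rewrite -expr2 real_normK ?num_real// ger0_norm ?divr_ge0 ?sqr_ge0//.
    have := sqr_ge0 (Z k w); lra.
  by apply: le_trans (ler_norm_sum _ _ _) _; apply: ler_sum => i _; rewrite normrM.
rewrite /near_prod EE_sum// mulr_sumr.
apply: (@le_trans _ _ (\sum_(k - r <= i < k.+1) C2 * (rho ^+ (k - i) + F))).
  rewrite [leLHS]big_nat_cond [leRHS]big_nat_cond; apply: ler_sum => i /andP[/andP[_ ik] _].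
  under eq_Rintegral do rewrite mulrC.
  exact: EE_normalized_prod.
rewrite -mulr_sumr ler_wpM2l// big_split/= lerD ?sum_geometric_past//.
rewrite sumr_const_nat -[leLHS]mulr_natl ler_wpM2r//; first exact: ltW.
by rewrite ler_nat subSn ?leq_subr// subKn.
Qed.

(** The geometric part of the correlations sums to a constant and the other part
    to the window length times [F]. *)
Lemma sum_xi_products k i : (i <= k)%N ->
  \sum_(k - r - r <= l < k.+1) \int[P]_w (`|xi i w| * `|Z l w|) <=
    sa^-1 * F * (C2 * (2 * q + r.*2.+1%:R * F)).
Proof.
move=> ik.
have ixZ l : intg P (fun w => `|xi i w| * `|Z l w|).
  under [X in intg _ X]funext => w do rewrite -normrM.
  apply: intg_norm; apply: intgM_sqr => //; first exact: measurable_normalized.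
  exact: intg_normalized_sqr.
pose D (l : nat) := if (l <= i)%N then rho ^+ (i - l) else rho ^+ (l - i).
have D0 l : 0 <= D l by rewrite /D; case: ifP => _; rewrite exprn_ge0//; case/andP: rho01.
have bd l : \int[P]_w (`|xi i w| * `|Z l w|) <= sa^-1 * F * (C2 * (D l + F)).
  apply: (@le_trans _ _ (\int[P]_w (sa^-1 * (`|xi i w| * `|xi l w| + C * F * `|xi i w|)))).
    apply: EE_le => //.
      by apply/intgZ/intgD => //; exact/intgZ/intg_norm.
    move=> w; apply: (@le_trans _ _ (`|xi i w| * (sa^-1 * (`|xi l w| + C * F)))).
      by rewrite ler_wpM2l// normalized_le.
    by rewrite le_eqVlt; apply/orP; left; apply/eqP; ring.
  rewrite EE_Z; last by apply/intgD => //; exact/intgZ/intg_norm.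
  rewrite EE_D//; last exact/intgZ/intg_norm.
  rewrite (EE_Z (C * F) (intg_norm (ixi1 i))) -(mulrA sa^-1) ler_wpM2l ?invr_ge0 ?sqrtr_ge0//.
  have CF0 : 0 <= C * F by rewrite mulr_ge0// ltW.
  have b2 : \int[P]_w (`|xi i w| * `|xi l w|) <= C * (D l * F + F ^+ 2).
    rewrite /D; case: leqP => il; last exact/xi_b2/ltnW.
    by under eq_Rintegral do rewrite mulrC; exact: xi_b2.
  have h1 := ler_wpM2l CF0 (xi_b1 i).
  have : 0 <= C ^+ 2 * D l * F by rewrite !mulr_ge0// ?sqr_ge0// ltW.
  have : 0 <= C ^+ 2 * (F * F) by rewrite !mulr_ge0// ?sqr_ge0// ltW.
  move: b2 h1; rewrite !expr2; lra.
apply: (@le_trans _ _ (\sum_(k - r - r <= l < k.+1) sa^-1 * F * (C2 * (D l + F)))).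
  by apply: ler_sum.
rewrite -mulr_sumr -mulr_sumr ler_wpM2l//.
  by rewrite mulr_ge0// ?invr_ge0 ?sqrtr_ge0// ltW.
rewrite ler_wpM2l// big_split/= lerD//; last first.
  rewrite sumr_const_nat -[leLHS]mulr_natl ler_wpM2r//; first exact: ltW.
  by rewrite ler_nat -subnDA addnn leq_subLR addnS ltnS addnC -leq_subLR.
have [ki|ik'] := leqP (k - r - r) i.+1; last first.
  rewrite big_nat (eq_bigr (fun l => rho ^+ (l - i))); last first.
    move=> l /andP[li _]; rewrite /D leqNgt; case: ltnP => // il.
    by exfalso; move: (leq_trans ik' li); rewrite ltnNge leqW.
  rewrite -big_nat; apply: (@le_trans _ _ (\sum_(i <= l < k.+1) rho ^+ (l - i))).
    rewrite [leRHS](@big_cat_nat _ _ _ (k - r - r)%N)//=; last 2 first.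
      exact: leq_trans (leqnSn i) (ltnW ik').
      by rewrite -subnDA (leq_trans (leq_subr _ _)).
    by rewrite lerDr sumr_ge0// => l _; rewrite exprn_ge0//; case/andP: rho01.
  by apply: le_trans (sum_geometric_future _ _ rho01) _; have := q0; lra.
rewrite (@big_cat_nat _ _ _ i.+1)//=.
rewrite (_ : 2 * q = q + q); last by ring.
apply: lerD.
  rewrite big_nat (eq_bigr (fun l => rho ^+ (i - l))); last first.
    by move=> l /andP[_ li]; rewrite /D -ltnS li.
  by rewrite -big_nat sum_geometric_past.
apply: (@le_trans _ _ (\sum_(i <= l < k.+1) rho ^+ (l - i))).
  rewrite [leRHS](@big_cat_nat _ _ _ i.+1)//= big_nat1 subnn.
  rewrite [leLHS]big_nat (eq_bigr (fun l => rho ^+ (l - i))); last first.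
    by move=> l /andP[li _]; rewrite /D leqNgt li.
  by rewrite -big_nat lerDr.
exact: sum_geometric_future.
Qed.

Variables (K kappa : R).
Hypothesis K0 : 0 <= K.
Hypothesis xi_ui : forall j,
  \int[P]_w (xi j w ^+ 2 * (if K < `|xi j w| then 1 else 0)) <= kappa * F.

Local Notation B := (2 * (kappa + C ^+ 2 * F + K * sa^-1 * (C2 * (2 * q + r.*2.+1%:R * F)))).

(** Lindeberg: where [xi i] exceeds [K] the square has expectation at most
    [kappa F]; elsewhere one factor [xi i] is bounded by [K], and the other one
    has small correlations with the window. *)
Lemma EE_sqr_min k i : (i <= k)%N ->
  n%:R * \int[P]_w (Z i w ^+ 2 * Num.min 1 (near_abs Z r k w)) <= B.
Proof.
move=> ik.
have mW : measurable_fun setT (near_abs Z r k).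
  apply: (intg_measurable (P := P)); apply: intg_near_abs.
    exact: measurable_normalized.
  exact: intg_normalized_sqr.
have mI : measurable_fun setT (fun w => if K < `|xi i w| then 1 else 0 : R).
  apply: measurable_fun_ifT => //; apply: measurable_fun_ltr => //.
  exact: measurableT_comp.
have W0 w : 0 <= near_abs Z r k w by exact: near_abs_ge0.
have ixZ l : intg P (fun w => `|xi i w| * `|Z l w|).
  under [X in intg _ X]funext => w do rewrite -normrM.
  apply: intg_norm; apply: intgM_sqr => //; first exact: measurable_normalized.
  exact: intg_normalized_sqr.
have ixW : intg P (fun w => `|xi i w| * near_abs Z r k w).
  under [X in intg _ X]funext => w do rewrite /near_abs mulr_sumr.
  exact: intg_sum.
have ixI : intg P (fun w => xi i w ^+ 2 * (if K < `|xi i w| then 1 else 0)).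
  under [X in intg _ X]funext => w do rewrite mulrC.
  apply: (@intgM_bounded _ _ _ _ _ _ 1) => // w.
  by case: ifP => _; rewrite ?normr1 ?normr0.
rewrite -ler_pdivlMl ?ltr0n//.
apply: (@le_trans _ _ (\int[P]_w (sa^-1 ^+ 2 * (2 * (xi i w ^+ 2 * (if K < `|xi i w| then 1 else 0)
    + K * (`|xi i w| * near_abs Z r k w) + (C * F) ^+ 2))))).
  apply: EE_le.
  - under [X in intg _ X]funext => w do rewrite mulrC.
    apply: (@intgM_bounded _ _ _ _ _ _ 1); last exact: intg_normalized_sqr.
      exact: measurable_min1.
    by move=> w; rewrite ger0_norm ?ge_min ?lexx// le_min ler01 W0.
  - apply/intgZ/intgZ/intgD; last exact: intg_cst.
    by apply: intgD => //; exact: intgZ.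
  move=> w; rewrite /normalized exprMn -mulrA ler_wpM2l ?sqr_ge0//.
  have W0w := W0 w; set W := near_abs Z r k w in W0w *.
  have m2 : m ^+ 2 <= (C * F) ^+ 2.
    by rewrite -(real_normK (num_real m)) lerXn2r// ?nnegrE ?mulr_ge0 ?(ltW F0)// norm_mean_le.
  have h1 : (xi i w - m) ^+ 2 <= 2 * xi i w ^+ 2 + 2 * m ^+ 2.
    have := sqr_ge0 (xi i w + m); rewrite !expr2; lra.
  have min0 : 0 <= Num.min 1 W by rewrite le_min ler01 W0w.
  have min1 : Num.min 1 W <= 1 by rewrite ge_min lexx.
  have minW : Num.min 1 W <= W by rewrite ge_min lexx orbT.
  have h2 : xi i w ^+ 2 * Num.min 1 W <=
     xi i w ^+ 2 * (if K < `|xi i w| then 1 else 0) + K * (`|xi i w| * W).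
    case: ltP => [Kx|xK].
      rewrite mulr1 -[leLHS]addr0; apply: lerD; last by rewrite !mulr_ge0.
      by rewrite ler_piMr// sqr_ge0.
    rewrite mulr0 add0r -(real_normK (num_real (xi i w))) expr2 -mulrA.
    by apply: ler_pM => //; [exact: mulr_ge0|exact: ler_wpM2l].
  apply: (@le_trans _ _ ((2 * xi i w ^+ 2 + 2 * m ^+ 2) * Num.min 1 W)).
    exact: ler_wpM2r.
  have h3 : m ^+ 2 * Num.min 1 W <= (C * F) ^+ 2.
    by apply: le_trans m2; rewrite ler_piMr// sqr_ge0.
  lra.
rewrite EE_Z; last first.
  apply/intgZ/intgD; last exact: intg_cst.
  by apply: intgD => //; exact: intgZ.
rewrite exprVn sqr_sqrtr; last exact: ltW.
rewrite invfM -(mulrA n%:R^-1) ler_wpM2l ?invr_ge0// ler_pdivrMl//.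
rewrite EE_Z; last first.
  apply/intgD; last exact: intg_cst.
  by apply: intgD => //; exact: intgZ.
rewrite EE_D; [|by apply: intgD => //; exact: intgZ|exact: intg_cst].
rewrite EE_D//; last exact: intgZ.
rewrite (EE_Z K ixW).
have -> : \int[P]_w (C * F) ^+ 2 = (C * F) ^+ 2 := EE_cst P _.
have h : \int[P]_w (`|xi i w| * near_abs Z r k w) <=
    sa^-1 * F * (C2 * (2 * q + r.*2.+1%:R * F)).
  apply: le_trans (sum_xi_products ik); rewrite -EE_sum//.
  apply: EE_le => //; first exact: intg_sum.
  by move=> w; rewrite /near_abs mulr_sumr.
have {}h := ler_wpM2l K0 h; have := xi_ui i.
move: h; set I1 := \int[P]_w _; set I2 := K * \int[P]_w _; set X := C2 * _.
rewrite !expr2; lra.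
Qed.

(** Pairs at distance less than [L] are bounded by squares, for which the
    minimum with 1 is small; remote pairs have small products already. *)
Lemma EE_near_prod_min k L : (r <= k)%N -> (0 <= kappa) ->
  n%:R * \int[P]_w (near_prod Z r k w * Num.min 1 (near_abs Z r k w)) <=
   L%:R * B + C2 * (rho ^+ L * q + r.+1%:R * F).
Proof.
move=> rk k0.
have mW : measurable_fun setT (near_abs Z r k).
  apply: (intg_measurable (P := P)); apply: intg_near_abs.
    exact: measurable_normalized.
  exact: intg_normalized_sqr.
have W0 w : 0 <= near_abs Z r k w by exact: near_abs_ge0.
have min0 w : 0 <= Num.min 1 (near_abs Z r k w) by rewrite le_min ler01 W0.
have min1 w : Num.min 1 (near_abs Z r k w) <= 1 by rewrite ge_min lexx.
have imin f : intg P f -> intg P (fun w => f w * Num.min 1 (near_abs Z r k w)).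
  move=> fi; under [X in intg _ X]funext => w do rewrite mulrC.
  apply: (@intgM_bounded _ _ _ _ _ _ 1) => //; first exact: measurable_min1.
  by move=> w; rewrite ger0_norm.
have B0 : 0 <= B.
  rewrite mulr_ge0// !addr_ge0// ?mulr_ge0 ?sqr_ge0 ?invr_ge0 ?sqrtr_ge0 ?addr_ge0 ?mulr_ge0//;
    exact: ltW.
pose b (dd : nat) := (if (dd < L)%N then B else 0) + C2 * ((if (L <= dd)%N then rho ^+ dd else 0) + F).
have bi i : (i <= k)%N ->
    n%:R * \int[P]_w (`|Z k w| * `|Z i w| * Num.min 1 (near_abs Z r k w)) <= b (k - i)%N.
  move=> ik; rewrite /b; case: ltnP => kL.
    apply: (@le_trans _ _ B); last by rewrite lerDl add0r mulr_ge0// ltW.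
    have hk := EE_sqr_min (leqnn k); have hi := EE_sqr_min ik.
    apply: (@le_trans _ _ (2^-1 * (n%:R * \int[P]_w (Z k w ^+ 2 * Num.min 1 (near_abs Z r k w))
       + n%:R * \int[P]_w (Z i w ^+ 2 * Num.min 1 (near_abs Z r k w))))); last by lra.
    rewrite -mulrDr mulrCA ler_wpM2l// -EE_D; try exact/imin/intg_normalized_sqr.
    rewrite -EE_Z; last by apply: intgD; exact/imin/intg_normalized_sqr.
    apply: EE_le; first exact: imin.
      by apply/intgZ/intgD; exact/imin/intg_normalized_sqr.
    move=> w; rewrite -mulrDl mulrA ler_wpM2r//.
    rewrite -(real_normK (num_real (Z k w))) -(real_normK (num_real (Z i w))).
    have := sqr_ge0 (`|Z k w| - `|Z i w|); rewrite !expr2; lra.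
  rewrite add0r; apply: le_trans (EE_normalized_prod ik).
  rewrite ler_wpM2l//; under [leRHS]eq_Rintegral do rewrite mulrC.
  apply: EE_le => //; first exact: imin.
  by move=> w; rewrite ler_piMr// mulr_ge0.
apply: (@le_trans _ _ (\sum_(k - r <= i < k.+1) b (k - i)%N)).
  under eq_Rintegral do rewrite /near_prod mulr_suml.
  rewrite EE_sum; last by move=> i; exact: imin.
  rewrite mulr_sumr [leLHS]big_nat [leRHS]big_nat.
  by apply: ler_sum => i /andP[_]; rewrite ltnS; exact: bi.
rewrite (sum_nat_rev b); last by rewrite (leq_trans (leq_subr _ _)).
rewrite /b big_split/= lerD//; first exact: sum_initial_const.
rewrite -mulr_sumr ler_wpM2l// big_split/= lerD ?sum_geometric_tail//.
rewrite sumr_const_nat -[leLHS]mulr_natl ler_wpM2r//; first exact: ltW.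
by rewrite ler_nat subn0 subSn ?leq_subr// subKn.
Qed.

End fixed_n.

Lemma subn_gap r k : (r + r <= k)%N -> (k - r - r + r = k - r)%N.
Proof. lia. Qed.

Section fixed_n_mixing.
Context {d} {T : measurableType d} {R : realType} (P : probability T R).
Variables (xi : nat -> T -> R) (n r : nat) (F C rho e m : R).
Hypothesis mxi : forall j, measurable_fun setT (xi j).
Hypothesis ixi : forall j, intg P (fun w => xi j w ^+ 2).
Hypothesis n0 : (0 < n)%N.
Hypothesis F01 : 0 < F <= 1.
Hypothesis a1 : 1 <= n%:R * F.
Hypothesis C0 : 0 <= C.
Hypothesis rho01 : 0 <= rho < 1.
Hypothesis CF1 : C * F <= 1.
Hypothesis xi_mean : forall j, \int[P]_w xi j w = m.
Hypothesis xi_b1 : forall j, \int[P]_w `|xi j w| <= C * F.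
Hypothesis xi_b2 : forall i j, (i <= j)%N ->
  \int[P]_w (`|xi i w| * `|xi j w|) <= C * (rho ^+ (j - i) * F + F ^+ 2).

Local Notation sa := (Num.sqrt (n%:R * F)).
Local Notation Z := (normalized xi m sa).
Local Notation q := (1 - rho)^-1.
Local Notation C2 := (C + 3 * C ^+ 2).
Local Notation S := (psum Z).

Hypothesis mix1 : forall c k j, (k + r <= j)%N ->
  `|\int[P]_w (xi j w * cos (S k w + c)) - m * \int[P]_w cos (S k w + c)| <= e.
Hypothesis mix2 : forall c k i j, (k + r <= i <= j)%N ->
  `|\int[P]_w (xi i w * xi j w * cos (S k w + c))
    - \int[P]_w (xi i w * xi j w) * \int[P]_w cos (S k w + c)| <= e.
Hypothesis mix3 : forall i j, (i + r <= j)%N ->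
  `|\int[P]_w (xi i w * xi j w) - m ^+ 2| <= e.

Let F0 : 0 < F. Proof. by case/andP: F01. Qed.
Let F1 : F <= 1. Proof. by case/andP: F01. Qed.
Let e0 : 0 <= e. Proof. exact: le_trans (normr_ge0 _) (mix3 (leqnn (0 + r))). Qed.
Let a0 : 0 < n%:R * F. Proof. by rewrite mulr_gt0// ltr0n. Qed.
Let sa0 : 0 < sa. Proof. by rewrite sqrtr_gt0. Qed.
Let sa1 : 1 <= sa. Proof. by rewrite -[leLHS]sqrtr1 ler_wsqrtr. Qed.
Let saV1 : sa^-1 <= 1. Proof. by rewrite invf_le1//; exact: sa1. Qed.
Let ixi1 j : intg P (xi j). Proof. exact: intg_of_sqr. Qed.
Let ixixi i j : intg P (fun w => xi i w * xi j w).
Proof. exact: intgM_sqr. Qed.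
Let mZ j : measurable_fun setT (Z j). Proof. exact: measurable_normalized. Qed.
Let iZ2 j : intg P (fun w => Z j w ^+ 2). Proof. exact: intg_normalized_sqr. Qed.
Let iZZ i j : intg P (fun w => Z i w * Z j w).
Proof. exact: intgM_sqr. Qed.
Let iZ j : intg P (Z j). Proof. exact: intg_of_sqr. Qed.
Let m1 : `|m| <= 1.
Proof. exact: le_trans (norm_mean_le mxi ixi xi_mean xi_b1) CF1. Qed.

Let mcos k c : measurable_fun setT (fun w => cos (S k w + c)).
Proof. exact/measurable_cosD/measurable_psum. Qed.
Let imul f k c : intg P f -> intg P (fun w => f w * cos (S k w + c)).
Proof.
move=> i; under [X in intg _ X]funext => w do rewrite mulrC.
by apply: (@intgM_bounded _ _ _ _ _ _ 1) => // w; exact: cos_max.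
Qed.

(* [dl] is bilinear and kills constants, so bounds for the xi carry over. *)
Let dl f k c := \int[P]_w (f w * cos (S k w + c)) - \int[P]_w f w * \int[P]_w cos (S k w + c).

Let dlD f g k c : intg P f -> intg P g -> dl (fun w => f w + g w) k c = dl f k c + dl g k c.
Proof.
move=> fi gi; rewrite /dl EE_D//; under eq_Rintegral do rewrite mulrDl.
by rewrite EE_D; [ring|exact: imul|exact: imul].
Qed.

Let dlZ a f k c : intg P f -> dl (fun w => a * f w) k c = a * dl f k c.
Proof.
move=> fi; rewrite /dl EE_Z//; under eq_Rintegral do rewrite -mulrA.
by rewrite EE_Z; [ring|exact: imul].
Qed.

Let dl_cst a k c : dl (fun=> a) k c = 0.
Proof.
rewrite /dl EE_cst EE_Z ?subrr//.
by apply: (@intg_bounded _ _ _ _ _ 1) => // w; exact: cos_max.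
Qed.

Let dl_sum (I : Type) (s : seq I) (f : I -> T -> R) k c : (forall i, intg P (f i)) ->
  dl (fun w => \sum_(i <- s) f i w) k c = \sum_(i <- s) dl (f i) k c.
Proof.
move=> fi; elim: s => [|i s ih].
  transitivity (dl (fun=> 0) k c); last by rewrite dl_cst big_nil.
  by congr dl; apply/funext => w; rewrite big_nil.
rewrite big_cons -ih -dlD//; last exact: intg_sum.
by congr dl; apply/funext => w; rewrite big_cons.
Qed.

Let dl_xi j k c : (k + r <= j)%N -> `|dl (xi j) k c| <= e.
Proof. by move=> h; rewrite /dl xi_mean; exact: mix1. Qed.

Lemma mixing_normalized c k j : (k + r <= j)%N ->
  `|\int[P]_w (Z j w * cos (S k w + c))| <= e.
Proof.
move=> kj; have EZ : \int[P]_w Z j w = 0.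
  rewrite EE_Z; last by apply: intgB => //; exact: intg_cst.
  by rewrite EE_B ?EE_cst ?xi_mean ?subrr ?mulr0//; exact: intg_cst.
have -> : \int[P]_w (Z j w * cos (S k w + c)) = dl (Z j) k c.
  by rewrite /dl EZ mul0r subr0.
have -> : Z j = (fun w => sa^-1 * (xi j w + (- m))) by [].
rewrite dlZ; last by apply: intgD => //; exact: intg_cst.
rewrite dlD//; last exact: intg_cst.
rewrite dl_cst addr0 normrM ger0_norm ?invr_ge0 ?sqrtr_ge0//.
by apply: le_trans (dl_xi c kj); rewrite ler_piMl.
Qed.

Lemma mixing_normalized_prod c k i j : (k + r <= i <= j)%N ->
  `|dl (fun w => Z i w * Z j w) k c| <= 3 * e.
Proof.
move=> /andP[ki ij].
have -> : (fun w => Z i w * Z j w) = (fun w => sa^-1 ^+ 2 *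
    (xi i w * xi j w + ((- m) * xi i w + ((- m) * xi j w + m ^+ 2)))).
  by apply/funext => w; rewrite /normalized; ring.
have i1 : intg P (fun w => - m * xi j w + m ^+ 2).
  by apply: intgD; [exact: intgZ|exact: intg_cst].
have i2 : intg P (fun w => - m * xi i w + (- m * xi j w + m ^+ 2)).
  by apply: intgD => //; exact: intgZ.
rewrite dlZ; last exact: intgD.
rewrite dlD// dlD//; last exact: intgZ.
rewrite dlD; [|exact: intgZ|exact: intg_cst].
rewrite dl_cst addr0 !dlZ// normrM ger0_norm ?sqr_ge0//.
apply: (@le_trans _ _ (e + (e + e))); last by lra.
apply: (@le_trans _ _ (`|dl (fun w => xi i w * xi j w) k c + (- m * dl (xi i) k c + - m * dl (xi j) k c)|)).
  by rewrite ler_piMl// exprn_ile1.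
apply: le_trans (ler_normD _ _) _; apply: lerD; first by apply: mix2; rewrite ki.
apply: le_trans (ler_normD _ _) _; apply: lerD; rewrite normrM normrN.
  by rewrite -[e]mul1r; apply: ler_pM => //; exact: dl_xi.
by rewrite -[e]mul1r; apply: ler_pM => //; exact/dl_xi/(leq_trans ki).
Qed.

(** The window of [near_quad] starts [r] steps after the last term of the
    cosine, so each of its products is covered by the mixing of pairs. *)
Lemma mixing_near_quad c k : (r + r <= k)%N ->
  `|\int[P]_w (near_quad Z r k w * cos (S (k - r - r) w + c))
   - \int[P]_w near_quad Z r k w * \int[P]_w cos (S (k - r - r) w + c)| <=
   3 * r.+1%:R * e.
Proof.
move=> rk; rewrite -/(dl (near_quad Z r k) (k - r - r)%N c).
have -> : near_quad Z r k = (fun w => 2^-1 * (Z k w * Z k w) +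
    \sum_(i <- index_iota (k - r) k) Z i w * Z k w).
  apply/funext => w; rewrite /near_quad expr2 mulrC; congr (_ + _).
  by apply: eq_bigr => i _; rewrite mulrC.
rewrite dlD; [|exact: intgZ|exact: intg_sum].
rewrite dlZ// dl_sum//; apply: le_trans (ler_normD _ _) _.
have -> : 3 * r.+1%:R * e = 3 * e + 3 * r%:R * e by rewrite -(natr1 r); ring.
apply: lerD.
  rewrite normrM ger0_norm ?invr_ge0//.
  have : `|dl (fun w => Z k w * Z k w) (k - r - r) c| <= 3 * e.
    by apply: mixing_normalized_prod; rewrite leqnn andbT subn_gap// leq_subr.
  by have := e0; lra.
apply: le_trans (ler_norm_sum _ _ _) _.
apply: (@le_trans _ _ (\sum_(k - r <= i < k) (3 * e))).
  rewrite [leLHS]big_nat [leRHS]big_nat; apply: ler_sum => i /andP[ki ik].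
  by apply: mixing_normalized_prod; rewrite (ltnW ik) andbT subn_gap.
rewrite sumr_const_nat -[leLHS]mulr_natl mulrCA mulrA ler_wpM2r//.
by rewrite ler_wpM2l// ler_nat subKn// (leq_trans (leq_addr r r)).
Qed.

(** Products at distance at most [r] are summed with the correlation bound, the
    others with the mixing rate. *)
Lemma EE_psum_sqr k : (k <= n)%N ->
  n%:R * \int[P]_w (S k w ^+ 2) <= k%:R * (2 * (C2 * (q + r.+1%:R * F) + n%:R * n%:R * e)).
Proof.
have iS k' : intg P (S k') by apply: intg_sum => i.
have iS2 k' : intg P (fun w => S k' w ^+ 2).
  elim: k' => [|k' ih].
    rewrite (_ : (fun w => _) = fun=> 0); first exact: intg_cst.
    by apply/funext => w; rewrite /psum big_geq// expr0n.
  rewrite (_ : (fun w => _) = fun w => S k' w ^+ 2 + (2 * (S k' w * Z k' w) + Z k' w ^+ 2)).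
    apply: intgD => //; apply: intgD => //; apply/intgZ/intgM_sqr => //.
    exact: measurable_psum.
  by apply/funext => w; rewrite /psum big_nat_recr//=; ring.
elim: k => [|k ih] kn.
  rewrite mul0r (eq_Rintegral _ (g := fun=> 0)) ?EE_cst ?mulr0//.
  by move=> w _; rewrite /psum big_geq// expr0n.
rewrite (eq_Rintegral _ (g := fun w => S k w ^+ 2 + (2 * (S k w * Z k w) + Z k w ^+ 2))); last first.
  by move=> w _; rewrite /psum big_nat_recr//=; ring.
have iSZ : intg P (fun w => S k w * Z k w).
  by apply: intgM_sqr => //; exact: measurable_psum.
rewrite EE_D//; last by apply: intgD => //; exact: intgZ.
rewrite EE_D//; last exact: intgZ.
set X := 2 * (_ + n%:R * n%:R * e).
have -> : k.+1%:R = k%:R + 1 :> R by rewrite natr1.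
rewrite EE_Z// (mulrDl k%:R 1 X) mul1r mulrDr lerD ?ih//; first exact: ltnW.
have ESZ : \int[P]_w (S k w * Z k w) = \sum_(0 <= i < k) \int[P]_w (Z i w * Z k w).
  under eq_Rintegral do rewrite /psum mulr_suml.
  by rewrite EE_sum.
have far i : (i + r <= k)%N -> `|\int[P]_w (Z i w * Z k w)| <= e.
  move=> ik; have -> : \int[P]_w (Z i w * Z k w) =
     sa^-1 ^+ 2 * (\int[P]_w (xi i w * xi k w) - m ^+ 2).
    rewrite (eq_Rintegral _ (g := fun w => sa^-1 ^+ 2 *
      (xi i w * xi k w + ((- m) * xi i w + ((- m) * xi k w + m ^+ 2))))); last first.
      by move=> w _; rewrite /normalized; ring.
    have i1 : intg P (fun w => - m * xi k w + m ^+ 2).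
      by apply: intgD; [exact: intgZ|exact: intg_cst].
    have i2 : intg P (fun w => - m * xi i w + (- m * xi k w + m ^+ 2)).
      by apply: intgD => //; exact: intgZ.
    rewrite EE_Z; last exact: intgD.
    rewrite EE_D// EE_D//; last exact: intgZ.
    rewrite EE_D; [|exact: intgZ|exact: intg_cst].
    have -> : \int[P]_w m ^+ 2 = m ^+ 2 := EE_cst P _.
    by rewrite !EE_Z// !xi_mean; ring.
  rewrite normrM ger0_norm ?sqr_ge0//; apply: le_trans (mix3 ik).
  by rewrite ler_piMl// exprn_ile1.
have close i : (i <= k)%N -> n%:R * `|\int[P]_w (Z i w * Z k w)| <= C2 * (rho ^+ (k - i) + F).
  move=> ik.
  apply: (@le_trans _ _ (n%:R * \int[P]_w (`|Z i w| * `|Z k w|))); last exact: EE_normalized_prod.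
  rewrite ler_wpM2l//; apply: le_trans (EE_norm _) _ => //.
  by under eq_Rintegral do rewrite normrM.
have C20 : 0 <= C2 by rewrite addr_ge0// mulr_ge0// sqr_ge0.
have rho0 : 0 <= rho by case/andP: rho01.
have all_ i : (i <= k)%N -> n%:R * `|\int[P]_w (Z i w * Z k w)| <=
    C2 * (rho ^+ (k - i) + (if (k - i < r)%N then F else 0)) + n%:R * e.
  move=> ik; case: ltnP => ri.
    by apply: le_trans (close _ ik) _; rewrite lerDl mulr_ge0.
  apply: (@le_trans _ _ (n%:R * e)); first by rewrite ler_wpM2l// far// -leq_subRL.
  by rewrite lerDr mulr_ge0// addr0 exprn_ge0.
have Zk2 : \int[P]_w (Z k w ^+ 2) <= 2 * `|\int[P]_w (Z k w * Z k w)|.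
  under eq_Rintegral do rewrite expr2.
  have := ler_norm (\int[P]_w (Z k w * Z k w)); have := normr_ge0 (\int[P]_w (Z k w * Z k w)); lra.
apply: (@le_trans _ _ (2 * \sum_(0 <= i < k.+1) n%:R * `|\int[P]_w (Z i w * Z k w)|)).
  rewrite -mulr_sumr big_nat_recr//= [leRHS]mulrCA ler_wpM2l// mulrDr lerD//.
  rewrite ler_wpM2l// ESZ; exact: le_trans (ler_norm _) (ler_norm_sum _ _ _).
rewrite ler_wpM2l//.
apply: (@le_trans _ _ (\sum_(0 <= i < k.+1) (C2 * (rho ^+ (k - i) + (if (k - i < r)%N then F else 0)) + n%:R * e))).
  by rewrite [leLHS]big_nat [leRHS]big_nat; apply: ler_sum => i /andP[_]; rewrite ltnS; exact: all_.
rewrite big_split/=; apply: lerD; last first.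
  rewrite sumr_const_nat -[leLHS]mulr_natl subn0 mulrA ler_wpM2r// ler_wpM2r//.
  by rewrite ler_nat.
rewrite -mulr_sumr ler_wpM2l// big_split/= lerD ?sum_geometric_past//.
rewrite (sum_nat_rev (fun dd => if (dd < r)%N then F else 0))// subn0.
apply: le_trans (sum_initial_const _ _ _) _; first exact: ltW.
by rewrite ler_wpM2r ?ler_nat// ltW.
Qed.

End fixed_n_mixing.

(** * Limits of sums of covariances *)

Section limits.
Context {R : realType}.

Lemma cvg_sum_nat (a b : nat) (u : nat -> nat -> R) (l : nat -> R) :
  (forall i, u n i @[n --> \oo] --> l i) ->
  (\sum_(a <= i < b) u n i) @[n --> \oo] --> \sum_(a <= i < b) l i.
Proof.
move=> h; elim: b => [|b ih].
  by rewrite big_geq//; under eq_fun do rewrite big_geq//; exact: cvg_cst.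
have [ab|ba] := leqP a b; last first.
  by rewrite big_geq//; under eq_fun do rewrite big_geq//; exact: cvg_cst.
by rewrite big_nat_recr//=; under eq_fun do rewrite big_nat_recr//=; exact: cvgD.
Qed.

Lemma norm_limit_le (u : nat -> R) (l b : R) (v : nat -> R) :
  u n @[n --> \oo] --> l -> v n @[n --> \oo] --> b ->
  (\forall n \near \oo, `|u n| <= v n) -> `|l| <= b.
Proof. by move=> ul vb uv; apply: ler_cvg_to (cvg_norm ul) vb uv. Qed.

Variables (gam : nat -> nat -> R) (c : nat -> R) (F : nat -> R) (r : nat -> nat).
Variables (C rho : R).
Hypothesis C0 : 0 <= C.
Hypothesis rho01 : 0 <= rho < 1.
Hypothesis F0 : F n @[n --> \oo] --> (0 : R).
Hypothesis rF0 : (r n)%:R * F n @[n --> \oo] --> (0 : R).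
Hypothesis ry : forall L, \forall n \near \oo, (L <= r n)%N.
Hypothesis gb : \forall n \near \oo, forall dd, `|gam n dd| <= C * (rho ^+ dd + F n).
Hypothesis gc : forall dd, gam n dd @[n --> \oo] --> c dd.

Local Notation q := (1 - rho)^-1.

Lemma limit_covariance_le dd : `|c dd| <= C * rho ^+ dd.
Proof.
apply: (@norm_limit_le (gam ^~ dd) _ _ (fun n => C * (rho ^+ dd + F n))) => //.
  rewrite -[X in _ --> C * X]addr0; apply: cvgM; first exact: cvg_cst.
  by apply: cvgD => //; exact: cvg_cst.
by near=> n; move: dd; near: n.
Unshelve. all: by end_near. Qed.

Lemma cvg_covariance_series : cvgn (fun n => \sum_(1 <= j < n) c j).
Proof.
have : cvgn (series (fun k => c k.+1)).
  apply: normed_cvg; apply: (@series_le_cvg _ _ (geometric C rho)) => //.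
  - by move=> n /=.
  - by move=> n; rewrite /geometric /= mulr_ge0// exprn_ge0//; case/andP: rho01.
  - move=> n; apply: le_trans (limit_covariance_le _) _; rewrite /geometric/=.
    rewrite ler_wpM2l// exprS ler_piMl ?exprn_ge0//; case/andP: rho01 => // _ /ltW//.
  - by apply: is_cvg_geometric_series; rewrite ger0_norm; case/andP: rho01.
move=> /cvg_ex[l hl]; apply/cvg_ex; exists l.
rewrite -cvg_shiftS; apply: cvg_trans hl; apply: near_eq_cvg; near=> n.
by rewrite /series/= big_add1.
Unshelve. all: by end_near. Qed.

(** Dominated convergence for series: the terms converge one by one, the
    geometric part of the bound is summable, and [r n * F n] tends to 0. *)
Lemma tannery : (\sum_(1 <= dd < (r n).+1) gam n dd) @[n --> \oo] -->
  \big[+%R/0]_(1 <= j <oo) c j.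
Proof.
set l := \big[_/_]_(_ <= _ <oo) _.
have cl : (\sum_(1 <= j < n) c j) @[n --> \oo] --> l by exact: cvg_covariance_series.
apply/cvgrPdist_le => eps eps0.
have q0 : 0 < q by rewrite invr_gt0 subr_gt0; case/andP: rho01.
have e4 : 0 < eps / 4 by lra.
have [L Ltail [L1 Lc]] : exists2 L : nat, C * (rho ^+ L * q) <= eps / 4 &
    (0 < L)%N /\ `|l - \sum_(1 <= j < L) c j| <= eps / 4.
  have h1 : (C * (rho ^+ n * q)) @[n --> \oo] --> (0 : R).
    rewrite -(mulr0 C); apply: cvgM; first exact: cvg_cst.
    rewrite -[X in _ --> X](mul0r q); apply: cvgM; last exact: cvg_cst.
    by apply: cvg_expr; rewrite ger0_norm; case/andP: rho01.
  move/cvgrPdist_le : cl => /(_ _ e4) h2.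
  move/cvgrPdist_le : h1 => /(_ _ e4) h1.
  near \oo => L; exists L.
    apply: le_trans (ler_norm _) _; rewrite -normrN -(sub0r (C * _)).
    by near: L.
  by split; [near: L; exists 1%N|near: L].
have h3 : (\sum_(1 <= j < L) gam n j) @[n --> \oo] --> \sum_(1 <= j < L) c j.
  exact: cvg_sum_nat.
move/cvgrPdist_le : h3 => /(_ _ e4) h3.
have h4 : C * ((r n)%:R * F n) @[n --> \oo] --> (0 : R).
  by rewrite -(mulr0 C); apply: cvgM => //; exact: cvg_cst.
move/cvgrPdist_le : h4 => /(_ _ e4) h4.
near=> n.
have Lr : (L <= (r n).+1)%N by apply: leqW; near: n; exact: ry.
rewrite (@big_cat_nat _ _ _ L)//= opprD addrA.
have b1 : `|\sum_(1 <= j < L) c j - \sum_(1 <= j < L) gam n j| <= eps / 4 by near: n.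
have b2 : `|\sum_(L <= i < (r n).+1) gam n i| <= eps / 4 + eps / 4.
  apply: le_trans (ler_norm_sum _ _ _) _.
  apply: (@le_trans _ _ (\sum_(L <= i < (r n).+1) C * (rho ^+ i + F n))).
    by apply: ler_sum => i _; move: i; near: n.
  rewrite -mulr_sumr big_split/= mulrDr; apply: lerD.
    apply: le_trans Ltail; rewrite ler_wpM2l//.
    apply: le_trans (sum_geometric_tail L (r n).+1 rho01).
    rewrite [leRHS](@big_cat_nat _ _ _ L)//=.
    rewrite [X in _ <= _ + X](eq_big_nat _ _ (F2 := fun i => rho ^+ i)); last first.
      by move=> i /andP[->].
    rewrite lerDr sumr_ge0// => i _.
    by case: ifP => // _; rewrite exprn_ge0//; case/andP: rho01.
  rewrite sumr_const_nat -[F n *+ _]mulr_natl.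
  have [F0n|F0n] := leP 0 (F n).
    apply: (@le_trans _ _ (C * ((r n)%:R * F n))).
      by rewrite ler_wpM2l// ler_wpM2r// ler_nat leq_subLR -add1n leq_add2r.
    apply: le_trans (ler_norm _) _; rewrite -normrN -(sub0r (C * _)).
    by near: n.
  apply: le_trans (ltW e4); rewrite mulr_ge0_le0// mulr_ge0_le0// ltW//.
rewrite -[l](subrK (\sum_(1 <= j < L) c j)).
set x := l - _ in Lc *; set y := \sum_(1 <= j < L) c j; set z := \sum_(1 <= j < L) gam n j.
rewrite (_ : x + y - z = x + (y - z)); last by ring.
apply: le_trans (ler_normB _ _) _; apply: (@le_trans _ _ (eps / 4 + eps / 4 + (eps / 4 + eps / 4))); last by lra.
by apply: lerD => //; apply: le_trans (ler_normD _ _) _; exact: lerD.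
Unshelve. all: by end_near. Qed.

End limits.

(** * A central limit theorem for weakly dependent arrays *)

Section sequential_clt.
Context {d} {T : measurableType d} {R : realType} (P : probability T R).

(** What a Markov chain with drift provides for one value of [n]: rare events of
    probability [F] that cluster geometrically, and mixing at distance [r] with
    error [e], for single terms and for products of two terms. The cosine of a
    partial sum is the only function of the past that is needed. *)
Record block_bounds (xi : nat -> T -> R) (n r : nat) (F C rho e m : R) : Prop :=
  BlockBounds {
  bb_measurable : forall j, measurable_fun setT (xi j);
  bb_sqr : forall j, intg P (fun w => xi j w ^+ 2);
  bb_n0 : (0 < n)%N;
  bb_F : 0 < F <= 1;
  bb_a : 1 <= n%:R * F;
  bb_CF : C * F <= 1;
  bb_mean : forall j, \int[P]_w xi j w = m;
  bb_norm : forall j, \int[P]_w `|xi j w| <= C * F;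
  bb_prod : forall i j, (i <= j)%N ->
    \int[P]_w (`|xi i w| * `|xi j w|) <= C * (rho ^+ (j - i) * F + F ^+ 2);
  bb_mix1 : forall c k j, (k + r <= j)%N ->
    `|\int[P]_w (xi j w * cos (psum (normalized xi m (Num.sqrt (n%:R * F))) k w + c))
      - m * \int[P]_w cos (psum (normalized xi m (Num.sqrt (n%:R * F))) k w + c)| <= e;
  bb_mix2 : forall c k i j, (k + r <= i <= j)%N ->
    `|\int[P]_w (xi i w * xi j w
        * cos (psum (normalized xi m (Num.sqrt (n%:R * F))) k w + c))
      - \int[P]_w (xi i w * xi j w)
        * \int[P]_w cos (psum (normalized xi m (Num.sqrt (n%:R * F))) k w + c)| <= e;
  bb_mix3 : forall i j, (i + r <= j)%N ->
    `|\int[P]_w (xi i w * xi j w) - m ^+ 2| <= e }.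

Lemma step_error xi n r F C rho e m (K kappa : R) L k x :
  0 <= C -> 0 <= rho < 1 -> block_bounds xi n r F C rho e m ->
  0 <= K -> 0 <= kappa ->
  (forall j, \int[P]_w (xi j w ^+ 2 * (if K < `|xi j w| then 1 else 0)) <= kappa * F) ->
  (r + r <= k)%N ->
  n%:R * `|\int[P]_w cos (psum (normalized xi m (Num.sqrt (n%:R * F))) k.+1 w + x) -
    (1 - \int[P]_w near_quad (normalized xi m (Num.sqrt (n%:R * F))) r k w) *
    \int[P]_w cos (psum (normalized xi m (Num.sqrt (n%:R * F))) k w + x)| <=
  10 * (L%:R * (2 * (kappa + C ^+ 2 * F + K * (Num.sqrt (n%:R * F))^-1 *
       ((C + 3 * C ^+ 2) * (2 * (1 - rho)^-1 + r.*2.+1%:R * F))))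
     + (C + 3 * C ^+ 2) * (rho ^+ L * (1 - rho)^-1 + r.+1%:R * F))
  + n%:R * e + n%:R * (3 * r.+1%:R * e)
  + 2 * ((C + 3 * C ^+ 2) * ((1 - rho)^-1 + r.+1%:R * F)) *
    (r.*2.+1%:R * (2 * C * F / Num.sqrt (n%:R * F))).
Proof.
move=> C0 rho01 [mxi ixi n0 F01 a1 CF1 Em b1 b2 mix1 mix2 mix3] K0 k0 ui rk.
set sa := Num.sqrt _; set Z := normalized xi m sa; set q := (1 - rho)^-1.
set C2 := C + _.
have e0 : 0 <= e by exact: le_trans (normr_ge0 _) (mix3 _ _ (leqnn (0 + r))).
have rk' : (r <= k)%N by exact: leq_trans (leq_addr r r) rk.
have sa0 : 0 <= sa by rewrite sqrtr_ge0.
have mZ j : measurable_fun setT (Z j) by exact: measurable_normalized.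
have iZ j : intg P (fun w => Z j w ^+ 2) by exact: intg_normalized_sqr.
have F0 : 0 < F by case/andP: F01.
apply: le_trans (ler_wpM2l _ (cos_psum_recursion r k x mZ iZ)) _ => //.
rewrite 3!(mulrDr n%:R); apply: lerD; last first.
  rewrite (mulrA n%:R) (mulrCA n%:R 2); apply: ler_pM => //.
  - by apply: EE_ge0 => w; exact: near_abs_ge0.
  - by rewrite ler_pM2l//; exact: (EE_near_quad mxi).
  - exact: EE_near_abs.
apply: lerD; last first.
  by rewrite ler_wpM2l// (mixing_near_quad mxi ixi n0 F01 a1 CF1 Em b1 mix1 mix2 mix3).
apply: lerD; last first.
  rewrite ler_wpM2l// (mixing_normalized mxi ixi n0 F01 a1 Em mix1)//.
  by rewrite subnK.
rewrite mulrCA ler_wpM2l//.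
exact: (EE_near_prod_min mxi).
Qed.

Lemma EE_normalized_cov (xi : nat -> T -> R) n (F m : R) i j : 0 < n%:R * F ->
  (forall j, measurable_fun setT (xi j)) -> (forall j, intg P (fun w => xi j w ^+ 2)) ->
  (forall j, \int[P]_w xi j w = m) ->
  let Z := normalized xi m (Num.sqrt (n%:R * F)) in
  n%:R * \int[P]_w (Z i w * Z j w) = (\int[P]_w (xi i w * xi j w) - m ^+ 2) / F.
Proof.
move=> a0 mxi ixi Em Z.
have ixi1 k : intg P (xi k) by exact: intg_of_sqr.
rewrite (eq_Rintegral _ (g := fun w => (Num.sqrt (n%:R * F))^-1 ^+ 2 *
  (xi i w * xi j w + ((- m) * xi i w + ((- m) * xi j w + m ^+ 2))))); last first.
  by move=> w _; rewrite /Z/normalized; ring.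
have i1 : intg P (fun w => - m * xi j w + m ^+ 2).
  by apply: intgD; [exact: intgZ|exact: intg_cst].
have i2 : intg P (fun w => - m * xi i w + (- m * xi j w + m ^+ 2)).
  by apply: intgD => //; exact: intgZ.
have i3 : intg P (fun w => xi i w * xi j w) by exact: intgM_sqr.
rewrite EE_Z; last exact: intgD.
rewrite EE_D// EE_D//; last exact: intgZ.
rewrite EE_D; [|exact: intgZ|exact: intg_cst].
have -> : \int[P]_w m ^+ 2 = m ^+ 2 := EE_cst P _.
rewrite !EE_Z// !Em exprVn sqr_sqrtr; last exact: ltW.
have nF : n%:R != 0 :> R /\ F != 0 by split; apply: contraTneq a0 => ->; rewrite ?mulr0 ?mul0r ltxx.
by field; rewrite nF.1 nF.2.
Qed.

(** Under stationarity the second order part has an expectation that does not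
    depend on [k]; its limit is half of the limit variance. *)
Lemma EE_near_quadE xi n r F C rho e m (g : nat -> R) k :
  block_bounds xi n r F C rho e m ->
  (forall i dd, \int[P]_w (xi i w * xi (i + dd)%N w) = g dd) -> (r <= k)%N ->
  n%:R * \int[P]_w near_quad (normalized xi m (Num.sqrt (n%:R * F))) r k w =
   2^-1 * ((g 0%N - m ^+ 2) / F) + \sum_(1 <= dd < r.+1) (g dd - m ^+ 2) / F.
Proof.
move=> [mxi ixi n0 F01 a1 CF1 Em b1 b2 mix1 mix2 mix3] gE rk.
set sa := Num.sqrt _; set Z := normalized xi m sa.
have F0 : 0 < F by case/andP: F01.
have a0 : 0 < n%:R * F by rewrite mulr_gt0// ltr0n.
have iZZ i j : intg P (fun w => Z i w * Z j w).
  by apply: intgM_sqr; try exact: measurable_normalized; exact: intg_normalized_sqr.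
have cv i : (i <= k)%N -> n%:R * \int[P]_w (Z k w * Z i w) = (g (k - i)%N - m ^+ 2) / F.
  move=> ik; rewrite -(gE i) subnKC// -(EE_normalized_cov i k a0 mxi ixi Em).
  by congr (_ * _); apply: eq_Rintegral => w _; rewrite mulrC.
rewrite (eq_Rintegral _ (g := fun w => 2^-1 * (Z k w * Z k w) +
    \sum_(k - r <= i < k) Z k w * Z i w)); last first.
  by move=> w _; rewrite /near_quad expr2 mulrC.
rewrite EE_D; [|exact: intgZ|exact: intg_sum].
rewrite EE_Z// EE_sum// mulrDr mulrCA cv// subnn; congr (_ + _).
rewrite mulr_sumr; set f := fun dd => (g dd - m ^+ 2) / F.
rewrite big_nat (eq_bigr (fun i => f (k - i)%N)); last by move=> i /andP[_ /ltnW]; exact: cv.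
rewrite -big_nat.
have h := sum_nat_rev f (leqW (leq_subr r k)).
rewrite big_nat_recr ?leq_subr//= subSn ?leq_subr// subKn// subnn big_nat_recl//= in h.
rewrite -[RHS]/(\sum_(1 <= dd < r.+1) f dd) big_add1/=.
by move: h; lra.
Qed.

Variables (xi : nat -> nat -> T -> R) (F : nat -> R) (r : nat -> nat) (e m : nat -> R).
Variables (g : nat -> nat -> R) (c : nat -> R) (C rho : R).
Hypothesis C0 : 0 <= C.
Hypothesis rho01 : 0 <= rho < 1.
Hypothesis F0 : F n @[n --> \oo] --> (0 : R).
Hypothesis ay : n%:R * F n @[n --> \oo] --> +oo.
Hypothesis rF0 : (r n)%:R * F n @[n --> \oo] --> (0 : R).
Hypothesis ry : forall L, \forall n \near \oo, (L <= r n)%N.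
Hypothesis e0 : n%:R ^+ 2 * (r n).+1%:R * e n @[n --> \oo] --> (0 : R).
Hypothesis bb : \forall n \near \oo, block_bounds (xi n) n (r n) (F n) C rho (e n) (m n).
Hypothesis ui : forall kappa, 0 < kappa -> exists2 K, 0 <= K &
  \forall n \near \oo, forall j,
  \int[P]_w (xi n j w ^+ 2 * (if K < `|xi n j w| then 1 else 0)) <= kappa * F n.
Hypothesis st : \forall n \near \oo, forall i dd,
  \int[P]_w (xi n i w * xi n (i + dd)%N w) = g n dd.
Hypothesis gc : forall dd, g n dd / F n @[n --> \oo] --> c dd.

Local Notation sa n := (Num.sqrt (n%:R * F n)).
Local Notation Z n := (normalized (xi n) (m n) (sa n)).
Local Notation q := (1 - rho)^-1.
Local Notation C2 := (C + 3 * C ^+ 2).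
Local Notation gam n dd := ((g n dd - m n ^+ 2) / F n).

Let C20 : 0 <= C2. Proof. by rewrite addr_ge0// mulr_ge0// sqr_ge0. Qed.
Let q0 : 0 <= q.
Proof. by rewrite invr_ge0 subr_ge0; case/andP: rho01 => _ /ltW. Qed.

Let rS : (r n).+1%:R * F n @[n --> \oo] --> (0 : R).
Proof.
rewrite -(addr0 0); under eq_fun do rewrite -natr1 mulrDl mul1r.
exact: cvgD.
Qed.

Let r2S : (r n).*2.+1%:R * F n @[n --> \oo] --> (0 : R).
Proof.
have -> : (fun n => (r n).*2.+1%:R * F n) = (fun n => (r n)%:R * F n + (r n).+1%:R * F n).
  by apply/funext => n; rewrite -mulrDl -natrD addnS addnn.
by rewrite -(addr0 0); exact: cvgD.
Qed.

Let saV : (sa n)^-1 @[n --> \oo] --> (0 : R).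
Proof.
have h : \forall n \near \oo, 0 < sa n.
  by near=> n; rewrite sqrtr_gt0; near: n; move/cvgryPgt : ay; exact.
apply/(gtr0_cvgV0 h); apply/cvgryPge => A.
near=> n; apply: le_trans (ler_norm A) _.
rewrite -(sqrtr_sqr A) ler_wsqrtr//; near: n.
by move/cvgryPge : ay; exact.
Unshelve. all: by end_near. Qed.

Let ne0 : n%:R * e n @[n --> \oo] --> (0 : R).
Proof.
apply: (@squeeze_cvgr _ _ _ _ (fun=> 0) (fun n => n%:R ^+ 2 * (r n).+1%:R * e n)) => //; last exact: cvg_cst.
near=> n; have [mxi ixi n0 F01 a1 CF1 Em b1 b2 mix1 mix2 mix3] :
  block_bounds (xi n) n (r n) (F n) C rho (e n) (m n) by near: n.
have en0 : 0 <= e n by exact: le_trans (normr_ge0 _) (mix3 _ _ (leqnn (0 + r n))).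
rewrite mulr_ge0//= ler_wpM2r// expr2 -mulrA ler_peMr//.
by rewrite -natrM ler1n muln_gt0 n0.
Unshelve. all: by end_near. Qed.

Let nre0 : n%:R * (3 * (r n).+1%:R * e n) @[n --> \oo] --> (0 : R).
Proof.
have h : 3 * (n%:R ^+ 2 * (r n).+1%:R * e n) @[n --> \oo] --> (0 : R).
  by rewrite -(mulr0 3); apply: cvgM => //; exact: cvg_cst.
apply: (@squeeze_cvgr _ _ _ _ (fun=> 0) (fun n => 3 * (n%:R ^+ 2 * (r n).+1%:R * e n))) => //; last exact: cvg_cst.
near=> n; have [mxi ixi n0 F01 a1 CF1 Em b1 b2 mix1 mix2 mix3] :
  block_bounds (xi n) n (r n) (F n) C rho (e n) (m n) by near: n.
have en0 : 0 <= e n by exact: le_trans (normr_ge0 _) (mix3 _ _ (leqnn (0 + r n))).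
rewrite !mulr_ge0//= -mulrA (mulrCA n%:R 3) ler_pM2l//.
rewrite -mulrA ler_wpM2r ?mulr_ge0// expr2 ler_peMr//.
by rewrite ler1n.
Unshelve. all: by end_near. Qed.

Let gam_cvg dd : gam n dd @[n --> \oo] --> c dd.
Proof.
have h : m n ^+ 2 / F n @[n --> \oo] --> (0 : R).
  apply: (@squeeze_cvgr _ _ _ _ (fun=> 0) (fun n => C ^+ 2 * F n)); last 2 first.
  - exact: cvg_cst.
  - by rewrite -(mulr0 (C ^+ 2)); apply: cvgM => //; exact: cvg_cst.
  near=> n; have [mxi ixi n0 F01 a1 CF1 Em b1 b2 mix1 mix2 mix3] :
    block_bounds (xi n) n (r n) (F n) C rho (e n) (m n) by near: n.
  have Fn : 0 < F n by case/andP: F01.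
  apply/andP; split; first by rewrite divr_ge0 ?sqr_ge0// ltW.
  rewrite ler_pdivrMr// -mulrA -expr2 -exprMn.
  rewrite -(real_normK (num_real (m n))) lerXn2r ?nnegrE ?mulr_ge0 ?(ltW Fn)//.
  exact: (norm_mean_le mxi ixi Em b1).
rewrite -[c dd]subr0; under eq_fun do rewrite mulrBl.
exact: cvgB.
Unshelve. all: by end_near. Qed.

Let gam_bound : \forall n \near \oo, forall dd, `|gam n dd| <= C2 * (rho ^+ dd + F n).
Proof.
near=> n => dd; have [mxi ixi n0 F01 a1 CF1 Em b1 b2 mix1 mix2 mix3] :
    block_bounds (xi n) n (r n) (F n) C rho (e n) (m n) by near: n.
have Fn : 0 < F n by case/andP: F01.
have a0 : 0 < n%:R * F n by rewrite mulr_gt0// ltr0n.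
have <- : \int[P]_w (xi n 0%N w * xi n (0 + dd)%N w) = g n dd.
  by move: 0%N dd; near: n.
rewrite -(EE_normalized_cov _ _ a0 mxi ixi Em) normrM ger0_norm//.
apply: (@le_trans _ _ (n%:R * \int[P]_w (`|Z n 0%N w| * `|Z n (0 + dd)%N w|))).
  rewrite ler_wpM2l//.
  under [leRHS]eq_Rintegral do rewrite -normrM.
  by apply/EE_norm/intgM_sqr; try exact: measurable_normalized; exact: intg_normalized_sqr.
by have := EE_normalized_prod mxi ixi n0 F01 C0 rho01 Em b1 b2 (leq0n (0 + dd)); rewrite subn0.
Unshelve. all: by end_near. Qed.

Let t n := 2^-1 * gam n 0%N + \sum_(1 <= dd < (r n).+1) gam n dd.
Let s := 2^-1 * c 0%N + \big[+%R/0]_(1 <= j <oo) c j.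

Let t_cvg : t n @[n --> \oo] --> s.
Proof.
have h1 : 2^-1 * gam n 0%N @[n --> \oo] --> 2^-1 * c 0%N.
  by apply: cvgM => //; exact: cvg_cst.
have h2 : (\sum_(1 <= dd < (r n).+1) gam n dd) @[n --> \oo] -->
    \big[+%R/0]_(1 <= j <oo) c j.
  exact: (tannery C20 rho01 F0 rF0 ry gam_bound gam_cvg).
exact: (cvgD h1 h2).
Qed.

Lemma limit_covariance_summable : cvgn (fun n => \sum_(1 <= j < n) c j).
Proof. exact: (cvg_covariance_series C20 rho01 F0 gam_bound gam_cvg). Qed.

(** This gives tightness of the normalized sums. *)
Lemma EE_psum_sqr_bounded :
  exists M, \forall n \near \oo, \int[P]_w (psum (Z n) n w ^+ 2) <= M.
Proof.
have h : 2 * (C2 * (q + (r n).+1%:R * F n) + n%:R ^+ 2 * (r n).+1%:R * e n)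
    @[n --> \oo] --> 2 * (C2 * (q + 0) + 0).
  apply: cvgM; first exact: cvg_cst.
  apply: cvgD => //; apply: cvgM; first exact: cvg_cst.
  by apply: cvgD => //; exact: cvg_cst.
exists (2 * (C2 * (q + 0) + 0) + 1); near=> n.
have [mxi ixi n0 F01 a1 CF1 Em b1 b2 mix1 mix2 mix3] :
    block_bounds (xi n) n (r n) (F n) C rho (e n) (m n) by near: n.
have en0 : 0 <= e n by exact: le_trans (normr_ge0 _) (mix3 _ _ (leqnn (0 + r n))).
apply: (@le_trans _ _ (2 * (C2 * (q + (r n).+1%:R * F n) + n%:R ^+ 2 * (r n).+1%:R * e n))); last first.
  near: n; move/cvgrPdist_le : h => /(_ 1 ltr01); apply: filterS => n.
  by rewrite distrC ler_norml => /andP[_]; rewrite lerBlDl.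
have := EE_psum_sqr mxi ixi n0 F01 a1 C0 rho01 Em b1 b2 mix3 (leqnn n).
rewrite ler_pM2l ?ltr0n// => /le_trans; apply.
rewrite ler_pM2l// lerD2l ler_wpM2r// expr2 ler_peMr ?mulr_ge0//.
by rewrite ler1n.
Unshelve. all: by end_near. Qed.

Let small_start x : \int[P]_w cos (psum (Z n) (r n + r n) w + x) @[n --> \oo] --> cos x.
Proof.
have h : 2 * ((r n).*2.+1%:R * F n * (2 * C * (sa n)^-1)) @[n --> \oo] --> (0 : R).
  rewrite -(mulr0 2) -(mul0r (2 * C * 0)).
  apply: cvgM; first exact: cvg_cst.
  by apply: cvgM => //; apply: cvgM => //; exact: cvg_cst.
apply/cvgrPdist_le => eps eps0; near=> n.
have [mxi ixi n0 F01 a1 CF1 Em b1 b2 mix1 mix2 mix3] :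
    block_bounds (xi n) n (r n) (F n) C rho (e n) (m n) by near: n.
apply: (@le_trans _ _ (2 * ((r n).*2.+1%:R * F n * (2 * C * (sa n)^-1)))); last first.
  apply: le_trans (ler_norm _) _; rewrite -normrN -sub0r; near: n.
  by move/cvgrPdist_le : h; exact.
have mZ j : measurable_fun setT (Z n j) by exact: measurable_normalized.
have iZ2 j : intg P (fun w => Z n j w ^+ 2) by exact: intg_normalized_sqr.
have iZ j : intg P (Z n j) by exact: intg_of_sqr.
have ic : intg P (fun w => cos (psum (Z n) (r n + r n) w + x)).
  apply: (@intg_bounded _ _ _ _ _ 1); last by move=> w; exact: cos_max.
  exact/measurable_cosD/measurable_psum.
rewrite -[cos x](EE_cst P) distrC.
apply: (@le_trans _ _ (\int[P]_w (2 * near_abs (Z n) (r n) (r n + r n) w))); last first.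
  rewrite EE_Z; last exact: intg_near_abs.
  rewrite ler_pM2l//.
  apply: (@le_trans _ _ ((r n).*2.+1%:R * (2 * C * F n / sa n))).
    exact: (EE_near_abs n (r n) mxi ixi F01 C0 Em b1).
  by rewrite le_eqVlt; apply/orP; left; apply/eqP; ring.
apply: EE_dist_le => //; first exact: intg_cst.
  by apply: intgZ; exact: intg_near_abs.
move=> w; apply: le_trans (cos_lipschitz _ _) _; rewrite ler_pM2l// ge_min addrK.
apply/orP; right; rewrite /near_abs -subnDA subnn.
apply: le_trans (ler_norm_sum _ _ _) _.
by rewrite [leRHS]big_nat_recr//= lerDl.
Unshelve. all: by end_near. Qed.

(** Each step multiplies the characteristic function by [1 - t n / n] up to
    [o (1 / n)], where [t n] tends to [s]. The [n] steps therefore multiply it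
    by [expR (- s)]; the first [2 r n] terms of the sum are negligible. *)
Theorem sequential_clt x :
  \int[P]_w cos (psum (Z n) n w + x) @[n --> \oo] --> expR (- s) * cos x.
Proof.
pose err L K kappa n :=
  10 * (L%:R * (2 * (kappa + C ^+ 2 * F n + K * (sa n)^-1 *
       (C2 * (2 * q + (r n).*2.+1%:R * F n))))
     + C2 * (rho ^+ L * q + (r n).+1%:R * F n))
  + n%:R * e n + n%:R * (3 * (r n).+1%:R * e n)
  + 2 * (C2 * (q + (r n).+1%:R * F n)) * ((r n).*2.+1%:R * (2 * C * F n / sa n)).
have err_cvg L K kappa : err L K kappa n @[n --> \oo] -->
    10 * (L%:R * (2 * (kappa + C ^+ 2 * 0 + K * 0 * (C2 * (2 * q + 0))))
     + C2 * (rho ^+ L * q + 0)) + 0 + 0 + 2 * (C2 * (q + 0)) * (0 * (2 * C * 0)).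
  have hl : (r n).*2.+1%:R * (2 * C * F n / sa n) @[n --> \oo] --> 0 * (2 * C * 0).
    have -> : (fun n => (r n).*2.+1%:R * (2 * C * F n / sa n)) =
      (fun n => ((r n).*2.+1%:R * F n) * (2 * C * (sa n)^-1)).
      by apply/funext => n; ring.
    by apply: cvgM => //; apply: cvgM => //; exact: cvg_cst.
  rewrite /err.
  apply: cvgD; [apply: cvgD; [apply: cvgD; [|exact: ne0]|exact: nre0]|].
    apply: cvgM; first exact: cvg_cst.
    apply: cvgD.
      apply: cvgM; first exact: cvg_cst.
      apply: cvgM; first exact: cvg_cst.
      apply: cvgD.
        by apply: cvgD; [exact: cvg_cst|apply: cvgM => //; exact: cvg_cst].
      apply: cvgM; first by apply: cvgM => //; exact: cvg_cst.
      apply: cvgM; first exact: cvg_cst.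
      by apply: cvgD => //; exact: cvg_cst.
    apply: cvgM; first exact: cvg_cst.
    by apply: cvgD => //; exact: cvg_cst.
  apply: cvgM => //; apply: cvgM; first exact: cvg_cst.
  apply: cvgM; first exact: cvg_cst.
  by apply: cvgD => //; exact: cvg_cst.
pose X n k := \int[P]_w cos (psum (Z n) k w + x).
have step eps : 0 < eps -> \forall n \near \oo, forall k, (r n + r n <= k)%N ->
    `|X n k.+1 - (1 - t n / n%:R) * X n k| <= eps / n%:R.
  move=> eps0.
  have [L L0] : exists L, 10 * (C2 * (rho ^+ L * q)) <= eps / 3.
    have h : 10 * (C2 * (rho ^+ n * q)) @[n --> \oo] --> 10 * (C2 * (0 * q)).
      apply: cvgM; first exact: cvg_cst.
      apply: cvgM; first exact: cvg_cst.
      apply: cvgM; last exact: cvg_cst.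
      by apply: cvg_expr; rewrite ger0_norm; case/andP: rho01.
    have e3 : 0 < eps / 3 by rewrite divr_gt0.
    move/cvgrPdist_le : h => /(_ _ e3) h; near \oo => L; exists L.
    apply: le_trans (ler_norm _) _; rewrite -normrN -sub0r.
    have -> : (0 : R) = 10 * (C2 * (0 * q)) by rewrite mul0r !mulr0.
    by near: L.
  pose kappa := eps / 3 / (20 * L.+1%:R).
  have L10 : 0 < L.+1%:R :> R by rewrite ltr0n.
  have kp : 0 < kappa by rewrite /kappa !divr_gt0// mulr_gt0.
  have [K K0 uiK] := ui kp.
  have kL : 10 * (L%:R * (2 * kappa)) <= eps / 3.
    have h : 20 * L.+1%:R * kappa = eps / 3.
      by rewrite /kappa; field; rewrite gt_eqF.
    rewrite -h -mulrA (_ : 10 * _ = 20 * (L%:R * kappa)); last by ring.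
    by rewrite ler_pM2l// ler_pM2r// ler_nat.
  have e3 : 0 < eps / 3 by rewrite divr_gt0.
  move/cvgrPdist_le : (err_cvg L K kappa) => /(_ _ e3) h.
  near=> n => k rk.
  have b : block_bounds (xi n) n (r n) (F n) C rho (e n) (m n) by near: n.
  have n0 : (0 < n)%N by case: b.
  have gE : forall i dd, \int[P]_w (xi n i w * xi n (i + dd)%N w) = g n dd by near: n.
  have tE : t n / n%:R = \int[P]_w near_quad (Z n) (r n) k w.
    rewrite /t -(EE_near_quadE b gE (leq_trans (leq_addr _ _) rk)) mulrC mulKf//.
    by rewrite pnatr_eq0 -lt0n.
  rewrite ler_pdivlMr ?ltr0n// mulrC tE.
  have uin : forall j, \int[P]_w (xi n j w ^+ 2 * (if K < `|xi n j w| then 1 else 0)) <= kappa * F n.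
    by near: n.
  apply: le_trans (step_error L x C0 rho01 b K0 (ltW kp) uin rk) _.
  rewrite -/(err L K kappa n).
  have : err L K kappa n - (10 * (L%:R * (2 * (kappa + C ^+ 2 * 0 + K * 0 * (C2 * (2 * q + 0))))
     + C2 * (rho ^+ L * q + 0)) + 0 + 0 + 2 * (C2 * (q + 0)) * (0 * (2 * C * 0))) <= eps / 3.
    apply: le_trans (ler_norm _) _; rewrite distrC; near: n; exact: h.
  rewrite !(mulr0, mul0r, addr0); move: kL L0; lra.
have [M M0 tM] : exists2 M, 0 <= M & \forall n \near \oo, `|t n| <= M.
  exists (`|s| + 1); first by rewrite addr_ge0.
  near=> n; have : `|s - t n| <= 1.
    by near: n; move/cvgrPdist_le : t_cvg => /(_ _ ltr01).
  move=> st1; rewrite -[t n](subrK s) addrC; apply: le_trans (ler_normD _ _) _.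
  by rewrite lerD2l distrC.
have nV : n%:R^-1 @[n --> \oo] --> (0 : R).
  apply/(@gtr0_cvgV0 _ _ _ _ (fun n => n%:R)); last exact: cvgr_idn.
  by near=> n; rewrite ltr0n; near: n; exists 1%N.
have r_n : (r n + r n)%:R / n%:R @[n --> \oo] --> (0 : R).
  have h : ((r n)%:R * F n + (r n)%:R * F n) * ((sa n)^-1 * (sa n)^-1) @[n --> \oo] --> (0 + 0) * (0 * 0 : R).
    by apply: cvgM; [exact: cvgD|exact: cvgM].
  rewrite (_ : (0 + 0) * (0 * 0) = 0) in h; last by rewrite mulr0 mulr0.
  apply: cvg_trans h; apply: near_eq_cvg; near=> n.
  have [mxi ixi n0 F01 a1 CF1 Em b1 b2 mix1 mix2 mix3] :
    block_bounds (xi n) n (r n) (F n) C rho (e n) (m n) by near: n.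
  have Fn : 0 < F n by case/andP: F01.
  rewrite -expr2 exprVn sqr_sqrtr ?mulr_ge0 ?(ltW Fn)// natrD.
  have nn0 : n%:R != 0 :> R by rewrite pnatr_eq0 -lt0n.
  have Fn0 : F n != 0 by rewrite gt_eqF.
  by field; rewrite ?nn0 ?Fn0.
have rn : \forall n \near \oo, (r n + r n <= n)%N.
  move/cvgrPdist_le : r_n => /(_ _ ltr01) h; near=> n.
  have n0 : (0 < n)%N by near: n; exists 1%N.
  have : `|0 - (r n + r n)%:R / n%:R| <= 1 :> R by near: n.
  rewrite sub0r normrN ger0_norm ?divr_ge0// ler_pdivrMr ?ltr0n// mul1r.
  by rewrite ler_nat.
have X1 n k : `|X n k| <= 1 \/ ~ (forall j, measurable_fun setT (xi n j)).
  have [mxi|] := pselect (forall j, measurable_fun setT (xi n j)); [left|by right].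
  rewrite /X; apply: EE_norm_bounded; last by move=> w; exact: cos_max.
  by apply/measurable_cosD/measurable_psum => j; exact: measurable_normalized.
have main eps : 0 < eps -> \forall n \near \oo,
    `|X n n - expR (- ((n - (r n + r n))%:R * (t n / n%:R))) * X n (r n + r n)%N| <= eps.
  move=> eps0.
  have ep : 0 < eps / 2 / expR M by rewrite !divr_gt0// expR_gt0.
  have hM : 2 * M ^+ 2 * n%:R^-1 @[n --> \oo] --> (0 : R).
    by rewrite -(mulr0 (2 * M ^+ 2)); apply: cvgM => //; exact: cvg_cst.
  have hM2 : M * n%:R^-1 @[n --> \oo] --> (0 : R).
    by rewrite -(mulr0 M); apply: cvgM => //; exact: cvg_cst.
  have h2 : 0 < 2^-1 :> R by rewrite invr_gt0.
  move/cvgrPdist_le : hM => /(_ _ ep) hM.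
  move/cvgrPdist_le : hM2 => /(_ _ h2) hM2.
  near=> n.
  have b : block_bounds (xi n) n (r n) (F n) C rho (e n) (m n) by near: n.
  have n0 : (0 < n)%N by case: b.
  have np : 0 < n%:R :> R by rewrite ltr0n.
  have tn : `|t n| <= M by near: n.
  have tau2 : `|t n / n%:R| <= M / n%:R.
    by rewrite normrM (ger0_norm (_ : 0 <= n%:R^-1)) ?invr_ge0// ler_wpM2r// invr_ge0.
  have tauh : `|t n / n%:R| <= 2^-1.
    apply: le_trans tau2 _; apply: le_trans (ler_norm _) _.
    by rewrite -normrN -sub0r; near: n.
  have tauM : 2 * M ^+ 2 / n%:R <= eps / 2 / expR M.
    by apply: le_trans (ler_norm _) _; rewrite -normrN -sub0r; near: n.
  have st1 k : (r n + r n <= k < n)%N ->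
      `|X n k.+1 - (1 - t n / n%:R) * X n k| <= (eps / 2 / expR M) / n%:R.
    by move=> /andP[rk _]; move: k rk; near: n; exact: step.
  have en0 : 0 <= (eps / 2 / expR M) / n%:R by rewrite divr_ge0// ltW.
  have x1 k : `|X n k| <= 1 by have [//|[]] := X1 n k; case: b.
  have rnn : (r n + r n <= n)%N by near: n.
  apply: le_trans (recursion_bound rnn tauh en0 st1 x1) _.
  have nn : (n - (r n + r n))%:R <= n%:R :> R by rewrite ler_nat leq_subr.
  have ex : expR ((n - (r n + r n))%:R * `|t n / n%:R|) <= expR M.
    rewrite ler_expR; apply: (@le_trans _ _ (n%:R * (M / n%:R))); first exact: ler_pM.
    by rewrite mulrC mulfVK// gt_eqF.
  have bd : (n - (r n + r n))%:R * (eps / 2 / expR M / n%:R + 2 * (t n / n%:R) ^+ 2) <= eps / expR M.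
    apply: (@le_trans _ _ (n%:R * (eps / 2 / expR M / n%:R + 2 * (M / n%:R) ^+ 2))).
      apply: ler_pM => //; first by rewrite addr_ge0// mulr_ge0// sqr_ge0.
      rewrite lerD2l ler_pM2l// -(real_normK (num_real (t n / n%:R))).
      by rewrite lerXn2r// nnegrE divr_ge0.
    rewrite mulrDr mulrC mulfVK ?gt_eqF//.
    have -> : n%:R * (2 * (M / n%:R) ^+ 2) = 2 * M ^+ 2 / n%:R by field; rewrite gt_eqF.
    have -> : eps / expR M = eps / 2 / expR M + eps / 2 / expR M by field; rewrite gt_eqF ?expR_gt0.
    by rewrite lerD2l.
  apply: (@le_trans _ _ (eps / expR M * expR M)); last by rewrite mulfVK// gt_eqF ?expR_gt0.
  by apply: ler_pM => //; rewrite ?expR_ge0// mulr_ge0// addr_ge0// mulr_ge0// sqr_ge0.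
have lim2 : expR (- ((n - (r n + r n))%:R * (t n / n%:R))) * X n (r n + r n)%N @[n --> \oo] -->
    expR (- s) * cos x.
  apply: cvgM; last exact: small_start.
  apply: (@continuous_cvg _ _ _ _ _ (fun n => - ((n - (r n + r n))%:R * (t n / n%:R))) expR).
    exact: continuous_expR.
  apply: cvgN.
  have h : (1 - (r n + r n)%:R / n%:R) * t n @[n --> \oo] --> (1 - 0) * s.
    by apply: cvgM => //; apply: cvgB => //; exact: cvg_cst.
  rewrite subr0 mul1r in h; apply: cvg_trans h; apply: near_eq_cvg; near=> n.
  have n0 : (0 < n)%N by near: n; exists 1%N.
  rewrite natrB; last by near: n.
  by field; rewrite pnatr_eq0 -lt0n.
rewrite -[X in _ --> X]add0r.
have -> : (fun n => \int[P]_w cos (psum (Z n) n w + x)) = (fun n =>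
   (X n n - expR (- ((n - (r n + r n))%:R * (t n / n%:R))) * X n (r n + r n)%N) +
   expR (- ((n - (r n + r n))%:R * (t n / n%:R))) * X n (r n + r n)%N).
  by apply/funext => n; rewrite subrK.
apply: cvgD => //; apply/cvgrPdist_le => eps eps0; near=> n.
by rewrite sub0r normrN; near: n; exact: main.
Unshelve. all: by end_near. Qed.

End sequential_clt.

(** * Geometric ergodicity from drift and minorization *)

Section kernel_operator.
Context {R : realType} {d} {E : measurableType d} (Pi : R.-pker E ~> E).

Definition kprob (y : E) : set E -> \bar R := Pi y.
HB.instance Definition _ y := Measure.on (kprob y).
Lemma kprob_setT y : kprob y setT = 1%E. Proof. exact: prob_kernel. Qed.
HB.instance Definition _ y := Measure_isProbability.Build _ _ _ (kprob y) (kprob_setT y).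

(** The transition operator, on functions dominated by the weight [V]. *)
Definition Pop (f : E -> R) (y : E) : R := \int[kprob y]_z f z.

Definition dominated (V f : E -> R) : Prop :=
  measurable_fun setT f /\ exists c, forall y, `|f y| <= c * V y.

Variables (V : E -> R) (gamma b : R).
Hypothesis mV : measurable_fun setT V.
Hypothesis V1 : forall y, 1 <= V y.
Hypothesis gamma01 : 0 < gamma < 1.
Hypothesis b0 : 0 < b.
Hypothesis driftV : forall y, (\int[Pi y]_z (V z)%:E <= (gamma * V y + b)%:E)%E.

Lemma intg_kernel_V y : intg (kprob y) V.
Proof.
apply: intg_lty => //; first by move=> w; exact: le_trans (V1 w).
by apply: le_lt_trans (driftV y) _; exact: ltry.
Qed.

Lemma Pop_V y : Pop V y <= gamma * V y + b.
Proof.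
rewrite -lee_fin -integral_EFin_EE; last exact: intg_kernel_V.
exact: driftV.
Qed.

Lemma dominated_intg f y : dominated V f -> intg (kprob y) f.
Proof.
move=> [mf [c fc]]; apply: (intg_le0 mf fc).
exact/intgZ/intg_kernel_V.
Qed.

Lemma dominated_bounded (f : E -> R) M : measurable_fun setT f -> (forall y, `|f y| <= M) ->
  dominated V f.
Proof.
move=> mf fM; split => //; exists M => y; apply: le_trans (fM y) _.
by rewrite ler_peMr//; exact: le_trans (fM y).
Qed.

Lemma dominated_self : dominated V V.
Proof.
split => //; exists 1 => y; rewrite mul1r ger0_norm//.
exact: le_trans (V1 y).
Qed.

Lemma dominatedD f g : dominated V f -> dominated V g -> dominated V (fun y => f y + g y).
Proof.
move=> [mf [c fc]] [mg [c' gc]]; split; first exact: measurable_funD.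
exists (c + c') => y; apply: le_trans (ler_normD _ _) _.
by rewrite mulrDl lerD.
Qed.

Lemma dominatedZ a f : dominated V f -> dominated V (fun y => a * f y).
Proof.
move=> [mf [c fc]]; split; first exact: measurable_funM.
by exists (`|a| * c) => y; rewrite normrM -mulrA ler_wpM2l.
Qed.

Lemma measurable_Pop f : dominated V f -> measurable_fun setT (Pop f).
Proof.
move=> df; have [mf _] := df.
have h (g : E -> R) : dominated V g -> (forall y, 0 <= g y) -> measurable_fun setT (Pop g).
  move=> dg g0; have [mg _] := dg.
  apply/measurable_EFinP; rewrite (_ : _ \o _ = fun y => \int[Pi y]_z (g z)%:E)%E.
    apply: measurable_fun_integral_kernel; first by move=> U mU; exact: measurable_kernel.
      by move=> z; rewrite lee_fin.
    exact/measurable_EFinP.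
  apply/funext => y /=; rewrite -integral_EFin_EE//; exact: dominated_intg.
have da : dominated V (fun y => `|f y|).
  have [c fc] := df.2; split; first exact: measurableT_comp.
  by exists c => y; rewrite normr_id.
have ds : dominated V (fun y => `|f y| + f y) by exact: dominatedD.
have -> : Pop f = (fun y => Pop (fun z => `|f z| + f z) y - Pop (fun z => `|f z|) y).
  apply/funext => y; rewrite /Pop EE_D; try exact: dominated_intg.
  by rewrite addrAC subrr add0r.
apply: measurable_funB; apply: h => // y.
by rewrite -lerBlDr sub0r -normrN ler_norm.
Qed.

Lemma Pop_le f g y : dominated V f -> dominated V g -> (forall z, f z <= g z) ->
  Pop f y <= Pop g y.
Proof. by move=> df dg fg; apply: EE_le => //; exact: dominated_intg. Qed.

Lemma Pop_D f g y : dominated V f -> dominated V g ->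
  Pop (fun z => f z + g z) y = Pop f y + Pop g y.
Proof. by move=> df dg; rewrite /Pop EE_D//; exact: dominated_intg. Qed.

Lemma Pop_Z a f y : dominated V f -> Pop (fun z => a * f z) y = a * Pop f y.
Proof. by move=> df; rewrite /Pop EE_Z//; exact: dominated_intg. Qed.

Lemma dominated_Pop f : dominated V f -> dominated V (Pop f).
Proof.
move=> df; split; first exact: measurable_Pop.
have [mf [c fc]] := df; exists (`|c| * (gamma + b)) => y.
apply: le_trans (EE_norm (dominated_intg y df)) _.
apply: (@le_trans _ _ (Pop (fun z => `|c| * V z) y)).
  apply: EE_le; first exact/intg_norm/dominated_intg.
    exact/intgZ/intg_kernel_V.
  move=> z; apply: le_trans (fc z) _; rewrite ler_wpM2r ?ler_norm//.
  exact: le_trans (V1 z).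
rewrite Pop_Z; last exact: dominated_self.
rewrite -mulrA ler_wpM2l//; apply: le_trans (Pop_V y) _.
by rewrite mulrDl lerD2l ler_peMr// ltW.
Qed.

Lemma dominated_iter n f : dominated V f -> dominated V (iter n Pop f).
Proof. by move=> df; elim: n => //= n; exact: dominated_Pop. Qed.

Lemma iter_Pop_le n f g y : dominated V f -> dominated V g -> (forall z, f z <= g z) ->
  iter n Pop f y <= iter n Pop g y.
Proof.
move=> df dg fg; elim: n y => //= n ih y.
by apply: Pop_le => //; exact: dominated_iter.
Qed.

Lemma iter_Pop_D n f g y : dominated V f -> dominated V g ->
  iter n Pop (fun z => f z + g z) y = iter n Pop f y + iter n Pop g y.
Proof.
move=> df dg; elim: n y => //= n ih y.
by rewrite -Pop_D; [congr Pop; apply/funext|exact: dominated_iter|exact: dominated_iter].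
Qed.

Lemma iter_Pop_Z n a f y : dominated V f ->
  iter n Pop (fun z => a * f z) y = a * iter n Pop f y.
Proof.
move=> df; elim: n y => //= n ih y.
by rewrite -Pop_Z; [congr Pop; apply/funext|exact: dominated_iter].
Qed.

Lemma iter_Pop_cst n c y : iter n Pop (fun=> c) y = c.
Proof.
elim: n y => //= n ih y.
by rewrite (_ : iter n Pop _ = fun=> c) ?/Pop ?EE_cst//; apply/funext.
Qed.

Lemma dominated_cst c : dominated V (fun=> c).
Proof. by apply: (@dominated_bounded _ `|c|). Qed.

Lemma iter_Pop_V_sharp n y :
  iter n Pop V y <= gamma ^+ n * V y + b / (1 - gamma) * (1 - gamma ^+ n).
Proof.
have [g0 g1] := andP gamma01; have g1' : 1 - gamma != 0 by rewrite gt_eqF// subr_gt0.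
elim: n y => [|n ih] y /=; first by rewrite expr0 mul1r subrr mulr0 addr0.
apply: (@le_trans _ _ (Pop (fun z => gamma ^+ n * V z + b / (1 - gamma) * (1 - gamma ^+ n)) y)).
  apply: Pop_le => //; first exact/dominated_iter/dominated_self.
  by apply: dominatedD; [exact/dominatedZ/dominated_self|exact: dominated_cst].
rewrite Pop_D; [|exact/dominatedZ/dominated_self|exact: dominated_cst].
rewrite Pop_Z; last exact: dominated_self.
rewrite {2}/Pop EE_cst.
have h : gamma ^+ n * Pop V y <= gamma ^+ n * (gamma * V y + b).
  by rewrite ler_wpM2l ?Pop_V// exprn_ge0// ltW.
apply: le_trans (lerD h (lexx _)) _.
by rewrite le_eqVlt; apply/orP; left; apply/eqP; rewrite exprS; field.
Qed.

Lemma iter_Pop_V n y : iter n Pop V y <= gamma ^+ n * V y + b / (1 - gamma).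
Proof.
have [g0 g1] := andP gamma01.
apply: le_trans (iter_Pop_V_sharp n y) _; rewrite lerD2l ler_piMr//.
  by rewrite divr_ge0 ?ltW// subr_gt0.
by rewrite gerBl exprn_ge0// ltW.
Qed.

(** Kernel iterates give probabilities only, and the operator gives integrals of
    functions; the two agree on indicators. *)
Lemma kernel_iterE n y B : measurable B ->
  kernel_iter Pi n y B = (iter n Pop (\1_B) y)%:E.
Proof.
move=> mB; elim: n y => [|n ih] y /=; first by rewrite diracE indicE.
rewrite -integral_EFin_EE.
  by apply: eq_integral => z _; exact: ih.
apply/dominated_intg/dominated_iter/(@dominated_bounded _ 1).
  exact: measurable_indic.
by move=> z; rewrite indicE; case: (_ \in _); rewrite ?normr1 ?normr0.
Qed.

Lemma kernel_iter_indic_ge m eps (mu : probability E R) B y : measurable B ->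
  (eps%:E * mu B <= kernel_iter Pi m y B)%E ->
  eps * fine (mu B) <= iter m Pop (\1_B) y.
Proof.
by move=> mB; rewrite kernel_iterE// -[mu B]fineK ?fin_num_measure// -EFinM lee_fin.
Qed.

Variables (m : nat) (x0 : R).
Hypothesis m0 : (0 < m)%N.
Hypothesis x01 : 1 <= x0.
Hypothesis small : forall x, x0 <= x -> exists (mu : probability E R) (eps : R), 0 < eps /\
  forall (y : E) (B : set E), V y <= x -> measurable B ->
    (eps%:E * mu B <= kernel_iter Pi m y B)%E.

Local Notation K := (b / (1 - gamma)).

Let K0 : 0 < K.
Proof. by have [g0 g1] := andP gamma01; rewrite divr_gt0// subr_gt0. Qed.

(** A bound on oscillations by [w x + w y] is a bound on the distance to a
    constant: the supremum of [f - w] lies below the infimum of [f + w]. *)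
Lemma osc_center (f w : E -> R) : (forall x y, f x - f y <= w x + w y) ->
  (exists y : E, True) -> exists c, forall y, `|f y - c| <= w y.
Proof.
move=> fw [y0 _]; pose A := [set f x - w x | x in [set: E]].
have ubA : has_ubound A.
  by exists (f y0 + w y0) => _ [x _ <-]; have := fw x y0; lra.
have A0 : A !=set0 by exists (f y0 - w y0); exists y0.
exists (sup A) => y; rewrite ler_norml; apply/andP; split.
  rewrite lerBrDl; have : sup A <= f y + w y; last by lra.
  by apply: ge_sup => // _ [x _ <-]; have := fw x y; lra.
rewrite lerBlDr -lerBlDl; apply: ub_le_sup => //; exists y => //.
Qed.

(** The contraction estimate of Hairer and Mattingly: in the seminorm that
    weights oscillations by 2 + beta V(x) + beta V(y), far pairs contract by
    the drift condition and close pairs by the minorization. *)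
Lemma harris_contraction : exists beta a, [/\ 0 < beta, 0 < a < 1 &
  forall f, dominated V f ->
   (forall x y, f x - f y <= 2 + beta * V x + beta * V y) ->
   forall x y, iter m Pop f x - iter m Pop f y <= a * (2 + beta * V x + beta * V y)].
Proof.
have [g0 g1] := andP gamma01.
pose g := gamma ^+ m.
have gm0 : 0 < g by rewrite exprn_gt0.
have gm1 : g < 1 by rewrite exprn_ilt1 ?(ltW g0)// -lt0n.
have iV z : iter m Pop V z <= g * V z + K by exact: iter_Pop_V.
clearbody g.
have K0' := K0; move: K0' iV; move: K => K' K0' iV.
pose R0 := x0 + 4 * K' / (1 - g).
have g1' : 0 < 1 - g by lra.
have R00 : x0 <= R0 by rewrite lerDl (divr_ge0 (mulr_ge0 _ (ltW K0')) (ltW g1')).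
have R0p : 0 < R0 by apply: lt_le_trans R00; exact: lt_le_trans x01.
have KR : 2 * K' <= (1 - g) / 2 * R0.
  rewrite /R0 mulrDr.
  have -> : (1 - g) / 2 * (4 * K' / (1 - g)) = 2 * K' by field; rewrite !gt_eqF ?subr_gt0.
  rewrite lerDr; apply: mulr_ge0; last exact: le_trans x01.
  by apply: divr_ge0 => //; exact: ltW.
clearbody R0.
have [mu [eps [eps0 minor]]] := small R00.
have [eps1 eps1p] : exists2 e1, 0 < e1 <= 1 & e1 <= eps.
  by exists (Num.min 1 eps); rewrite ?ge_min ?lexx ?orbT// lt_min ltr01 eps0.
move=> e1eps.
pose beta := eps1 / (4 * K').
have [e10 e11] := andP eps1p.
have beta0 : 0 < beta by rewrite divr_gt0// mulr_gt0.
have bK : 2 * (beta * K') = eps1 / 2 by rewrite /beta; field; rewrite gt_eqF.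
clearbody beta.
pose a1 := (4 + beta * R0 * (1 + g)) / (4 + 2 * beta * R0).
pose a2 := Num.max (1 - eps1 / 4) g.
have a2e : 1 - eps1 / 4 <= a2 by rewrite le_max lexx.
have a2g : g <= a2 by rewrite le_max lexx orbT.
have a21 : a2 < 1 by rewrite gt_max gm1 andbT; lra.
clearbody a2.
have bR : 0 < beta * R0 by rewrite mulr_gt0.
have a10 : 0 < a1 by rewrite divr_gt0//; nra.
have a11 : a1 < 1 by rewrite /a1 ltr_pdivrMr; nra.
have a1E : a1 * (4 + 2 * beta * R0) = 4 + beta * R0 * (1 + g).
  by rewrite /a1 mulfVK// gt_eqF//; nra.
clearbody a1.
exists beta, (Num.max a1 a2); split => //.
  by rewrite lt_max a10/= gt_max a11 a21.
move=> f df fosc x y.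
pose w z := 1 + beta * V z.
have dw : dominated V w.
  by apply: dominatedD; [exact: dominated_cst|exact/dominatedZ/dominated_self].
have iw z : iter m Pop w z <= 1 + beta * (g * V z + K').
  rewrite iter_Pop_D; [|exact: dominated_cst|exact/dominatedZ/dominated_self].
  rewrite iter_Pop_cst lerD2l iter_Pop_Z; last exact: dominated_self.
  by rewrite ler_pM2l// iV.
have [c hc] : exists c, forall z, `|f z - c| <= w z.
  apply: osc_center; last by exists x.
  by move=> x' y'; apply: le_trans (fosc x' y') _; rewrite /w; lra.
pose f1 z := f z - c.
have df1 : dominated V f1 by apply: dominatedD => //; exact: dominated_cst.
have f1E z : iter m Pop f1 z = iter m Pop f z - c.
  by rewrite iter_Pop_D//; [rewrite iter_Pop_cst|exact: dominated_cst].
have f1w z : f1 z <= w z by apply: le_trans (ler_norm _) (hc z).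
have f1w' z : - w z <= f1 z by have := hc z; rewrite ler_norml => /andP[].
have -> : iter m Pop f x - iter m Pop f y = iter m Pop f1 x - iter m Pop f1 y.
  by rewrite !f1E; ring.
have V1x := V1 x; have V1y := V1 y.
have Vx0 : 0 <= V x by exact: le_trans V1x.
have Vy0 : 0 <= V y by exact: le_trans V1y.
have pos : 0 <= 2 + beta * V x + beta * V y.
  by rewrite !addr_ge0// mulr_ge0// ltW.
have [far|close] := leP R0 (V x + V y).
  have h1 : iter m Pop f1 x <= iter m Pop w x by exact: iter_Pop_le.
  have h2 : - iter m Pop w y <= iter m Pop f1 y.
    rewrite -mulN1r -iter_Pop_Z//; apply: iter_Pop_le => //; first exact: dominatedZ.
    by move=> z; rewrite mulN1r.
  apply: (@le_trans _ _ (a1 * (2 + beta * V x + beta * V y))); last first.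
    by rewrite ler_wpM2r ?le_max ?lexx.
  have hx := iw x; have hy := iw y.
  apply: (@le_trans _ _ (2 + beta * (g + (1 - g) / 2) * (V x + V y))).
    have : 2 * (beta * K') <= beta * ((1 - g) / 2) * (V x + V y).
      rewrite mulrCA -mulrA ler_pM2l//; apply: le_trans KR _.
      by rewrite ler_wpM2l// divr_ge0// ltW.
    move: h1 h2 hx hy; lra.
  have p4 : 0 < 4 + 2 * beta * R0 by nra.
  rewrite -(ler_pM2r p4) [leRHS]mulrAC a1E.
  move: far; rewrite (_ : 2 + beta * V x + beta * V y = 2 + beta * (V x + V y)); last by ring.
  move: (V x + V y) => v far.
  have : 0 <= beta * (1 - g) * (v - R0) by rewrite !mulr_ge0 ?subr_ge0// ltW.
  lra.
apply: (@le_trans _ _ (a2 * (2 + beta * V x + beta * V y))); last first.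
  by rewrite ler_wpM2r ?le_max ?lexx ?orbT.
have hx : V x <= R0 by lra.
have hy : V y <= R0 by lra.
pose A := [set z | f1 z <= 0].
have mA : measurable A.
  rewrite (_ : A = f1 @^-1` `]-oo, 0]%classic); last first.
    by apply/seteqP; split => z; rewrite /A/= in_itv.
  by rewrite -[X in measurable X]setTI; apply: df1.1.
have dind B : measurable B -> dominated V (\1_B).
  move=> mB; apply: (@dominated_bounded _ 1); first exact: measurable_indic.
  by move=> z; rewrite indicE; case: (_ \in _); rewrite ?normr1 ?normr0.
have dwf : dominated V (fun z => w z + (-1) * f1 z) by apply: dominatedD => //; exact: dominatedZ.
have dwf' : dominated V (fun z => w z + f1 z) by apply: dominatedD.
have hA : iter m Pop (\1_A) x <= iter m Pop (fun z => w z + (-1) * f1 z) x.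
  apply: iter_Pop_le => //; first exact: dind.
  move=> z; rewrite indicE; case: (boolP (z \in A)) => [/set_mem zA|_]/=; last first.
    by have := f1w z; rewrite mulN1r; lra.
  by rewrite /A/= in zA; rewrite mulN1r /w; have := V1 z; nra.
have hAC : iter m Pop (\1_(~` A)) y <= iter m Pop (fun z => w z + f1 z) y.
  apply: iter_Pop_le => //; first exact/dind/measurableC.
  move=> z; rewrite indicE; case: (boolP (z \in ~` A)) => [/set_mem zA|_]/=; last first.
    by have := f1w' z; lra.
  have : 0 < f1 z by rewrite ltNge; apply/negP.
  by rewrite /w; have := V1 z; nra.
have mA1 := kernel_iter_indic_ge mA (minor _ _ hx mA).
have mA2 := kernel_iter_indic_ge (measurableC mA) (minor _ _ hy (measurableC mA)).
have mAC : fine (mu (~` A)) = 1 - fine (mu A).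
  by rewrite probability_setC// fineB// fin_num_measure.
rewrite iter_Pop_D// in hA; last exact: dominatedZ.
rewrite iter_Pop_Z// in hA; rewrite iter_Pop_D// in hAC.
rewrite mAC in mA2; have hwx := iw x; have hwy := iw y.
have : beta * (V x + V y) * g <= beta * (V x + V y) * a2.
  by rewrite ler_wpM2l// mulr_ge0//; [exact: ltW|lra].
move: hA hAC mA1 mA2 hwx hwy; lra.
Qed.

Lemma bernoulli_ge (t : R) n : 0 <= t <= 1 -> 1 - n%:R * t <= (1 - t) ^+ n.
Proof.
move=> /andP[t0 t1]; elim: n => [|n ih]; first by rewrite mul0r subr0 expr0.
have h : (1 - n%:R * t) * (1 - t) <= (1 - t) ^+ n * (1 - t).
  by rewrite ler_wpM2r// subr_ge0.
rewrite exprSr; apply: le_trans h; rewrite -natr1.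
have : 0 <= n%:R * (t * t) by rewrite !mulr_ge0.
lra.
Qed.

(** Write [n = k m + j]. The [k] contractions give the rate and the first [j]
    steps only inflate the weight by a constant. *)
Lemma geometric_ergodicity : exists C rho, [/\ 0 <= C, 0 < rho < 1 &
  forall c (f : E -> R), 0 <= c -> measurable_fun setT f -> (forall y, `|f y| <= c * V y) ->
  forall n x y, iter n Pop f x - iter n Pop f y <= c * C * rho ^+ n * (V x + V y)].
Proof.
have [beta [a [beta0 a01 contr]]] := harris_contraction.
have [a0 a1] := andP a01.
have iterk k f : dominated V f ->
    (forall x y, f x - f y <= 2 + beta * V x + beta * V y) ->
    forall x y, iter (k * m) Pop f x - iter (k * m) Pop f y <=
      a ^+ k * (2 + beta * V x + beta * V y).
  move=> df fosc; elim: k => [|k ih] x y; first by rewrite mul0n expr0 mul1r; exact: fosc.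
  have ak0 : 0 < a ^+ k by exact: exprn_gt0.
  have dk : dominated V (iter (k * m) Pop f) by exact: dominated_iter.
  have := contr (fun z => (a ^+ k)^-1 * iter (k * m) Pop f z) (dominatedZ _ dk).
  rewrite mulSn iterD => h.
  have {}h : iter m Pop (fun z => (a ^+ k)^-1 * iter (k * m) Pop f z) x -
     iter m Pop (fun z => (a ^+ k)^-1 * iter (k * m) Pop f z) y <=
     a * (2 + beta * V x + beta * V y).
    by apply: h => x' y'; rewrite -mulrBr ler_pdivrMl.
  by move: h; rewrite !iter_Pop_Z// -mulrBr ler_pdivrMl// mulrA -exprSr.
pose rho := 1 - (1 - a) / m%:R.
have mp : 0 < m%:R :> R by rewrite ltr0n.
have t01 : 0 < (1 - a) / m%:R <= 1 - a.
  rewrite divr_gt0 ?subr_gt0//= ler_pdivrMr// ler_peMr ?subr_ge0 ?(ltW a1)//.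
  by rewrite ler1n.
have [t0 t1] := andP t01.
have rho01 : 0 < rho < 1 by rewrite /rho; apply/andP; split; lra.
have [r0 r1] := andP rho01.
have arho : a <= rho ^+ m.
  have h1 : 0 <= (1 - a) / m%:R <= 1 by apply/andP; split; lra.
  apply: le_trans (bernoulli_ge m h1).
  by rewrite mulrC mulfVK ?gt_eqF// opprB addrC subrK.
pose M := (1 + K) * (beta^-1 + 1) / rho ^+ m.
have K0' := K0.
have M0 : 0 <= M.
  by rewrite !mulr_ge0 ?addr_ge0 ?invr_ge0 ?exprn_ge0// ltW.
exists M, rho; split => // c f c0 mf fV n x y.
have df : dominated V f by split => //; exists c.
have [g0 g1] := andP gamma01.
pose j := (n %% m)%N; pose k := (n %/ m)%N.
have nE : n = (k * m + j)%N by exact: divn_eq.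
pose h := iter j Pop f.
have dh : dominated V h by exact: dominated_iter.
have hV z : `|h z| <= c * ((1 + K) * V z).
  have iVz : iter j Pop V z <= (1 + K) * V z.
    apply: le_trans (iter_Pop_V j z) _; rewrite mulrDl mul1r; apply: lerD.
      rewrite ler_piMl ?exprn_ile1// ?(ltW g0) ?(ltW g1)//.
      exact: le_trans (V1 z).
    by rewrite ler_peMr// ltW.
  have hh : c * iter j Pop V z <= c * ((1 + K) * V z) by rewrite ler_wpM2l.
  rewrite -iter_Pop_Z in hh; last exact: dominated_self.
  have dcV : dominated V (fun z => c * V z) by exact/dominatedZ/dominated_self.
  have fc z' : - (c * V z') <= f z' <= c * V z' by rewrite -ler_norml.
  rewrite ler_norml; apply/andP; split; last first.
    by apply: le_trans hh; apply: iter_Pop_le => // z'; case/andP: (fc z').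
  rewrite lerNl; apply: le_trans hh; rewrite /h -mulN1r -iter_Pop_Z//.
  apply: iter_Pop_le => //; first exact: dominatedZ.
  by move=> z'; rewrite mulN1r lerNl; case/andP: (fc z').
have [c00|cn0] := eqVneq c 0.
  have f0 z : f z = 0 by apply/eqP; rewrite -normr_le0; apply: le_trans (fV z) _; rewrite c00 mul0r.
  have -> : f = fun=> 0 by apply/funext.
  by rewrite !iter_Pop_cst subrr c00 !mul0r.
have cp : 0 < c by rewrite lt_def cn0.
pose s := beta / (c * (1 + K)).
have sp : 0 < s by rewrite divr_gt0// mulr_gt0// addr_gt0.
have osc x' y' : s * h x' - s * h y' <= 2 + beta * V x' + beta * V y'.
  have hb z : s * `|h z| <= beta * V z.
    rewrite /s mulrAC ler_pdivrMr ?mulr_gt0 ?addr_gt0//.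
    rewrite -mulrA ler_pM2l//; apply: le_trans (hV z) _.
    by rewrite le_eqVlt; apply/orP; left; apply/eqP; ring.
  have h1 := hb x'; have h2 := hb y'.
  have h3 : s * h x' <= s * `|h x'| by rewrite ler_pM2l// ler_norm.
  have h4 : - (s * h y') <= s * `|h y'| by rewrite -mulrN ler_pM2l// -normrN ler_norm.
  lra.
have := iterk k _ (dominatedZ s dh) osc x y.
rewrite !iter_Pop_Z// -mulrBr /h -!iterD -nE => main.
have xy : 0 <= 2 + beta * V x + beta * V y.
  have V1x := V1 x; have V1y := V1 y.
  by rewrite !addr_ge0// mulr_ge0 ?(ltW beta0)//; [exact: le_trans V1x|exact: le_trans V1y].
have ak : a ^+ k <= rho ^+ n / rho ^+ m.
  rewrite ler_pdivlMr ?exprn_gt0//.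
  apply: (@le_trans _ _ (rho ^+ (m * k) * rho ^+ m)).
    by rewrite ler_wpM2r ?exprn_ge0 ?(ltW r0)// exprM lerXn2r// nnegrE ?exprn_ge0// ltW.
  rewrite -exprD ler_wiXn2l ?(ltW r0) ?(ltW r1)//.
  by rewrite {1}nE mulnC leq_add2l ltnW// ltn_pmod.
rewrite -(ler_pM2l sp); apply: le_trans main _.
apply: (@le_trans _ _ (rho ^+ n / rho ^+ m * (2 + beta * V x + beta * V y))).
  by rewrite ler_wpM2r.
have -> : s * (c * M * rho ^+ n * (V x + V y)) =
   rho ^+ n / rho ^+ m * ((1 + beta) * (V x + V y)).
  rewrite /s /M; have K1 : 1 + K != 0 by rewrite gt_eqF// addr_gt0.
  have rm : rho ^+ m != 0 by rewrite gt_eqF// exprn_gt0.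
  move: (K) K1 => K' K1.
  by field; rewrite rm K1 cn0 gt_eqF.
rewrite ler_wpM2l ?divr_ge0 ?exprn_ge0 ?(ltW r0)//.
have V1x := V1 x; have V1y := V1 y; lra.
Qed.
End kernel_operator.

Section sqrt_drift.
Context {R : realType} {d} {E : measurableType d} (Pi : R.-pker E ~> E).
Variables (V : E -> R) (gamma b : R).
Hypothesis mV : measurable_fun setT V.
Hypothesis V1 : forall y, 1 <= V y.
Hypothesis gamma01 : 0 < gamma < 1.
Hypothesis b0 : 0 < b.
Hypothesis driftV : forall y, (\int[Pi y]_z (V z)%:E <= (gamma * V y + b)%:E)%E.

Lemma measurable_sqrtV : measurable_fun setT (fun y => Num.sqrt (V y)).
Proof.
apply: (measurableT_comp (f := @Num.sqrt R)) => //.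
by apply: continuous_measurable_fun; exact: sqrt_continuous.
Qed.

Lemma sqrt_V_ge1 y : 1 <= Num.sqrt (V y).
Proof. by rewrite -[leLHS]sqrtr1 ler_wsqrtr. Qed.

(** Jensen's inequality transfers the drift condition to the square root. *)
Lemma drift_sqrt y : (\int[Pi y]_z (Num.sqrt (V z))%:E <=
  (Num.sqrt gamma * Num.sqrt (V y) + Num.sqrt b)%:E)%E.
Proof.
have [g0 g1] := andP gamma01.
have iV := intg_kernel_V mV V1 driftV y.
have isV : intg (kprob Pi y) (fun z => Num.sqrt (V z)).
  apply: (intg_le0 measurable_sqrtV _ iV) => z.
  rewrite ger0_norm ?sqrtr_ge0// -{2}(sqr_sqrtr (le_trans ler01 (V1 z))).
  by rewrite expr2 ler_peMr ?sqrtr_ge0// sqrt_V_ge1.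
rewrite [leLHS](integral_EFin_EE isV) lee_fin.
set c := \int[_]_w _.
have c0 : 0 <= c by apply: EE_ge0 => z; exact: sqrtr_ge0.
have cV : c ^+ 2 <= gamma * V y + b.
  apply: le_trans (Pop_V mV V1 driftV y).
  have : 0 <= \int[kprob Pi y]_z (V z - (2 * c * Num.sqrt (V z) - c ^+ 2)).
    apply: EE_ge0 => z; rewrite -{1}(sqr_sqrtr (le_trans ler01 (V1 z))).
    by have := sqr_ge0 (Num.sqrt (V z) - c); rewrite !expr2; lra.
  rewrite EE_B//; last by apply: intgB; [exact: intgZ|exact: intg_cst].
  rewrite EE_B; [|exact: intgZ|exact: intg_cst].
  rewrite EE_Z// -/c.
  have -> : \int[kprob Pi y]_z c ^+ 2 = c ^+ 2 := EE_cst _ _.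
  rewrite /Pop !expr2; lra.
rewrite -(ler_pXn2r (n := 2))// ?nnegrE ?addr_ge0 ?mulr_ge0 ?sqrtr_ge0//.
apply: le_trans cV _; rewrite sqrrD exprMn !sqr_sqrtr ?(ltW g0) ?(ltW b0)//.
  by rewrite lerD2r lerDl mulrn_wge0// !mulr_ge0 ?sqrtr_ge0.
exact: le_trans (V1 y).
Qed.

End sqrt_drift.

(** * The Markov property for functions of the past and of the future *)

Section disintegration.
Context {R : realType} {dO} {Omega : measurableType dO} (P : probability Omega R)
  {dD} {D : measurableType dD} {dE} {E : measurableType dE} (k : R.-pker D ~> E)
  (U : Omega -> D) (Z : Omega -> E) (mU : measurable_fun setT U)
  (mZ : measurable_fun setT Z).

Let base (_ : unit) : {measure set Omega -> \bar R} := P.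
Let mbase B : measurable B -> measurable_fun setT (base ^~ B).
Proof. by move=> mB; exact: measurable_cst. Qed.
HB.instance Definition _ := isKernel.Build _ _ _ _ R base mbase.
Let base_setT x : base x setT = 1%E. Proof. exact: probability_setT. Qed.
HB.instance Definition _ := Kernel_isProbability.Build _ _ _ _ R base base_setT.

Let graph (x : unit * Omega) : {measure set (D * E) -> \bar R} :=
  measure_function_pushforward__canonical__measure_function_Measure
    (k (U x.2)) (pair1_measurable (U x.2)).

Let graphE x A : graph x A = k (U x.2) (xsection A (U x.2)).
Proof. by rewrite xsectionE. Qed.

Let mgraph A : measurable A -> measurable_fun setT (graph ^~ A).
Proof.
move=> mA.
rewrite (_ : (fun _ => _) = (fun d => k d (xsection A d)) \o U \o snd); last first.
  by apply/funext => x; rewrite graphE.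
apply: measurableT_comp; last exact: measurable_snd.
apply: (measurableT_comp (f := fun d => k d (xsection A d))); last exact: mU.
by apply: measurable_fun_xsection_finite_kernel; rewrite inE.
Qed.
HB.instance Definition _ := isKernel.Build _ _ _ _ R graph mgraph.
Let graph_setT x : graph x setT = 1%E.
Proof. by rewrite graphE xsectionE preimage_setT prob_kernel. Qed.
HB.instance Definition _ := Kernel_isProbability.Build _ _ _ _ R graph graph_setT.

Hypothesis joint : forall A B, measurable A -> measurable B ->
  P (U @^-1` A `&` Z @^-1` B) = (\int[P]_(w in U @^-1` A) k (U w) B)%E.

Let mUZ : measurable_fun setT (fun w => (U w, Z w)).
Proof. exact: measurable_fun_pair. Qed.

Let joint_law : {measure set (D * E) -> \bar R} :=
  measure_function_pushforward__canonical__measure_function_Measure P mUZ.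

Let joint_lawE A : measurable A -> joint_law A = kcomp base graph tt A.
Proof.
apply: (measure_unique _ (fun=> setT) (@measurable_prod_measurableType _ _ D E)).
- move=> _ _ [A1 mA1 [B1 mB1 <-]] [A2 mA2 [B2 mB2 <-]]; rewrite -setXI.
  by exists (A1 `&` A2); [exact: measurableI|exists (B1 `&` B2); [exact: measurableI|]].
- by move=> _; exists setT => //; exists setT => //; rewrite setXTT.
- by rewrite bigcup_const.
- move=> _ [A' mA' [B mB <-]]; transitivity (P (U @^-1` A' `&` Z @^-1` B)).
    by congr (P _); apply/seteqP; split => w /=.
  rewrite joint// integral_mkcond; apply: eq_integral => w _.
  rewrite graphE patchE /=; case: ifPn => wA.
    by rewrite in_xsectionX//; move: wA; rewrite !inE.
  by rewrite notin_xsectionX ?measure0//; move: wA; rewrite !notin_setE.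
- move=> _; rewrite (_ : joint_law setT = P setT); last by [].
  by rewrite probability_setT ltry.
Qed.

(** Both sides integrate [F] for a finite measure on the product, and the two
    measures agree on rectangles, which generate the product sigma-algebra. *)
Lemma integral_disintegration (F : D * E -> \bar R) :
  measurable_fun setT F -> (forall x, 0 <= F x)%E ->
  (\int[P]_w F (U w, Z w) = \int[P]_w \int[k (U w)]_z F (U w, z))%E.
Proof.
move=> mF F0; transitivity (\int[joint_law]_x F x)%E.
  by rewrite ge0_integral_pushforward.
transitivity (\int[kcomp base graph tt]_x F x)%E.
  by apply: eq_measure_integral => A mA _; exact: joint_lawE.
rewrite integral_kcomp//; apply: eq_integral => w _.
by rewrite ge0_integral_pushforward.
Qed.

Lemma measurable_disintegration (F : D * E -> \bar R) :
  measurable_fun setT F -> (forall x, 0 <= F x)%E ->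
  measurable_fun setT (fun d => \int[k d]_z F (d, z))%E.
Proof. by move=> mF F0; exact: (measurable_kfcomp k mF F0). Qed.
End disintegration.

Section kernel_along.
Context {R : realType} {dD} {D : measurableType dD} {dE} {E : measurableType dE}
  (Pi : R.-pker E ~> E) (s : D -> E) (ms : measurable_fun setT s).

(** The transition kernel composed with a map into the state space, to be used
    as a conditional law given the whole past. *)
Definition kernel_along_fun of measurable_fun setT s :=
  fun d : D => Pi (s d) : {measure set E -> \bar R}.

Local Notation kpre := (kernel_along_fun ms).

Let mker U : measurable U -> measurable_fun setT (kpre ^~ U).
Proof.
by move=> mU; apply: (measurableT_comp (f := Pi ^~ U)) => //; exact: measurable_kernel.
Qed.
HB.instance Definition _ := isKernel.Build _ _ _ _ R kpre mker.
Let kernel_along_setT d : kpre d setT = 1%E. Proof. exact: prob_kernel. Qed.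
HB.instance Definition _ := Kernel_isProbability.Build _ _ _ _ R kpre kernel_along_setT.
Definition kernel_along : R.-pker D ~> E := kpre.
End kernel_along.

Section markov_past.
Context {R : realType} {dO} {Omega : measurableType dO} (P : probability Omega R)
  {dE} {E : measurableType dE} (Pi : R.-pker E ~> E) (Y : int -> {RV P >-> E}).

Definition past_generators (n : int) : set (set Omega) :=
  \bigcup_(j in [set j : int | j <= n]) preimage_set_system setT (Y j) measurable.

Definition past (n : int) := g_sigma_algebraType (past_generators n).

Lemma measurable_past_sub n (A : set Omega) :
  measurable (A : set (past n)) -> measurable A.
Proof.
apply: smallest_sub; first exact: sigma_algebra_measurable.
by move=> B [j _ [C mC <-]]; rewrite setTI -[X in measurable X]setTI; exact: measurable_funP.
Qed.

Lemma measurable_fun_past_sub n d' (T' : measurableType d') (U : Omega -> T') :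
  measurable_fun setT (U : past n -> T') -> measurable_fun setT U.
Proof. move=> mU _ B mB; apply: (@measurable_past_sub n); exact: mU. Qed.

Lemma measurable_past_le n n' (A : set Omega) : n <= n' ->
  measurable (A : set (past n)) -> measurable (A : set (past n')).
Proof.
move=> nn'; apply: sub_sigma_algebra2 => B [j jn h]; exists j => //.
exact: le_trans jn nn'.
Qed.

Lemma measurable_fun_past_le n n' d' (T' : measurableType d') (U : Omega -> T') : n <= n' ->
  measurable_fun setT (U : past n -> T') ->
  measurable_fun setT (U : past n' -> T').
Proof. by move=> nn' mU _ B mB; apply: (measurable_past_le nn'); exact: mU. Qed.

Lemma measurable_past_Y n j : j <= n ->
  measurable_fun setT (Y j : past n -> E).
Proof.
move=> jn _ B mB; rewrite setTI; apply: sub_sigma_algebra.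
by exists j => //; exists B => //; rewrite setTI.
Qed.

Section one_step.
Variable n : int.

Hypothesis mc : markov_chain Pi Y.

(** The Markov property is assumed for events of the past and of the next state.
    It extends to all nonnegative functions of the pair by disintegration. *)
Lemma markov_step (F : past n * E -> \bar R) : measurable_fun setT F ->
  (forall x, 0 <= F x)%E ->
  (\int[P]_w F (w, Y (n + 1) w) = \int[P]_w \int[Pi (Y n w)]_z F (w, z))%E.
Proof.
move=> mF F0.
apply: (@integral_disintegration _ _ _ P _ (past n) _ _
  (kernel_along Pi (measurable_past_Y (lexx n))) id) => //.
- by move=> _ B mB; rewrite setTI; exact: (@measurable_past_sub n).
- by move=> A B mA mB; exact: mc.
Qed.

End one_step.

Definition last_int p (f : p.+2.-tuple E -> \bar R) (t : p.+1.-tuple E) : \bar R :=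
  (\int[Pi (tnth t ord_max)]_z f [tuple of rcons t z])%E.

Fixpoint future_int p : (p.+1.-tuple E -> \bar R) -> E -> \bar R :=
  if p is p'.+1 return (p.+1.-tuple E -> \bar R) -> E -> \bar R
  then fun f => future_int (last_int f) else fun f y => f [tuple y].

Definition path_from (n : int) p (w : Omega) : p.+1.-tuple E :=
  [tuple Y (n + (i : nat)%:Z) w | i < p.+1].

Lemma measurable_rcons p d' (T' : measurableType d') (f : T' -> p.-tuple E) (g : T' -> E) :
  measurable_fun setT f -> measurable_fun setT g ->
  measurable_fun setT (fun x => [tuple of rcons (f x) (g x)] : p.+1.-tuple E).
Proof.
move=> mf mg; apply/measurable_fun_tnthP => i.
have [ip|ip] := ltnP i p.
  rewrite (_ : _ \o _ = fun x => tnth (f x) (Ordinal ip)).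
    exact: (measurable_fun_tnthP _).1.
  apply/funext => x /=; rewrite !(tnth_nth (g x))/= nth_rcons size_tuple ip.
  by [].
rewrite (_ : _ \o _ = g)//; apply/funext => x /=.
rewrite (tnth_nth (g x))/= nth_rcons size_tuple ltnNge ip /=.
by case: eqP.
Qed.

Lemma measurable_last_int p (f : p.+2.-tuple E -> \bar R) :
  measurable_fun setT f -> (forall t, 0 <= f t)%E -> measurable_fun setT (last_int f).
Proof.
move=> mf f0.
apply: (@measurable_disintegration _ _ _ _ _ (kernel_along Pi (measurable_tnth ord_max))
  (fun tz => f [tuple of rcons tz.1 tz.2])) => //.
apply: measurableT_comp => //.
by apply: measurable_rcons; [exact: measurable_fst|exact: measurable_snd].
Qed.

Lemma last_int_ge0 p (f : p.+2.-tuple E -> \bar R) :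
  (forall t, 0 <= f t)%E -> forall t, (0 <= last_int f t)%E.
Proof. by move=> f0 t; exact: integral_ge0. Qed.

Lemma future_int_ge0 p (f : p.+1.-tuple E -> \bar R) :
  (forall t, 0 <= f t)%E -> forall y, (0 <= future_int f y)%E.
Proof.
elim: p f => [f f0 y /=|p IH f f0 /=]; first exact: f0.
by apply: IH; exact: last_int_ge0.
Qed.

Lemma measurable_future_int p (f : p.+1.-tuple E -> \bar R) :
  measurable_fun setT f -> (forall t, 0 <= f t)%E -> measurable_fun setT (future_int f).
Proof.
elim: p f => [f mf f0 /=|p IH f mf f0 /=].
  apply: measurableT_comp => //; apply/measurable_fun_tnthP => i.
  rewrite (_ : _ \o _ = id); first exact: measurable_id.
  by apply/funext => y /=; rewrite (ord1 i).
by apply: IH; [exact: measurable_last_int|exact: last_int_ge0].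
Qed.

Hypothesis mc : markov_chain Pi Y.

Lemma measurable_past_path n p :
  measurable_fun setT (path_from n p : past (n + (p : nat)%:Z) -> p.+1.-tuple E).
Proof.
apply/measurable_fun_tnthP => i.
rewrite (_ : _ \o _ = Y (n + (i : nat)%:Z)); last first.
  by apply/funext => w /=; rewrite tnth_mktuple.
by apply: measurable_past_Y; rewrite lerD2l lez_nat -ltnS ltn_ord.
Qed.

Lemma path_from_rcons n p w : path_from n p.+1 w =
  [tuple of rcons (path_from n p w) (Y (n + p%:Z + 1) w)].
Proof.
apply: eq_from_tnth => i; rewrite tnth_mktuple.
rewrite (tnth_nth (Y 0 w)) /= nth_rcons size_map size_enum_ord.
case: ltnP => ip.
  rewrite (nth_map ord0) ?size_enum_ord//; congr (Y (n + _%:Z) w).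
  by rewrite nth_enum_ord.
have -> : (i : nat) = p.+1 by apply/eqP; rewrite eqn_leq ip -ltnS ltn_ord.
by rewrite eqxx -addn1 PoszD addrA.
Qed.

(** By induction on the length of the path, the last state being integrated out
    with the help of [markov_step]. *)
Lemma markov_future n p (A : Omega -> \bar R) (f : p.+1.-tuple E -> \bar R) :
  measurable_fun setT (A : past n -> \bar R) -> (forall w, 0 <= A w)%E ->
  measurable_fun setT f -> (forall t, 0 <= f t)%E ->
  (\int[P]_w (A w * f (path_from n p w)) = \int[P]_w (A w * future_int f (Y n w)))%E.
Proof.
move=> mA A0; elim: p f => [f mf f0|p IH f mf f0].
  apply: eq_integral => w _ /=; congr (_ * f _)%E.
  by apply: eq_from_tnth => i; rewrite tnth_mktuple (ord1 i) addr0.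
rewrite -(IH (last_int f)); [|exact: measurable_last_int|exact: last_int_ge0].
under eq_integral do rewrite path_from_rcons.
have mA' : measurable_fun setT (A : past (n + p%:Z) -> \bar R).
  by apply: (measurable_fun_past_le _ mA); rewrite lerDl.
rewrite (@markov_step _ mc (fun x => A x.1 * f [tuple of rcons (path_from n p x.1) x.2])%E).
- apply: eq_integral => w _ /=; rewrite /last_int tnth_mktuple ge0_integralZl//.
  by apply: measurableT_comp => //; apply: measurable_rcons => //; exact: measurable_cst.
- apply: emeasurable_funM; first exact: (measurableT_comp mA' measurable_fst).
  apply: measurableT_comp => //; apply: measurable_rcons; last exact: measurable_snd.
  have mp := @measurable_past_path n p.
  by have := measurableT_comp mp (@measurable_fst _ _ (past (n + p%:Z)) E); exact.
- by move=> x; exact: mule_ge0.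
Qed.

End markov_past.

(** * Stationary paths and mixing *)

Section stationarity.
Context {R : realType} {dO} {Omega : measurableType dO} (P : probability Omega R)
  {dE} {E : measurableType dE} (Y : int -> {RV P >-> E}).
Hypothesis sY : strictly_stationary Y.

Lemma measurable_path n p : measurable_fun setT (path_from Y n p).
Proof.
apply/measurable_fun_tnthP => i; rewrite (_ : _ \o _ = Y (n + (i : nat)%:Z)) => [//|].
by apply/funext => w /=; rewrite tnth_mktuple.
Qed.

Lemma ge0_path_stationary n p (f : p.+1.-tuple E -> \bar R) : measurable_fun setT f ->
  (forall t, 0 <= f t)%E ->
  (\int[P]_w f (path_from Y n p w) = \int[P]_w f (path_from Y 0 p w))%E.
Proof.
move=> mf f0.
have push m : (\int[P]_w f (path_from Y m p w) =
  \int[measure_function_pushforward__canonical__measure_function_Measure P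
    (@measurable_path m p)]_t f t)%E.
  by rewrite ge0_integral_pushforward//; exact: measurable_path.
rewrite !push; apply: eq_measure_integral => B mB _.
have := sY [tuple (i : nat)%:Z | i < p.+1] n mB.
rewrite /= /pushforward; congr (P _ = P _); apply/seteqP; split => w /=.
all: rewrite /path_from; congr B; apply: eq_from_tnth => i; rewrite !tnth_mktuple.
all: by rewrite ?(addrC _ n) ?add0r.
Qed.

Lemma EE_path_stationary n p (f : p.+1.-tuple E -> R) : measurable_fun setT f ->
  \int[P]_w f (path_from Y n p w) = \int[P]_w f (path_from Y 0 p w).
Proof.
move=> mf; rewrite /Rintegral integralE [in RHS]integralE.
have mEf : measurable_fun setT (EFin \o f) by exact/measurable_EFinP.
congr (fine (_ - _)).
- have := @ge0_path_stationary n p _ (measurable_funepos mEf) (fun t => funepos_ge0 _ t).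
  move=> h; transitivity (\int[P]_w (EFin \o f)^\+%E (path_from Y n p w))%E.
    by apply: eq_integral => w _; rewrite !funeposE.
  by rewrite h; apply: eq_integral => w _; rewrite !funeposE.
- have := @ge0_path_stationary n p _ (measurable_funeneg mEf) (fun t => funeneg_ge0 _ t).
  move=> h; transitivity (\int[P]_w (EFin \o f)^\-%E (path_from Y n p w))%E.
    by apply: eq_integral => w _; rewrite !funenegE.
  by rewrite h; apply: eq_integral => w _; rewrite !funenegE.
Qed.

Lemma ge0_stationary n (f : E -> \bar R) : measurable_fun setT f ->
  (forall t, 0 <= f t)%E -> (\int[P]_w f (Y n w) = \int[P]_w f (Y 0 w))%E.
Proof.
move=> mf f0.
have := @ge0_path_stationary n 0 (fun t => f (tnth t ord0)).
rewrite /path_from; under eq_integral do rewrite tnth_mktuple addr0.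
move=> h; rewrite h//; last by apply: measurableT_comp => //; exact: measurable_tnth.
by apply: eq_integral => w _; rewrite tnth_mktuple add0r.
Qed.

Lemma EE_stationary n (f : E -> R) : measurable_fun setT f ->
  \int[P]_w f (Y n w) = \int[P]_w f (Y 0 w).
Proof.
move=> mf.
have := @EE_path_stationary n 0 (fun t => f (tnth t ord0)).
rewrite /path_from; under eq_Rintegral do rewrite tnth_mktuple addr0.
move=> h; rewrite h//; last by apply: measurableT_comp => //; exact: measurable_tnth.
by apply: eq_Rintegral => w _; rewrite tnth_mktuple add0r.
Qed.

Lemma intg_stationary n (f : E -> R) : measurable_fun setT f ->
  intg P (fun w => f (Y 0 w)) -> intg P (fun w => f (Y n w)).
Proof.
move=> mf if0; have mfY m : measurable_fun setT (fun w => f (Y m w)).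
  by apply: (measurableT_comp (f := f)).
apply/integrableP; split; first exact/measurable_EFinP.
rewrite (@ge0_stationary n (fun y => `|(f y)%:E|)%E) => //; first by have /integrableP[] := if0.
by apply: measurableT_comp => //; exact/measurable_EFinP.
Qed.

End stationarity.

Section future_bounds.
Context {R : realType} {dO} {Omega : measurableType dO} (P : probability Omega R)
  {dE} {E : measurableType dE} (Pi : R.-pker E ~> E).
Variables (W : E -> R) (gamma b : R).
Hypothesis mW : measurable_fun setT W.
Hypothesis W1 : forall y, 1 <= W y.
Hypothesis gamma01 : 0 < gamma < 1.
Hypothesis b0 : 0 < b.
Hypothesis driftW : forall y, (\int[Pi y]_z (W z)%:E <= (gamma * W y + b)%:E)%E.

Definition path_weight p (t : p.-tuple E) : R := \sum_(i < p) W (tnth t i).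

Lemma path_weight_ge0 p (t : p.-tuple E) : 0 <= path_weight t.
Proof. by apply: sumr_ge0 => i _; exact: le_trans (W1 _). Qed.

Lemma path_weight_rcons p (t : p.-tuple E) z :
  path_weight [tuple of rcons t z] = path_weight t + W z.
Proof.
rewrite /path_weight big_ord_recr /=; congr (_ + W _).
  apply: eq_bigr => i _; congr W; rewrite !(tnth_nth z) /= nth_rcons size_tuple.
  by rewrite ltn_ord.
by rewrite (tnth_nth z) /= nth_rcons size_tuple ltnn eqxx.
Qed.

Lemma tnth_rcons_max p (t : p.-tuple E) z : tnth [tuple of rcons t z] ord_max = z.
Proof. by rewrite (tnth_nth z) /= nth_rcons size_tuple ltnn eqxx. Qed.

(** Integrating out the last coordinate keeps the form of the bound
    [c * (sum of the weights) + c * gamma / (1 - gamma) * (last weight) + d],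
    and increases the constant [d] only. *)
Lemma last_int_le p (f : p.+2.-tuple E -> \bar R) c d : 0 <= c -> 0 <= d ->
  measurable_fun setT f -> (forall t, 0 <= f t)%E ->
  (forall t, f t <= (c * path_weight t + c * (gamma / (1 - gamma)) * W (tnth t ord_max) + d)%:E)%E ->
  forall t, (last_int Pi f t <= (c * path_weight t +
    c * (gamma / (1 - gamma)) * W (tnth t ord_max) + (d + c * (b / (1 - gamma))))%:E)%E.
Proof.
move=> c0 d0 mf f0 fle t; have [g0 g1] := andP gamma01.
have g1' : 0 < 1 - gamma by rewrite subr_gt0.
set y := tnth t ord_max.
set a := c * path_weight t + d; set s := c / (1 - gamma).
have s0 : 0 <= s by rewrite divr_ge0// ltW.
have a0 : 0 <= a by rewrite addr_ge0// mulr_ge0// path_weight_ge0.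
have iaW : intg (kprob Pi y) (fun z => a + s * W z).
  by apply: intgD; [exact: intg_cst|apply: intgZ; exact: intg_kernel_V].
apply: (@le_trans _ _ (\int[kprob Pi y]_z (a + s * W z)%:E)%E).
  apply: ge0_le_integral => //.
  - apply: measurableT_comp => //; apply: measurable_rcons => //; exact: measurable_cst.
  - by apply/measurable_EFinP; exact: intg_measurable iaW.
  - move=> z _; apply: le_trans (fle _) _; rewrite path_weight_rcons tnth_rcons_max.
    rewrite lee_fin /a /s le_eqVlt; apply/orP; left; apply/eqP; field.
    by rewrite subr_eq0 gt_eqF.
rewrite integral_EFin_EE// lee_fin EE_D; [|exact: intg_cst|by apply: intgZ; exact: intg_kernel_V].
rewrite EE_cst EE_Z; last exact: intg_kernel_V.
have := Pop_V mW W1 driftW y => /(ler_wpM2l s0) h.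
apply: (@le_trans _ _ (a + s * (gamma * W y + b))); first by rewrite lerD2l.
rewrite /a /s le_eqVlt; apply/orP; left; apply/eqP; field.
by rewrite subr_eq0 gt_eqF.
Qed.

Lemma future_int_le_aux p (f : p.+1.-tuple E -> \bar R) c d : 0 <= c -> 0 <= d ->
  measurable_fun setT f -> (forall t, 0 <= f t)%E ->
  (forall t, f t <= (c * path_weight t + c * (gamma / (1 - gamma)) * W (tnth t ord_max) + d)%:E)%E ->
  forall y, (future_int Pi f y <=
     (c / (1 - gamma) * W y + d + p%:R * (c * (b / (1 - gamma))))%:E)%E.
Proof.
move=> c0; have [g0 g1] := andP gamma01.
have g1' : 0 < 1 - gamma by rewrite subr_gt0.
elim: p f d => [f d d0 mf f0 fle y /=|p IH f d d0 mf f0 fle y /=].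
  apply: le_trans (fle _) _; rewrite lee_fin /path_weight big_ord1 (tnth_nth y)/=.
  rewrite (tnth_nth y)/= le_eqVlt; apply/orP; left; apply/eqP; field.
  by rewrite subr_eq0 gt_eqF.
have d0' : 0 <= d + c * (b / (1 - gamma)).
  by rewrite addr_ge0// mulr_ge0// divr_ge0// ltW.
apply: le_trans (IH (last_int Pi f) _ d0' _ _ _ y) _.
- exact: measurable_last_int.
- exact: last_int_ge0.
- exact: last_int_le.
- have -> : p.+1%:R = p%:R + 1 :> R by rewrite natr1.
  by rewrite lee_fin mulrDl mul1r; lra.
Qed.

Lemma future_int_le p (f : p.+1.-tuple E -> \bar R) c : 0 <= c ->
  measurable_fun setT f -> (forall t, 0 <= f t)%E ->
  (forall t, f t <= (c * path_weight t)%:E)%E ->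
  forall y, (future_int Pi f y <= (c * p.+1%:R * ((1 + b) / (1 - gamma)) * W y)%:E)%E.
Proof.
move=> c0 mf f0 fle y; have [g0 g1] := andP gamma01.
have g1' : 0 < 1 - gamma by rewrite subr_gt0.
apply: le_trans (@future_int_le_aux _ f c 0 c0 (lexx 0) mf f0 _ y) _.
  move=> t; apply: le_trans (fle t) _; rewrite lee_fin addr0 lerDl !mulr_ge0 ?invr_ge0//.
  - exact: ltW.
  - exact: ltW.
  - exact: le_trans (W1 _).
rewrite lee_fin addr0.
have -> : c * p.+1%:R * ((1 + b) / (1 - gamma)) * W y =
  c / (1 - gamma) * W y + (c / (1 - gamma)) * (p%:R * W y + (p.+1%:R * b) * W y).
  have -> : p.+1%:R = p%:R + 1 :> R by rewrite natr1.
  by field; rewrite subr_eq0 gt_eqF.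
rewrite lerD2l (_ : _ * (_ * _) = c / (1 - gamma) * (p%:R * b)); last first.
  by field; rewrite subr_eq0 gt_eqF.
rewrite ler_wpM2l ?divr_ge0 ?(ltW g1')//.
have W1y := W1 y; apply: (@le_trans _ _ (p.+1%:R * b * W y)).
  apply: (@le_trans _ _ (p.+1%:R * b)).
    by rewrite ler_wpM2r ?ler_nat// ltW.
  by rewrite ler_peMr// mulr_ge0// ltW.
by rewrite lerDr mulr_ge0//; exact: le_trans (W1 _).
Qed.

Variable Y : int -> {RV P >-> E}.
Hypothesis mc : markov_chain Pi Y.
Hypothesis sY : strictly_stationary Y.
Hypothesis iW : intg P (fun w => W (Y 0 w)).

Let iWn n : intg P (fun w => W (Y n w)).
Proof. exact: (intg_stationary sY). Qed.

Definition future_cst p : R := p.+1%:R * ((1 + b) / (1 - gamma)).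

Lemma future_cst_ge0 p : 0 <= future_cst p.
Proof.
have [_ g1] := andP gamma01; rewrite mulr_ge0// divr_ge0 ?subr_ge0 ?addr_ge0//; exact: ltW.
Qed.

Let fbound p c (f : p.+1.-tuple E -> R) := forall t, `|f t| <= c * path_weight t.

(** The Markov property reduces the whole future path to the present state,
    and the drift condition bounds the result by the weight of this state. *)
Lemma conditional_ge0 p (f : p.+1.-tuple E -> R) c : 0 <= c ->
  measurable_fun setT f -> (forall t, 0 <= f t) -> fbound c f ->
  exists g : E -> R, [/\ measurable_fun setT g,
    forall y, g y = fine (future_int Pi (EFin \o f) y),
    forall y, 0 <= g y <= c * future_cst p * W y &
    forall n (A : Omega -> R), measurable_fun setT (A : past Y n -> R) ->
      (forall w, 0 <= A w) -> intg P (fun w => A w * W (Y n w)) ->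
      intg P (fun w => A w * f (path_from Y n p w)) /\
      \int[P]_w (A w * f (path_from Y n p w)) = \int[P]_w (A w * g (Y n w))].
Proof.
move=> c0 mf f0 fle.
have mEf : measurable_fun setT (EFin \o f) by exact/measurable_EFinP.
have f0' t : (0 <= (EFin \o f) t)%E by rewrite lee_fin.
have gle y : (future_int Pi (EFin \o f) y <= (c * future_cst p * W y)%:E)%E.
  rewrite /future_cst (mulrA c).
  apply: future_int_le => // t; rewrite lee_fin.
  exact: le_trans (ler_norm _) (fle t).
have g0 y := future_int_ge0 Pi f0' y.
have gfin y : (future_int Pi (EFin \o f) y = (fine (future_int Pi (EFin \o f) y))%:E)%E.
  rewrite fineK// ge0_fin_numE//; apply: le_lt_trans (gle y) _; exact: ltry.
exists (fine \o future_int Pi (EFin \o f)); split.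
- apply: measurableT_comp => //; exact: measurable_future_int.
- by [].
- move=> y; rewrite -!lee_fin /= -gfin; apply/andP; split; [exact: g0|exact: gle].
move=> n A mA A0 iA.
have mA' : measurable_fun setT A := measurable_fun_past_sub mA.
have mg : measurable_fun setT (fun y => fine (future_int Pi (EFin \o f) y)).
  by apply: measurableT_comp => //; exact: measurable_future_int.
have mAf : measurable_fun setT (fun w => A w * f (path_from Y n p w)).
  by apply: measurable_funM => //; apply: measurableT_comp => //; exact: measurable_path.
have E1 : (\int[P]_w (A w * f (path_from Y n p w))%:E =
  \int[P]_w (A w * fine (future_int Pi (EFin \o f) (Y n w)))%:E)%E.
  have := @markov_future _ _ _ P _ _ Pi Y mc n p (EFin \o A) (EFin \o f) _ _ mEf f0'.
  move=> ->.
  - by apply: eq_integral => w _; rewrite [in LHS]gfin.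
  - by exact/measurable_EFinP.
  - by move=> w; rewrite lee_fin.
have iAg : intg P (fun w => A w * fine (future_int Pi (EFin \o f) (Y n w))).
  have := intgZ (c * future_cst p) iA; apply: intg_le0.
    by apply: measurable_funM => //; exact: (measurableT_comp mg).
  move=> w; rewrite ger0_norm ?mulr_ge0 ?fine_ge0//.
  by rewrite mulrCA ler_wpM2l// -lee_fin -gfin.
split; last by rewrite /Rintegral E1.
apply: intg_lty => //; first by move=> w; rewrite mulr_ge0.
by rewrite E1 integral_EFin_EE// ltry.
Qed.

Lemma conditional_path p (f : p.+1.-tuple E -> R) c : 0 <= c ->
  measurable_fun setT f -> fbound c f ->
  exists g : E -> R, [/\ measurable_fun setT g,
    forall y, `|g y| <= c * future_cst p * W y &
    forall n (A : Omega -> R), measurable_fun setT (A : past Y n -> R) ->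
      intg P (fun w => A w * W (Y n w)) ->
      \int[P]_w (A w * f (path_from Y n p w)) = \int[P]_w (A w * g (Y n w))].
Proof.
move=> c0 mf fle.
have mfp : measurable_fun setT (fun t => Num.max (f t) 0) by exact: measurable_maxr.
have mfn : measurable_fun setT (fun t => Num.max (- f t) 0).
  by apply: measurable_maxr => //; exact: measurableT_comp.
have posb (x : R) : `|Num.max x 0| <= `|x|.
  by rewrite /Num.max; case: ifPn; rewrite ?normr0.
have pos0 (x : R) : 0 <= Num.max x 0 by rewrite le_max lexx orbT.
have posE (x : R) : x = Num.max x 0 - Num.max (- x) 0.
  by rewrite /Num.max oppr_lt0; case: ltgtP => [x0|x0|->]; rewrite ?subr0 ?sub0r ?opprK.
have [gp [mgp _ gpb gpE]] := conditional_ge0 c0 mfp (fun t => pos0 (f t))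
  (fun t => le_trans (posb _) (fle t)).
have fnle t : `|Num.max (- f t) 0| <= c * path_weight t.
  by apply: le_trans (posb _) _; rewrite normrN.
have [gn [mgn _ gnb gnE]] := conditional_ge0 c0 mfn (fun t => pos0 (- f t)) fnle.
exists (fun y => gp y - gn y); split.
- exact: measurable_funB.
- move=> y; have /andP[h1 h2] := gpb y; have /andP[h3 h4] := gnb y.
  by rewrite ler_norml; apply/andP; split; lra.
move=> n A mA iA; have mA' : measurable_fun setT A := measurable_fun_past_sub mA.
have signed (B : Omega -> R) : measurable_fun setT (B : past Y n -> R) -> (forall w, 0 <= B w) ->
    (forall w, B w <= `|A w|) ->
  [/\ intg P (fun w => B w * f (path_from Y n p w)), intg P (fun w => B w * (gp (Y n w) - gn (Y n w))) &
  \int[P]_w (B w * f (path_from Y n p w)) = \int[P]_w (B w * (gp (Y n w) - gn (Y n w)))].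
  move=> mB B0 BA; have mB' : measurable_fun setT B := measurable_fun_past_sub mB.
  have iB : intg P (fun w => B w * W (Y n w)).
    have mBW : measurable_fun setT (fun w => B w * W (Y n w)).
      by apply: measurable_funM => //; exact: measurableT_comp.
    apply: (intg_le mBW _ iA) => w; rewrite !normrM ler_wpM2r//.
    by rewrite ger0_norm.
  have [i1 e1] := gpE n B mB B0 iB; have [i2 e2] := gnE n B mB B0 iB.
  have ig (g : E -> R) : measurable_fun setT g ->
      (forall y, 0 <= g y <= c * future_cst p * W y) -> intg P (fun w => B w * g (Y n w)).
    move=> mg gb; have := intgZ (c * future_cst p) iB; apply: intg_le0.
      by apply: measurable_funM => //; exact: measurableT_comp.
    move=> w; have /andP[h1 h2] := gb (Y n w).
    by rewrite ger0_norm ?mulr_ge0// mulrCA ler_wpM2l.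
  have ip := ig gp mgp gpb; have iq := ig gn mgn gnb.
  have -> : (fun w => B w * f (path_from Y n p w)) = (fun w =>
      B w * Num.max (f (path_from Y n p w)) 0 - B w * Num.max (- f (path_from Y n p w)) 0).
    by apply/funext => w; rewrite -mulrBr -posE.
  have -> : (fun w => B w * (gp (Y n w) - gn (Y n w))) =
      (fun w => B w * gp (Y n w) - B w * gn (Y n w)).
    by apply/funext => w; rewrite mulrBr.
  by split; [exact: intgB|exact: intgB|rewrite EE_B// EE_B// e1 e2].
have mAp : measurable_fun setT ((fun w => Num.max (A w) 0) : past Y n -> R).
  exact: measurable_maxr.
have mAn : measurable_fun setT ((fun w => Num.max (- A w) 0) : past Y n -> R).
  by apply: measurable_maxr => //; exact: measurableT_comp.
have Apb w : Num.max (A w) 0 <= `|A w| := le_trans (ler_norm _) (posb _).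
have Anb w : Num.max (- A w) 0 <= `|A w|.
  by apply: le_trans (ler_norm _) _; apply: le_trans (posb _) _; rewrite normrN.
have [i1 j1 e1] := signed _ mAp (fun w => pos0 _) Apb.
have [i2 j2 e2] := signed _ mAn (fun w => pos0 _) Anb.
have AE (h : Omega -> R) : (fun w => A w * h w) = (fun w =>
    Num.max (A w) 0 * h w - Num.max (- A w) 0 * h w).
  by apply/funext => w; rewrite -mulrBl -posE.
by rewrite (AE (fun w => f (path_from Y n p w))) (AE (fun w => gp (Y n w) - gn (Y n w)))
  EE_B// EE_B// e1 e2.
Qed.

Lemma dominated_ge0 (g : E -> R) : dominated W g ->
  exists2 c, 0 <= c & forall y, `|g y| <= c * W y.
Proof.
move=> [_ [c gc]]; exists `|c| => // y; apply: le_trans (gc y) _.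
by rewrite ler_wpM2r ?ler_norm//; exact: le_trans (W1 _).
Qed.

Lemma one_step_ge0 n (A : Omega -> R) (g : E -> R) : dominated W g -> (forall y, 0 <= g y) ->
  measurable_fun setT (A : past Y n -> R) -> (forall w, 0 <= A w) ->
  intg P (fun w => A w * W (Y n w)) ->
  intg P (fun w => A w * g (Y (n + 1) w)) /\
  \int[P]_w (A w * g (Y (n + 1) w)) = \int[P]_w (A w * Pop Pi g (Y n w)).
Proof.
move=> dg g0 mA A0 iA; have [mg _] := dg; have [c c0 gc] := dominated_ge0 dg.
have mf : measurable_fun setT (fun t : 2.-tuple E => g (tnth t ord_max)).
  by apply: (measurableT_comp mg); exact: measurable_tnth.
have fle : fbound c (fun t : 2.-tuple E => g (tnth t ord_max)).
  move=> t; apply: le_trans (gc _) _; rewrite ler_wpM2l// /path_weight.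
  by rewrite (bigD1 ord_max)//= lerDl sumr_ge0// => i _; exact: le_trans (W1 _).
have [g' [mg' g'E _ cond]] := conditional_ge0 c0 mf (fun t => g0 _) fle.
have last w : tnth (path_from Y n 1 w) ord_max = Y (n + 1) w by rewrite tnth_mktuple.
have [i1 e1] := cond n A mA A0 iA; split.
  by move: i1; congr intg; apply/funext => w; rewrite last.
transitivity (\int[P]_w (A w * g (tnth (path_from Y n 1 w) ord_max))).
  by apply: eq_Rintegral => w _; rewrite last.
rewrite e1; apply: eq_Rintegral => w _; rewrite g'E /Pop /Rintegral /= /last_int.
by congr (_ * fine _); apply: eq_integral => z _ /=; rewrite tnth_rcons_max.
Qed.

(** Positive and negative parts reduce this to [markov_step]. *)
Lemma one_step n (A : Omega -> R) (g : E -> R) : dominated W g ->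
  measurable_fun setT (A : past Y n -> R) -> intg P (fun w => A w * W (Y n w)) ->
  intg P (fun w => A w * g (Y (n + 1) w)) /\
  \int[P]_w (A w * g (Y (n + 1) w)) = \int[P]_w (A w * Pop Pi g (Y n w)).
Proof.
move=> dg mA iA; have [mg _] := dg; have [c c0 gc] := dominated_ge0 dg.
have mA' : measurable_fun setT A := measurable_fun_past_sub mA.
have dW : dominated W W := dominated_self mW W1.
have d1 : dominated W (fun y => g y + c * W y) by apply: dominatedD => //; exact: dominatedZ.
have d10 y : 0 <= g y + c * W y.
  by have := gc y; rewrite ler_norml => /andP[h _]; rewrite -lerBlDr sub0r.
have W0 y : 0 <= W y by exact: le_trans (W1 _).
have mY m (h : E -> R) : measurable_fun setT h -> measurable_fun setT (fun w => h (Y m w)).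
  by move=> mh; apply: (measurableT_comp mh).
have PW := dominated_Pop mW W1 b0 driftW.
have [mPg _] := PW _ dg; have [cP cP0 gcP] := dominated_ge0 (PW _ dg).
have [mPW _] := PW _ dW; have [cW cW0 gcW] := dominated_ge0 (PW _ dW).
have nonneg (B : Omega -> R) : measurable_fun setT (B : past Y n -> R) -> (forall w, 0 <= B w) ->
    intg P (fun w => B w * W (Y n w)) ->
    [/\ intg P (fun w => B w * g (Y (n + 1) w)), intg P (fun w => B w * Pop Pi g (Y n w)) &
    \int[P]_w (B w * g (Y (n + 1) w)) = \int[P]_w (B w * Pop Pi g (Y n w))].
  move=> mB B0 iB; have mB' : measurable_fun setT B := measurable_fun_past_sub mB.
  have [i1 e1] := one_step_ge0 d1 d10 mB B0 iB.
  have [i2 e2] := one_step_ge0 dW W0 mB B0 iB.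
  have iPop (h : E -> R) k : measurable_fun setT h -> 0 <= k -> (forall y, `|h y| <= k * W y) ->
      intg P (fun w => B w * h (Y n w)).
    move=> mh k0 hk; apply: intg_le0 (intgZ k iB); first by apply: measurable_funM => //; exact: mY.
    by move=> w; rewrite normrM (ger0_norm (B0 w)) mulrCA ler_wpM2l.
  have j1 := iPop _ _ mPg cP0 gcP; have j2 := iPop _ _ mPW cW0 gcW.
  have E1 : (fun w => B w * g (Y (n + 1) w)) =
    (fun w => B w * (g (Y (n + 1) w) + c * W (Y (n + 1) w)) - c * (B w * W (Y (n + 1) w))).
    by apply/funext => w; ring.
  have j3 := intgZ c j2; have i3 := intgZ c i2.
  rewrite E1; split; [exact: (intgB i1 i3)|exact: j1|].
  rewrite (EE_B i1 i3) e1 (EE_Z c i2) e2.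
  have -> : (fun w => B w * Pop Pi (fun y => g y + c * W y) (Y n w)) =
    (fun w => B w * Pop Pi g (Y n w) + c * (B w * Pop Pi W (Y n w))).
    apply/funext => w; rewrite (Pop_D mW W1 driftW)//; last exact: dominatedZ.
    by rewrite (Pop_Z mW W1 driftW)//; ring.
  by rewrite (EE_D j1 j3) (EE_Z c j2) addrK.
have nA w : 0 <= `|A w| by [].
have mnA : measurable_fun setT ((fun w => `|A w|) : past Y n -> R) by exact: measurableT_comp.
have inA : intg P (fun w => `|A w| * W (Y n w)).
  have := intg_norm iA; congr intg; apply/funext => w.
  by rewrite normrM (ger0_norm (W0 _)).
have [i1 j1 e1] := nonneg _ mnA nA inA.
have mpA : measurable_fun setT ((fun w => A w + `|A w|) : past Y n -> R) by exact: measurable_funD.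
have pA w : 0 <= A w + `|A w| by have := ler_norm (- A w); rewrite normrN; lra.
have ipA : intg P (fun w => (A w + `|A w|) * W (Y n w)).
  rewrite (_ : (fun w => _) = (fun w => A w * W (Y n w) + `|A w| * W (Y n w))).
    exact: intgD.
  by apply/funext => w; rewrite mulrDl.
have [i2 j2 e2] := nonneg _ mpA pA ipA.
have AE (h : Omega -> R) : (fun w => A w * h w) =
    (fun w => (A w + `|A w|) * h w - `|A w| * h w).
  by apply/funext => w; ring.
rewrite (AE (fun w => g (Y (n + 1) w))) (AE (fun w => Pop Pi g (Y n w))).
by split; [exact: intgB|rewrite !EE_B// e1 e2].
Qed.

(** The weight stays integrable against [A] by the drift condition, so the
    operator can be applied once for each unit of time. *)
Lemma EE_iter_Pop r n (A : Omega -> R) (g : E -> R) : dominated W g ->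
  measurable_fun setT (A : past Y n -> R) -> intg P (fun w => A w * W (Y n w)) ->
  intg P (fun w => A w * g (Y (n + r%:Z) w)) /\
  \int[P]_w (A w * g (Y (n + r%:Z) w)) = \int[P]_w (A w * iter r (Pop Pi) g (Y n w)).
Proof.
move=> dg mA iA; elim: r g dg => [|r IH] g dg.
  rewrite addr0; split => //=; have [mg _] := dg; have [c c0 gc] := dominated_ge0 dg.
  apply: intg_le (intgZ c iA).
    apply: measurable_funM; first exact: (measurable_fun_past_sub mA).
    exact: (measurableT_comp mg).
  move=> w; rewrite !normrM (ger0_norm c0) mulrCA ler_wpM2l//.
  by apply: le_trans (gc _) _; rewrite ler_wpM2l// ler_norm.
have mA' : measurable_fun setT (A : past Y (n + r%:Z) -> R).
  by apply: (measurable_fun_past_le _ mA); rewrite lerDl.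
have [iAr _] := IH W (dominated_self mW W1).
have [i1 e1] := one_step dg mA' iAr.
rewrite -addn1 PoszD addrA; split => //; rewrite e1 addn1 iterSr.
have dPg : dominated W (Pop Pi g) by apply: (dominated_Pop mW W1 b0 driftW).
by have [] := IH _ dPg.
Qed.

Variables (Cg rho : R).
Hypothesis Cg0 : 0 <= Cg.
Hypothesis rho01 : 0 < rho < 1.
Hypothesis ergodic : forall c (f : E -> R), 0 <= c -> measurable_fun setT f ->
  (forall y, `|f y| <= c * W y) ->
  forall n x y, iter n (Pop Pi) f x - iter n (Pop Pi) f y <= c * Cg * rho ^+ n * (W x + W y).

(** Conditionally on the past, [f] becomes a function of the state at time
    [n + r] dominated by the weight. Applying the transition operator [r] times
    makes it constant up to [rho ^+ r], and the constant is [E f]. *)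
Theorem mixing_path p (f : p.+1.-tuple E -> R) c : 0 <= c ->
  measurable_fun setT f -> fbound c f ->
  forall n r (A : Omega -> R), measurable_fun setT (A : past Y n -> R) ->
    intg P A -> intg P (fun w => A w * W (Y n w)) ->
  `|\int[P]_w (A w * f (path_from Y (n + r%:Z) p w)) -
    \int[P]_w A w * \int[P]_w f (path_from Y (n + r%:Z) p w)| <=
  c * future_cst p * Cg * rho ^+ r *
    (\int[P]_w (`|A w| * W (Y n w)) + \int[P]_w `|A w| * \int[P]_w W (Y 0 w)).
Proof.
move=> c0 mf fle n r A mA iA iAW.
have mA' : measurable_fun setT A := measurable_fun_past_sub mA.
have W0 y : 0 <= W y by exact: le_trans (W1 _).
have [g [mg gb cond]] := conditional_path c0 mf fle.
set K := c * future_cst p; have K0 : 0 <= K by rewrite mulr_ge0// future_cst_ge0.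
have dg : dominated W g by split => //; exists K.
have mAr : measurable_fun setT (A : past Y (n + r%:Z) -> R).
  by apply: (measurable_fun_past_le _ mA); rewrite lerDl.
have [iAWr _] := EE_iter_Pop r (dominated_self mW W1) mA iAW.
rewrite (cond _ _ mAr iAWr).
have [_ ->] := EE_iter_Pop r dg mA iAW.
have m1 k : measurable_fun setT ((fun=> 1) : past Y k -> R) by exact: measurable_cst.
have iW1 k : intg P (fun w => 1 * W (Y k w)).
  by have := iWn k; congr intg; apply/funext => w; rewrite mul1r.
set G := iter r (Pop Pi) g.
have -> : \int[P]_w f (path_from Y (n + r%:Z) p w) = \int[P]_w G (Y n w).
  transitivity (\int[P]_w (1 * f (path_from Y (n + r%:Z) p w))).
    by apply: eq_Rintegral => w _; rewrite mul1r.
  rewrite (cond _ _ (m1 _) (iW1 _)).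
  have [_ ->] := EE_iter_Pop r dg (m1 n) (iW1 n).
  by apply: eq_Rintegral => w _; rewrite mul1r.
have dG : dominated W G by apply: (dominated_iter mW W1 b0 driftW).
have [mG _] := dG; have [cG cG0 Gc] := dominated_ge0 dG.
have mGY : measurable_fun setT (fun w => G (Y n w)) by apply: (measurableT_comp mG).
have iG : intg P (fun w => G (Y n w)) by apply: (intg_le0 mGY _ (intgZ cG (iWn n))) => w; exact: Gc.
have iAG : intg P (fun w => A w * G (Y n w)).
  apply: intg_le (intgZ cG iAW); first exact: measurable_funM.
  move=> w; rewrite !normrM (ger0_norm cG0) mulrCA ler_wpM2l//.
  by rewrite (ger0_norm (W0 _)).
set kappa := K * Cg * rho ^+ r.
have [r0 r1] := andP rho01.
have k0 : 0 <= kappa.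
  apply: mulr_ge0; last by rewrite exprn_ge0// ltW.
  exact: mulr_ge0.
have osc x y : `|G x - G y| <= kappa * (W x + W y).
  rewrite ler_norml lerNl opprB; apply/andP; split; last exact: ergodic.
  by rewrite (addrC (W x)); exact: ergodic.
set m := \int[P]_w G (Y n w); set wb := \int[P]_w W (Y 0 w).
have Gm x : `|G x - m| <= kappa * (W x + wb).
  have -> : G x - m = \int[P]_w (G x - G (Y n w)).
    rewrite EE_B//; last exact: intg_cst.
    by rewrite EE_cst.
  apply: le_trans (EE_norm_le _ (_ : intg P (fun w => kappa * (W x + W (Y n w)))) _) _.
  - by apply: measurable_funB => //; exact: measurable_cst.
  - by apply: intgZ; apply: intgD; [exact: intg_cst|].
  - by move=> w; exact: osc.
  - rewrite EE_Z; last by apply: intgD; [exact: intg_cst|].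
    rewrite EE_D//; last exact: intg_cst.
    by rewrite EE_cst (EE_stationary sY n mW).
have -> : \int[P]_w (A w * G (Y n w)) - \int[P]_w A w * m = \int[P]_w (A w * (G (Y n w) - m)).
  have -> : (fun w => A w * (G (Y n w) - m)) = (fun w => A w * G (Y n w) - m * A w).
    by apply/funext => w; ring.
  by rewrite EE_B ?EE_Z// ?(mulrC m)//; exact: intgZ.
have inA : intg P (fun w => `|A w| * W (Y n w)).
  have := intg_norm iAW; congr intg; apply/funext => w.
  by rewrite normrM (ger0_norm (W0 _)).
have iB : intg P (fun w => kappa * (`|A w| * W (Y n w) + wb * `|A w|)).
  by apply: intgZ; apply: intgD => //; apply: intgZ; exact: intg_norm.
apply: le_trans (EE_norm_le _ iB _) _.
- apply: measurable_funM => //; apply: measurable_funB => //; exact: measurable_cst.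
- move=> w; rewrite normrM; apply: le_trans (ler_wpM2l (normr_ge0 _) (Gm _)) _.
  by rewrite le_eqVlt; apply/orP; left; apply/eqP; ring.
rewrite EE_Z; last by apply: intgD => //; apply: intgZ; exact: intg_norm.
rewrite EE_D//; last by apply: intgZ; exact: intg_norm.
by rewrite EE_Z ?(mulrC wb)//; exact: intg_norm.
Qed.

End future_bounds.

Section stationary_weight.
Context {R : realType} {dO} {Omega : measurableType dO} (P : probability Omega R)
  {dE} {E : measurableType dE} (Pi : R.-pker E ~> E).
Variables (V : E -> R) (gamma b : R).
Hypothesis mV : measurable_fun setT V.
Hypothesis V1 : forall y, 1 <= V y.
Hypothesis gamma01 : 0 < gamma < 1.
Hypothesis b0 : 0 < b.
Hypothesis driftV : forall y, (\int[Pi y]_z (V z)%:E <= (gamma * V y + b)%:E)%E.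
Variable Y : int -> {RV P >-> E}.
Hypothesis mc : markov_chain Pi Y.
Hypothesis sY : strictly_stationary Y.

Lemma one_step_bounded (T : E -> R) M : measurable_fun setT T -> (forall y, `|T y| <= M) ->
  \int[P]_w T (Y 0 w) = \int[P]_w Pop Pi T (Y 0 w).
Proof.
move=> mT TM; pose W (_ : E) : R := 1.
have half : 0 < (2^-1 : R) < 1 by apply/andP; split; lra.
have drift1 y : (\int[Pi y]_z (W z)%:E <= (2^-1 * W y + 1)%:E)%E.
  rewrite (_ : (\int[Pi y]_z (W z)%:E)%E = (\int[kprob Pi y]_z (W z)%:E)%E)//.
  rewrite (integral_EFin_EE (intg_cst _ 1)) EE_cst lee_fin /W; lra.
have W1 (y : E) : 1 <= W y by [].
have mW : measurable_fun setT W by exact: measurable_cst.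
have dT : dominated W T by split => //; exists M => y; rewrite mulr1.
have m1 : measurable_fun setT ((fun=> 1) : past Y 0 -> R) by exact: measurable_cst.
have i1 : intg P (fun w => 1 * W (Y 0 w)).
  have -> : (fun w => 1 * W (Y 0 w)) = fun=> 1 by apply/funext => w; rewrite mulr1.
  exact: intg_cst.
have [_] := one_step mW W1 half ltr01 drift1 mc dT m1 i1.
under eq_Rintegral do rewrite mul1r.
under [in X in _ = X -> _]eq_Rintegral do rewrite mul1r.
by rewrite (EE_stationary sY).
Qed.

(** Under stationarity the drift inequality applied to the truncations of
    the weight bounds their expectations, hence the weight is integrable. *)
Lemma intg_stationary_weight : intg P (fun w => V (Y 0 w)).
Proof.
have [g0 g1] := andP gamma01.
have V0 y : 0 <= V y := le_trans ler01 (V1 y).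
have mVY : measurable_fun setT (fun w => V (Y 0 w)) by apply: (measurableT_comp mV).
pose T M y : R := if V y <= M%:R then V y else 0.
have mI M : measurable_fun setT (fun y => Num.min (V y) M%:R : R).
  by apply: measurable_minr => //; exact: measurable_cst.
have mS M : measurable [set y | V y <= M%:R].
  have := mV measurableT (@measurable_itv R `]-oo, M%:R]).
  by rewrite setTI; congr measurable; apply/seteqP; split => y /=; rewrite in_itv.
have mT M : measurable_fun setT (T M).
  rewrite (_ : T M = fun y => V y * \1_[set y | V y <= M%:R] y).
    by apply: measurable_funM => //; exact: measurable_indic.
  apply/funext => y; rewrite /T indicE; case: ifPn => h; first by rewrite mem_set ?mulr1.
  by rewrite memNset ?mulr0//; apply/negP.
have TM M y : `|T M y| <= M%:R by rewrite /T; case: ifPn; rewrite ?normr0// ger0_norm.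
have boundT M : \int[P]_w T M (Y 0 w) <= b / (1 - gamma).
  have IM y : `|Num.min (V y) M%:R| <= M%:R.
    by rewrite ger0_norm ?ge_min ?lexx ?orbT// le_min V0 ler0n.
  have iI : intg P (fun w => Num.min (V (Y 0 w)) M%:R : R).
    apply: (@intg_bounded _ _ _ P _ M%:R) => //; exact: (measurableT_comp (mI M)).
  have iT : intg P (fun w => T M (Y 0 w)).
    apply: (@intg_bounded _ _ _ P _ M%:R) => //; exact: (measurableT_comp (mT M)).
  have dI : dominated V (fun y => Num.min (V y) M%:R : R).
    by split => //; exists 1 => y; rewrite mul1r ger0_norm ?ge_min ?lexx// le_min V0 ler0n.
  have Pop_le1 y : Pop Pi (fun y => Num.min (V y) M%:R : R) y <= Num.min (V y) M%:R + (b - (1 - gamma) * T M y).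
    rewrite /T; case: ifPn => VM.
      rewrite (min_idPl VM); have -> : V y + (b - (1 - gamma) * V y) = gamma * V y + b by ring.
      apply: le_trans (Pop_V mV V1 driftV y); apply: (Pop_le mV V1 driftV) => //.
        exact: dominated_self.
      by move=> z; rewrite ge_min lexx.
    have MV : M%:R <= V y by rewrite ltW// ltNge.
    rewrite (min_idPr MV) mulr0 subr0.
    apply: (@le_trans _ _ M%:R); last by rewrite lerDl ltW.
    apply: (@le_trans _ _ (Pop Pi (fun=> M%:R) y)); last by rewrite /Pop EE_cst.
    apply: (Pop_le mV V1 driftV) => //; first exact: dominated_cst.
    by move=> z; rewrite ge_min lexx orbT.
  have [mP _] := dominated_Pop mV V1 b0 driftV dI.
  have iP : intg P (fun w => Pop Pi (fun y => Num.min (V y) M%:R : R) (Y 0 w)).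
    apply: (@intg_bounded _ _ _ P _ M%:R); first exact: (measurableT_comp mP).
    by move=> w; exact: EE_norm_bounded.
  have i2 : intg P (fun w => (1 - gamma) * T M (Y 0 w)) by exact: intgZ.
  have i3 : intg P (fun w => b - (1 - gamma) * T M (Y 0 w)) by apply: intgB => //; exact: intg_cst.
  have := EE_le iP (intgD iI i3) (fun w => Pop_le1 (Y 0 w)).
  rewrite -(one_step_bounded (mI M) IM) (EE_D iI i3) EE_B//; last exact: intg_cst.
  rewrite EE_cst EE_Z// lerDl subr_ge0 ler_pdivlMr ?subr_gt0//.
  by rewrite mulrC.
apply: intg_lty => //.
have cvgT w : ((T M (Y 0 w))%:E @[M --> \oo] --> (V (Y 0 w))%:E)%E.
  apply: cvg_near_cst; near=> M; rewrite /T ifT//.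
  near: M; exact: nbhs_infty_ger.
rewrite (_ : (\int[P]_w _)%E = (\int[P]_w limn (fun M => (T M (Y 0 w))%:E))%E); last first.
  by apply: eq_integral => w _; apply/esym/cvg_lim => //; exact: cvgT.
rewrite monotone_convergence//.
- apply: le_lt_trans (ltry (b / (1 - gamma))).
  apply: lime_le; last first.
    apply: nearW => M; rewrite integral_EFin_EE ?lee_fin ?boundT//.
    apply: (@intg_bounded _ _ _ P _ M%:R) => //; exact: (measurableT_comp (mT M)).
  apply: ereal_nondecreasing_is_cvgn => m n mn.
  apply: ge0_le_integral => //.
  + by move=> w _; rewrite lee_fin /T; case: ifP.
  + by apply/measurable_EFinP; exact: (measurableT_comp (mT m)).
  + by apply/measurable_EFinP; exact: (measurableT_comp (mT n)).
  + move=> w _; rewrite lee_fin /T; case: ifPn => h; last by case: ifP.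
    by rewrite ifT//; apply: le_trans h _; rewrite ler_nat.
- by move=> n; apply/measurable_EFinP; exact: (measurableT_comp (mT n)).
- by move=> n w _; rewrite lee_fin /T; case: ifP.
- move=> w _ m n mn; rewrite lee_fin /T; case: ifPn => h; last by case: ifP.
  by rewrite ifT//; apply: le_trans h _; rewrite ler_nat.
Unshelve. all: by end_near. Qed.

End stationary_weight.

(** * Borel vectors and the growth of the test functions *)

Section borel_vectors.
Context {R : realType}.

Lemma nbhs_rVP m (U : set 'rV[R]_m) (x : 'rV[R]_m) : nbhs x U <->
  exists2 e : R, 0 < e & forall y : 'rV[R]_m, (forall k, `|x 0 k - y 0 k| < e) -> U y.
Proof.
split=> [/nbhs_ballP[e /= e0 eU]|[e e0 eU]].
  by exists e => // y xy; apply: eU; split => // i j; rewrite (ord1 i); exact: xy.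
by apply/nbhs_ballP; exists e => //= y [_ xy]; apply: eU => k; exact: xy.
Qed.

(** Coordinates suffice because every open set is a countable union of boxes
    with rational data. *)
Lemma measurable_rV m d (T : measurableType d) (f : T -> 'rV[R]_m) :
  (forall k, measurable_fun setT (fun t => f t 0 k)) ->
  measurable_fun setT (f : T -> borel_rV R m).
Proof.
move=> mf; apply: (@measurability _ _ T (borel_rV R m) setT f (@open 'rV[R]_m)) => // _ [U oU <-]; rewrite setTI.
pose box (qr : 'rV[rat]_m * rat) : set 'rV[R]_m :=
  [set x | forall k, `|x 0 k - ratr (qr.1 0 k)| < ratr qr.2].
pose F (qr : 'rV[rat]_m * rat) : set T :=
  if `[< box qr `<=` U >] then \bigcap_(k in [set: 'I_m])
    [set t | `|f t 0 k - ratr (qr.1 0 k)| < ratr qr.2] else set0.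
have -> : f @^-1` U = \bigcup_qr F qr.
  apply/seteqP; split => [t Uft|t [qr _]]; last first.
    rewrite /F; case: asboolP => // bU tb; apply: bU => k; exact: tb.
  have /nbhs_rVP[e e0 eU] : nbhs (f t) U by move: oU; rewrite openE; exact.
  have [r] : exists r : rat, ratr r \in `]0, (e / 2)[%R by exact/rat_in_itvoo/divr_gt0.
  rewrite in_itv /= => /andP[r0 re].
  have qk k : exists q : rat, `|f t 0 k - ratr q| < ratr r.
    have [q] : exists q : rat, ratr q \in `](f t 0 k - ratr r), (f t 0 k + ratr r)[%R.
      by apply: rat_in_itvoo; lra.
    by rewrite in_itv /= => /andP[q1 q2]; exists q; rewrite ltr_norml; apply/andP; split; lra.
  have [q qP] := choice qk.
  exists (\row_k q k, r) => //; rewrite /F; case: asboolP => [_ k _ /=|]; first by rewrite mxE.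
  case=> y yb; apply: eU => k; have := yb k; have := qP k; rewrite /= mxE => h1 h2.
  rewrite (_ : f t 0 k - y 0 k = (f t 0 k - ratr (q k)) - (y 0 k - ratr (q k))); last by ring.
  apply: le_lt_trans (ler_normB _ _) _; lra.
apply: countable_bigcupT_measurable => [|qr]; first exact: countableP.
rewrite /F; case: asboolP => [_|_]; last exact: measurable0.
apply: fin_bigcap_measurable => // k _.
have mg : measurable_fun setT (fun t => `|f t 0 k - ratr (qr.1 0 k)|).
  by apply: measurableT_comp => //; apply: measurable_funB => //; exact: measurable_cst.
have := mg measurableT _ (@measurable_itv R `]-oo, (ratr qr.2)[).
by rewrite setTI; congr measurable; apply/seteqP; split => t /=; rewrite in_itv.
Qed.

End borel_vectors.

Section growth.
Context {R : realType} (h : nat) (N : 'rV[R]_h.+1 -> R).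
Hypothesis normN : is_norm N.

Lemma is_norm0 : N 0 = 0.
Proof. by have := norm_homogeneous normN 0 0; rewrite scale0r normr0 mul0r. Qed.

Lemma is_norm_ge0 x : 0 <= N x.
Proof.
have := norm_triangle normN x (- x); rewrite subrr is_norm0.
have -> : N (- x) = N x by rewrite -scaleN1r (norm_homogeneous normN) normrN1 mul1r.
by rewrite -mulr2n pmulrn_lge0.
Qed.

Lemma is_norm_sum x : N x <= \sum_(k < h.+1) `|x 0 k| * N (delta_mx 0 k).
Proof.
rewrite {1}(row_sum_delta x).
elim/big_ind2: _ => [|a b c d ab cd|k _]; first by rewrite is_norm0.
  by apply: le_trans (norm_triangle normN _ _) _; exact: lerD.
by rewrite (norm_homogeneous normN).
Qed.

Lemma is_norm_max : exists2 kappa : R, 0 < kappa & forall x, exists k : 'I_h.+1,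
  N x <= kappa * `|x 0 k|.
Proof.
exists (1 + \sum_(k < h.+1) N (delta_mx 0 k)).
  by rewrite ltr_pwDl// sumr_ge0// => k _; exact: is_norm_ge0.
move=> x; have [k _ xk] := @Order.TotalTheory.arg_maxP _ _ 'I_h.+1 ord0 xpredT
  (fun k => `|x 0 k|) isT.
exists k; apply: le_trans (is_norm_sum x) _.
rewrite mulrDl mul1r mulr_suml -[leLHS]add0r lerD// ler_sum// => i _.
by rewrite mulrC ler_wpM2l ?is_norm_ge0//; exact: xk.
Qed.

Variables (q0 : R).
Hypothesis q00 : 0 < q0.

(** [tail_power s x] dominates every function of the class considered here,
    and also its square and a slightly higher power. *)
Definition tail_power (s t : R) : R := `|t| `^ q0 * (if s < `|t| then 1 else 0).
Definition tail_power_sum (s : R) (x : 'rV[R]_h.+1) : R := \sum_k tail_power s (x 0 k).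

Lemma tail_power_ge0 s t : 0 <= tail_power s t.
Proof. by rewrite /tail_power; case: ifP => _; rewrite ?mulr1 ?mulr0 ?powR_ge0. Qed.

(** Where [phi] does not vanish some coordinate is bounded below, so constants
    are dominated by tail powers; and [N x] is at most a multiple of the largest
    coordinate, raised to a power at most [q0] in each of the three bounds. *)
Lemma growth_tail_power (q delta : R) (phi : 'rV[R]_h.+1 -> R) : 0 <= q -> 0 < delta ->
  q * (2 + delta) <= q0 ->
  (exists2 eps : R, 0 < eps & forall x, `|phi x| <=
      eps^-1 * Num.max (N x `^ q) 1 * (if eps < N x then 1 else 0)) ->
  exists C s : R, [/\ 0 < C, 0 < s & forall x,
    [/\ `|phi x| `^ (2 + delta) <= C * tail_power_sum s x,
        phi x ^+ 2 <= C * tail_power_sum s x &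
        `|phi x| <= C * tail_power_sum s x]].
Proof.
move=> q_ge0 d0 qd [eps e0 phib]; have [kappa k0 Nk] := is_norm_max.
pose s := eps / kappa; have s0 : 0 < s by rewrite divr_gt0.
pose C1 := eps^-1 `^ (2 + delta) * (2 * (s `^ q0)^-1 + kappa `^ q0).
have sq0 : 0 < s `^ q0 by rewrite powR_gt0.
have C10 : 0 <= C1.
  rewrite mulr_ge0 ?powR_ge0// addr_ge0 ?powR_ge0// mulr_ge0// invr_ge0; exact: ltW.
have main x : eps < N x -> 1 <= (s `^ q0)^-1 * tail_power_sum s x /\
    `|phi x| `^ (2 + delta) <= C1 * tail_power_sum s x.
  move=> eN; have [k Nxk] := Nk x.
  have sk : s < `|x 0 k| by rewrite /s ltr_pdivrMr// mulrC; exact: lt_le_trans Nxk.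
  have mS : `|x 0 k| `^ q0 <= tail_power_sum s x.
    rewrite /tail_power_sum (bigD1 k)//= {1}/tail_power sk mulr1 lerDl.
    by rewrite sumr_ge0// => i _; exact: tail_power_ge0.
  have one : 1 <= (s `^ q0)^-1 * `|x 0 k| `^ q0.
    rewrite mulrC ler_pdivlMr// mul1r ge0_ler_powR// ?nnegrE ?(ltW s0) ?(ltW q00)//.
    exact: ltW.
  split; first by apply: le_trans one _; rewrite ler_pM2l// invr_gt0.
  have Nq : N x `^ (q * (2 + delta)) <= 1 + kappa `^ q0 * `|x 0 k| `^ q0.
    have N0 := is_norm_ge0 x.
    have [N1|N1] := leP (N x) 1.
      have : N x `^ (q * (2 + delta)) <= 1 `^ (q * (2 + delta)).
        by apply: ge0_ler_powR; rewrite ?nnegrE ?ler01// mulr_ge0// addr_ge0// ltW.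
      rewrite powR1 => /le_trans; apply.
      by rewrite lerDl mulr_ge0 ?powR_ge0.
    apply: (@le_trans _ _ (N x `^ q0)); first by rewrite ler_powR// ltW.
    rewrite -powRM ?(ltW k0)//.
    apply: le_trans (_ : _ <= (kappa * `|x 0 k|) `^ q0) _; last by rewrite lerDr.
    rewrite ge0_ler_powR ?nnegrE ?(ltW q00)//; exact: le_trans Nxk.
  have := phib x; rewrite eN mulr1 => phibx.
  have d2 : 0 <= 2 + delta by rewrite addr_ge0// ltW.
  apply: (@le_trans _ _ ((eps^-1 * Num.max (N x `^ q) 1) `^ (2 + delta))).
    rewrite ge0_ler_powR ?nnegrE//; exact: le_trans phibx.
  have mx0 : 0 <= Num.max (N x `^ q) 1 by rewrite le_max ler01 orbT.
  rewrite powRM ?invr_ge0 ?(ltW e0)// /C1 -mulrA ler_wpM2l ?powR_ge0//.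
  have mxb : (Num.max (N x `^ q) 1) `^ (2 + delta) <= N x `^ (q * (2 + delta)) + 1.
    rewrite powRrM; rewrite /Num.max; case: ifPn => _.
      by rewrite powR1 lerDr powR_ge0.
    by rewrite lerDl.
  apply: le_trans mxb _; apply: le_trans (lerD Nq (lexx 1)) _.
  apply: (@le_trans _ _ ((2 * (s `^ q0)^-1 + kappa `^ q0) * `|x 0 k| `^ q0)).
    by rewrite mulrDl -mulrA; move: one; set z := _^-1 * _; set y := kappa `^ q0 * _; lra.
  by rewrite ler_wpM2l// addr_ge0 ?powR_ge0// mulr_ge0// invr_ge0 ltW.
have zero x : ~~ (eps < N x) -> phi x = 0.
  by move=> eN; apply/eqP; rewrite -normr_le0; have := phib x; rewrite (negbTE eN) mulr0.
have S0 x : 0 <= tail_power_sum s x by apply: sumr_ge0 => k _; exact: tail_power_ge0.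
exists (1 + C1 + (s `^ q0)^-1), s; split => //.
  by rewrite -addrA ltr_pwDl// addr_ge0// invr_ge0 ltW.
have Cpos : 0 <= 1 + C1 + (s `^ q0)^-1.
  by rewrite addr_ge0 ?invr_ge0 ?(ltW sq0)// addr_ge0.
move=> x; have [eN|eN] := boolP (eps < N x); last first.
  rewrite (zero _ eN) normr0 powR0 ?expr0n /=; last first.
    by rewrite gt_eqF// addr_gt0.
  by split; exact: mulr_ge0.
have [h1 h2] := main x eN.
have d2 : 1 <= 2 + delta by lra.
have low (p : R) : 0 <= p <= 2 + delta -> `|phi x| `^ p <= 1 + `|phi x| `^ (2 + delta).
  move=> /andP[p0 p2]; have [N1|N1] := leP (`|phi x|) 1.
    have : `|phi x| `^ p <= 1 `^ p by rewrite ge0_ler_powR ?nnegrE.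
    by rewrite powR1 => /le_trans; apply; rewrite lerDl powR_ge0.
  by apply: (@le_trans _ _ (`|phi x| `^ (2 + delta))); rewrite ?lerDr// ler_powR// ltW.
have fin (z : R) : z <= 1 + `|phi x| `^ (2 + delta) ->
    z <= (1 + C1 + (s `^ q0)^-1) * tail_power_sum s x.
  move=> /le_trans; apply; apply: le_trans (lerD h1 h2) _.
  rewrite -mulrDl ler_wpM2r//; lra.
split.
- by apply: fin; rewrite lerDr.
- apply: fin; rewrite -[phi x ^+ 2]real_normK ?num_real// -powR_mulrn//.
  by apply: low; apply/andP; split; lra.
- apply: fin; rewrite -[leLHS]powRr1//; apply: low; apply/andP; split; lra.
Qed.

End growth.

(** * Exceedances of the stationary chain *)

Section exceedances.
Context {R : realType} {dO} {Omega : measurableType dO} {P : probability Omega R}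
  {dE} {E : measurableType dE} {Pi : R.-pker E ~> E} {Y : int -> {RV P >-> E}}
  {g : {mfun E >-> R}} {X : int -> {RV P >-> R}} {alpha : R}
  {nu : forall i, {measure set (borel_punctured R i) -> \bar R}}
  {V : {mfun E >-> R}} {q0 : R} {u : nat -> R}.
Hypothesis drift : drift_assumption Pi Y g X alpha nu V q0 u.
Hypothesis u0 : forall n, 0 < u n.
Hypothesis ndu : nondecreasing_seq u.
Hypothesis aoo : n%:R * survival X (u n) @[n --> \oo] --> +oo.

Local Notation F n := (survival X (u n)).

Lemma survival_ge0 x : 0 <= survival X x.
Proof. by rewrite /survival /ccdf fine_ge0. Qed.

Lemma survival_le1 x : survival X x <= 1.
Proof.
rewrite /survival /ccdf -[leRHS]/(fine 1%E) fine_le ?probability_le1//.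
exact: fin_num_measure.
Qed.

Lemma survival_gt0_near : \forall n \near \oo, 0 < F n.
Proof.
have /cvgryPge/(_ 1) := aoo; apply: filterS => n h.
rewrite lt_neqAle survival_ge0 andbT eq_sym; apply/eqP => F0.
by move: h; rewrite F0 mulr0; lra.
Qed.

Let q00 : 0 < q0. Proof. by case/andP: (drift_q0 drift). Qed.
Let V1 y : 1 <= V y := drift_V_ge1 drift y.
Let V0 y : 0 <= V y := le_trans ler01 (V1 y).
Let mV : measurable_fun setT V := measurable_funP V.
Let mc := drift_markov drift.
Let sY := drift_stationary drift.

Lemma intg_V n : intg P (fun w => V (Y n w)).
Proof.
have [gamma [b [g01 b0 dV]]] := drift_condition drift.
apply: (intg_stationary sY) => //.
exact: (intg_stationary_weight mV V1 g01 b0 dV mc sY).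
Qed.

Definition exceeds (s : R) n (y : E) : R := if u n * s < `|g y| then 1 else 0.
Definition excess (s : R) n (y : E) : R := tail_power q0 s ((u n)^-1 * g y).

Lemma excessE s n y : excess s n y = `|g y| `^ q0 * (u n `^ q0)^-1 * exceeds s n y.
Proof.
have un := u0 n.
rewrite /excess /tail_power /exceeds normrM gtr0_norm ?invr_gt0//.
rewrite powRM ?invr_ge0 ?(ltW un)// -[in LHS]powR_inv1 ?(ltW un)// -powRrM mulN1r powRN.
rewrite powR_inv1 ?(ltW un)// mulrC [X in _ * X]mulrC -mulrA.
by rewrite ltr_pdivlMl//; case: ifP => _; ring.
Qed.

Lemma exceeds_ge0 s n y : 0 <= exceeds s n y. Proof. by rewrite /exceeds; case: ifP. Qed.
Lemma exceeds_le1 s n y : exceeds s n y <= 1. Proof. by rewrite /exceeds; case: ifP. Qed.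

Lemma measurable_exceeds s n : measurable_fun setT (exceeds s n).
Proof.
apply: measurable_fun_ifT; [|exact: measurable_cst|exact: measurable_cst].
apply: measurable_fun_ltr; first exact: measurable_cst.
by apply: measurableT_comp => //; exact: measurable_funP.
Qed.

Lemma measurable_excess s n : measurable_fun setT (excess s n).
Proof.
rewrite (_ : excess s n = fun y => `|g y| `^ q0 * (u n `^ q0)^-1 * exceeds s n y); last first.
  by apply/funext => y; rewrite excessE.
apply: measurable_funM; last exact: measurable_exceeds.
apply: measurable_funM; last exact: measurable_cst.
apply: (measurableT_comp (f := fun x : R => x `^ q0)); first exact: measurable_powR.
by apply: measurableT_comp => //; exact: measurable_funP.
Qed.

Lemma excess_ge0 s n y : 0 <= excess s n y. Proof. exact: tail_power_ge0. Qed.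

(** This is the moment condition at the level [s * u n], read off the upper
    limit. *)
Lemma EE_V_exceeds s : 0 < s -> exists2 K, 0 <= K & \forall n \near \oo,
  \int[P]_w (V (Y 0 w) * exceeds s n (Y 0 w)) <= K * u n `^ q0 * F n.
Proof.
move=> s0; have := drift_limsup drift s0.
move=> /ereal_inf_lt[_ [A A_oo <-]] supA.
have [K K0 supK] : exists2 K : R, 0 <= K & forall n, A n -> (((u n `^ q0 * F n)^-1)%:E *
    'E_P[fun w => (V (Y 0 w) * \1_[set y | (`|g y| > u n * s)%R] (Y 0 w))%R] <= K%:E)%E.
  move: supA; set l := ereal_sup _ => loo.
  have [K K0 lK] : exists2 K : R, 0 <= K & (l <= K%:E)%E.
    case: (l) loo => [r _|//|_]; last by exists 0; rewrite ?leNye.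
    by exists `|r|; rewrite ?lee_fin ?ler_norm.
  by exists K => // n An; apply: le_trans lK; apply: ereal_sup_ubound; exists n.
exists K => //; have F0 := survival_gt0_near.
near=> n.
have An : A n by near: n.
have Fn : 0 < F n by near: n.
have iVe : intg P (fun w => V (Y 0 w) * exceeds s n (Y 0 w)).
  have := intg_V 0; apply: intg_le0.
    apply: measurable_funM; first exact: (measurableT_comp mV).
    by apply: (measurableT_comp (measurable_exceeds s n)).
  by move=> w; rewrite ger0_norm ?mulr_ge0 ?exceeds_ge0// ler_piMr ?exceeds_le1.
have := supK n An; rewrite unlock.
have VE w : V (Y 0 w) * \1_[set y | (`|g y| > u n * s)%R] (Y 0 w) =
    V (Y 0 w) * exceeds s n (Y 0 w).
  rewrite /exceeds indicE; congr (_ * _).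
  by case: ifPn => h; [rewrite mem_set|rewrite memNset//; exact/negP].
under eq_integral do rewrite VE.
rewrite integral_EFin_EE// -EFinM lee_fin ler_pdivrMl ?mulr_gt0 ?powR_gt0//.
by rewrite mulrC mulrA.
Unshelve. all: by end_near. Qed.

Lemma excess_le_exceeds s : exists2 c, 0 <= c & forall n y,
  excess s n y <= c * (u n `^ q0)^-1 * (V y * exceeds s n y).
Proof.
have [c c0 dom] := drift_domination drift; exists c; first exact: ltW.
move=> n y; rewrite excessE.
have -> : c * (u n `^ q0)^-1 * (V y * exceeds s n y) =
  (c * V y) * (u n `^ q0)^-1 * exceeds s n y by ring.
by rewrite ler_wpM2r ?exceeds_ge0// ler_wpM2r ?dom// invr_ge0 powR_ge0.
Qed.

(** The level [u n] is bounded below because [u] is nondecreasing and positive. *)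
Lemma excess_le_V s : exists2 c, 0 <= c & forall n y, excess s n y <= c * V y.
Proof.
have [c c0 le] := excess_le_exceeds s.
exists (c * (u 0%N `^ q0)^-1); first by rewrite mulr_ge0// invr_ge0 powR_ge0.
move=> n y; apply: le_trans (le n y) _.
rewrite -!mulrA ler_wpM2l//; apply: ler_pM.
- by rewrite invr_ge0 powR_ge0.
- by rewrite mulr_ge0 ?exceeds_ge0.
- rewrite lef_pV2 ?posrE ?powR_gt0// ge0_ler_powR ?nnegrE ?(ltW q00) ?(ltW (u0 _))//.
  exact: ndu.
- by rewrite ler_piMr ?exceeds_le1.
Qed.

Lemma intg_excess s n j : intg P (fun w => excess s n (Y j w)).
Proof.
have [c c0 le] := excess_le_V s.
apply: (intg_le0 _ _ (intgZ c (intg_V j))).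
  by apply: (measurableT_comp (measurable_excess s n)).
by move=> w; rewrite ger0_norm ?excess_ge0.
Qed.

Lemma EE_excess s : 0 < s -> exists2 K, 0 <= K & \forall n \near \oo,
  \int[P]_w excess s n (Y 0 w) <= K * F n.
Proof.
move=> s0; have [K K0 KP] := EE_V_exceeds s0; have [c c0 le] := excess_le_exceeds s.
exists (c * K); first exact: mulr_ge0.
near=> n.
have iVe : intg P (fun w => V (Y 0 w) * exceeds s n (Y 0 w)).
  have := intg_V 0; apply: intg_le0.
    apply: measurable_funM; first exact: (measurableT_comp mV).
    by apply: (measurableT_comp (measurable_exceeds s n)).
  by move=> w; rewrite ger0_norm ?mulr_ge0 ?exceeds_ge0// ler_piMr ?exceeds_le1.
have un : 0 < u n `^ q0 by rewrite powR_gt0.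
have := EE_le (intg_excess s n 0) (intgZ (c * (u n `^ q0)^-1) iVe) (fun w => le n (Y 0 w)).
rewrite EE_Z// => /le_trans; apply.
have -> : c * K * F n = c * (u n `^ q0)^-1 * (K * u n `^ q0 * F n).
  by field; rewrite gt_eqF.
rewrite ler_wpM2l; [by []|by rewrite mulr_ge0// invr_ge0 ltW|].
by near: n.
Unshelve. all: by end_near. Qed.

Lemma sqrt_excess_le s n y : 0 < s ->
  Num.sqrt (excess s n y) <= (Num.sqrt (s `^ q0))^-1 * excess s n y.
Proof.
move=> s0; have sq : 0 < s `^ q0 by rewrite powR_gt0.
rewrite /excess /tail_power; set t := `|_|; case: ifPn => [st|_]; last by rewrite mulr0 sqrtr0 mulr0.
rewrite mulr1 -{2}(sqr_sqrtr (powR_ge0 t q0)) expr2 mulrA ler_peMl ?sqrtr_ge0//.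
rewrite mulrC ler_pdivlMr ?sqrtr_gt0// mul1r ler_sqrt ?powR_ge0//.
by rewrite ge0_ler_powR ?nnegrE ?(ltW q00) ?(ltW s0)//; [exact: normr_ge0|exact: ltW].
Qed.

(** Mixing for the weight [Num.sqrt V] compares the second root of an excess
    with its mean, of order [F]. A root of an excess is at most a multiple of
    [u n ^ (- q0 / 2) * Num.sqrt V] and vanishes off the exceedance. So the first
    root times [Num.sqrt V] has expectation of order [u n ^ (q0 / 2) * F], and the
    powers of [u n] cancel in the mixing error. *)
Lemma EE_sqrt_excess_pair s : 0 < s -> exists K rho, [/\ 0 <= K, 0 < rho < 1 &
  \forall n \near \oo, forall (i : int) (d : nat),
  \int[P]_w (Num.sqrt (excess s n (Y i w)) * Num.sqrt (excess s n (Y (i + d%:Z) w))) <=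
    K * (rho ^+ d * F n + F n ^+ 2)].
Proof.
move=> s0.
have [gamma [b [g01 b0 dV]]] := drift_condition drift.
have [g0 g1] := andP g01.
have [m [x0 [m0 x01 small]]] := drift_small_sets drift.
pose W y := Num.sqrt (V y).
have mW : measurable_fun setT W := measurable_sqrtV mV.
have W1 : forall y, 1 <= W y := sqrt_V_ge1 V1.
have dW := drift_sqrt mV V1 g01 b0 dV.
have sg01 : 0 < Num.sqrt gamma < 1.
  by rewrite sqrtr_gt0 g0 -[ltRHS]sqrtr1 ltr_sqrt.
have sb0 : 0 < Num.sqrt b by rewrite sqrtr_gt0.
have W2 y : W y ^+ 2 = V y by rewrite sqr_sqrtr.
have smallW x : x0 <= x -> exists (mu : probability E R) (eps : R), 0 < eps /\
   (forall (y : E) (B : set E), W y <= x -> measurable B -> (eps%:E * mu B <= kernel_iter Pi m y B)%E).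
  move=> x0x; have x1 : 1 <= x := le_trans x01 x0x.
  have [|mu [eps [e0 H]]] := small (x ^+ 2).
    by apply: le_trans x0x _; rewrite expr2 ler_peMr// (le_trans ler01).
  exists mu, eps; split => // y B Wx mB; apply: H => //.
  by rewrite -W2 ler_pXn2r ?nnegrE ?sqrtr_ge0// (le_trans ler01).
have [Cg [rho [Cg0 rho01 erg]]] := geometric_ergodicity mW W1 sg01 sb0 dW m0 x01 smallW.
have iW j : intg P (fun w => W (Y j w)).
  have := intg_V j; apply: intg_le0; first exact: (measurableT_comp mW).
  move=> w; rewrite ger0_norm ?sqrtr_ge0// -[leRHS]W2 expr2 ler_peMr ?sqrtr_ge0//.
have [c c0 le] := excess_le_exceeds s.
have [K K0 KP] := EE_V_exceeds s0.
have [K1 K10 K1P] := EE_excess s0.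
set wb := \int[P]_w W (Y 0 w).
have wb0 : 0 <= wb by apply: EE_ge0 => w; exact: sqrtr_ge0.
pose fc := @future_cst R (Num.sqrt gamma) (Num.sqrt b) 0.
have fc0 : 0 <= fc by apply: future_cst_ge0.
pose k2 := (Num.sqrt (s `^ q0))^-1.
have k20 : 0 <= k2 by rewrite invr_ge0 sqrtr_ge0.
have KK0 : 0 <= fc * Cg * (c * K) * (1 + wb) + (k2 * K1) ^+ 2.
  apply: addr_ge0; last exact: sqr_ge0.
  apply: mulr_ge0; last exact: addr_ge0.
  by apply: mulr_ge0; exact: mulr_ge0.
exists (fc * Cg * (c * K) * (1 + wb) + (k2 * K1) ^+ 2), rho; split => //.
near=> n => i d.
set A := fun w => Num.sqrt (excess s n (Y i w)).
pose f (t : 1.-tuple E) := Num.sqrt (excess s n (tnth t ord0)).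
have un : 0 < u n `^ q0 by rewrite powR_gt0.
pose c' := Num.sqrt (c * (u n `^ q0)^-1).
have c'0 : 0 <= c' by exact: sqrtr_ge0.
have c'2 : c' ^+ 2 = c * (u n `^ q0)^-1 by rewrite sqr_sqrtr// mulr_ge0// invr_ge0 ltW.
have msq : measurable_fun setT (fun y => Num.sqrt (excess s n y)).
  apply: (measurableT_comp (f := @Num.sqrt R)); last exact: measurable_excess.
  by apply: continuous_measurable_fun; exact: sqrt_continuous.
have sle y : Num.sqrt (excess s n y) <= c' * W y * exceeds s n y.
  apply: (@le_trans _ _ (Num.sqrt (c * (u n `^ q0)^-1 * (V y * exceeds s n y)))).
    by rewrite ler_wsqrtr.
  rewrite /exceeds; case: ifP => _; last by rewrite !mulr0 sqrtr0.
  by rewrite !mulr1 sqrtrM// mulr_ge0// invr_ge0 ltW.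
have sle' y : Num.sqrt (excess s n y) <= c' * W y.
  by apply: le_trans (sle y) _; rewrite ler_piMr ?exceeds_le1// mulr_ge0 ?sqrtr_ge0.
have mA : measurable_fun setT (A : past Y i -> R).
  have mYi : measurable_fun setT (Y i : past Y i -> E) by exact: measurable_past_Y.
  by have := measurableT_comp msq mYi; exact.
have AW w : A w * W (Y i w) <= c' * (V (Y i w) * exceeds s n (Y i w)).
  apply: le_trans (ler_wpM2r (sqrtr_ge0 _) (sle _)) _.
  by rewrite -/(W (Y i w)) -W2 le_eqVlt expr2; apply/orP; left; apply/eqP; ring.
have A0 w : 0 <= A w by exact: sqrtr_ge0.
have mA' : measurable_fun setT A := measurable_fun_past_sub mA.
have mVe : measurable_fun setT (fun y => V y * exceeds s n y).
  by apply: measurable_funM => //; exact: measurable_exceeds.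
have iVe j : intg P (fun w => V (Y j w) * exceeds s n (Y j w)).
  have := intg_V j; apply: intg_le0; first exact: (measurableT_comp mVe).
  by move=> w; rewrite ger0_norm ?mulr_ge0 ?exceeds_ge0// ler_piMr ?exceeds_le1.
have iAW : intg P (fun w => A w * W (Y i w)).
  apply: intg_le0 (intgZ c' (iVe i)).
    by apply: measurable_funM => //; exact: (measurableT_comp mW).
  by move=> w; rewrite ger0_norm ?AW// mulr_ge0 ?sqrtr_ge0.
have iA : intg P A.
  apply: intg_le0 mA' _ iAW => w; rewrite ger0_norm// ler_peMr//.
have mf : measurable_fun setT f.
  by apply: (measurableT_comp msq); exact: measurable_tnth.
have fle t : `|f t| <= c' * path_weight W t.
  by rewrite ger0_norm ?sqrtr_ge0// /path_weight big_ord1; exact: sle'.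
have := @mixing_path _ _ _ P _ _ Pi W _ _ mW W1 sg01 sb0 dW Y (drift_markov drift) sY (iW 0)
  Cg rho Cg0 rho01 erg 0 f c' c'0 mf fle i d A mA iA iAW.
have fE j w : f (path_from Y j 0 w) = Num.sqrt (excess s n (Y j w)).
  by rewrite /f tnth_mktuple addr0.
under eq_Rintegral do rewrite fE.
under [in X in _ - _ * X]eq_Rintegral do rewrite fE.
move=> mix.
have Eexc : \int[P]_w (V (Y i w) * exceeds s n (Y i w)) <= K * u n `^ q0 * F n.
  by rewrite (EE_stationary sY i mVe); near: n.
have EAW : \int[P]_w (`|A w| * W (Y i w)) <= c' * (K * u n `^ q0 * F n).
  apply: (@le_trans _ _ (\int[P]_w (A w * W (Y i w)))).
    by under eq_Rintegral do rewrite (ger0_norm (A0 _)).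
  apply: le_trans (EE_le iAW (intgZ c' (iVe i)) AW) _.
  by rewrite EE_Z// ler_wpM2l.
set M := c' * (K * u n `^ q0 * F n) in EAW.
have EA : \int[P]_w `|A w| <= M.
  apply: le_trans EAW; apply: EE_le; first exact: intg_norm.
    by move: iAW; congr intg; apply/funext => w; rewrite ger0_norm.
  by move=> w; rewrite ler_peMr.
have Esq j : 0 <= \int[P]_w Num.sqrt (excess s n (Y j w)) <= k2 * K1 * F n.
  apply/andP; split; first by apply: EE_ge0 => w; exact: sqrtr_ge0.
  apply: (@le_trans _ _ (\int[P]_w (k2 * excess s n (Y j w)))).
    apply: EE_le0.
    - exact: (measurableT_comp msq).
    - by apply: intgZ; exact: intg_excess.
    - by move=> w; exact: sqrtr_ge0.
    - by move=> w; exact: sqrt_excess_le.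
  rewrite EE_Z; last exact: intg_excess.
  rewrite -mulrA ler_wpM2l//.
  by rewrite (EE_stationary sY j (measurable_excess s n)); near: n.
have [ea0 ea1] := andP (Esq i); have [eb0 eb1] := andP (Esq (i + d%:Z)).
have rd0 : 0 <= rho ^+ d by rewrite exprn_ge0// ltW//; case/andP: rho01.
have Fn0 : 0 <= F n := survival_ge0 _.
have prodb : \int[P]_w A w * \int[P]_w Num.sqrt (excess s n (Y (i + d%:Z) w)) <= (k2 * K1) ^+ 2 * F n ^+ 2.
  by rewrite -exprMn expr2 ler_pM.
have mixb : c' * future_cst (Num.sqrt gamma) (Num.sqrt b) 0 * Cg * rho ^+ d *
   (\int[P]_w (`|A w| * W (Y i w)) + \int[P]_w `|A w| * wb) <=
   fc * Cg * (c * K) * (1 + wb) * (rho ^+ d * F n).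
  apply: (@le_trans _ _ (c' * fc * Cg * rho ^+ d * (M + M * wb))).
    apply: ler_wpM2l; last by apply: lerD => //; exact: ler_wpM2r.
    by apply: mulr_ge0 => //; apply: mulr_ge0 => //; exact: mulr_ge0.
  have -> : c' * fc * Cg * rho ^+ d * (M + M * wb) =
     c' ^+ 2 * (u n `^ q0 * (fc * Cg * K * (1 + wb) * (rho ^+ d * F n))).
    by rewrite /M; ring.
  rewrite c'2 le_eqVlt; apply/orP; left; apply/eqP; field.
  by rewrite gt_eqF.
have := le_trans (ler_norm _) (le_trans mix mixb).
rewrite lerBlDr => /le_trans; apply.
apply: (@le_trans _ _ (fc * Cg * (c * K) * (1 + wb) * (rho ^+ d * F n) + (k2 * K1) ^+ 2 * F n ^+ 2)).
  exact: lerD.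
have a0 : 0 <= fc * Cg * (c * K) * (1 + wb).
  apply: mulr_ge0; last exact: addr_ge0.
  by apply: mulr_ge0; exact: mulr_ge0.
move: (fc * Cg * (c * K) * (1 + wb)) a0 => a a0.
rewrite [leRHS]mulrDr; apply: lerD; apply: ler_wpM2r; rewrite ?sqr_ge0 ?mulr_ge0//.
  by rewrite lerDl sqr_ge0.
by rewrite lerDr.
Unshelve. all: by end_near. Qed.

End exceedances.

(** * Blocks of consecutive observations *)

Section blocks.
Context {R : realType} {dO} {Omega : measurableType dO} {P : probability Omega R}
  {dE} {E : measurableType dE} {Pi : R.-pker E ~> E} {Y : int -> {RV P >-> E}}
  {g : {mfun E >-> R}} {X : int -> {RV P >-> R}} {alpha : R}
  {nu : forall i, {measure set (borel_punctured R i) -> \bar R}}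
  {V : {mfun E >-> R}} {q0 : R} {u : nat -> R}.
Hypothesis drift : drift_assumption Pi Y g X alpha nu V q0 u.
Hypothesis u0 : forall n, 0 < u n.
Hypothesis ndu : nondecreasing_seq u.
Hypothesis aoo : n%:R * survival X (u n) @[n --> \oo] --> +oo.

Local Notation F n := (survival X (u n)).

Variables (h : nat) (phi : 'rV[R]_h.+1 -> R) (C0 s : R).
Hypothesis mphi : measurable_fun setT (phi : borel_rV R h.+1 -> R).
Hypothesis C00 : 0 < C0.
Hypothesis s0 : 0 < s.
Hypothesis growth : forall x,
  phi x ^+ 2 <= C0 * tail_power_sum q0 s x /\ `|phi x| <= C0 * tail_power_sum q0 s x.

Definition path_phi n (t : h.+1.-tuple E) : R :=
  phi ((u n)^-1 *: \row_(k < h.+1) g (tnth t k)).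

Definition block_phi (n j : nat) (w : Omega) : R :=
  phi ((u n)^-1 *: block X h (j.+1)%:Z w).

Let V1 y : 1 <= V y := drift_V_ge1 drift y.
Let V0 y : 0 <= V y := le_trans ler01 (V1 y).
Let mV : measurable_fun setT V := measurable_funP V.
Let mc := drift_markov drift.
Let sY := drift_stationary drift.
Let W y := Num.sqrt (V y).
Let mW : measurable_fun setT W := measurable_sqrtV mV.
Let W1 : forall y, 1 <= W y := sqrt_V_ge1 V1.

Lemma block_phiE n j w : block_phi n j w = path_phi n (path_from Y (j.+1)%:Z h w).
Proof.
rewrite /block_phi /path_phi; congr (phi (_ *: _)); apply/rowP => k.
by rewrite !mxE tnth_mktuple (drift_observable drift).
Qed.

Lemma measurable_path_phi n : measurable_fun setT (path_phi n).
Proof.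
apply: (measurableT_comp mphi); apply: measurable_rV => k.
rewrite (_ : (fun _ => _) = fun t => (u n)^-1 * g (tnth t k)); last first.
  by apply/funext => t; rewrite !mxE.
apply: measurable_funM; first exact: measurable_cst.
by apply: measurableT_comp; [exact: measurable_funP|exact: measurable_tnth].
Qed.

Definition path_excess n (t : h.+1.-tuple E) : R := \sum_(k < h.+1) excess (g := g) (q0 := q0) (u := u) s n (tnth t k).

Lemma path_excessE n t :
  path_excess n t = tail_power_sum q0 s ((u n)^-1 *: \row_(k < h.+1) g (tnth t k)).
Proof. by apply: eq_bigr => k _; rewrite !mxE. Qed.

Lemma path_phi_sqr n t : path_phi n t ^+ 2 <= C0 * path_excess n t.
Proof. by rewrite path_excessE; case: (growth ((u n)^-1 *: \row_k g (tnth t k))). Qed.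

Lemma path_phi_le n t : `|path_phi n t| <= C0 * path_excess n t.
Proof. by rewrite path_excessE; case: (growth ((u n)^-1 *: \row_k g (tnth t k))). Qed.

Lemma sum_sqr_le (I : finType) (a : I -> R) : (forall i, 0 <= a i) ->
  \sum_i a i ^+ 2 <= (\sum_i a i) ^+ 2.
Proof.
move=> a0; rewrite expr2 mulr_suml ler_sum// => i _.
by rewrite expr2 ler_wpM2l// (bigD1 i)//= lerDl sumr_ge0.
Qed.

Lemma path_phi_sqrt_excess n t : `|path_phi n t| <= Num.sqrt C0 *
  \sum_(k < h.+1) Num.sqrt (excess (g := g) (q0 := q0) (u := u) s n (tnth t k)).
Proof.
have sum0 : 0 <= \sum_(k < h.+1) Num.sqrt (excess (g := g) (q0 := q0) (u := u) s n (tnth t k)).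
  by apply: sumr_ge0 => k _; exact: sqrtr_ge0.
rewrite -(ler_pXn2r (n := 2))// ?nnegrE ?mulr_ge0 ?sqrtr_ge0//.
rewrite real_normK ?num_real// exprMn sqr_sqrtr ?(ltW C00)//.
apply: le_trans (path_phi_sqr n t) _; rewrite ler_wpM2l ?(ltW C00)//.
apply: le_trans (sum_sqr_le _) => [|k]; last exact: sqrtr_ge0.
by apply: ler_sum => k _; rewrite sqr_sqrtr// excess_ge0.
Qed.

(** The square of a block is dominated by excesses, hence by the weight [V], and
    the block itself by the square root. *)
Lemma path_phi_weights : exists2 c, 0 <= c & forall n t,
  path_phi n t ^+ 2 <= c * path_weight V t /\ `|path_phi n t| <= c * path_weight W t.
Proof.
have [c c0 cV] := excess_le_V drift u0 ndu s.
have pV n t : path_phi n t ^+ 2 <= C0 * c * path_weight V t.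
  apply: le_trans (path_phi_sqr n t) _; rewrite -mulrA ler_wpM2l ?(ltW C00)//.
  by rewrite mulr_sumr ler_sum.
have Cc0 : 0 <= C0 * c by rewrite mulr_ge0// ltW.
have pW0 n (t : n.-tuple E) : 0 <= path_weight W t by exact: path_weight_ge0.
have pV0 n (t : n.-tuple E) : 0 <= path_weight V t by exact: path_weight_ge0.
exists (C0 * c + Num.sqrt (C0 * c)); first by rewrite addr_ge0// sqrtr_ge0.
move=> n t; split.
  by apply: le_trans (pV n t) _; rewrite ler_wpM2r// lerDl sqrtr_ge0.
apply: (@le_trans _ _ (Num.sqrt (C0 * c) * path_weight W t)); last first.
  by rewrite ler_wpM2r// lerDr.
rewrite -(ler_pXn2r (n := 2))// ?nnegrE ?mulr_ge0 ?sqrtr_ge0//.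
rewrite real_normK ?num_real// exprMn sqr_sqrtr//.
apply: le_trans (pV n t) _; rewrite ler_wpM2l//.
apply: le_trans (sum_sqr_le _) => [|k]; last exact: sqrtr_ge0.
by apply: ler_sum => k _; rewrite sqr_sqrtr.
Qed.

Lemma measurable_block_phi n j : measurable_fun setT (block_phi n j).
Proof.
rewrite (_ : block_phi n j = path_phi n \o path_from Y (j.+1)%:Z h).
  by apply: measurableT_comp; [exact: measurable_path_phi|exact: measurable_path].
by apply/funext => w; rewrite block_phiE.
Qed.

Lemma intg_path_weight_V n p : intg P (fun w => path_weight V (path_from Y n p w)).
Proof.
apply: intg_sum => k; have := intg_V drift (n + (k : nat)%:Z).
by congr intg; apply/funext => w; rewrite tnth_mktuple.
Qed.

Lemma intg_block_phi_sqr n j : intg P (fun w => block_phi n j w ^+ 2).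
Proof.
have [c c0 cP] := path_phi_weights.
apply: intg_le0 (intgZ c (intg_path_weight_V (j.+1)%:Z h)).
  by apply: measurable_funX; exact: measurable_block_phi.
by move=> w; rewrite ger0_norm ?sqr_ge0// block_phiE; case: (cP n (path_from Y (j.+1)%:Z h w)).
Qed.

Lemma intg_block_phi n j : intg P (block_phi n j).
Proof. by apply: intg_of_sqr; [exact: measurable_block_phi|exact: intg_block_phi_sqr]. Qed.

Lemma EE_block_phi n j : \int[P]_w block_phi n j w = \int[P]_w path_phi n (path_from Y 0 h w).
Proof.
under eq_Rintegral do rewrite block_phiE.
by rewrite (EE_path_stationary sY)//; exact: measurable_path_phi.
Qed.

(** A product of two blocks is a function of the path from the first block to the
    end of the second one; both blocks are windows of this path. *)
Definition subpath a p (t : p.+1.-tuple E) : h.+1.-tuple E :=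
  [tuple tnth t (inord (a + (k : nat))) | k < h.+1].

Lemma measurable_subpath a p : measurable_fun setT (@subpath a p).
Proof.
apply/measurable_fun_tnthP => k.
rewrite (_ : _ \o _ = fun t => tnth t (inord (a + (k : nat)))); first exact: measurable_tnth.
by apply/funext => t /=; rewrite tnth_mktuple.
Qed.

Lemma subpath_path_from a p n w : (a + h <= p)%N ->
  subpath a (path_from Y n p w) = path_from Y (n + a%:Z) h w.
Proof.
move=> ahp; apply: eq_from_tnth => k; rewrite !tnth_mktuple inordK; last first.
  by rewrite ltnS; apply: leq_trans ahp; rewrite leq_add2l -ltnS ltn_ord.
by rewrite PoszD addrA.
Qed.

Lemma path_weight_subpath (U : E -> R) a p (t : p.+1.-tuple E) : (forall y, 0 <= U y) ->
  (a + h <= p)%N -> path_weight U (subpath a t) <= path_weight U t.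
Proof.
move=> U0 ahp; rewrite /path_weight.
under eq_bigr do rewrite tnth_mktuple.
pose f (k : 'I_h.+1) : 'I_p.+1 := inord (a + (k : nat)).
have fK (k : 'I_h.+1) : f k = (a + k)%N :> nat.
  by rewrite inordK// ltnS; apply: leq_trans ahp; rewrite leq_add2l -ltnS ltn_ord.
have fI : injective f.
  by move=> k l /(congr1 val) /=; rewrite !fK => /addnI; exact: val_inj.
rewrite [leRHS](bigID (mem [set f k | k : 'I_h.+1]%SET))/=.
rewrite big_imset /=; last by move=> k l _ _; exact: fI.
rewrite (eq_bigl predT); last by move=> k; rewrite inE.
by rewrite lerDl sumr_ge0.
Qed.

Definition pair_phi n d (t : (d + h).+1.-tuple E) : R :=
  path_phi n (subpath 0 t) * path_phi n (subpath d t).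

Lemma block_phi_pairE n i d w : block_phi n i w * block_phi n (i + d) w =
  pair_phi n (path_from Y (i.+1)%:Z (d + h) w).
Proof.
rewrite /pair_phi !subpath_path_from ?leq_addl//.
by rewrite !block_phiE addr0 -PoszD.
Qed.

Lemma measurable_pair_phi n d : measurable_fun setT (@pair_phi n d).
Proof.
by apply: measurable_funM; apply: (measurableT_comp (measurable_path_phi n));
  exact: measurable_subpath.
Qed.

Lemma EE_block_phi_pair n i d : \int[P]_w (block_phi n i w * block_phi n (i + d) w) =
  \int[P]_w pair_phi n (path_from Y 0 (d + h) w).
Proof.
under eq_Rintegral do rewrite block_phi_pairE.
by rewrite (EE_path_stationary sY)//; exact: measurable_pair_phi.
Qed.

Lemma EE_abs_block_phi : exists2 K, 0 <= K & \forall n \near \oo, forall j,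
  \int[P]_w `|block_phi n j w| <= K * F n.
Proof.
have [K K0 KP] := EE_excess drift u0 ndu aoo s0.
exists (C0 * (h.+1%:R * K)); first by rewrite !mulr_ge0// ltW.
near=> n => j.
have iE : intg P (fun w => path_excess n (path_from Y (j.+1)%:Z h w)).
  apply: intg_sum => k; have := intg_excess drift u0 ndu s n ((j.+1)%:Z + (k : nat)%:Z).
  by congr intg; apply/funext => w; rewrite tnth_mktuple.
apply: le_trans (EE_le (intg_norm (intg_block_phi n j)) (intgZ C0 iE) _) _.
  by move=> w; rewrite block_phiE; exact: path_phi_le.
rewrite EE_Z// -mulrA ler_wpM2l ?(ltW C00)//.
rewrite EE_sum; last first.
  move=> k; have := intg_excess drift u0 ndu s n ((j.+1)%:Z + (k : nat)%:Z).
  by congr intg; apply/funext => w; rewrite tnth_mktuple.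
have Kn : \int[P]_w excess (g := g) (q0 := q0) (u := u) s n (Y 0 w) <= K * F n by near: n.
apply: (@le_trans _ _ (\sum_(k < h.+1) (K * F n))).
  apply: ler_sum => k _; under eq_Rintegral do rewrite tnth_mktuple.
  by rewrite (EE_stationary sY)//; exact: measurable_excess.
by rewrite sumr_const card_ord -[leLHS]mulr_natl mulrA.
Unshelve. all: by end_near. Qed.

Let vb := \int[P]_w V (Y 0 w).
Let vb0 : 0 <= vb. Proof. exact: EE_ge0. Qed.

Let W2 y : W y ^+ 2 = V y. Proof. by rewrite sqr_sqrtr. Qed.
Let W0 y : 0 <= W y. Proof. exact: sqrtr_ge0. Qed.

Let iW : intg P (fun w => W (Y 0 w)).
Proof.
have := intg_V drift 0; apply: intg_le0; first exact: (measurableT_comp mW).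
by move=> w; rewrite ger0_norm// -[leRHS]W2 expr2 ler_peMr.
Qed.

(** The square root is the weight for one block, which is bounded by a multiple
    of it; products of two blocks need the full weight. *)
Lemma drift_ergodicity : exists gamma b Cg rho : R, [/\ 0 < gamma < 1, 0 < b,
  forall y, (\int[Pi y]_z (V z)%:E <= (gamma * V y + b)%:E)%E,
  0 <= Cg & 0 < rho < 1 /\
  (forall c (f : E -> R), 0 <= c -> measurable_fun setT f -> (forall y, `|f y| <= c * V y) ->
  forall n x y, iter n (Pop Pi) f x - iter n (Pop Pi) f y <= c * Cg * rho ^+ n * (V x + V y)) /\
  (forall c (f : E -> R), 0 <= c -> measurable_fun setT f -> (forall y, `|f y| <= c * W y) ->
  forall n x y, iter n (Pop Pi) f x - iter n (Pop Pi) f y <= c * Cg * rho ^+ n * (W x + W y))].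
Proof.
have [gamma [b [g01 b0 dV]]] := drift_condition drift.
have [g0 g1] := andP g01.
have [m [x0 [m0 x01 small]]] := drift_small_sets drift.
have dW := drift_sqrt mV V1 g01 b0 dV.
have sg01 : 0 < Num.sqrt gamma < 1.
  by rewrite sqrtr_gt0 g0 -[ltRHS]sqrtr1 ltr_sqrt.
have sb0 : 0 < Num.sqrt b by rewrite sqrtr_gt0.
have smallW x : x0 <= x -> exists (mu : probability E R) (eps : R), 0 < eps /\
   (forall (y : E) (B : set E), W y <= x -> measurable B -> (eps%:E * mu B <= kernel_iter Pi m y B)%E).
  move=> x0x; have x1 : 1 <= x := le_trans x01 x0x.
  have [|mu [eps [e0 H]]] := small (x ^+ 2).
    by apply: le_trans x0x _; rewrite expr2 ler_peMr// (le_trans ler01).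
  exists mu, eps; split => // y B Wx mB; apply: H => //.
  by rewrite -W2 ler_pXn2r ?nnegrE// (le_trans ler01).
have [C1 [r1 [C10 r101 erg1]]] := geometric_ergodicity mV V1 g01 b0 dV m0 x01 small.
have [C2 [r2 [C20 r201 erg2]]] := geometric_ergodicity mW W1 sg01 sb0 dW m0 x01 smallW.
have [r10 r11] := andP r101; have [r20 r21] := andP r201.
exists gamma, b, (C1 + C2), (Num.max r1 r2); split => //; first exact: addr_ge0.
split; first by rewrite lt_max r10 gt_max r11.
split=> c f c0 mf fc n x y.
- apply: le_trans (erg1 c f c0 mf fc n x y) _; rewrite ler_wpM2r ?addr_ge0//.
  apply: ler_pM; rewrite ?mulr_ge0 ?exprn_ge0 ?(ltW r10)//.
    by rewrite ler_wpM2l// lerDl.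
  by rewrite lerXn2r ?nnegrE ?le_max ?lexx ?(ltW r10).
- apply: le_trans (erg2 c f c0 mf fc n x y) _; rewrite ler_wpM2r ?addr_ge0//.
  apply: ler_pM; rewrite ?mulr_ge0 ?exprn_ge0 ?(ltW r20)//.
    by rewrite ler_wpM2l// lerDr.
  by rewrite lerXn2r ?nnegrE ?le_max ?lexx ?(ltW r20) ?orbT.
Qed.

(** The block is a function of the path after a gap, dominated by the root of
    the weight, so [mixing_path] applies; Cauchy-Schwarz keeps the product of
    two such weights integrable. *)
Lemma single_mixing : exists K rho : R, [/\ 0 <= K, 0 < rho < 1 &
  forall n c (A : Omega -> R) (k : int) (j d : nat), 0 <= c ->
    measurable_fun setT (A : past Y k -> R) ->
    (forall w, `|A w| <= c * path_weight W (path_from Y (k - h%:Z) h w)) ->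
    (j.+1)%:Z = k + d%:Z ->
  `|\int[P]_w (A w * block_phi n j w) - \int[P]_w A w * \int[P]_w block_phi n j w| <=
    c * K * rho ^+ d].
Proof.
have [gamma [b [Cg [rho [g01 b0 dV Cg0 [rho01 [_ erg]]]]]]] := drift_ergodicity.
have [g0 g1] := andP g01.
have dW := drift_sqrt mV V1 g01 b0 dV.
have sg01 : 0 < Num.sqrt gamma < 1.
  by rewrite sqrtr_gt0 g0 -[ltRHS]sqrtr1 ltr_sqrt.
have sb0 : 0 < Num.sqrt b by rewrite sqrtr_gt0.
have [cp cp0 cpP] := path_phi_weights.
pose fc := @future_cst R (Num.sqrt gamma) (Num.sqrt b) h.
have fc0 : 0 <= fc by apply: future_cst_ge0.
set wb := \int[P]_w W (Y 0 w).
have wb0 : 0 <= wb by exact: EE_ge0.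
pose M := h.+1%:R * (2 * vb).
have M0 : 0 <= M by rewrite !mulr_ge0.
exists (cp * fc * Cg * (M + M * wb)), rho; split => //.
  apply: mulr_ge0; first by apply: mulr_ge0 => //; exact: mulr_ge0.
  by apply: addr_ge0 => //; exact: mulr_ge0.
move=> n c A k j d c0 mA Ac jkd.
have mA' : measurable_fun setT A := measurable_fun_past_sub mA.
have iVV : intg P (fun w => \sum_(l < h.+1) (V (Y (k - h%:Z + (l : nat)%:Z) w) + V (Y k w))).
  by apply: intg_sum => l; apply: intgD; exact: (intg_V drift).
have AWb w : `|A w| * W (Y k w) <=
    c * \sum_(l < h.+1) (V (Y (k - h%:Z + (l : nat)%:Z) w) + V (Y k w)).
  apply: le_trans (ler_wpM2r (W0 _) (Ac w)) _.
  rewrite -mulrA ler_wpM2l// /path_weight mulr_suml ler_sum// => l _.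
  rewrite tnth_mktuple -!W2; move: (W _) (W _) (W0 (Y (k - h%:Z + (l : nat)%:Z) w)) (W0 (Y k w)) => a e a0 e0.
  have := sqr_ge0 (a - e); have := mulr_ge0 a0 e0; rewrite !expr2; lra.
have iAW : intg P (fun w => A w * W (Y k w)).
  apply: intg_le0 (intgZ c iVV).
    by apply: measurable_funM => //; exact: (measurableT_comp mW).
  by move=> w; rewrite normrM (ger0_norm (W0 _)).
have iA : intg P A.
  apply: intg_le mA' _ iAW => w; rewrite normrM ler_peMr// ger0_norm//.
have fle t : `|path_phi n t| <= cp * path_weight W t by case: (cpP n t).
have := @mixing_path _ _ _ P _ _ Pi W _ _ mW W1 sg01 sb0 dW Y mc sY iW Cg rho Cg0 rho01 erg
  h (path_phi n) cp cp0 (measurable_path_phi n) fle k d A mA iA iAW.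
rewrite -jkd.
have E1 : \int[P]_w (A w * path_phi n (path_from Y (j.+1)%:Z h w)) = \int[P]_w (A w * block_phi n j w).
  by apply: eq_Rintegral => w _; rewrite block_phiE.
have E2 : \int[P]_w path_phi n (path_from Y (j.+1)%:Z h w) = \int[P]_w block_phi n j w.
  by apply: eq_Rintegral => w _; rewrite block_phiE.
rewrite E1 E2 => /le_trans; apply.
have EAW : \int[P]_w (`|A w| * W (Y k w)) <= c * M.
  have i1 : intg P (fun w => `|A w| * W (Y k w)).
    have := intg_norm iAW; congr intg; apply/funext => w.
    by rewrite normrM (ger0_norm (W0 _)).
  apply: le_trans (EE_le i1 (intgZ c iVV) AWb) _.
  rewrite EE_Z// ler_wpM2l// EE_sum; last by move=> l; apply: intgD; exact: (intg_V drift).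
  rewrite (eq_bigr (fun=> 2 * vb)); last first.
    move=> l _; rewrite EE_D; [|exact: (intg_V drift)|exact: (intg_V drift)].
    by rewrite !(EE_stationary sY)// -/vb; ring.
  by rewrite sumr_const card_ord -[leLHS]mulr_natl.
have EA : \int[P]_w `|A w| <= c * M.
  apply: le_trans EAW; apply: EE_le; first exact: intg_norm.
    have := intg_norm iAW; congr intg; apply/funext => w.
    by rewrite normrM (ger0_norm (W0 _)).
  by move=> w; rewrite ler_peMr.
have -> : c * (cp * fc * Cg * (M + M * wb)) * rho ^+ d =
  cp * fc * Cg * rho ^+ d * (c * M + c * M * wb) by ring.
apply: ler_wpM2l; last by apply: lerD => //; exact: ler_wpM2r.
apply: mulr_ge0; first by apply: mulr_ge0 => //; exact: mulr_ge0.
by rewrite exprn_ge0// ltW//; case/andP: rho01.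
Qed.

(** The product of two blocks is dominated by the full weight, so it is compared
    with bounded functions of the past only. *)
Lemma pair_mixing : exists K rho : R, [/\ 0 <= K, 0 < rho < 1 &
  forall n (A : Omega -> R) (k : int) (i e d : nat),
    measurable_fun setT (A : past Y k -> R) -> (forall w, `|A w| <= 1) ->
    (i.+1)%:Z = k + d%:Z ->
  `|\int[P]_w (A w * (block_phi n i w * block_phi n (i + e) w)) -
    \int[P]_w A w * \int[P]_w (block_phi n i w * block_phi n (i + e) w)| <=
    K * (e + h).+1%:R * rho ^+ d].
Proof.
have [gamma [b [Cg [rho [g01 b0 dV Cg0 [rho01 [erg _]]]]]]] := drift_ergodicity.
have [g0 g1] := andP g01.
have [cp cp0 cpP] := path_phi_weights.
have q0_ : 0 <= (1 + b) / (1 - gamma) by apply: divr_ge0; rewrite ?subr_ge0 ?addr_ge0// ltW.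
exists (cp * ((1 + b) / (1 - gamma)) * Cg * (vb + vb)), rho; split => //.
  apply: mulr_ge0; last exact: addr_ge0.
  by apply: mulr_ge0 => //; exact: mulr_ge0.
move=> n A k i e d mA A1 ikd.
have mA' : measurable_fun setT A := measurable_fun_past_sub mA.
have iVk := intg_V drift k.
have iAV : intg P (fun w => A w * V (Y k w)).
  by apply: (intgM_bounded mA' A1 iVk).
have iA : intg P A by apply: intg_bounded A1.
have fle (t : (e + h).+1.-tuple E) : `|pair_phi n t| <= cp * path_weight V t.
  rewrite /pair_phi normrM.
  have [a1 _] := cpP n (subpath 0 t); have [a2 _] := cpP n (subpath e t).
  have b1 : path_weight V (subpath 0 t) <= path_weight V t.
    by apply: path_weight_subpath => //; rewrite add0n leq_addl.
  have b2 : path_weight V (subpath e t) <= path_weight V t by exact: path_weight_subpath.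
  have h1 := le_trans a1 (ler_wpM2l cp0 b1); have h2 := le_trans a2 (ler_wpM2l cp0 b2).
  move: h1 h2; rewrite -[path_phi n (subpath 0 t) ^+ 2]real_normK ?num_real//.
  rewrite -[path_phi n (subpath e t) ^+ 2]real_normK ?num_real//.
  move: `|path_phi n (subpath 0 t)| `|path_phi n (subpath e t)| (cp * _) => x y z.
  have := sqr_ge0 (x - y); rewrite !expr2; lra.
have := @mixing_path _ _ _ P _ _ Pi V _ _ mV V1 g01 b0 dV Y mc sY (intg_V drift 0) Cg rho Cg0 rho01 erg
  (e + h) (@pair_phi n e) cp cp0 (@measurable_pair_phi n e) fle k d A mA iA iAV.
rewrite -ikd.
have -> : \int[P]_w (A w * pair_phi n (path_from Y (i.+1)%:Z (e + h) w)) =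
    \int[P]_w (A w * (block_phi n i w * block_phi n (i + e) w)).
  by apply: eq_Rintegral => w _; rewrite block_phi_pairE.
have -> : \int[P]_w pair_phi n (path_from Y (i.+1)%:Z (e + h) w) =
    \int[P]_w (block_phi n i w * block_phi n (i + e) w).
  by apply: eq_Rintegral => w _; rewrite block_phi_pairE.
move=> /le_trans; apply; rewrite /future_cst -/vb.
have E1 : \int[P]_w (`|A w| * V (Y k w)) <= vb.
  rewrite /vb -(EE_stationary sY k mV); apply: EE_le0 => //.
  - by apply: measurable_funM; [exact: measurableT_comp|exact: (measurableT_comp mV)].
  - by move=> w; exact: mulr_ge0.
  - by move=> w; rewrite ler_piMl.
have E2 : \int[P]_w `|A w| <= 1.
  rewrite -[leRHS](EE_cst P); apply: EE_le0 => //; last exact: intg_cst.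
  exact: measurableT_comp.
have -> : cp * ((1 + b) / (1 - gamma)) * Cg * (vb + vb) * (e + h).+1%:R * rho ^+ d =
  cp * ((e + h).+1%:R * ((1 + b) / (1 - gamma))) * Cg * rho ^+ d * (vb + vb) by ring.
apply: ler_wpM2l; last by apply: lerD => //; rewrite -[leRHS]mul1r ler_wpM2r.
apply: mulr_ge0; last by rewrite exprn_ge0// ltW//; case/andP: rho01.
by apply: mulr_ge0 => //; apply: mulr_ge0 => //; exact: mulr_ge0.
Qed.

(** A block is at most the sum of the roots of the excesses of its entries, up to a
    constant, and the lags inside a block only change the constant. *)
Lemma EE_block_phi_prod : exists K rho : R, [/\ 0 <= K, 0 < rho < 1 &
  \forall n \near \oo, forall i j, (i <= j)%N ->
  \int[P]_w (`|block_phi n i w| * `|block_phi n j w|) <=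
    K * (rho ^+ (j - i) * F n + F n ^+ 2)].
Proof.
have [K [rho [K0 rho01 KP]]] := EE_sqrt_excess_pair drift u0 ndu aoo s0.
have [r0 r1] := andP rho01.
pose cst := h.+1%:R * (h.+1%:R * (K * (rho ^+ h)^-1)).
have rh0 : 0 < rho ^+ h by rewrite exprn_gt0.
have cst0 : 0 <= cst by rewrite !mulr_ge0// invr_ge0 ltW.
exists (C0 * cst), rho; split => //; first by rewrite mulr_ge0// ltW.
near=> n.
have KPn : forall (i : int) (d : nat),
  \int[P]_w (Num.sqrt (excess (g := g) (q0 := q0) (u := u) s n (Y i w)) *
    Num.sqrt (excess (g := g) (q0 := q0) (u := u) s n (Y (i + d%:Z) w)))
  <= K * (rho ^+ d * F n + F n ^+ 2) by near: n.
move=> i j ij; set ex := fun y => Num.sqrt (excess (g := g) (q0 := q0) (u := u) s n y).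
have iex : intg P (fun w => \sum_(k < h.+1) \sum_(l < h.+1)
   (ex (Y ((i.+1)%:Z + (k : nat)%:Z) w) * ex (Y ((j.+1)%:Z + (l : nat)%:Z) w))).
  apply: intg_sum => k; apply: intg_sum => l.
  have mex : measurable_fun setT ex.
    apply: (measurableT_comp (f := @Num.sqrt R)); last exact: measurable_excess.
    by apply: continuous_measurable_fun; exact: sqrt_continuous.
  apply: intgM_sqr; try exact: (measurableT_comp mex).
    have := intg_excess drift u0 ndu s n ((i.+1)%:Z + (k : nat)%:Z).
    by congr intg; apply/funext => w; rewrite sqr_sqrtr// excess_ge0.
  have := intg_excess drift u0 ndu s n ((j.+1)%:Z + (l : nat)%:Z).
  by congr intg; apply/funext => w; rewrite sqr_sqrtr// excess_ge0.
apply: (@le_trans _ _ (C0 * \int[P]_w (\sum_(k < h.+1) \sum_(l < h.+1)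
   (ex (Y ((i.+1)%:Z + (k : nat)%:Z) w) * ex (Y ((j.+1)%:Z + (l : nat)%:Z) w))))).
  rewrite -EE_Z//; apply: EE_le0.
  - by apply: measurable_funM; apply: measurableT_comp => //; exact: measurable_block_phi.
  - exact: intgZ.
  - by move=> w; exact: mulr_ge0.
  - move=> w; rewrite !block_phiE.
    apply: le_trans (ler_pM _ _ (path_phi_sqrt_excess _ _) (path_phi_sqrt_excess _ _)) _ => //.
    rewrite mulrACA -expr2 sqr_sqrtr ?(ltW C00)// ler_wpM2l ?(ltW C00)//.
    rewrite mulr_suml ler_sum// => k _; rewrite mulr_sumr ler_sum// => l _.
    by rewrite !tnth_mktuple.
have mex : measurable_fun setT ex.
  apply: (measurableT_comp (f := @Num.sqrt R)); last exact: measurable_excess.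
  by apply: continuous_measurable_fun; exact: sqrt_continuous.
have ikl (k l : 'I_h.+1) : intg P (fun w =>
    ex (Y ((i.+1)%:Z + (k : nat)%:Z) w) * ex (Y ((j.+1)%:Z + (l : nat)%:Z) w)).
  apply: intgM_sqr; try exact: (measurableT_comp mex).
    have := intg_excess drift u0 ndu s n ((i.+1)%:Z + (k : nat)%:Z).
    by congr intg; apply/funext => w; rewrite sqr_sqrtr// excess_ge0.
  have := intg_excess drift u0 ndu s n ((j.+1)%:Z + (l : nat)%:Z).
  by congr intg; apply/funext => w; rewrite sqr_sqrtr// excess_ge0.
rewrite -mulrA ler_wpM2l ?(ltW C00)// EE_sum; last by move=> k; exact: intg_sum.
pose B := K * (rho ^+ h)^-1 * (rho ^+ (j - i) * F n + F n ^+ 2).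
have Fn0 : 0 <= F n := survival_ge0 _.
have dB d : (j - i <= d + h)%N -> K * (rho ^+ d * F n + F n ^+ 2) <= B.
  move=> jid; rewrite /B -mulrA ler_wpM2l// mulrDr lerD//.
    rewrite mulrA ler_wpM2r// mulrC ler_pdivlMr// -exprD.
    by apply: ler_wiXn2l => //; exact: ltW.
  rewrite ler_peMl ?sqr_ge0// invf_ge1//; apply: exprn_ile1; exact: ltW.
apply: (@le_trans _ _ (\sum_(k < h.+1) \sum_(l < h.+1) B)).
  apply: ler_sum => k _; rewrite EE_sum; last by move=> l; exact: ikl.
  apply: ler_sum => l _.
  have kh : (k <= h)%N by rewrite -ltnS.
  have lh : (l <= h)%N by rewrite -ltnS.
  rewrite -!PoszD; have [ab|ba] := leqP (i.+1 + k)%N (j.+1 + l)%N.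
    have -> : Posz (j.+1 + l) = Posz (i.+1 + k) + Posz (j.+1 + l - (i.+1 + k)).
      by rewrite -PoszD subnKC.
    apply: le_trans (KPn _ _) (dB _ _).
    by clear -ab kh ij; lia.
  under eq_Rintegral do rewrite mulrC.
  have -> : Posz (i.+1 + k) = Posz (j.+1 + l) + Posz (i.+1 + k - (j.+1 + l)).
    by rewrite -PoszD subnKC// ltnW.
  apply: le_trans (KPn _ _) (dB _ _).
  by clear -ba kh ij; lia.
rewrite !sumr_const card_ord /B -[leLHS]mulr_natl -[X in _ * X <= _]mulr_natl.
by rewrite /cst !mulrA.
Unshelve. all: by end_near. Qed.

End blocks.

(** * The central limit theorem for one test function *)

Section rates.
Context {R : realType}.

(** A window that grows like the logarithm makes the geometric mixing error
    smaller than any fixed power of [n], while the number of exceedances inside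
    the window still tends to 0. *)
Definition log_window (K n : nat) : nat := (K * (trunc_log 2 n).+1)%N.

Lemma log_window_exp (rho : R) : 0 < rho < 1 -> exists K, (0 < K)%N /\
  forall n, (0 < n)%N -> rho ^+ log_window K n <= (n%:R ^+ 10)^-1.
Proof.
move=> /andP[r0 r1].
have [K KP] : exists K, rho ^+ K.+1 <= (2 ^+ 10)^-1.
  have := @cvg_expr R rho; rewrite ger0_norm ?(ltW r0)// => /(_ r1).
  move=> /cvgrPdist_le/(_ (2 ^+ 10)^-1); case; first by rewrite invr_gt0 exprn_gt0.
  move=> K _ /(_ K.+1); rewrite /= sub0r normrN ger0_norm ?exprn_ge0 ?(ltW r0)//.
  by move=> /(_ (leqnSn K)) h; exists K.
exists K.+1; split => // n n0.
rewrite /log_window exprM.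
apply: (@le_trans _ _ ((2 ^+ 10)^-1 ^+ (trunc_log 2 n).+1)).
  by rewrite lerXn2r ?nnegrE ?exprn_ge0 ?invr_ge0 ?(ltW r0)// exprn_ge0.
rewrite exprVn lef_pV2 ?posrE ?exprn_gt0 ?ltr0n// -exprM mulnC exprM.
rewrite lerXn2r ?nnegrE ?exprn_ge0// -natrX ler_nat ltnW//.
exact: trunc_log_ltn.
Qed.

Lemma log_window_gt K L : (0 < K)%N -> \forall n \near \oo, (L <= log_window K n)%N.
Proof.
move=> K0; near=> n; apply: (@leq_trans (trunc_log 2 n).+1); last exact: leq_pmull.
apply: leqW; rewrite trunc_log_max//.
by near: n; exact: nbhs_infty_ge.
Unshelve. all: by end_near. Qed.

Lemma log_window_le K n : (0 < n)%N -> ((log_window K n).+1 <= K.+1 * n.*2)%N.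
Proof.
move=> n0; rewrite /log_window -[X in (X < _)%N]addn0.
have h : ((trunc_log 2 n).+1 <= n.*2)%N.
  have : (trunc_log 2 n <= n)%N.
    apply: leq_trans (trunc_logP (isT : (1 < 2)%N) n0).
    by apply: ltnW; exact: ltn_expl.
  by move: (trunc_log 2 n) => t tn; rewrite -addnn -addn1 leq_add.
rewrite addn0 mulSn -addn1 addnC; apply: leq_add; last by rewrite leq_mul2l h orbT.
by rewrite double_gt0.
Qed.

(** The logarithm is at most its power [1 + eta], up to a constant. *)
Lemma log_window_survival (K : nat) (eta : R) (F : nat -> R) : 0 < eta -> (forall n, 0 <= F n) ->
  ln n%:R `^ (1 + eta) * F n @[n --> \oo] --> (0 : R) ->
  (log_window K n)%:R * F n @[n --> \oo] --> (0 : R).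
Proof.
move=> eta0 F0 logF.
have ln2 : 0 < ln 2 :> R by rewrite ln_gt0// ltr1n.
pose c : R := K%:R * ((ln 2)^-1 + 1).
have up : c * (ln n%:R `^ (1 + eta) * F n) @[n --> \oo] --> (0 : R).
  by rewrite -(mulr0 c); apply: cvgM => //; exact: cvg_cst.
apply: (@squeeze_cvgr _ _ _ _ (fun=> 0) (fun n => c * (ln n%:R `^ (1 + eta) * F n))) => //; last exact: cvg_cst.
near=> n; apply/andP; split; first exact: mulr_ge0.
rewrite mulrA ler_wpM2r// /log_window natrM -mulrA ler_wpM2l//.
have n0 : (0 < n)%N by near: n; exact: nbhs_infty_gt.
have ln1 : 1 <= ln n%:R :> R.
  rewrite -[leLHS](@expRK R 1) ler_ln ?posrE ?expR_gt0 ?ltr0n//.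
  by near: n; exact: nbhs_infty_ger.
have lle : ln n%:R <= ln n%:R `^ (1 + eta) :> R.
  by rewrite -[leLHS]powRr1 ?(le_trans ler01)// ler_powR// lerDl ltW.
have tl : (trunc_log 2 n)%:R <= (ln 2)^-1 * ln n%:R :> R.
  rewrite mulrC ler_pdivlMr//.
  have -> : (trunc_log 2 n)%:R * ln 2 = ln (2 ^+ trunc_log 2 n) :> R.
    by rewrite lnXn// mulr_natl.
  by rewrite ler_ln ?posrE ?exprn_gt0 ?ltr0n// -natrX ler_nat trunc_logP.
have -> : (trunc_log 2 n).+1%:R = (trunc_log 2 n)%:R + 1 :> R by rewrite natr1.
apply: (@le_trans _ _ (((ln 2)^-1 + 1) * ln n%:R)); first by rewrite mulrDl mul1r lerD.
by rewrite ler_wpM2l// addr_ge0// invr_ge0 ltW.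
Unshelve. all: by end_near. Qed.

Lemma log_window_error (K h : nat) (rho Ke : R) : 0 < rho < 1 -> 0 <= Ke -> (0 < K)%N ->
  (forall n, (0 < n)%N -> rho ^+ log_window K n <= (n%:R ^+ 10)^-1) ->
  n%:R ^+ 2 * (log_window K n).+1%:R *
    (Ke * (log_window K n + h).+1%:R * rho ^+ (log_window K n - h)) @[n --> \oo] --> (0 : R).
Proof.
move=> /andP[r0 r1] Ke0 K0 KP.
have rh : 0 < rho ^+ h by rewrite exprn_gt0.
pose c : R := Ke * h.+1%:R * (rho ^+ h)^-1 * (K.+1%:R * 2) ^+ 2.
have c0 : 0 <= c by rewrite !mulr_ge0// ?invr_ge0 ?exprn_ge0// ltW.
have up : c * 2 * harmonic n @[n --> \oo] --> (0 : R).
  by rewrite -(mulr0 (c * 2)); apply: cvgM; [exact: cvg_cst|exact: cvg_harmonic].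
apply: (@squeeze_cvgr _ _ _ _ (fun=> 0) (fun n => c * 2 * harmonic n)) => //; last exact: cvg_cst.
near=> n.
have n0 : (0 < n)%N by near: n; exact: nbhs_infty_gt.
set r := log_window K n.
apply/andP; split.
  by rewrite !mulr_ge0// exprn_ge0// ltW.
have rr : rho ^+ (r - h) <= (rho ^+ h)^-1 * rho ^+ r.
  rewrite mulrC ler_pdivlMr// -exprD; apply: ler_wiXn2l; rewrite ?(ltW r0) ?(ltW r1)//.
  by rewrite addnC -leq_subLR.
have rK : r.+1%:R <= (K.+1%:R * 2) * n%:R :> R.
  have := log_window_le K n0; rewrite -(ler_nat R) natrM -muln2 natrM.
  by rewrite (mulrC n%:R) mulrA.
have rh1 : (r + h).+1%:R <= h.+1%:R * r.+1%:R :> R.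
  by rewrite -natrM ler_nat mulSn mulnS addnA -addSn leq_addr.
have n1 : 1 <= n%:R :> R by rewrite ler1n.
have nR : 0 < n%:R :> R by rewrite ltr0n.
apply: (@le_trans _ _ (n%:R ^+ 2 * (K.+1%:R * 2 * n%:R) *
   (Ke * (h.+1%:R * (K.+1%:R * 2 * n%:R)) * ((rho ^+ h)^-1 * (n%:R ^+ 10)^-1)))).
  apply: ler_pM; rewrite ?mulr_ge0 ?exprn_ge0 ?(ltW r0)//.
    by rewrite ler_wpM2l ?exprn_ge0.
  apply: ler_pM; rewrite ?mulr_ge0 ?exprn_ge0 ?(ltW r0)//.
    by rewrite ler_wpM2l//; apply: le_trans rh1 _; rewrite ler_wpM2l.
  by apply: le_trans rr _; rewrite ler_wpM2l ?KP// invr_ge0 ltW.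
have -> : n%:R ^+ 2 * (K.+1%:R * 2 * n%:R) *
   (Ke * (h.+1%:R * (K.+1%:R * 2 * n%:R)) * ((rho ^+ h)^-1 * (n%:R ^+ 10)^-1)) =
   c * (n%:R ^+ 6)^-1.
  rewrite /c; field; rewrite ?exprn_eq0 ?gt_eqF// ?exprn_gt0//.
rewrite -mulrA ler_wpM2l//.
apply: (@le_trans _ _ n%:R^-1).
  by rewrite lef_pV2 ?posrE ?exprn_gt0// exprS ler_peMr ?exprn_ege1// ltW.
rewrite /harmonic /= ler_pdivlMr ?ltr0n// mulrC ler_pdivrMr//.
have -> : n.+1%:R = n%:R + 1 :> R by rewrite natr1.
lra.
Unshelve. all: by end_near. Qed.

End rates.

Section block_clt.
Context {R : realType} {dO} {Omega : measurableType dO} {P : probability Omega R}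
  {dE} {E : measurableType dE} {Pi : R.-pker E ~> E} {Y : int -> {RV P >-> E}}
  {g : {mfun E >-> R}} {X : int -> {RV P >-> R}} {alpha : R}
  {nu : forall i, {measure set (borel_punctured R i) -> \bar R}}
  {V : {mfun E >-> R}} {q0 : R} {u : nat -> R}.
Hypothesis drift : drift_assumption Pi Y g X alpha nu V q0 u.
Hypothesis u0 : forall n, 0 < u n.
Hypothesis ndu : nondecreasing_seq u.
Hypothesis aoo : n%:R * survival X (u n) @[n --> \oo] --> +oo.

Local Notation F n := (survival X (u n)).

Variable eta : R.
Hypothesis eta0 : 0 < eta.
Hypothesis logF : ln n%:R `^ (1 + eta) * F n @[n --> \oo] --> (0 : R).

Variables (h : nat) (phi : 'rV[R]_h.+1 -> R) (C0 s delta : R).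
Hypothesis mphi : measurable_fun setT (phi : borel_rV R h.+1 -> R).
Hypothesis C00 : 0 < C0.
Hypothesis s0 : 0 < s.
Hypothesis delta0 : 0 < delta.
Hypothesis growth : forall x,
  [/\ `|phi x| `^ (2 + delta) <= C0 * tail_power_sum q0 s x,
   phi x ^+ 2 <= C0 * tail_power_sum q0 s x & `|phi x| <= C0 * tail_power_sum q0 s x].

Let growth' x : phi x ^+ 2 <= C0 * tail_power_sum q0 s x /\ `|phi x| <= C0 * tail_power_sum q0 s x.
Proof. by have [] := growth x. Qed.

Local Notation xi n := (block_phi (P := P) (X := X) (u := u) phi n).
Local Notation pphi n := (path_phi (g := g) (u := u) phi n).
Local Notation mean n := (\int[P]_w pphi n (path_from Y 0 h w)).
Local Notation Z n := (normalized (xi n) (mean n) (Num.sqrt (n%:R * F n))).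

Let mV : measurable_fun setT V := measurable_funP V.
Let W y := Num.sqrt (V y).
Let W1 : forall y, 1 <= W y := sqrt_V_ge1 (drift_V_ge1 drift).

Lemma survival_cvg0 : F n @[n --> \oo] --> (0 : R).
Proof.
have h1 := log_window_survival 1 eta0 (fun n => survival_ge0 (X := X) (u n)) logF.
apply: (@squeeze_cvgr _ _ _ _ (fun=> 0) (fun n => (log_window 1 n)%:R * F n)) => //; last exact: cvg_cst.
apply: nearW => n; rewrite survival_ge0 /= ler_peMl ?survival_ge0//.
by rewrite ler1n /log_window mul1n.
Qed.

Lemma measurable_past_block_phi n j (k : int) : (j.+1)%:Z + h%:Z <= k ->
  measurable_fun setT (xi n j : past Y k -> R).
Proof.
move=> jk; apply: (measurable_fun_past_le jk).
rewrite (_ : xi n j = pphi n \o path_from Y (j.+1)%:Z h); last first.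
  by apply/funext => w; rewrite (block_phiE drift).
have mp : measurable_fun setT (path_from Y (j.+1)%:Z h : past Y ((j.+1)%:Z + h%:Z) -> _).
  exact: measurable_past_path.
have mpp : measurable_fun setT (pphi n) by exact: measurable_path_phi.
by have := measurableT_comp mpp mp; exact.
Qed.

Lemma measurable_past_psum n c (k : nat) :
  measurable_fun setT ((fun w => cos (psum (Z n) k w + c)) : past Y (k + h)%:Z -> R).
Proof.
apply: (measurable_cosD (T := past Y (k + h)%:Z)); rewrite /psum.
under eq_fun do rewrite big_mkord.
apply: measurable_sum => -[i ik]; apply: measurable_funM; first exact: measurable_cst.
apply: measurable_funB; last exact: measurable_cst.
by apply: measurable_past_block_phi; rewrite -PoszD lez_nat leq_add2r.
Qed.

Lemma path_weight_ge1 n p w : 1 <= path_weight W (path_from Y n p w).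
Proof.
rewrite /path_weight (bigD1 ord0)//=; apply: le_trans (W1 (tnth (path_from Y n p w) ord0)) _.
by rewrite lerDl sumr_ge0// => i _; exact: le_trans (W1 _).
Qed.

(** A product of two blocks is mixing as one function of a path when the blocks
    are close, and by three applications of the mixing of single blocks when
    they are more than [r n] apart. *)
Lemma block_bounds_near : exists C rho K Ke rho' : R, [/\ 0 <= C, 0 < rho < 1, 0 <= Ke, 0 < rho' < 1 &
  forall r : nat -> nat, (\forall n \near \oo, (h <= r n)%N) ->
  \forall n \near \oo, block_bounds P (xi n) n (r n) (F n) C rho
    (Ke * (r n + h).+1%:R * rho' ^+ (r n - h)) (mean n)].
Proof.
have [Kn Kn0 KnP] := EE_abs_block_phi drift u0 ndu aoo mphi C00 s0 growth'.
have [Kp [rho [Kp0 rho01 KpP]]] := EE_block_phi_prod drift u0 ndu aoo mphi C00 s0 growth'.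
have [K1 [r1 [K10 r101 mix1]]] := single_mixing drift u0 ndu mphi C00 growth'.
have [K2 [r2 [K20 r201 mix2]]] := pair_mixing drift u0 ndu mphi C00 growth'.
have [cp cp0 cpP] := path_phi_weights drift u0 ndu C00 growth'.
have [r10 r11] := andP r101; have [r20 r21] := andP r201.
pose rho' := Num.max r1 r2.
have rho'01 : 0 < rho' < 1 by rewrite lt_max r10 gt_max r11.
have [p0 p1] := andP rho'01.
have r1p : r1 <= rho' by rewrite le_max lexx.
have r2p : r2 <= rho' by rewrite le_max lexx orbT.
pose Ke := K2 + (1 + 2 * cp) * K1 + K1.
have Ke0 : 0 <= Ke by rewrite /Ke !addr_ge0// mulr_ge0// addr_ge0// mulr_ge0.
exists (Kn + Kp), rho, 0, Ke, rho'; split => //; first exact: addr_ge0.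
move=> r hr; near=> n.
have Fn0 : 0 < F n by near: n; exact: (survival_gt0_near aoo).
have hrn : (h <= r n)%N by near: n.
have n0 : (0 < n)%N by near: n; exact: nbhs_infty_gt.
have CF : (Kn + Kp) * F n <= 1.
  near: n; have : (Kn + Kp) * F n @[n --> \oo] --> (Kn + Kp) * 0.
    by apply: cvgM; [exact: cvg_cst|exact: survival_cvg0].
  by rewrite mulr0 => /cvgrPdist_le/(_ 1 ltr01); apply: filterS => n;
    rewrite sub0r normrN; exact: le_trans (ler_norm _).
have Kn1 : forall j, \int[P]_w `|xi n j w| <= Kn * F n by near: n.
have Kp1 : forall i j, (i <= j)%N -> \int[P]_w (`|xi n i w| * `|xi n j w|) <=
    Kp * (rho ^+ (j - i) * F n + F n ^+ 2) by near: n.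
have Em j : \int[P]_w xi n j w = mean n := EE_block_phi drift mphi n j.
have ixi j : intg P (xi n j) := intg_block_phi drift u0 ndu mphi C00 growth' n j.
have mxi j : measurable_fun setT (xi n j) := measurable_block_phi drift mphi n j.
have m1 : `|mean n| <= 1.
  rewrite -(Em 0%N); apply: le_trans (EE_norm (ixi 0%N)) _; apply: le_trans (Kn1 _) _.
  by apply: le_trans CF; rewrite ler_wpM2r ?(ltW Fn0)// lerDl.
set rr := (r n - h)%N.
set e := Ke * _ * _.
have rr0 : 0 <= rho' ^+ rr by rewrite exprn_ge0// ltW.
(* every gap occurring below is at least [r n - h] *)
have pow (x K : R) d : 0 < x <= rho' -> 0 <= K -> (rr <= d)%N -> K * x ^+ d <= K * rho' ^+ rr.
  move=> /andP[x0 xp] K_0 rd; rewrite ler_wpM2l//.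
  apply: (@le_trans _ _ (rho' ^+ d)); first by rewrite lerXn2r ?nnegrE ?(ltW x0) ?(ltW p0).
  by apply: ler_wiXn2l => //; exact: ltW.
have r1p' : 0 < r1 <= rho' by rewrite r10.
have r2p' : 0 < r2 <= rho' by rewrite r20.
have le_e K : 0 <= K <= Ke -> K * rho' ^+ rr <= e.
  move=> /andP[K_0 KK]; rewrite /e -mulrA; apply: ler_pM => //.
  by rewrite ler_peMl// ler1n.
have cos_le c k w : `|cos (psum (Z n) k w + c)| <= 1.
  by rewrite ler_norml cos_geN1 cos_le1.
have cosW c k w : `|cos (psum (Z n) k w + c)| <= 1 * path_weight W (path_from Y ((k + h)%:Z - h%:Z) h w).
  by rewrite mul1r; apply: le_trans (cos_le _ _ _) (path_weight_ge1 _ _ _).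
have mix_cos c k j : (k + r n <= j)%N ->
  `|\int[P]_w (xi n j w * cos (psum (Z n) k w + c)) - mean n * \int[P]_w cos (psum (Z n) k w + c)|
    <= K1 * rho' ^+ rr.
  move=> krj; pose d := (j.+1 - (k + h))%N.
  have kj : (k + h <= j.+1)%N by apply: leqW; apply: leq_trans krj; rewrite leq_add2l.
  have jd : (j.+1)%:Z = (k + h)%:Z + d%:Z by rewrite -PoszD subnKC.
  have mA := @measurable_past_psum n c k.
  have := mix1 n 1 (fun w => cos (psum (Z n) k w + c)) _ j d ler01 mA (cosW c k) jd.
  rewrite Em mul1r [_ * mean n]mulrC.
  under eq_Rintegral do rewrite mulrC.
  move=> /le_trans; apply; apply: pow => //.
  by rewrite /rr /d; clear -krj; lia.
have xiW i w : `|xi n i w| <= cp * path_weight W (path_from Y ((i.+1 + h)%:Z - h%:Z) h w).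
  by rewrite (block_phiE drift) PoszD addrK; case: (cpP n (path_from Y (i.+1)%:Z h w)).
have mpast i : measurable_fun setT (xi n i : past Y (i.+1 + h)%:Z -> R).
  by apply: measurable_past_block_phi; rewrite PoszD.
have mix_xi i j : (i + r n <= j)%N ->
    `|\int[P]_w (xi n i w * xi n j w) - mean n ^+ 2| <= cp * K1 * rho' ^+ rr.
  move=> irj; pose d := (j.+1 - (i.+1 + h))%N.
  have ij : (i.+1 + h <= j.+1)%N by rewrite addSn ltnS; apply: leq_trans irj; rewrite leq_add2l.
  have jd : (j.+1)%:Z = (i.+1 + h)%:Z + d%:Z by rewrite -PoszD subnKC.
  have := mix1 n cp _ _ j d cp0 (mpast i) (xiW i) jd.
  rewrite !Em -expr2 => /le_trans; apply; apply: pow => //; first exact: mulr_ge0.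
  by rewrite /rr /d; clear -irj; lia.
split => //.
- by move=> j; exact: (intg_block_phi_sqr drift u0 ndu mphi C00 growth').
- by rewrite Fn0 survival_le1.
- by near: n; move/cvgryPge : aoo; exact.
- by move=> j; apply: le_trans (Kn1 j) _; rewrite ler_wpM2r ?(ltW Fn0)// lerDl.
- move=> i j ij; apply: le_trans (Kp1 i j ij) _; rewrite ler_wpM2r ?lerDr//.
  by rewrite addr_ge0 ?sqr_ge0// mulr_ge0 ?(ltW Fn0)// exprn_ge0// ltW//; case/andP: rho01.
- move=> c k j krj; apply: le_trans (mix_cos c k j krj) _; apply: le_e.
  by rewrite K10 /= /Ke lerDr addr_ge0// mulr_ge0// addr_ge0// mulr_ge0.
- move=> c k i j /andP[kri ij].
  set Ck := fun w => cos (psum (Z n) k w + c).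
  have mCk : measurable_fun setT Ck := measurable_fun_past_sub (@measurable_past_psum n c k).
  have [ijr|rij] := leqP (j - i) (r n).
    pose d := (i.+1 - (k + h))%N.
    have ki : (k + h <= i.+1)%N by apply: leqW; apply: leq_trans kri; rewrite leq_add2l.
    have jd : (i.+1)%:Z = (k + h)%:Z + d%:Z by rewrite -PoszD subnKC.
    have := mix2 n Ck _ i (j - i)%N d (@measurable_past_psum n c k) (cos_le c k) jd.
    rewrite subnKC// [X in _ - X]mulrC -/Ck.
    under eq_Rintegral do rewrite mulrC.
    move=> /le_trans; apply; rewrite /e.
    apply: (@le_trans _ _ (K2 * (j - i + h).+1%:R * rho' ^+ rr)).
      apply: pow => //; first exact: mulr_ge0.
      by rewrite /rr /d; clear -kri; lia.
    rewrite ler_wpM2r//; apply: ler_pM => //.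
      by rewrite /Ke -addrA lerDl addr_ge0// mulr_ge0// addr_ge0// mulr_ge0.
    by rewrite ler_nat ltnS leq_add2r.
  have irj : (i + r n <= j)%N by clear -rij; lia.
  pose d := (j.+1 - (i.+1 + h))%N.
  have ij' : (i.+1 + h <= j.+1)%N by rewrite addSn ltnS; apply: leq_trans irj; rewrite leq_add2l.
  have jd : (j.+1)%:Z = (i.+1 + h)%:Z + d%:Z by rewrite -PoszD subnKC.
  have mA : measurable_fun setT ((fun w => xi n i w * Ck w) : past Y (i.+1 + h)%:Z -> R).
    apply: measurable_funM => //; apply: measurable_fun_past_le (@measurable_past_psum n c k).
    by rewrite lez_nat leq_add2r; apply: leqW; apply: leq_trans kri; exact: leq_addr.
  have Ab w : `|xi n i w * Ck w| <= cp * path_weight W (path_from Y ((i.+1 + h)%:Z - h%:Z) h w).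
    by rewrite normrM; apply: le_trans (xiW i w); rewrite ler_piMr// cos_le.
  have h1 : `|\int[P]_w (xi n i w * xi n j w * Ck w) -
      mean n * \int[P]_w (xi n i w * Ck w)| <= cp * K1 * rho' ^+ rr.
    have := mix1 n cp _ _ j d cp0 mA Ab jd; rewrite Em [_ * mean n]mulrC.
    under eq_Rintegral do rewrite mulrAC.
    move=> /le_trans; apply; apply: pow => //; first exact: mulr_ge0.
    by rewrite /rr /d; clear -irj; lia.
  have h2 := mix_cos c k i kri; have h3 := mix_xi i j irj.
  have C1 : `|\int[P]_w Ck w| <= 1.
    by apply: EE_norm_bounded => [|w]; [exact: mCk|exact: cos_le].
  rewrite (_ : _ - _ = (\int[P]_w (xi n i w * xi n j w * Ck w) -
      mean n * \int[P]_w (xi n i w * Ck w)) +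
    mean n * (\int[P]_w (xi n i w * Ck w) - mean n * \int[P]_w Ck w) -
    \int[P]_w Ck w * (\int[P]_w (xi n i w * xi n j w) - mean n ^+ 2)); last by ring.
  apply: le_trans (ler_normB _ _) _; apply: le_trans (lerD (ler_normD _ _) (lexx _)) _.
  rewrite !normrM.
  have h2' := ler_pM (normr_ge0 _) (normr_ge0 _) m1 h2.
  have h3' := ler_pM (normr_ge0 _) (normr_ge0 _) C1 h3.
  apply: le_trans (lerD (lerD h1 h2') h3') _; rewrite !mul1r.
  have -> : cp * K1 * rho' ^+ rr + K1 * rho' ^+ rr + cp * K1 * rho' ^+ rr =
    ((1 + 2 * cp) * K1) * rho' ^+ rr by ring.
  apply: le_e; rewrite mulr_ge0 ?addr_ge0 ?mulr_ge0//= /Ke -addrA addrCA lerDl.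
  exact: addr_ge0.
- move=> i j irj; apply: le_trans (mix_xi i j irj) _; apply: le_e.
  rewrite mulr_ge0//= /Ke -addrA addrCA; apply: (@le_trans _ _ ((1 + 2 * cp) * K1)).
    by rewrite ler_wpM2r//; lra.
  by rewrite lerDl addr_ge0.
Unshelve. all: by end_near. Qed.

(** Truncating at a high level: this is where the moment of order
    [2 + delta] enters. *)
Lemma block_phi_uniform_integrability kappa : 0 < kappa -> exists2 K, 0 <= K &
  \forall n \near \oo, forall j,
  \int[P]_w (xi n j w ^+ 2 * (if K < `|xi n j w| then 1 else 0)) <= kappa * F n.
Proof.
move=> kappa0.
have [Ke Ke0 KeP] := EE_excess drift u0 ndu aoo s0.
pose B := C0 * (h.+1%:R * Ke); have B0 : 0 <= B by rewrite !mulr_ge0// ltW.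
pose K := (1 + B / kappa) `^ delta^-1.
have K1 : 1 <= 1 + B / kappa by rewrite lerDl divr_ge0// ltW.
have K0 : 0 < K by rewrite powR_gt0// (lt_le_trans ltr01).
have Kd : K `^ delta = 1 + B / kappa.
  by rewrite /K -powRrM mulVf ?gt_eqF// powRr1// (le_trans ler01).
clearbody K; exists K; first exact: ltW.
near=> n => j.
have Kn : \int[P]_w excess (g := g) (q0 := q0) (u := u) s n (Y 0 w) <= Ke * F n by near: n.
have iex k : intg P (fun w => excess (g := g) (q0 := q0) (u := u) s n (tnth (path_from Y (j.+1)%:Z h w) k)).
  have := intg_excess drift u0 ndu s n ((j.+1)%:Z + (k : nat)%:Z).
  by congr intg; apply/funext => w; rewrite tnth_mktuple.
have iE : intg P (fun w => path_excess (g := g) (q0 := q0) (u := u) s n (path_from Y (j.+1)%:Z h w)).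
  exact: intg_sum.
have pw w : xi n j w ^+ 2 * (if K < `|xi n j w| then 1 else 0) <=
    (K `^ delta)^-1 * C0 * path_excess (g := g) (q0 := q0) (u := u) s n (path_from Y (j.+1)%:Z h w).
  have ex0 : 0 <= path_excess (g := g) (q0 := q0) (u := u) s n (path_from Y (j.+1)%:Z h w).
    by apply: sumr_ge0 => k _; exact: excess_ge0.
  case: ifPn => Kx; last first.
    by rewrite mulr0 !mulr_ge0 ?invr_ge0 ?powR_ge0// ltW.
  rewrite mulr1 -mulrA mulrC ler_pdivlMr ?powR_gt0//.
  have [gr _ _] := growth ((u n)^-1 *: block X h (j.+1)%:Z w).
  apply: le_trans (_ : _ <= `|xi n j w| `^ (2 + delta)) _.
    have x0 : `|xi n j w| != 0 by rewrite gt_eqF// (lt_trans K0).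
    rewrite powRD ?x0 ?implybT// powR_mulrn// real_normK ?num_real// ler_wpM2l ?sqr_ge0//.
    by rewrite ge0_ler_powR ?nnegrE ?(ltW delta0) ?(ltW K0)// ltW.
  apply: le_trans gr _; rewrite ler_wpM2l ?(ltW C00)// path_excessE.
  have -> // : block X h (j.+1)%:Z w = \row_k g (tnth (path_from Y (j.+1)%:Z h w) k).
  by apply/rowP => k; rewrite !mxE tnth_mktuple (drift_observable drift).
apply: le_trans (EE_le0 _ (intgZ _ iE) _ pw) _.
- apply: measurable_funM.
    by apply: measurable_funX; exact: (measurable_block_phi drift mphi).
  apply: measurable_fun_ifT; [|exact: measurable_cst|exact: measurable_cst].
  apply: measurable_fun_ltr; first exact: measurable_cst.
  by apply: measurableT_comp => //; exact: (measurable_block_phi drift mphi).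
- by move=> w; case: ifP => _; rewrite ?mulr1 ?mulr0 ?sqr_ge0.
rewrite EE_Z// EE_sum//.
apply: (@le_trans _ _ ((K `^ delta)^-1 * C0 * (\sum_(k < h.+1) (Ke * F n)))).
  rewrite ler_wpM2l ?mulr_ge0 ?invr_ge0 ?powR_ge0 ?(ltW C00)//.
  apply: ler_sum => k _; under eq_Rintegral do rewrite tnth_mktuple.
  by rewrite (EE_stationary (drift_stationary drift))//; exact: measurable_excess.
rewrite sumr_const card_ord -[X in _ * X <= _]mulr_natl.
have -> : (K `^ delta)^-1 * C0 * (h.+1%:R * (Ke * F n)) = (K `^ delta)^-1 * B * F n.
  by rewrite /B; ring.
rewrite ler_wpM2r ?survival_ge0// Kd mulrC ler_pdivrMr ?(lt_le_trans ltr01)//.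
rewrite mulrDr mulr1 mulrCA divff ?gt_eqF// mulr1 lerDr ltW//.
Unshelve. all: by end_near. Qed.

(** The array theorem with a logarithmic window. *)
Theorem block_clt (c : nat -> R) :
  (forall d, \int[P]_w pair_phi (g := g) (u := u) phi n (path_from Y 0 (d + h) w) / F n
     @[n --> \oo] --> c d) ->
  [/\ exists M, \forall n \near \oo, \int[P]_w (psum (Z n) n w ^+ 2) <= M,
      cvgn (fun n => \sum_(1 <= j < n) c j) &
      forall x, \int[P]_w cos (psum (Z n) n w + x) @[n --> \oo] -->
        expR (- (2^-1 * c 0%N + \big[+%R/0]_(1 <= j <oo) c j)) * cos x].
Proof.
move=> gc.
have [C [rho [_ [Ke [rho' [C_0 rho01 Ke0 rho'01 bb]]]]]] := block_bounds_near.
have [K [K0 KP]] := log_window_exp rho'01.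
pose r := log_window K.
have hr : \forall n \near \oo, (h <= r n)%N by exact: log_window_gt.
have ne := log_window_error h rho'01 Ke0 K0 KP.
have rF := log_window_survival K eta0 (fun n => survival_ge0 (X := X) (u n)) logF.
have rho01' : 0 <= rho < 1 by case/andP: rho01 => r0 ->; rewrite ltW.
have st : \forall n \near \oo, forall i dd,
    \int[P]_w (xi n i w * xi n (i + dd)%N w) = \int[P]_w pair_phi (g := g) (u := u) phi n (path_from Y 0 (dd + h) w).
  by apply: nearW => n i dd; exact: (EE_block_phi_pair drift mphi).
have F0 := survival_cvg0.
have bbn := bb r hr.
split; first exact: (EE_psum_sqr_bounded C_0 rho01' F0 rF ne bbn).
  exact: (limit_covariance_summable C_0 rho01' F0 bbn st gc).
move=> x; apply: (sequential_clt C_0 rho01' F0 aoo rF (fun L => log_window_gt L K0) ne bbn) st gc x.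
exact: block_phi_uniform_integrability.
Qed.

End block_clt.

(** * Topology and measurability of the punctured space *)

Section null_levels.
Context {R : realType} {d} {T : measurableType d} (mu : {measure set T -> \bar R}).

(** A function has at most countably many levels of positive measure, so every
    nonempty open interval contains a null level. *)
Lemma null_level (S : set T) (f : T -> R) (a b : R) : measurable S -> (mu S < +oo)%E ->
  measurable_fun setT f -> a < b ->
  exists2 t, a < t < b & mu (S `&` f @^-1` [set t]) = 0%E.
Proof.
move=> mS S_fin mf ab; apply: contrapT => nex.
pose L t := S `&` f @^-1` [set t].
have mL t : measurable (L t).
  by apply: measurableI => //; rewrite -[X in measurable X]setTI; exact: mf.
have pos t : a < t < b -> (0 < mu (L t))%E.
  by move=> tab; rewrite lt0e measure_ge0 andbT; apply/eqP => h; apply: nex; exists t.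
pose B N := [set t | a < t < b /\ (N.+1%:R^-1%:E <= mu (L t))%E].
have Bfin N : finite_set (B N).
  apply: contrapT => /infiniteP/pcard_leP[f'].
  have fB j : B N (f' j) by exact: funS.
  have finj : injective f' by move=> x y; apply: (@inj _ _ setT f'); rewrite inE.
  have triv : trivIset [set: nat] (fun j => L (f' j)).
    move=> i j _ _ [x [[_ fi] [_ fj]]]; apply: finj; by rewrite -fi -fj.
  have Sr : mu S = (fine (mu S))%:E by rewrite fineK// ge0_fin_numE.
  set M := (N.+1 * (Num.truncn (fine (mu S))).+1)%N.
  have : (mu (\big[setU/set0]_(i < M) L (f' i)) <= mu S)%E.
    apply: le_measure; rewrite ?inE//; first by apply: bigsetU_measurable => i _; exact: mL.
    by elim/big_ind: _ => // [A A' hA hA'|i _]; [rewrite subUset|exact: subIsetl].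
  rewrite (@measure_bigsetU _ _ _ mu (fun j => L (f' j)))//.
  have h : (\sum_(i < M) (N.+1%:R^-1)%:E <= \sum_(i < M) mu (L (f' i)))%E.
    by apply: lee_sum => i _; case: (fB i).
  move=> /(le_trans h); rewrite Sr sumEFin lee_fin sumr_const card_ord -[leLHS]mulr_natl /M natrM.
  rewrite mulrAC divff ?pnatr_eq0// mul1r leNgt.
  by rewrite truncnS_gt// fine_ge0.
have : countable `]a, b[%classic.
  apply: (@sub_countable _ _ _ (\bigcup_N B N)); last first.
    by apply: bigcup_countable => // N _; exact: finite_set_countable.
  apply: subset_card_le => t; rewrite /= in_itv /= => tab; have tpos := pos t tab.
  have [N NP] : exists N, (N.+1%:R^-1%:E <= mu (L t))%E.
    move: tpos; case: (mu (L t)) => [r|_|//]; last by exists 0%N; rewrite leey.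
    rewrite lte_fin => r0; exists (Num.truncn r^-1); rewrite lee_fin.
    rewrite -[leRHS]invrK lef_pV2 ?posrE ?invr_gt0// ltW//.
    by apply: truncnS_gt; rewrite invr_ge0 ltW.
  by exists N.
move/countable_lebesgue_measure0; rewrite lebesgue_measure_itv /= lte_fin ab.
by rewrite -EFinB => /eqP; rewrite eqe subr_eq0 gt_eqF.
Qed.

End null_levels.

Section punctured_topology.
Context {R : realType}.

(** [contract] identifies the extended reals with a compact interval. *)
Lemma compact_ereal : compact [set: \bar R].
Proof.
move=> F PF _.
have [|t [t1 tF]] := @segment_compact R (-1) 1 (@contract R @ F) _.
  have : F (@contract R @^-1` `[(-1 : R), 1]%classic); last by [].
  by apply: filterS filterT => x _; rewrite /= in_itv /= -ler_norml contract_le1.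
have tE : contract (expand t) = t.
  by apply: expandK; rewrite inE ler_norml; move: t1; rewrite /= in_itv.
exists (expand t); split => // A B FA /nbhs_ballP[e /= e0 eB].
have FA' : F (@contract R @^-1` (@contract R @` A)) by apply: filterS FA => x Ax; exists x.
have [_ [[y Ay <-] yt]] := tF (@contract R @` A) (ball t e) FA' (nbhsx_ballx t e e0).
exists y; split => //; apply: eB; rewrite /ball /= /ereal_ball tE; exact: yt.
Qed.

Variable i : nat.

Lemma coords_continuous : continuous (@coords R i).
Proof. by move=> x; exact: initial_continuous. Qed.

Lemma coord_punctured_continuous k : continuous (fun x : punctured R i => coords x ord0 k).
Proof.
move=> x A nA; apply: (@coords_continuous x [set v | A (v ord0 k)]).
exists (fun _ b => if b == k then A else setT); last first.
  by move=> v /(_ ord0 k); rewrite /= eqxx.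
by move=> a b; rewrite (ord1 a); case: eqP => [->//|_]; exact: filterT.
Qed.

Definition far (s : R) : set (punctured R i) := [set x | exists k, (s%:E <= `|coords x ord0 k|)%E].

Lemma coords_inj : injective (@coords R i).
Proof. by move=> [x hx] [y hy] /= xy; apply: val_inj. Qed.

Lemma punctured_lift (v : 'rV[\bar R]_i.+1) k : v ord0 k != 0%E ->
  exists x : punctured R i, coords x = v.
Proof.
move=> vk; have h : v \in [set x : 'rV[\bar R]_i.+1 | exists k, x 0 k != 0%E].
  by apply/mem_set; exists k.
by exists (exist _ v h).
Qed.

Lemma closed_far_coord s (k : 'I_i.+1) :
  closed [set v : 'rV[\bar R]_i.+1 | (s%:E <= `|v ord0 k|)%E].
Proof.
move=> v vcl /=; rewrite leNgt; apply/negP => vs.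
have E (z : \bar R) : ((`|z| < s%:E) = ((- s)%:E < z) && (z < s%:E))%E.
  case: z => [r| |]; last 2 first.
  - by rewrite /= !ltNge !leey andbF.
  - by rewrite /= !ltNge ?leey ?leNye.
  by rewrite /= !lte_fin ltr_norml.
have nb : nbhs (v ord0 k) [set z | (`|z| < s%:E)%E].
  have /andP[h1 h2] : ((- s)%:E < v ord0 k)%E && (v ord0 k < s%:E)%E by rewrite -E.
  have n1 : nbhs (v ord0 k) [set z | ((- s)%:E < z)%E].
    by apply: open_nbhs_nbhs; split => //; exact: open_ereal_gt_ereal.
  have n2 : nbhs (v ord0 k) [set z | (z < s%:E)%E].
    by apply: open_nbhs_nbhs; split => //; exact: open_ereal_lt_ereal.
  by apply: filterS2 n1 n2 => z z1 z2 /=; rewrite E; apply/andP.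
have nv : nbhs v [set w : 'rV[\bar R]_i.+1 | (`|w ord0 k| < s%:E)%E].
  exists (fun _ b => if b == k then [set z | (`|z| < s%:E)%E] else setT); last first.
    by move=> w /(_ ord0 k); rewrite /= eqxx.
  by move=> a b; rewrite (ord1 a); case: eqP => [->//|_]; exact: filterT.
by have [w [/= w1 w2]] := vcl _ nv; move: w1; rewrite leNgt w2.
Qed.

(** Sets that stay away from the origin are closed in a compact product of
    extended lines; this is why the exponent measure is finite on them. *)
Lemma compact_far s : 0 < s -> compact (far s).
Proof.
move=> s0 F PF Ffar.
pose K := [set v : 'rV[\bar R]_i.+1 | exists k, (s%:E <= `|v ord0 k|)%E].
have cK : compact K.
  apply: subclosed_compact (rV_compact (fun _ : 'I_i.+1 => compact_ereal)) _ => //.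
  have -> : K = \bigcup_(k in [set: 'I_i.+1]) [set v | (s%:E <= `|v ord0 k|)%E].
    by apply/seteqP; split => v [k]; [exists k|move=> _ h; exists k].
  by apply: closed_bigcup => [|k _]; [exact: finite_finset|exact: closed_far_coord].
have [|v [[k vk] vF]] := cK (@coords R i @ F) _.
  have : F (@coords R i @^-1` K); last by [].
  by apply: filterS Ffar => x [k xk]; exists k.
have vk0 : v ord0 k != 0%E.
  by apply/eqP => v0; move: vk; rewrite v0 abse0 lee_fin leNgt s0.
have [x xv] := punctured_lift vk0.
exists x; split; first by exists k; rewrite xv.
move=> A B FA; rewrite nbhsE => -[U [oU Ux] UB].
have [W oW WU] : exists2 W : set 'rV[\bar R]_i.+1, open W & @coords R i @^-1` W = U.
  by case: oU => W oW WU; exists W.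
have FA' : F (@coords R i @^-1` (@coords R i @` A)) by apply: filterS FA => y Ay; exists y.
have nW : nbhs v W.
  by apply: open_nbhs_nbhs; split => //; rewrite -xv; have : U x by []; rewrite -WU.
have [_ [[y Ay <-] Wy]] := vF (@coords R i @` A) W FA' nW.
by exists y; split => //; apply: UB; rewrite -WU.
Qed.

Lemma closed_far s : closed (far s).
Proof.
have -> : far s = @coords R i @^-1` (\bigcup_(k in [set: 'I_i.+1]) [set v | (s%:E <= `|v ord0 k|)%E]).
  by apply/seteqP; split => v [k]; [exists k|move=> _ h; exists k].
apply: preimage_closed; first by move=> x _; exact: coords_continuous.
by apply: closed_bigcup => [|k _]; [exact: finite_finset|exact: closed_far_coord].
Qed.

Lemma nbhs_finite_coords (x : punctured R i) e : 0 < e -> finite_points x ->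
  nbhs x [set y | finite_points y /\ forall k, `|real_coords x 0 k - real_coords y 0 k| < e].
Proof.
move=> e0 fx.
have nk (k : 'I_i.+1) : nbhs x [set y | coords y ord0 k \is a fin_num /\
    `|real_coords x 0 k - real_coords y 0 k| < e].
  have nb : nbhs (coords x ord0 k) [set z | z \is a fin_num /\ `|real_coords x 0 k - fine z| < e].
    have -> : coords x ord0 k = (real_coords x 0 k)%:E by rewrite mxE fineK.
    by rewrite /nbhs /=; apply/nbhs_ballP; exists e => //= r re; split.
  have cnb : nbhs x ((fun y => coords y ord0 k) @^-1` [set z | z \is a fin_num /\
    `|real_coords x 0 k - fine z| < e]) := coord_punctured_continuous nb.
  apply: filterS cnb => y /= [fy ye]; split => //.
  by rewrite [X in _ - X]mxE.
have := filter_forall (nbhs_filter x) nk; apply: filterS => y h; split=> k; by case: (h k).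
Qed.

(** Around a finite point the punctured space looks like the real vectors. *)
Lemma nbhs_real_coords (x : punctured R i) (U : set 'rV[R]_i.+1) : finite_points x ->
  nbhs (real_coords x) U -> nbhs x [set y | finite_points y /\ U (real_coords y)].
Proof.
move=> fx /nbhs_rVP[e e0 eU]; have := nbhs_finite_coords e0 fx.
by apply: filterS => y [fy ye]; split => //; apply: eU.
Qed.

Lemma measurable_coord_punctured k :
  measurable_fun setT ((fun x => coords x ord0 k) : borel_punctured R i -> \bar R).
Proof.
apply: (@measurability _ _ (borel_punctured R i) _ setT _ (ErealGenOInfty.G (R := R))).
  exact: ErealGenOInfty.measurableE.
move=> _ [_ [x ->] <-]; rewrite setTI; apply: sub_sigma_algebra.
apply: open_comp => [y _|]; first exact: coord_punctured_continuous.
rewrite (_ : [set` _] = [set y | (x%:E < y)%E]); first exact: open_ereal_gt_ereal.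
by apply/seteqP; split => y; rewrite /= in_itv /= andbT.
Qed.

Lemma measurable_real_coords :
  measurable_fun setT (@real_coords R i : borel_punctured R i -> borel_rV R i.+1).
Proof.
apply: measurable_rV => k.
rewrite (_ : (fun _ => _) = fine \o (fun x => coords x ord0 k)); last first.
  by apply/funext => x; rewrite mxE.
by apply: measurableT_comp; [|exact: measurable_coord_punctured].
Qed.

Lemma measurable_finite_points : measurable (@finite_points R i : set (borel_punctured R i)).
Proof.
have -> : @finite_points R i = \bigcap_(k in [set: 'I_i.+1])
    [set x : borel_punctured R i | coords x ord0 k \is a fin_num].
  by apply/seteqP; split => x h k; [move=> _; exact: h|exact: h].
apply: fin_bigcap_measurable => // k _.
by rewrite -[X in measurable X]setTI; apply: emeasurable_fin_num => //; exact: measurable_coord_punctured.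
Qed.

End punctured_topology.

(** * Convergence of the probabilities of level sets *)

Section exponent_limit.
Context {R : realType} {dO} {Omega : measurableType dO} {P : probability Omega R}
  {X : int -> {RV P >-> R}} {alpha : R}
  {nu : forall i, {measure set (borel_punctured R i) -> \bar R}}.
Hypothesis rv : regularly_varying X alpha nu.
Variable u : nat -> R.
Hypothesis u0 : forall n, 0 < u n.
Hypothesis uoo : u n @[n --> \oo] --> +oo.
Variable i : nat.

Local Notation F n := (survival X (u n)).
Definition scaled_block n (w : Omega) : 'rV[R]_i.+1 := (u n)^-1 *: block X i 0 w.
Local Notation Z := scaled_block.

Lemma measurable_scaled_block n : measurable_fun setT (Z n : Omega -> borel_rV R i.+1).
Proof.
apply: measurable_rV => k.
rewrite (_ : (fun _ => _) = fun w => (u n)^-1 * X (0 + (k : nat)%:Z) w); last first.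
  by apply/funext => w; rewrite !mxE.
by apply: measurable_funM; [exact: measurable_cst|exact: measurable_funP].
Qed.

Variables (psi : 'rV[R]_i.+1 -> R) (s : R).
Hypothesis s0 : 0 < s.
Hypothesis mpsi : measurable_fun setT (psi : borel_rV R i.+1 -> R).
Hypothesis psi_far : forall x : 'rV[R]_i.+1, (forall k, `|x 0 k| < s) -> psi x = 0.
Hypothesis psi_cont : {ae nu i, forall x : punctured R i, finite_points x ->
  {for real_coords x, continuous psi}}.

Definition level_set (t : R) : set (borel_punctured R i) :=
  @finite_points R i `&` [set x | t < psi (real_coords x)].

Lemma measurable_psi_real_coords :
  measurable_fun setT ((fun x => psi (real_coords x)) : borel_punctured R i -> R).
Proof. by apply: (measurableT_comp mpsi); exact: measurable_real_coords. Qed.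

Lemma measurable_level_set t : measurable (level_set t).
Proof.
apply: measurableI; first exact: measurable_finite_points.
have := measurable_psi_real_coords measurableT (@measurable_itv R `]t, +oo[).
by rewrite setTI; congr measurable; apply/seteqP; split => x /=; rewrite in_itv /= andbT.
Qed.

Lemma level_set_far t : 0 <= t -> level_set t `<=` far (i := i) s.
Proof.
move=> t0 x [fx /= tx]; apply: contrapT => nfar.
move: tx; rewrite psi_far ?ltNge ?t0// => k; rewrite mxE.
rewrite ltNge; apply/negP => sk; apply: nfar; exists k.
rewrite -(fineK (fx k)); rewrite lee_fin; exact: sk.
Qed.

Lemma measurable_far : measurable (far (i := i) s : set (borel_punctured R i)).
Proof.
rewrite -[X in measurable X]setCK; apply: measurableC; apply: sub_sigma_algebra.
exact/closed_openC/closed_far.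
Qed.

Lemma far_lty : (nu i (far s) < +oo)%E.
Proof. by apply: (rv_radon rv); exact: compact_far. Qed.

Lemma level_set_lty t : 0 <= t -> (nu i (level_set t) < +oo)%E.
Proof.
move=> t0; apply: le_lt_trans far_lty.
by apply: le_measure; rewrite ?inE; [exact: measurable_level_set|exact: measurable_far|exact: level_set_far].
Qed.

(** At a finite point where [psi] is continuous, the boundary of the level set
    lies in the level [t]; other points are negligible. *)
Lemma level_set_boundary t : 0 <= t ->
  nu i (@finite_points R i `&` (fun x => psi (real_coords x)) @^-1` [set t]) = 0%E ->
  nu i (closure (level_set t : set (punctured R i)) `\`
    interior (level_set t : set (punctured R i))) = 0%E.
Proof.
move=> t0 null_t.
have mfin := @measurable_finite_points R i.
have mB : measurable (closure (level_set t : set (punctured R i)) `\`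
    interior (level_set t : set (punctured R i)) : set (borel_punctured R i)).
  apply: measurableD; last by apply: sub_sigma_algebra; exact: open_interior.
  rewrite -[X in measurable X]setCK; apply: measurableC; apply: sub_sigma_algebra.
  exact/closed_openC/closed_closure.
apply/negligibleP => //.
have n1 : (nu i).-negligible (~` @finite_points R i : set (borel_punctured R i)).
  by apply/negligibleP; [exact: measurableC|exact: (rv_infinity rv)].
have n2 : (nu i).-negligible (@finite_points R i `&` (fun x => psi (real_coords x)) @^-1` [set t] : set (borel_punctured R i)).
  apply/negligibleP => //; apply: measurableI => //.
  by have := measurable_psi_real_coords measurableT (measurable_set1 t); rewrite setTI.
have := negligibleU (negligibleU n1 n2) psi_cont.
apply: negligibleS => x [xcl xint].
have [fx|nfx] := pselect (finite_points x); last by left; left.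
have [xt|xt] := pselect (psi (real_coords x) = t); first by left; right.
right; move=> /(_ fx) cx.
have [tx|tx] := ltP t (psi (real_coords x)).
  apply: xint; rewrite /interior.
  have nt : nbhs (real_coords x) (psi @^-1` [set z | t < z]).
    by apply: cx; apply: open_nbhs_nbhs; split => //; exact: open_gt.
  by apply: filterS (nbhs_real_coords fx nt) => y [fy ty].
have {}tx : psi (real_coords x) < t by rewrite lt_neqAle tx andbT; exact/eqP.
have nt : nbhs (real_coords x) (psi @^-1` [set z | z < t]).
  by apply: cx; apply: open_nbhs_nbhs; split => //; exact: open_lt.
have [y [[_ /= y1] [_ /= y2]]] := xcl _ (nbhs_real_coords fx nt).
by move: y1; rewrite ltNge (ltW y2).
Qed.

Lemma level_set_event t n : 0 <= t ->
  [set w | exists2 y, dilation (u n) (level_set t) y & coords y = map_mx EFin (block X i 0 w)] =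
  [set w | t < psi (Z n w)].
Proof.
move=> t0; apply/seteqP; split => [w [y [a [fa ta] ya] yw]|w tw] /=.
  have -> : Z n w = real_coords a => //.
  apply/rowP => k; rewrite /scaled_block !mxE.
  have := ya k; rewrite yw !mxE -(fineK (fa k)) -EFinM => -[->].
  by rewrite mulKf// gt_eqF.
have [k Zk] : exists k, s <= `|Z n w 0 k|.
  apply: contrapT => nk; move: tw; rewrite /= psi_far ?ltNge ?t0// => k.
  by rewrite ltNge; apply/negP => h; apply: nk; exists k.
have Zk0 : Z n w 0 k != 0 by rewrite -normr_gt0 (lt_le_trans s0).
have [a aE] := @punctured_lift R i (map_mx EFin (Z n w)) k ltac:(by rewrite mxE eqe).
have bk0 : block X i 0 w 0 k != 0.
  by move: Zk0; rewrite /scaled_block mxE mulf_eq0 negb_or => /andP[].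
have [y yE] := @punctured_lift R i (map_mx EFin (block X i 0 w)) k ltac:(by rewrite mxE eqe).
have ra : real_coords a = Z n w by apply/rowP => l; rewrite /real_coords aE !mxE.
exists y => //; exists a.
  by split => [l|]; [rewrite aE mxE|rewrite /= ra].
move=> l; rewrite yE aE !mxE -EFinM mulrA divff ?mul1r// gt_eqF//.
Qed.

(** The event that [psi] exceeds [t] at the scaled block is a dilated level set,
    to which regular variation applies as its boundary is null. *)
Lemma level_set_limit t : 0 <= t ->
  nu i (@finite_points R i `&` (fun x => psi (real_coords x)) @^-1` [set t]) = 0%E ->
  fine (P [set w | t < psi (Z n w)]) / F n @[n --> \oo] --> fine (nu i (level_set t)).
Proof.
move=> t0 null_t.
have := @rv_limit _ _ _ _ _ _ _ rv i (level_set t) (measurable_level_set t) _ (level_set_boundary t0 null_t).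
move=> lim.
have prec : precompact (level_set t : set (punctured R i)).
  apply: precompact_subset (level_set_far t0) _.
  by rewrite precompact_closed; [exact: compact_far|exact: closed_far].
have {}lim := cvg_comp _ _ uoo (lim prec).
have nuE : nu i (level_set t) = (fine (nu i (level_set t)))%:E.
  by rewrite fineK// ge0_fin_numE// level_set_lty.
rewrite nuE in lim.
apply: cvg_trans (fine_cvg lim); apply: near_eq_cvg; apply: nearW => n /=.
by rewrite level_set_event.
Qed.

End exponent_limit.

(** * Convergence of expectations to integrals for the exponent measure *)

Section level_steps.
Context {R : realType}.

(** A layer cake with one level in each interval [(eta k, eta (k + 1))] is as
    good as the regular one, and leaves the freedom to choose null levels. *)
Lemma step_approx (eta : R) (t : nat -> R) m y : 0 < eta ->
  (forall k, eta * k%:R < t k < eta * k.+1%:R) -> 0 <= y <= eta * m%:R ->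
  `|y - \sum_(0 <= k < m) eta * (if t k < y then 1 else 0)| <= eta * (if 0 < y then 1 else 0).
Proof.
move=> eta0 tk /andP[y0 ym].
pose S m := \sum_(0 <= k < m) eta * (if t k < y then 1 else 0).
have tpos k : 0 < t k by have /andP[h _] := tk k; apply: le_lt_trans h; rewrite mulr_ge0// ltW.
have [y00|yn0] := eqVneq y 0.
  rewrite y00 ltxx mulr0 big1 ?subr0 ?normr0// => k _.
  by rewrite ltNge ltW ?mulr0// tpos.
have y1 : 0 < y by rewrite lt_neqAle eq_sym yn0.
rewrite y1 mulr1.
have full j : eta * j%:R <= y -> S j = eta * j%:R.
  move=> jy; rewrite /S (eq_big_nat _ _ (F2 := fun=> eta)); last first.
    move=> k /andP[_ kj]; have /andP[_ h] := tk k.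
    rewrite ifT ?mulr1//; apply: lt_le_trans h _; apply: le_trans jy.
    by rewrite ler_pM2l// ler_nat.
  by rewrite sumr_const_nat subn0 mulr_natr.
have gen j : `|Num.min y (eta * j%:R) - S j| <= eta.
  elim: j => [|j IH].
    by rewrite mulr0 (min_idPr y0) /S big_geq// subr0 normr0 ltW.
  have [jy|yj] := leP (eta * j%:R) y.
    have Sj : S j.+1 = eta * j%:R + eta * (if t j < y then 1 else 0).
      by rewrite {1}/S big_nat_recr//= -/(S j) full.
    have e1 : eta * j.+1%:R = eta * j%:R + eta.
      by have -> : j.+1%:R = j%:R + 1 :> R; [rewrite natr1|rewrite mulrDr mulr1].
    have h1 : eta * j%:R <= Num.min y (eta * j.+1%:R).
      by rewrite le_min jy e1 lerDl ltW.
    have h2 : Num.min y (eta * j.+1%:R) <= eta * j%:R + eta by rewrite -e1 ge_min lexx orbT.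
    rewrite Sj; move: (Num.min _ _) (eta * j%:R) h1 h2 => a e h1 h2.
    by case: ifP => _; rewrite ler_norml; apply/andP; split; lra.
  have e1 : Num.min y (eta * j.+1%:R) = y.
    by apply/min_idPl; apply: le_trans (ltW yj) _; rewrite ler_pM2l// ler_nat.
  have -> : S j.+1 = S j.
    rewrite /S big_nat_recr//= [t j < y]ltNge ltW ?mulr0 ?addr0//.
    by have /andP[h _] := tk j; exact: lt_trans h.
  by move: IH; rewrite e1 (min_idPl (ltW yj)).
by have := gen m; rewrite (min_idPl ym).
Qed.

Definition upper_level {T : Type} (D : set T) (f : T -> R) (t : R) : set T :=
  D `&` [set x | t < f x].

Context {d} {T : measurableType d} (mu : {measure set T -> \bar R}) (D : set T).
Hypothesis mD : measurable D.
Variable f : T -> R.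
Hypothesis mf : measurable_fun setT f.

Let ind t x : R := if t < f x then 1 else 0.

Let mlev t : measurable [set x | t < f x].
Proof.
have := mf measurableT (@measurable_itv R `]t, +oo[).
by rewrite setTI; congr measurable; apply/seteqP; split => x /=; rewrite in_itv /= andbT.
Qed.

Let indE t : (fun x => (ind t x)%:E) = (fun x => (\1_[set x | t < f x] x)%:E).
Proof.
apply/funext => x; rewrite /ind indicE; case: ifPn => h; first by rewrite mem_set.
by rewrite memNset//; exact/negP.
Qed.

Lemma integral_level t : (\int[mu]_(x in D) (ind t x)%:E = mu (upper_level D f t))%E.
Proof. by rewrite indE integral_indic// setIC. Qed.

Lemma integrable_level t : (mu (upper_level D f t) < +oo)%E ->
  mu.-integrable D (EFin \o ind t).
Proof.
move=> fin; apply/integrableP; split.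
  apply/measurable_EFinP; apply: measurable_funTS.
  apply: measurable_fun_ifT; [|exact: measurable_cst|exact: measurable_cst].
  by apply: measurable_fun_ltr => //; exact: measurable_cst.
rewrite (eq_integral (fun x => (ind t x)%:E)); first by rewrite integral_level.
by move=> x _ /=; rewrite ger0_norm// /ind; case: ifP.
Qed.

Lemma integrable_bounded_level K : (forall x, 0 <= f x <= K) ->
  (mu (upper_level D f 0%R) < +oo)%E -> mu.-integrable D (EFin \o f).
Proof.
move=> fK fin; have := integrableZl mD K (integrable_level fin).
apply: le_integrable => //; first by apply/measurable_EFinP; exact: measurable_funTS.
move=> x _ /=; have /andP[f0 fk] := fK x.
rewrite lee_fin ger0_norm// ger0_norm; last first.
  by apply: mulr_ge0; [exact: le_trans fk|rewrite /ind; case: ifP].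
rewrite /ind; case: ltP => h; first by rewrite mulr1.
by rewrite mulr0.
Qed.

Lemma step_integral (eta : R) (t : nat -> R) m : 0 < eta ->
  (forall k, eta * k%:R < t k < eta * k.+1%:R) -> (forall x, 0 <= f x <= eta * m%:R) ->
  (mu (upper_level D f 0%R) < +oo)%E ->
  `|\int[mu]_(x in D) f x - \sum_(0 <= k < m) eta * fine (mu (upper_level D f (t k)))| <=
  eta * fine (mu (upper_level D f 0%R)).
Proof.
move=> eta0 tk fm fin.
have tpos k : 0 < t k by have /andP[h _] := tk k; apply: le_lt_trans h; rewrite mulr_ge0// ltW.
have fint k : (mu (upper_level D f (t k)) < +oo)%E.
  apply: le_lt_trans fin; apply: le_measure; rewrite ?inE; try exact: measurableI.
  by move=> x [Dx /= tx]; split => //=; exact: lt_trans tx.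
have intf := integrable_bounded_level fm fin.
have RI t' : (mu (upper_level D f t') < +oo)%E ->
    \int[mu]_(x in D) (eta * ind t' x) = eta * fine (mu (upper_level D f t')).
  by move=> h; rewrite RintegralZl//; [rewrite /Rintegral integral_level|exact: integrable_level].
have [iS eS] : mu.-integrable D (EFin \o (fun x => \sum_(0 <= k < m) eta * ind (t k) x)) /\
   \int[mu]_(x in D) (\sum_(0 <= k < m) eta * ind (t k) x) =
   \sum_(0 <= k < m) eta * fine (mu (upper_level D f (t k))).
  clear fm; elim: m => [|m [IH1 IH2]].
    rewrite (_ : (fun x => \sum_(0 <= k < 0) _) = fun=> 0); last first.
      by apply/funext => x; rewrite big_geq.
    split; first exact: integrable0.
    by rewrite big_geq// /Rintegral integral0.
  have it := integrableZl mD eta (integrable_level (fint m)).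
  rewrite (_ : (fun x => \sum_(0 <= k < m.+1) _) =
    (fun x => \sum_(0 <= k < m) eta * ind (t k) x + eta * ind (t m) x)); last first.
    by apply/funext => x; rewrite big_nat_recr.
  split; first exact: (integrableD mD IH1 it).
  by rewrite (RintegralD mD IH1 it) IH2 RI// big_nat_recr.
rewrite -eS -RintegralB// -RI//.
have iB := integrableB mD intf iS.
apply: le_trans (le_normr_Rintegral mD iB) _; apply: le_Rintegral => //.
- exact: (integrable_norm iB).
- exact: (integrableZl mD eta (integrable_level fin)).
- by move=> x _; exact: step_approx.
Qed.

End level_steps.

Lemma continuous_cut {R : realType} {T : topologicalType} (f : T -> R) (a : R) x :
  {for x, continuous f} -> {for x, continuous (fun y => Num.min (f y) a)}.
Proof.
move=> cf; apply: (@continuous_min R T f (fun=> a)) => //.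
exact: cst_continuous.
Qed.

Lemma continuous_pos {R : realType} {T : topologicalType} (f : T -> R) x :
  {for x, continuous f} -> {for x, continuous (fun y => Num.max (f y) 0)}.
Proof.
move=> cf; apply: (@continuous_max R T f (fun=> 0)) => //.
exact: cst_continuous.
Qed.

Section exponent_expectation.
Context {R : realType} {dO} {Omega : measurableType dO} {P : probability Omega R}
  {X : int -> {RV P >-> R}} {alpha : R}
  {nu : forall i, {measure set (borel_punctured R i) -> \bar R}}.
Hypothesis rv : regularly_varying X alpha nu.
Variable u : nat -> R.
Hypothesis u0 : forall n, 0 < u n.
Hypothesis uoo : u n @[n --> \oo] --> +oo.
Variable i : nat.
Local Notation F n := (survival X (u n)).
Local Notation Z := (@scaled_block _ _ _ _ X u i).
Hypothesis F0 : \forall n \near \oo, 0 < F n.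
Variable s : R.
Hypothesis s0 : 0 < s.

Definition ae_continuous (psi : 'rV[R]_i.+1 -> R) : Prop :=
  {ae nu i, forall x : punctured R i, finite_points x -> {for real_coords x, continuous psi}}.

Definition far_supported (psi : 'rV[R]_i.+1 -> R) : Prop :=
  forall x : 'rV[R]_i.+1, (forall k, `|x 0 k| < s) -> psi x = 0.

Variable C : R.
Hypothesis far_bound : \forall n \near \oo, forall A : set Omega, measurable A ->
  A `<=` [set w | exists k, s <= `|Z n w 0 k|] -> fine (P A) <= C * F n.

Local Notation D := (@finite_points R i : set (borel_punctured R i)).

(** A layer cake over null levels approximates [psi], on both sides of the limit,
    within [eta] times the mass of a set away from the origin. *)
Lemma bounded_limit psi K : measurable_fun setT (psi : borel_rV R i.+1 -> R) ->
  far_supported psi -> ae_continuous psi -> (forall x, 0 <= psi x <= K) ->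
  \int[P]_w psi (Z n w) / F n @[n --> \oo] --> \int[nu i]_(x in D) psi (real_coords x).
Proof.
move=> mpsi fpsi cpsi psiK.
pose f (x : borel_punctured R i) := psi (real_coords x).
have mf : measurable_fun setT f by exact: measurable_psi_real_coords.
have mD : measurable D := @measurable_finite_points R i.
have levE t : level_set psi t = upper_level D f t by [].
have fin0 : (nu i (upper_level D f 0%R) < +oo)%E.
  by rewrite -levE; exact: (level_set_lty rv s0 mpsi fpsi).
set B := fine (nu i (upper_level D f 0%R)).
have B0 : 0 <= B by rewrite fine_ge0.
have C0 : 0 <= C + 1 + B + 0 + `|C|.
  by have := ler_norm (- C); rewrite normrN; lra.
pose M := 1 + `|C| + B.
have M0 : 0 < M by rewrite /M -addrA ltr_pwDl// addr_ge0.
apply/cvgrPdist_le => eps eps0.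
pose eta := eps / 2 / M.
have eta0 : 0 < eta by rewrite !divr_gt0.
pose m := (Num.truncn (K / eta)).+1.
have Km : K <= eta * m%:R by rewrite mulrC -ler_pdivrMr// ltW// truncnS_gt//.
have tex (k : nat) : exists t : R, eta * k%:R < t < eta * k.+1%:R /\
    nu i (D `&` f @^-1` [set t]) = 0%E.
  have ab : eta * k%:R < eta * k.+1%:R by rewrite ltr_pM2l// ltr_nat.
  have mS : measurable (upper_level D f 0%R) by rewrite -levE; exact: measurable_level_set.
  have [t tab nt] := null_level mS fin0 mf ab.
  exists t; split => //; rewrite -nt; congr (nu i _).
  have t0 : 0 < t by case/andP: tab => h _; apply: le_lt_trans h; rewrite mulr_ge0// ltW.
  by apply/seteqP; split => [x [Dx fx]|x [[Dx _] fx]]; split => //; split => //=; rewrite fx.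
have [t tk] := choice tex.
have tpos k : 0 <= t k.
  by have [/andP[h _] _] := tk k; apply: le_trans (ltW h); rewrite mulr_ge0// ltW.
have lim k : fine (P [set w | t k < psi (Z n w)]) / F n @[n --> \oo] --> fine (nu i (upper_level D f (t k))).
  have [_ nt] := tk k; exact: (level_set_limit rv u0 uoo s0 mpsi fpsi cpsi (tpos k) nt).
have limS : (\sum_(0 <= k < m) eta * (fine (P [set w | t k < psi (Z n w)]) / F n)) @[n --> \oo] -->
    \sum_(0 <= k < m) eta * fine (nu i (upper_level D f (t k))).
  by apply: cvg_sum_nat => k; apply: cvgM => //; exact: cvg_cst.
have tk' k : eta * k%:R < t k < eta * k.+1%:R by have [] := tk k.
have f_le x : 0 <= f x <= eta * m%:R.
  by have /andP[h1 h2] := psiK (real_coords x); rewrite h1 (le_trans h2).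
have nuB := step_integral mD mf eta0 tk' f_le fin0.
have /cvgrPdist_le/(_ (eps / 2)) := limS; rewrite divr_gt0// => /(_ isT) near1.
near=> n.
have Fn : 0 < F n by near: n.
have farn : forall A : set Omega, measurable A ->
  A `<=` [set w | exists k, s <= `|Z n w 0 k|] -> fine (P A) <= C * F n by near: n.
have nearn : `|\sum_(0 <= k < m) eta * fine (nu i (upper_level D f (t k))) -
   \sum_(0 <= k < m) eta * (fine (P [set w | t k < psi (Z n w)]) / F n)| <= eps / 2 by near: n.
have mZ : measurable_fun setT (fun w => psi (Z n w)).
  by apply: (measurableT_comp mpsi); exact: measurable_scaled_block.
have g_le w : 0 <= psi (Z n w) <= eta * m%:R.
  by have /andP[h1 h2] := psiK (Z n w); rewrite h1 (le_trans h2).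
have upE t' : upper_level setT (fun w => psi (Z n w)) t' = [set w | t' < psi (Z n w)].
  by rewrite /upper_level setTI.
have mup t' : measurable [set w | t' < psi (Z n w)].
  have := mZ measurableT _ (@measurable_itv R `]t', +oo[); rewrite setTI.
  by congr measurable; apply/seteqP; split => w /=; rewrite in_itv /= andbT.
have P0 : (P (upper_level setT (fun w => psi (Z n w)) 0%R) < +oo)%E.
  by apply: le_lt_trans (ltry 1); apply: probability_le1; rewrite upE.
have PB := step_integral measurableT mZ eta0 tk' g_le P0.
have PC : fine (P (upper_level setT (fun w => psi (Z n w)) 0%R)) <= `|C| * F n.
  apply: (@le_trans _ _ (C * F n)); last by rewrite ler_wpM2r ?ler_norm// ltW.
  apply: farn; rewrite upE// => w /= pos.
  apply: contrapT => nfar; move: pos; rewrite fpsi ?ltxx// => k.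
  by rewrite ltNge; apply/negP => h; apply: nfar; exists k.
have PB' : `|\int[P]_w psi (Z n w) / F n -
    \sum_(0 <= k < m) eta * (fine (P [set w | t k < psi (Z n w)]) / F n)| <= eta * `|C|.
  have -> : \sum_(0 <= k < m) eta * (fine (P [set w | t k < psi (Z n w)]) / F n) =
      (\sum_(0 <= k < m) eta * fine (P (upper_level setT (fun w => psi (Z n w)) (t k)))) / F n.
    by rewrite mulr_suml; apply: eq_bigr => k _; rewrite upE mulrA.
  rewrite -mulrBl normrM [`|(F n)^-1|]gtr0_norm ?invr_gt0// ler_pdivrMr//.
  by apply: le_trans PB _; rewrite -[leRHS]mulrA ler_pM2l.
have etaM : eta * B + eta * `|C| <= eps / 2.
  have e1 : eta * M = eps / 2 by rewrite /eta divfK// gt_eqF.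
  by rewrite -e1 /M; have := ltW eta0; nra.
rewrite [X in `|X|](_ : _ = (\int[nu i]_(x in D) f x - \sum_(0 <= k < m) eta * fine (nu i (upper_level D f (t k))))
  + (\sum_(0 <= k < m) eta * fine (nu i (upper_level D f (t k))) -
   \sum_(0 <= k < m) eta * (fine (P [set w | t k < psi (Z n w)]) / F n))
  - (\int[P]_w psi (Z n w) / F n -
    \sum_(0 <= k < m) eta * (fine (P [set w | t k < psi (Z n w)]) / F n))); last by ring.
apply: le_trans (ler_normB _ _) _; apply: le_trans (lerD (ler_normD _ _) (lexx _)) _.
apply: le_trans (lerD (lerD nuB nearn) PB') _.
rewrite -/B; lra.
Unshelve. all: by end_near. Qed.

Variable C' : R.
Hypothesis C'0 : 0 <= C'.

(** Uniform integrability relative to the rate [F n]. *)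
Definition excess_integrable (psi : 'rV[R]_i.+1 -> R) : Prop :=
  [/\ forall n, intg P (fun w => psi (Z n w)),
   \forall n \near \oo, \int[P]_w `|psi (Z n w)| <= C' * F n &
   forall kappa, 0 < kappa -> exists2 K, 0 <= K & \forall n \near \oo,
     \int[P]_w (`|psi (Z n w)| * (if K < `|psi (Z n w)| then 1 else 0)) <= kappa * F n].

(** Truncation at a high level costs little, uniformly in [n] by uniform
    integrability, and in the limit by monotone convergence. *)
Lemma nonneg_limit psi : measurable_fun setT (psi : borel_rV R i.+1 -> R) ->
  far_supported psi -> ae_continuous psi -> (forall x, 0 <= psi x) -> excess_integrable psi ->
  (nu i).-integrable D (fun x => (psi (real_coords x))%:E) /\
  (\int[P]_w psi (Z n w) / F n @[n --> \oo] --> \int[nu i]_(x in D) psi (real_coords x)).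
Proof.
move=> mpsi fpsi cpsi psi0 [ipsi bpsi ui].
pose f (x : borel_punctured R i) := psi (real_coords x).
have mf : measurable_fun setT f by exact: measurable_psi_real_coords.
have mD : measurable D := @measurable_finite_points R i.
pose cut (k : nat) (x : 'rV[R]_i.+1) := Num.min (psi x) k%:R.
have mcut k : measurable_fun setT (cut k : borel_rV R i.+1 -> R).
  by apply: measurable_minr => //; exact: measurable_cst.
have cut0 k x : 0 <= cut k x <= k%:R.
  by rewrite /cut le_min psi0 ler0n /= ge_min lexx orbT.
have cutle k x : cut k x <= psi x by rewrite /cut ge_min lexx.
have fcut k : far_supported (cut k) by move=> x /fpsi; rewrite /cut => ->; apply/min_idPl.
have ccut k : ae_continuous (cut k).
  apply: negligibleS cpsi => x nQ hP; apply: nQ => fx; have cx := hP fx.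
  exact: continuous_cut.
have lim k := bounded_limit (mcut k) (@fcut k) (@ccut k) (cut0 k).
set L := fun k => \int[nu i]_(x in D) cut k (real_coords x).
have mcutrc k : measurable_fun setT (fun x : borel_punctured R i => cut k (real_coords x)).
  by exact: measurable_psi_real_coords.
have icut k n : intg P (fun w => cut k (Z n w)).
  apply: (intg_le0 _ _ (ipsi n)).
    by apply: (measurableT_comp (mcut k)); exact: measurable_scaled_block.
  by move=> w; have /andP[h _] := cut0 k (Z n w); rewrite ger0_norm.
have LC k : L k <= C'.
  apply: (ler_cvg_to (lim k) (cvg_cst C')).
  near=> n; have Fn : 0 < F n by near: n.
  rewrite ler_pdivrMr//; apply: (@le_trans _ _ (\int[P]_w `|psi (Z n w)|)); last by near: n.
  apply: EE_le; [exact: icut|exact: intg_norm|move=> w].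
  exact: le_trans (cutle _ _) (ler_norm _).
have inu k : (nu i).-integrable D (fun x => (cut k (real_coords x))%:E).
  apply: (integrable_bounded_level mD (mcutrc k) (fun x => cut0 k (real_coords x))).
  exact: (level_set_lty rv s0 (mcut k) (@fcut k) (lexx 0)).
have LE k : (\int[nu i]_(x in D) (cut k (real_coords x))%:E = (L k)%:E)%E.
  by rewrite /L /Rintegral fineK//; exact: integrable_fin_num.
have mono : (\int[nu i]_(x in D) (cut k (real_coords x))%:E)%E @[k --> \oo] -->
    (\int[nu i]_(x in D) (f x)%:E)%E.
  have := @cvg_monotone_convergence _ _ _ (nu i) D mD (fun k x => (cut k (real_coords x))%:E).
  have -> : (\int[nu i]_(x in D) limn (fun k => (cut k (real_coords x))%:E) =
      \int[nu i]_(x in D) (f x)%:E)%E.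
    apply: eq_integral => x _; apply/cvg_lim => //; apply: cvg_near_cst; near=> k.
    rewrite /cut /f; congr (_%:E); apply/min_idPl; near: k; exact: nbhs_infty_ger.
  apply.
  - by move=> k; apply/measurable_EFinP; apply: measurable_funTS.
  - by move=> k x _; rewrite lee_fin; case/andP: (cut0 k (real_coords x)).
  - move=> x _ k l kl; rewrite lee_fin /cut le_min ge_min lexx /= ge_min.
    by rewrite ler_nat kl orbT.
have fle : (\int[nu i]_(x in D) (f x)%:E <= C'%:E)%E.
  rewrite -(cvg_lim _ mono)//; apply: lime_le; first by apply/cvg_ex; eexists; exact: mono.
  by apply: nearW => k; rewrite LE lee_fin.
have if_ : (nu i).-integrable D (fun x => (f x)%:E).
  apply/integrableP; split; first by apply/measurable_EFinP; exact: measurable_funTS.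
  rewrite (eq_integral (fun x => (f x)%:E)); first by apply: le_lt_trans fle (ltry _).
  by move=> x _ /=; rewrite ger0_norm//; exact: psi0.
split => //.
set l := \int[nu i]_(x in D) psi (real_coords x).
have Llim : L k @[k --> \oo] --> l.
  have lE : (\int[nu i]_(x in D) (f x)%:E = l%:E)%E.
    by rewrite /l /Rintegral fineK//; exact: integrable_fin_num.
  move: mono; rewrite lE; under eq_cvg do rewrite LE; exact: fine_cvg.
apply/cvgrPdist_le => eps eps0.
have e3 : 0 < eps / 3 by rewrite divr_gt0.
have [K K0 KP] := ui _ e3.
have /cvgrPdist_le/(_ _ e3) Ln := Llim.
have [k [kK kL]] : exists k : nat, K <= k%:R /\ `|l - L k| <= eps / 3.
  have : \forall k \near \oo, K <= k%:R /\ `|l - L k| <= eps / 3.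
    by apply: filterS2 Ln (nbhs_infty_ger K) => k h1 h2; split.
  by move=> /filter_ex.
have /cvgrPdist_le/(_ _ e3) Lk := lim k.
near=> n; have Fn : 0 < F n by near: n.
have uin : \int[P]_w (`|psi (Z n w)| * (if K < `|psi (Z n w)| then 1 else 0)) <= eps / 3 * F n by near: n.
have Lkn : `|L k - \int[P]_w cut k (Z n w) / F n| <= eps / 3 by near: n.
have mpsiZ : measurable_fun setT (fun w => psi (Z n w)).
  by apply: (measurableT_comp mpsi); exact: measurable_scaled_block.
have diff : `|\int[P]_w psi (Z n w) - \int[P]_w cut k (Z n w)| <= eps / 3 * F n.
  apply: le_trans uin; apply: EE_dist_le => //.
    have := intg_norm (ipsi n); apply: intg_le0.
      apply: measurable_funM; first exact: measurableT_comp.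
      apply: measurable_fun_ifT; [|exact: measurable_cst|exact: measurable_cst].
      by apply: measurable_fun_ltr; [exact: measurable_cst|exact: measurableT_comp].
    by move=> w; case: ifP; rewrite ?mulr1 ?mulr0 ?normr0 ?normr_id.
  move=> w; rewrite (ger0_norm (psi0 _)) /cut; have p0 := psi0 (Z n w).
  have [pk|kp] := leP (psi (Z n w)) k%:R; first by rewrite subrr normr0 mulr_ge0//; case: ifP.
  rewrite ifT ?(le_lt_trans kK)// mulr1 ger0_norm ?subr_ge0 ?(ltW kp)//.
  by rewrite lerBlDr lerDl.
have diff' : `|\int[P]_w psi (Z n w) / F n - \int[P]_w cut k (Z n w) / F n| <= eps / 3.
  by rewrite -mulrBl normrM [`|(F n)^-1|]gtr0_norm ?invr_gt0// ler_pdivrMr.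
rewrite (_ : _ - _ = (l - L k) + (L k - \int[P]_w cut k (Z n w) / F n)
  - (\int[P]_w psi (Z n w) / F n - \int[P]_w cut k (Z n w) / F n)); last by ring.
apply: le_trans (ler_normB _ _) _; apply: le_trans (lerD (ler_normD _ _) (lexx _)) _.
apply: le_trans (lerD (lerD kL Lkn) diff') _; lra.
Unshelve. all: by end_near. Qed.

Theorem exponent_expectation psi : measurable_fun setT (psi : borel_rV R i.+1 -> R) ->
  far_supported psi -> ae_continuous psi -> excess_integrable psi ->
  \int[P]_w psi (Z n w) / F n @[n --> \oo] --> \int[nu i]_(x in D) psi (real_coords x).
Proof.
move=> mpsi fpsi cpsi [ipsi bpsi ui].
have mD : measurable D := @measurable_finite_points R i.
have part (psi' : 'rV[R]_i.+1 -> R) : measurable_fun setT (psi' : borel_rV R i.+1 -> R) ->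
    far_supported psi' -> ae_continuous psi' -> (forall x, `|psi' x| = `|psi x|) ->
    (nu i).-integrable D (fun x => (Num.max (psi' (real_coords x)) 0)%:E) /\
    (forall n, intg P (fun w => Num.max (psi' (Z n w)) 0)) /\
    (\int[P]_w Num.max (psi' (Z n w)) 0 / F n @[n --> \oo] -->
     \int[nu i]_(x in D) Num.max (psi' (real_coords x)) 0).
  move=> mpsi' fpsi' cpsi' absE.
  have mp : measurable_fun setT ((fun x => Num.max (psi' x) 0) : borel_rV R i.+1 -> R).
    by apply: measurable_maxr => //; exact: measurable_cst.
  have mle x : `|Num.max (psi' x) 0| <= `|psi x|.
    by rewrite -absE; rewrite /Num.max; case: ifP => _; rewrite ?normr0.
  have mp0 x : 0 <= Num.max (psi' x) 0 by rewrite le_max lexx orbT.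
  have mpZ n : measurable_fun setT (fun w => Num.max (psi' (Z n w)) 0).
    by apply: (measurableT_comp mp); exact: measurable_scaled_block.
  have ip n : intg P (fun w => Num.max (psi' (Z n w)) 0).
    by apply: (intg_le (mpZ n) _ (ipsi n)) => w; exact: mle.
  have mpsiZ n : measurable_fun setT (fun w => psi (Z n w)).
    by apply: (measurableT_comp mpsi); exact: measurable_scaled_block.
  have far' : far_supported (fun x : 'rV[R]_i.+1 => Num.max (psi' x) 0).
    by move=> x /fpsi' ->; rewrite /Num.max ltxx.
  have ae' : ae_continuous (fun x : 'rV[R]_i.+1 => Num.max (psi' x) 0).
    apply: negligibleS cpsi' => x nQ hP; apply: nQ => fx; have cx := hP fx.
    exact: continuous_pos.
  have ui' : excess_integrable (fun x : 'rV[R]_i.+1 => Num.max (psi' x) 0).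
    split => //.
      apply: filterS bpsi => n; apply: le_trans.
      by apply: EE_le => [| |w]; [exact: intg_norm|exact: intg_norm|exact: mle].
    move=> kappa k0; have [K K0 KP] := ui _ k0; exists K => //.
    apply: filterS KP => n; apply: le_trans.
    have mI (h : Omega -> R) : measurable_fun setT h ->
        measurable_fun setT (fun w => `|h w| * (if K < `|h w| then 1 else 0)).
      move=> mh; apply: measurable_funM; first exact: measurableT_comp.
      apply: measurable_fun_ifT; [|exact: measurable_cst|exact: measurable_cst].
      by apply: measurable_fun_ltr; [exact: measurable_cst|exact: measurableT_comp].
    apply: EE_le0; first exact: (mI _ (mpZ n)).
    + apply: intg_le0 (mI _ (mpsiZ n)) _ (intg_norm (ipsi n)) => w.
      by case: ifP; rewrite ?mulr1 ?mulr0 ?normr0 ?normr_id.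
    + by move=> w; apply: mulr_ge0 => //; case: ifP.
    + move=> w; have h := mle (Z n w); case: ifPn => Kx; last first.
        by rewrite mulr0 mulr_ge0//; case: ifP.
      have -> : K < `|psi (Z n w)| by exact: lt_le_trans Kx h.
      by rewrite !mulr1.
  have [H1 H2] := nonneg_limit mp far' ae' mp0 ui'.
  by split; [exact: H1|split; [exact: ip|exact: H2]].
have [ip1 [ip2 ip3]] := part psi mpsi fpsi cpsi (fun=> erefl).
have [||||in1 [in2 in3]] := part (fun x => - psi x) => //.
- exact: measurableT_comp.
- by move=> x /fpsi ->; rewrite oppr0.
- by apply: negligibleS cpsi => x nQ hP; apply: nQ => fx; have cx := hP fx; exact: continuousN.
- by move=> x; rewrite normrN.
have posE (x : R) : x = Num.max x 0 - Num.max (- x) 0.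
  by rewrite /Num.max oppr_lt0; case: ltgtP => [x0|x0|->]; rewrite ?subr0 ?sub0r ?opprK.
have -> : \int[nu i]_(x in D) psi (real_coords x) =
    \int[nu i]_(x in D) Num.max (psi (real_coords x)) 0 -
    \int[nu i]_(x in D) Num.max (- psi (real_coords x)) 0.
  by rewrite -RintegralB//; apply: eq_Rintegral => x _; exact: posE.
have -> : (fun n => \int[P]_w psi (Z n w) / F n) = (fun n =>
    \int[P]_w Num.max (psi (Z n w)) 0 / F n - \int[P]_w Num.max (- psi (Z n w)) 0 / F n).
  apply/funext => n; rewrite -mulrBl -EE_B//.
  by congr (_ / _); apply: eq_Rintegral => w _; exact: posE.
exact: cvgB.
Qed.

End exponent_expectation.

(** * Moments and characteristic function of Gaussian variables *)

Section density.
Context {R : realType}.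
Local Notation mu := (@lebesgue_measure R).

(** The integral over [-n, n] is [H n - H (- n)]. *)
Lemma integral_derivative_eq0 (H H' : R -> R) :
  (forall x : R, is_derive x (1 : R) H (H' x)) -> continuous H' ->
  mu.-integrable setT (EFin \o H') ->
  H n%:R @[n --> \oo] --> (0 : R) -> H (- n%:R) @[n --> \oo] --> (0 : R) ->
  (\int[mu]_x (H' x)%:E = 0)%E.
Proof.
move=> dH cH' iH' Hp Hn.
have mH' : measurable_fun setT H' by exact: continuous_measurable_fun.
have cH : continuous H.
  by move=> x; apply: differentiable_continuous; apply/derivable1_diffP; case: (dH x).
pose f n x := (H' x * \1_(`[- n%:R, n%:R]%classic : set R) x)%:E.
have lim1 : (\int[mu]_x f n x)%E @[n --> \oo] --> (\int[mu]_x (H' x)%:E)%E.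
  apply: (@dominated_cvg _ _ _ mu _ measurableT f _ (fun x => `|H' x|%:E)) => //.
  - by move=> n; apply/measurable_EFinP; apply: measurable_funM.
  - move=> x _; apply: cvg_near_cst; near=> n; rewrite /f indicE mem_set ?mulr1//=.
    rewrite in_itv/= -ler_norml; near: n; exact: nbhs_infty_ger.
  - exact: (integrable_norm iH').
  - by move=> n x _; rewrite /f /= lee_fin normrM ler_piMr// indicE; case: (_ \in _); rewrite ?normr1 ?normr0.
have lim2 : (\int[mu]_x f n x)%E @[n --> \oo] --> (0 : \bar R)%E.
  suff h : \forall n \near \oo, (\int[mu]_x f n x)%E = (H n%:R - H (- n%:R))%:E.
    have h0 : (H n%:R - H (- n%:R))%:E @[n --> \oo] --> (0 - 0 : R)%:E.
      by apply: cvg_EFin; [near=> n => //|exact: cvgB].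
    rewrite subr0 in h0; apply: cvg_trans h0; apply: near_eq_cvg.
    by apply: filterS h => n ->.
  near=> n.
  have n0 : - n%:R < n%:R :> R by rewrite gtrN// ltr0n; near: n; exact: nbhs_infty_gt.
  rewrite EFinB -(@continuous_FTC2 _ H' H _ _ n0).
  - rewrite [RHS]integral_mkcond; apply: eq_integral => x _.
    by rewrite /f patchE indicE; case: ifPn => _; rewrite ?mulr1 ?mulr0.
  - by apply: continuous_subspaceT.
  - split => [x _||]; first by case: (dH x).
      exact: (cvg_at_right_filter (cH _)).
    exact: (cvg_at_left_filter (cH _)).
  - by move=> x _; rewrite derive1E; apply: derive_val.
exact: (cvg_unique _ lim1 lim2).
Unshelve. all: by end_near. Qed.
Context {dO} {Omega : measurableType dO} (P : probability Omega R)
  (Z : Omega -> R) (mZ : measurable_fun setT Z) (m s : R) (s0 : s != 0)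
  (lawZ : forall A : set R, measurable A -> P (Z @^-1` A) = normal_prob m s A).
Local Notation p := (normal_pdf m s).

Let p0 x : 0 <= p x. Proof. exact: normal_pdf_ge0. Qed.
Let mp : measurable_fun setT p. Proof. exact: measurable_normal_pdf. Qed.

Lemma ge0_integral_gaussian (f : R -> R) : measurable_fun setT f -> (forall x, 0 <= f x) ->
  (\int[P]_w (f (Z w))%:E = \int[mu]_x (f x * p x)%:E)%E.
Proof.
move=> mf f0; pose N : probability _ R := normal_prob m s.
have NN : N `<< mu by exact: normal_prob_dominates.
have mfE : measurable_fun setT (EFin \o f) by exact/measurable_EFinP.
transitivity (\int[N]_x (f x)%:E)%E.
  pose T := g_sigma_algebraType R.-ocitv.-measurable.
  have mZ' : measurable_fun setT (Z : Omega -> T) by exact: mZ.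
  rewrite -[LHS](@ge0_integral_pushforward _ _ _ T R Z mZ' P setT (EFin \o f)) //; last first.
    by move=> x _; rewrite lee_fin.
  by apply: (@eq_measure_integral _ T R setT N) => A mA _; exact: lawZ.
rewrite -(Radon_Nikodym_SigmaFinite.change_of_variables NN _ measurableT mfE); last first.
  by move=> x; rewrite lee_fin.
set D := Radon_Nikodym_SigmaFinite.f _ _.
have iD : mu.-integrable setT D by exact: Radon_Nikodym_SigmaFinite.f_integrable.
have mD := measurable_int _ iD.
have mpE : measurable_fun setT (EFin \o p) by exact/measurable_EFinP.
apply: ae_eq_integral => //; [exact: emeasurable_funM|exact/measurable_EFinP/measurable_funM|].
rewrite (_ : (fun x => (f x * p x)%:E) = (EFin \o f) \* (EFin \o p))%E //.
apply: ae_eqe_mul2l; apply: integral_ae_eq => // A _ mA.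
by rewrite -Radon_Nikodym_SigmaFinite.f_integral.
Qed.

Lemma intg_gaussian (f : R -> R) : measurable_fun setT f ->
  mu.-integrable setT (fun x => (f x * p x)%:E) -> intg P (f \o Z).
Proof.
move=> mf /integrableP[_ fp]; apply/integrableP; split.
  by apply/measurable_EFinP; exact: measurableT_comp.
have := @ge0_integral_gaussian (fun x => `|f x|) (measurableT_comp (@normr_measurable _ _) mf) (fun x => normr_ge0 _).
move=> /= ->; apply: le_lt_trans fp; rewrite le_eqVlt; apply/orP; left; apply/eqP.
by apply: eq_integral => x _; rewrite /= normrM (ger0_norm (p0 x)).
Qed.

Lemma EE_gaussian (f : R -> R) : measurable_fun setT f ->
  mu.-integrable setT (fun x => (f x * p x)%:E) ->
  (\int[mu]_x (f x * p x)%:E = (\int[P]_w f (Z w))%:E)%E.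
Proof.
move=> mf ifp; have iZ := intg_gaussian mf ifp.
have nf : measurable_fun setT (fun x => `|f x|) by exact: measurableT_comp.
have gf : measurable_fun setT (fun x => `|f x| - f x) by exact: measurable_funB.
have inf : mu.-integrable setT (fun x => (`|f x| * p x)%:E).
  have := integrable_norm ifp; apply: eq_integrable => // x _ /=.
  by rewrite normrM (ger0_norm (p0 x)).
have igf : mu.-integrable setT (fun x => ((`|f x| - f x) * p x)%:E).
  have := integrableB measurableT inf ifp; apply: eq_integrable => // x _ /=.
  by rewrite mulrBl EFinB.
have h1 := ge0_integral_gaussian nf (fun x => normr_ge0 _).
have h2 := ge0_integral_gaussian gf (fun x => ltac:(by rewrite subr_ge0 ler_norm)).
rewrite -integral_EFin_EE//.
transitivity (\int[P]_w (`|f (Z w)|%:E - (`|f (Z w)| - f (Z w))%:E))%E; last first.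
  by apply: eq_integral => w _; rewrite -EFinB; congr EFin; rewrite opprB addrC subrK.
rewrite integralB//; last 2 first.
- exact: intg_norm.
- by apply: intgB => //; exact: intg_norm.
rewrite h1 h2 -integralB//; apply: eq_integral => x _.
by rewrite -EFinB -mulrBl opprB addrC subrK.
Qed.

Let scale (x : R) := (x - m) ^+ 2 / (s ^+ 2 *+ 2).

Let scale0 x : 0 <= scale x.
Proof. by rewrite /scale divr_ge0 ?sqr_ge0// mulrn_wge0// sqr_ge0. Qed.

Let pE x : p x = normal_peak s * expR (- scale x).
Proof. by rewrite normal_pdfE// /normal_fun mulNr. Qed.

Let is_derive_p (x : R) : is_derive x (1 : R) p (- ((x - m) / s ^+ 2) * p x).
Proof.
rewrite (_ : p = fun x => normal_peak s * expR (- scale x)); last exact/funext.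
have d1 : is_derive x (1 : R) (fun x => - scale x) (- ((x - m) / s ^+ 2)).
  rewrite /scale; apply: is_derive_eq.
  by rewrite scaler0 add0r subr0 /GRing.scale /=; field.
have d2 := is_derive1_comp (is_derive_expR _) d1.
apply: is_derive_eq.
by rewrite /GRing.scale /=; ring.
Qed.

Let peak_ratio := (4 / 3) * (normal_peak s / normal_peak (2 * s)).

Let wide_pdf x : (1 + scale x) * p x <= peak_ratio * normal_pdf m (2 * s) x.
Proof.
have s20 : 2 * s != 0 by rewrite mulf_neq0.
rewrite pE normal_pdfE// /normal_fun.
have -> : - (x - m) ^+ 2 / ((2 * s) ^+ 2 *+ 2) = - (scale x / 4) by rewrite /scale; field.
have P1 := normal_peak_gt0 s0; have P2 := normal_peak_gt0 s20.
have -> : peak_ratio * (normal_peak (2 * s) * expR (- (scale x / 4))) =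
   normal_peak s * (4 / 3 * expR (- (scale x / 4))).
  by rewrite /peak_ratio; field; exact: lt0r_neq0.
rewrite mulrCA ler_wpM2l// ?(ltW P1)//.
have -> : - (scale x / 4) = - scale x + 3 / 4 * scale x by field.
rewrite expRD mulrCA [leLHS]mulrC ler_wpM2l ?expR_ge0//.
by have := expR_ge1Dx (3 / 4 * scale x); have := scale0 x; lra.
Qed.

Let peak_ratio_ge0 : 0 <= peak_ratio.
Proof. by rewrite mulr_ge0// ?divr_ge0 ?normal_peak_ge0//; lra. Qed.

Let cvg_tail (H : R -> R) (C : R) : 0 <= C -> (forall x, `|H x| <= C * ((1 + scale x) * p x)) ->
  H n%:R @[n --> \oo] --> (0 : R) /\ H (- n%:R) @[n --> \oo] --> (0 : R).
Proof.
move=> C0 hH.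
have s20 : 2 * s != 0 by rewrite mulf_neq0.
have key x : `|H x| * `|x - m| <= C * (peak_ratio * normal_peak (2 * s)) * (1 + 8 * s ^+ 2).
  have h1 := hH x; have h2 := wide_pdf x; rewrite (normal_pdfE _ s20) /normal_fun in h2.
  have e1 : - (x - m) ^+ 2 / ((2 * s) ^+ 2 *+ 2) = - (scale x / 4) by rewrite /scale; field.
  rewrite e1 in h2.
  have h3 : `|H x| <= C * (peak_ratio * normal_peak (2 * s)) * expR (- (scale x / 4)).
    rewrite -mulrA -(mulrA peak_ratio); apply: le_trans h1 _; exact: ler_wpM2l.
  have cc : 0 <= C * (peak_ratio * normal_peak (2 * s)).
    by apply: mulr_ge0 => //; apply: mulr_ge0 => //; exact: normal_peak_ge0.
  apply: le_trans (ler_wpM2r (normr_ge0 _) h3) _; rewrite -[leLHS]mulrA; apply: ler_wpM2l => //.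
  rewrite expRN mulrC ler_pdivrMr ?expR_gt0//.
  have h4 := expR_ge1Dx (scale x / 4).
  have s2 : 0 < s ^+ 2 by rewrite exprn_even_gt0.
  have h5 : 0 <= 1 + 8 * s ^+ 2 by lra.
  apply: le_trans (ler_wpM2l h5 h4).
  have -> : (1 + 8 * s ^+ 2) * (1 + scale x / 4) =
      1 + `|x - m| ^+ 2 + 8 * s ^+ 2 + `|x - m| ^+ 2 / (8 * s ^+ 2).
    by rewrite /scale real_normK ?num_real//; field.
  have : 0 <= `|x - m| ^+ 2 / (8 * s ^+ 2) by rewrite divr_ge0 ?sqr_ge0//; lra.
  have := sqr_ge0 (`|x - m| - 1); nra.
set K := C * _ * _ in key.
have K0 : 0 <= K by apply: le_trans (key 0); rewrite mulr_ge0.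
have small (v : nat -> R) : (forall n, n%:R - `|m| <= `|v n - m|) -> H (v n) @[n --> \oo] --> (0 : R).
  move=> hv; apply/cvgr0Pnorm_le => e e0; near=> n.
  have nm : (K / e) <= n%:R - `|m|.
    by rewrite lerBrDr; near: n; exact: nbhs_infty_ger.
  have n1 : 1 <= n%:R - `|m|.
    by rewrite lerBrDr; near: n; exact: nbhs_infty_ger.
  have h := key (v n); have hn := hv n.
  rewrite ler_pdivrMr// in nm.
  have a0 : 0 < `|v n - m| by lra.
  rewrite -(ler_pM2r a0); apply: le_trans h _; apply: le_trans nm _.
  by rewrite mulrC ler_wpM2l// ltW.
split; apply: small => n.
- by have := ler_norm (n%:R - m); have := ler_norm m; lra.
- by have := ler_norm (- (- n%:R - m)); rewrite normrN; have := ler_norm (- m); rewrite normrN; lra.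
Unshelve. all: by end_near. Qed.

Let integrable_wide (f : R -> R) (C : R) : 0 <= C -> measurable_fun setT f ->
  (forall x, `|f x| <= C * (1 + scale x)) -> mu.-integrable setT (fun x => (f x * p x)%:E).
Proof.
move=> C0 mf hf.
have iq := integrable_normal_pdf m (2 * s).
have := integrableZl measurableT (C * peak_ratio) iq.
apply: le_integrable => //.
  by apply/measurable_EFinP; exact: measurable_funM.
move=> x _ /=; rewrite lee_fin normrM (ger0_norm (p0 x)).
apply: le_trans (ler_norm _); rewrite -mulrA.
apply: le_trans (ler_wpM2l C0 (wide_pdf x)); rewrite mulrA.
by apply: ler_wpM2r.
Qed.

Let norm_le_scale x : `|x - m| <= (1 + s ^+ 2) * (1 + scale x).
Proof.
have s2 : 0 < s ^+ 2 by rewrite exprn_even_gt0.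
have -> : (1 + s ^+ 2) * (1 + scale x) = 1 + s ^+ 2 + scale x + `|x - m| ^+ 2 / 2.
  by rewrite /scale real_normK ?num_real//; field.
have := scale0 x; have := sqr_ge0 (`|x - m| - 1); nra.
Qed.

Let sqr_le_scale x : (x - m) ^+ 2 <= 2 * s ^+ 2 * (1 + scale x).
Proof.
have s2 : 0 < s ^+ 2 by rewrite exprn_even_gt0.
have -> : 2 * s ^+ 2 * (1 + scale x) = 2 * s ^+ 2 + (x - m) ^+ 2 by rewrite /scale; field.
lra.
Qed.

Lemma intg_gaussian_le (f : R -> R) (C : R) : measurable_fun setT f ->
  (forall x, `|f x| <= C * (1 + (x - m) ^+ 2)) -> intg P (f \o Z).
Proof.
move=> mf hf.
have C0 : 0 <= C by have := le_trans (normr_ge0 _) (hf m); rewrite subrr expr0n addr0 mulr1.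
apply: intg_gaussian => //; apply: (@integrable_wide _ (C * (1 + 2 * s ^+ 2))) => //.
  by rewrite mulr_ge0//; have := sqr_ge0 s; lra.
move=> x; apply: le_trans (hf x) _; rewrite -mulrA ler_wpM2l//.
have := sqr_le_scale x; have := scale0 x; lra.
Qed.

(** The derivative of [G p] is [(G' - G (x - m) / s ^ 2) p] for the Gaussian
    density [p], and [G p] vanishes at infinity. All moments and the
    characteristic function follow from this identity of Stein. *)
Lemma gaussian_integration_by_parts (G G' : R -> R) (C : R) :
  (forall x : R, is_derive x (1 : R) G (G' x)) -> continuous G' ->
  (forall x, `|G x| <= C * (1 + `|x - m|)) -> (forall x, `|G' x| <= C) ->
  \int[P]_w G' (Z w) = \int[P]_w (G (Z w) * (Z w - m)) / s ^+ 2.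
Proof.
move=> dG cG' hG hG'.
have C0 : 0 <= C by apply: le_trans (hG' 0).
have s2 : 0 < s ^+ 2 by rewrite exprn_even_gt0.
have cG : continuous G.
  by move=> x; apply: differentiable_continuous; apply/derivable1_diffP; case: (dG x).
have mG : measurable_fun setT G by exact: continuous_measurable_fun.
have mG' : measurable_fun setT G' by exact: continuous_measurable_fun.
have cxm : continuous (fun x : R => x - m) by move=> x; apply: cvgB => //; exact: cvg_cst.
have mGx : measurable_fun setT (fun x => G x * (x - m)).
  by apply: measurable_funM => //; exact: continuous_measurable_fun.
have bG x : `|G x| <= C * (2 + s ^+ 2) * (1 + scale x).
  apply: le_trans (hG x) _; rewrite -mulrA ler_wpM2l//.
  have := norm_le_scale x; have := scale0 x; lra.
have bGx x : `|G x * (x - m)| <= C * (1 + 3 * s ^+ 2) * (1 + scale x).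
  rewrite normrM; apply: le_trans (ler_wpM2r (normr_ge0 _) (hG x)) _.
  rewrite -!mulrA ler_wpM2l//.
  have -> : (1 + `|x - m|) * `|x - m| = `|x - m| + (x - m) ^+ 2.
    by rewrite mulrDl mul1r -expr2 real_normK ?num_real.
  have := norm_le_scale x; have := sqr_le_scale x; lra.
have bG'x x : `|G' x| <= C * (1 + scale x).
  by apply: le_trans (hG' x) _; rewrite ler_peMr//; have := scale0 x; lra.
have i1 := integrable_wide C0 mG' bG'x.
have i2 : mu.-integrable setT (fun x => (G x * (x - m) * p x)%:E).
  by apply: integrable_wide bGx => //; rewrite mulr_ge0//; lra.
have := @integral_derivative_eq0 (fun x => G x * p x)
  (fun x => G' x * p x - s ^- 2 * (G x * (x - m) * p x)).
have i3 := integrableZl measurableT (s ^- 2) i2.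
have [||t1 t2] := @cvg_tail (fun x => G x * p x) (C * (2 + s ^+ 2)).
  by rewrite mulr_ge0//; lra.
  by move=> x; rewrite normrM (ger0_norm (p0 x)) mulrA ler_wpM2r.
move=> /(_ _ _ _ t1 t2) h.
have {h} : (\int[mu]_x (G' x * p x - s ^- 2 * (G x * (x - m) * p x))%:E = 0)%E.
  apply: h.
  - move=> x; have d1 := dG x; have d2 := is_derive_p x.
    have d3 := is_deriveM d1 d2; apply: (is_derive_eq d3).
    by rewrite /GRing.scale /=; field.
  - have cp : continuous p by exact: continuous_normal_pdf.
    move=> x; apply: cvgB; first exact: cvgM (cG' x) (cp x).
    apply: cvgM; first exact: cvg_cst.
    exact: cvgM (cvgM (cG x) (cxm x)) (cp x).
  - have := integrableB measurableT i1 i3; apply: eq_integrable => // x _ /=.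
under eq_integral do rewrite EFinB.
rewrite integralB//.
under [X in (_ - X)%E]eq_integral do rewrite EFinM.
rewrite integralZl// !EE_gaussian// -EFinM -EFinB => -[] /eqP; rewrite subr_eq0 => /eqP ->.
by rewrite mulrC.
Qed.

Lemma gaussian_mean : \int[P]_w Z w = m.
Proof.
have i1 : intg P (fun w => Z w - m).
  apply: (@intg_gaussian_le (fun x => x - m) 1).
    by apply: measurable_funB.
  move=> x; rewrite mul1r ler_norml; have := sqr_ge0 (x - m - 1); have := sqr_ge0 (x - m + 1); nra.
have := @gaussian_integration_by_parts (fun=> 1) (fun=> 0) 1.
rewrite EE_cst => h.
have {h} h : 0 = \int[P]_w (1 * (Z w - m)) / s ^+ 2.
  apply: h => [|x|x].
  - exact: cst_continuous.
  - by rewrite mul1r normr1; have := normr_ge0 (x - m); lra.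
  - by rewrite normr0.
have s2 : s ^- 2 != 0 by rewrite invr_eq0 expf_neq0.
move/eqP: h; rewrite eq_sym mulf_eq0 (negbTE s2) orbF => /eqP h.
have iZ : intg P Z.
  have := intgD i1 (intg_cst P m); congr (intg _ _); apply/funext => w; lra.
have : \int[P]_w (Z w - m) = 0.
  by rewrite -[RHS]h; apply: eq_Rintegral => w _; rewrite mul1r.
rewrite EE_B//; last exact: intg_cst.
by rewrite EE_cst => /eqP; rewrite subr_eq0 => /eqP.
Qed.

Lemma gaussian_variance : \int[P]_w (Z w - m) ^+ 2 = s ^+ 2.
Proof.
have s2 : s ^+ 2 != 0 by rewrite expf_neq0.
have := @gaussian_integration_by_parts (fun x => x - m) (fun=> 1) 1.
rewrite EE_cst => h.
have {h} h : 1 = \int[P]_w ((Z w - m) * (Z w - m)) / s ^+ 2.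
  apply: h => [x||x|x].
  - by apply: is_derive_eq; rewrite subr0.
  - exact: cst_continuous.
  - by rewrite mul1r; lra.
  - by rewrite normr1.
have e := mulfVK s2 (\int[P]_w ((Z w - m) * (Z w - m))).
by rewrite -h mul1r in e.
Qed.

(** Integration by parts turns the derivative in [t] into [- s ^ 2 t phi c t],
    a differential equation with a unique solution; [c] is an arbitrary phase. *)
Let phi c t := \int[P]_w sin (t * (Z w - m) + c).

Let affine_continuous t c : continuous (fun x : R => t * (x - m) + c).
Proof.
move=> x; apply: cvgD; last exact: cvg_cst.
by apply: cvgM; [exact: cvg_cst|apply: cvgB => //; exact: cvg_cst].
Qed.

Let mtrig (f : R -> R) t c : continuous f -> measurable_fun setT (fun x : R => f (t * (x - m) + c)).
Proof.
move=> cf; apply: continuous_measurable_fun => x.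
by apply: (continuous_comp (@affine_continuous t c x)); exact: cf.
Qed.

Let trig_ibp t c :
  \int[P]_w (cos (t * (Z w - m) + c) * (Z w - m)) = - (s ^+ 2 * t) * phi c t.
Proof.
have s2 : s ^+ 2 != 0 by rewrite expf_neq0.
have h := @gaussian_integration_by_parts (fun x => cos (t * (x - m) + c))
  (fun x => - t * sin (t * (x - m) + c)) (1 + `|t|).
have {h} h : \int[P]_w (- t * sin (t * (Z w - m) + c)) =
    \int[P]_w (cos (t * (Z w - m) + c) * (Z w - m)) / s ^+ 2.
  apply: h => [x||x|x].
  - have d1 : is_derive x (1 : R) (fun x => t * (x - m) + c) t.
      by apply: is_derive_eq; rewrite /GRing.scale /=; lra.
    have d2 := is_derive1_comp (is_derive_cos _) d1.
    by apply: (is_derive_eq d2); rewrite /GRing.scale /=; lra.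
  - move=> x; apply: cvgM; first exact: cvg_cst.
    by apply: (continuous_comp (@affine_continuous t c x)); exact: continuous_sin.
  - apply: le_trans (cos_max _) _; rewrite mulrDr mulr1 -addrA lerDl.
    by rewrite addr_ge0// mulr_ge0// addr_ge0.
  - rewrite normrM normrN; apply: le_trans (ler_wpM2l (normr_ge0 _) (sin_max _)) _; lra.
have e := mulfVK s2 (\int[P]_w (cos (t * (Z w - m) + c) * (Z w - m))).
rewrite -h EE_Z in e; last first.
  apply: (@intg_bounded _ _ _ P _ 1) => [|w]; last exact: sin_max.
  apply: (measurableT_comp (mtrig _ _ (@continuous_sin R))) => //.
by rewrite -e /phi; ring.
Qed.

Let phi_derive c t : is_derive t (1 : R) (phi c) (- (s ^+ 2 * t) * phi c t).
Proof.
have mZm (f : R -> R) x d : continuous f -> measurable_fun setT (fun w => f (x * (Z w - m) + d)).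
  by move=> cf; apply: (measurableT_comp (mtrig x d cf)).
have i1 x : intg P (fun w => sin (x * (Z w - m) + c)).
  by apply: (@intg_bounded _ _ _ P _ 1) => [|w]; [exact: mZm (@continuous_sin R)|exact: sin_max].
have i2 : intg P (fun w => cos (t * (Z w - m) + c) * (Z w - m)).
  apply: (@intg_gaussian_le (fun x => cos (t * (x - m) + c) * (x - m)) 1).
    apply: measurable_funM; first exact: mtrig (@continuous_cos R).
    exact: measurable_funB.
  move=> x; rewrite mul1r normrM.
  apply: le_trans (ler_wpM2r (normr_ge0 _) (cos_max _)) _; rewrite mul1r ler_norml.
  by have := sqr_ge0 (x - m - 1); have := sqr_ge0 (x - m + 1); nra.
have i3 : intg P (fun w => (Z w - m) ^+ 2).
  apply: (@intg_gaussian_le (fun x => (x - m) ^+ 2) 1).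
    by apply: measurable_funX; apply: measurable_funB.
  by move=> x; rewrite ger0_norm ?sqr_ge0//; lra.
have bound d : `|phi c (t + d) - phi c t - d * (- (s ^+ 2 * t) * phi c t)| <= 4 * s ^+ 2 * d ^+ 2.
  rewrite -trig_ibp /phi -EE_B// -EE_Z// -EE_B//; last 2 first.
  - exact: intgB.
  - exact: intgZ.
  apply: (@le_trans _ _ (\int[P]_w (4 * d ^+ 2 * (Z w - m) ^+ 2))); last first.
    by rewrite EE_Z// gaussian_variance; lra.
  apply: EE_norm_le; [|exact: intgZ|].
    by apply: intg_measurable; apply: intgB; [exact: intgB|exact: intgZ].
  move=> w; have := sin_taylor1 (t * (Z w - m) + c) (d * (Z w - m)).
  rewrite [_ + c + _]addrAC -mulrDl -mulrA [(Z w - m) * _]mulrC.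
  move/le_trans; apply; rewrite -[leRHS]mulrA ler_pM2l//.
  rewrite -exprMn -real_normK ?num_real// expr2 ler_wpM2l//.
  by rewrite ge_min lexx orbT.
set D := - (s ^+ 2 * t) * phi c t in bound *.
have lim : d^-1 *: (phi c (d *: (1 : R) + t) - phi c t) @[d --> (0 : R)^'] --> D.
  apply/cvgrPdist_le => e e0; near=> d.
  have d0 : d != 0 by near: d; exact: nbhs_dnbhs_neq.
  rewrite distrC /GRing.scale /= mulr1 [d + t]addrC.
  have -> : d^-1 * (phi c (t + d) - phi c t) - D = (phi c (t + d) - phi c t - d * D) / d.
    by field.
  rewrite normrM normfV ler_pdivrMr ?normr_gt0//; apply: le_trans (bound d) _.
  have -> : 4 * s ^+ 2 * d ^+ 2 = 4 * s ^+ 2 * `|d| * `|d|.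
    by rewrite -[RHS]mulrA -expr2 real_normK ?num_real.
  apply: ler_wpM2r => //.
  have : `|d| < e / (1 + 4 * s ^+ 2).
    near: d; apply: dnbhs0_lt; rewrite divr_gt0//; have := sqr_ge0 s; lra.
  have s2 := sqr_ge0 s; rewrite ltr_pdivlMr; last lra.
  have := normr_ge0 d; nra.
split; first exact: cvgP lim.
exact: cvg_lim lim.
Unshelve. all: by end_near. Qed.

Let phiE c : phi c 1 = expR (- (s ^+ 2 / 2)) * sin c.
Proof.
pose k t := phi c t * expR (s ^+ 2 * t ^+ 2 / 2).
have k01 : k 1 = k 0.
  apply: is_derive_0_is_cst => t.
  have d1 : is_derive t (1 : R) (fun t => s ^+ 2 * t ^+ 2 / 2) (s ^+ 2 * t).
    by apply: is_derive_eq; rewrite /GRing.scale /=; field.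
  have d2 := is_derive1_comp (is_derive_expR _) d1.
  have d3 := is_deriveM (phi_derive c t) d2.
  by apply: (is_derive_eq d3); rewrite /GRing.scale /=; ring.
move: k01; rewrite /k expr0n mulr0 mul0r expR0 mulr1 expr1n mulr1 => h.
have h0 : phi c 0 = sin c.
  rewrite /phi -[RHS](EE_cst P); apply: eq_Rintegral => w _; congr sin; lra.
by rewrite -h0 -h mulrCA -expRD addNr expR0 mulr1.
Qed.

Lemma gaussian_cos c : \int[P]_w cos (Z w + c) = expR (- (s ^+ 2 / 2)) * cos (m + c).
Proof.
have -> : cos (m + c) = sin (m + c + pi / 2) by rewrite sinDpihalf.
rewrite -phiE /phi; apply: eq_Rintegral => w _.
by rewrite -sinDpihalf; congr sin; lra.
Qed.
End density.

Section gaussian_variable.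
Context {R : realType} {dO} {Omega : measurableType dO} (P : probability Omega R)
  (Z : Omega -> R) (mZ : measurable_fun setT Z).

Lemma ae_cst_expectation (m : R) (f : R -> R) : measurable_fun setT f ->
  P (Z @^-1` [set m]) = 1%E -> intg P (f \o Z) /\ \int[P]_w f (Z w) = f m.
Proof.
move=> mf Pm; have mfZ : measurable_fun setT (f \o Z) by exact: measurableT_comp.
have mA : measurable (Z @^-1` [set m]) by rewrite -[X in measurable X]setTI; exact: mZ.
have ae : ae_eq P setT (EFin \o (f \o Z)) (EFin \o cst (f m)).
  exists (~` (Z @^-1` [set m])); split; first exact: measurableC.
    by have := probability_setC P mA; rewrite Pm subee.
  by move=> w /= h1 h2; apply: h1 => _; rewrite h2.
have mc : measurable_fun setT (EFin \o cst (f m) : Omega -> \bar R).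
  by apply/measurable_EFinP; exact: measurable_cst.
have mE : measurable_fun setT (EFin \o (f \o Z)) by exact/measurable_EFinP.
have i : intg P (f \o Z).
  apply/integrableP; split => //.
  rewrite (ae_eq_integral (abse \o (EFin \o cst (f m)))) //; last exact: ae_eq_abse.
  - have /integrableP[_] := intg_cst P (f m); exact.
  - exact: measurableT_comp.
  - exact: measurableT_comp.
split => //; apply: EFin_inj; rewrite -integral_EFin_EE//.
rewrite (ae_eq_integral _ _ measurableT mE mc ae).
by have := integral_EFin_EE (intg_cst P (f m)); rewrite EE_cst.
Qed.

(** In the degenerate case the variable is almost surely its mean, which is 0. *)
Lemma gaussian_characterization : gaussian P Z -> \int[P]_w Z w = 0 ->
  intg P (fun w => Z w ^+ 2) /\
  forall c, \int[P]_w cos (Z w + c) = expR (- ((\int[P]_w (Z w ^+ 2)) / 2)) * cos c.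
Proof.
have cc c : measurable_fun setT (fun x : R => cos (x + c)).
  apply: continuous_measurable_fun => x; apply: continuous_comp; last exact: continuous_cos.
  by apply: cvgD => //; exact: cvg_cst.
move=> [m [s [s_ge0 law]]] mean0.
have [s0|s0] := eqVneq s 0.
  have Pm : P (Z @^-1` [set m]) = 1%E.
    by rewrite law// s0 eqxx diracE mem_set.
  have [_ Em] := @ae_cst_expectation m id (@measurable_id _ _ setT) Pm.
  have {}Em : m = 0 by rewrite -Em.
  have [i2 E2] := @ae_cst_expectation m (fun x => x ^+ 2) (measurable_funX 2 (@measurable_id _ _ setT)) Pm.
  split => // c; have [_ ->] := @ae_cst_expectation m (fun x => cos (x + c)) (cc c) Pm.
  by rewrite E2 Em expr0n mul0r oppr0 expR0 mul1r add0r.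
have law' A : measurable A -> P (Z @^-1` A) = normal_prob m s A.
  by move=> mA; rewrite law// (negbTE s0).
have m0 := gaussian_mean mZ s0 law'; rewrite mean0 in m0.
have v := gaussian_variance mZ s0 law'.
have Zm : (fun w => (Z w - m) ^+ 2) = (fun w => Z w ^+ 2).
  by apply/funext => w; rewrite -m0 subr0.
split.
  apply: (@intg_gaussian_le _ _ _ P Z mZ m s s0 law' (fun x => x ^+ 2) 1).
    exact: measurable_funX.
  by move=> x; rewrite -m0 subr0 ger0_norm ?sqr_ge0//; lra.
move=> c; have := gaussian_cos mZ s0 law' c; rewrite -v -m0 add0r => ->.
by congr (expR (- (_ / 2)) * _); apply: eq_Rintegral => w _; rewrite subr0.
Qed.
End gaussian_variable.

(** * From cosines to convergence in distribution *)

Section bernstein.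
Context {R : realType} {m : nat}.
Implicit Types (y : 'I_m -> R) (G H : ('I_m -> nat) -> R) (k : 'I_m -> nat) (s : seq 'I_m).

Definition incr (i : 'I_m) k : 'I_m -> nat := fun j => (k j + (j == i))%N.

(** The expectation of [G] at the final position of independent steps: the entry
    [i] of the list increments coordinate [i] with probability [y i]. With [N]
    copies of each coordinate this is the Bernstein operator in several
    variables; the recursive form makes it visibly a sum of products of the [y i]
    and [1 - y i]. *)
Fixpoint bernstein s y G k : R :=
  if s is i :: s' then
    y i * bernstein s' y G (incr i k) + (1 - y i) * bernstein s' y G k
  else G k.

Lemma bernstein_dist_le s y G H c k : (forall i, 0 <= y i <= 1) ->
  (forall k, `|G k - c| <= H k) -> `|bernstein s y G k - c| <= bernstein s y H k.
Proof.
move=> y01 GH; elim: s k => [|i s IH] k /=; first exact: GH.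
have /andP[yi0 yi1] := y01 i.
have -> : y i * bernstein s y G (incr i k) + (1 - y i) * bernstein s y G k - c =
  y i * (bernstein s y G (incr i k) - c) + (1 - y i) * (bernstein s y G k - c) by ring.
apply: le_trans (ler_normD _ _) _; rewrite !normrM (ger0_norm yi0) (ger0_norm (_ : 0 <= 1 - y i)) ?subr_ge0//.
by apply: lerD; apply: ler_wpM2l => //; rewrite subr_ge0.
Qed.

(** Mean and variance of the independent steps. *)
Lemma bernstein_quadratic s y (e C a : R) k :
  bernstein s y (fun k => e + \sum_j C * ((k j)%:R * a - y j) ^+ 2) k =
  e + \sum_j C * ((((k j)%:R + (count_mem j s)%:R * y j) * a - y j) ^+ 2
                  + (count_mem j s)%:R * (y j * (1 - y j)) * a ^+ 2).
Proof.
elim: s k => [|i s IH] k /=.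
  by congr (_ + _); apply: eq_bigr => j _; rewrite !mul0r !addr0.
have mix A B : y i * (e + A) + (1 - y i) * (e + B) = e + (y i * A + (1 - y i) * B).
  by ring.
rewrite !IH mix !mulr_sumr -big_split /=.
congr (_ + _); apply: eq_bigr => j _; rewrite /incr.
case: (eqVneq j i) => [->|ji].
  by rewrite addn1 add1n -!natr1; ring.
by rewrite addn0 add0n; ring.
Qed.

Lemma count_copies N (j : 'I_m) : count_mem j (flatten (nseq N (enum 'I_m))) = N.
Proof.
elim: N => //= N IH; rewrite count_cat IH count_uniq_mem ?enum_uniq// mem_enum.
by rewrite add1n.
Qed.

(** The weak law of large numbers for the steps, in Bernstein's form: [G] may be
    bounded away from [c] only where the frequencies are away from [y]. *)
Lemma bernstein_approx N y G c (e C : R) : (0 < N)%N -> (forall i, 0 <= y i <= 1) -> 0 <= C ->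
  (forall k, `|G k - c| <= e + \sum_j C * ((k j)%:R / N%:R - y j) ^+ 2) ->
  `|bernstein (flatten (nseq N (enum 'I_m))) y G (fun=> 0%N) - c| <= e + m%:R * C / N%:R.
Proof.
move=> N0 y01 C0 hG; apply: le_trans (bernstein_dist_le _ _ y01 hG) _.
rewrite bernstein_quadratic lerD2l.
have NR : 0 < N%:R :> R by rewrite ltr0n.
apply: (@le_trans _ _ (\sum_(j < m) C / N%:R)); last first.
  by rewrite sumr_const card_ord -[leLHS]mulr_natl mulrA.
apply: ler_sum => j _; rewrite count_copies add0r.
have -> : (N%:R * y j / N%:R - y j) ^+ 2 + N%:R * (y j * (1 - y j)) * N%:R^-1 ^+ 2 =
   y j * (1 - y j) / N%:R by field; exact: lt0r_neq0.
apply: ler_wpM2l => //; rewrite ler_piMl ?invr_ge0 ?ltW//.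
by have := y01 j; nra.
Qed.

Lemma bernstein_bounded s y G (K : R) k : (forall i, 0 <= y i <= 1) ->
  (forall k, `|G k| <= K) -> `|bernstein s y G k| <= K.
Proof.
move=> y01 GK.
have := @bernstein_dist_le s y G (fun=> K) 0 k y01; rewrite subr0 => h.
apply: le_trans (h _) _ => [k'|]; first by rewrite subr0.
rewrite (_ : bernstein _ _ _ _ = K)//; elim: s k {h} => //= i s IH k.
by rewrite !IH; ring.
Qed.
End bernstein.

Section trigonometric_tests.
Context {R : realType} {dO} {Omega : measurableType dO} (P : probability Omega R)
  {dO'} {Omega' : measurableType dO'} (P' : probability Omega' R) {m : nat}
  (S : nat -> Omega -> 'I_m -> R) (S' : Omega' -> 'I_m -> R).
Hypothesis mS : forall n k, measurable_fun setT (fun w => S n w k).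
Hypothesis mS' : forall k, measurable_fun setT (fun w => S' w k).
Hypothesis cvg_cos : forall (t : 'I_m -> R) c,
  \int[P]_w cos (\sum_k t k * S n w k + c) @[n --> \oo] -->
  \int[P']_w cos (\sum_k t k * S' w k + c).

(** Functions whose product with every cosine has convergent expectations. The
    product with cosines is part of the definition because it makes the class
    stable under multiplication by sines. *)
Definition test (F : ('I_m -> R) -> R) :=
  [/\ forall n, measurable_fun setT (fun w => F (S n w)),
      measurable_fun setT (fun w => F (S' w)),
      exists C, forall x, `|F x| <= C &
      forall (t : 'I_m -> R) c,
  \int[P]_w (F (S n w) * cos (\sum_k t k * S n w k + c)) @[n --> \oo] -->
  \int[P']_w (F (S' w) * cos (\sum_k t k * S' w k + c))].

Let mlin n (t : 'I_m -> R) c : measurable_fun setT (fun w => cos (\sum_k t k * S n w k + c)).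
Proof.
apply: measurable_cosD; apply: measurable_sum => k.
by apply: measurable_funM => //; exact: measurable_cst.
Qed.

Let mlin' (t : 'I_m -> R) c : measurable_fun setT (fun w => cos (\sum_k t k * S' w k + c)).
Proof.
apply: measurable_cosD; apply: measurable_sum => k.
by apply: measurable_funM => //; exact: measurable_cst.
Qed.

Let intg_test F n t c : test F -> intg P (fun w => F (S n w) * cos (\sum_k t k * S n w k + c)).
Proof.
move=> [mF _ [C FC] _]; apply: (@intg_bounded _ _ _ P _ C).
  by apply: measurable_funM.
move=> w; rewrite normrM; apply: le_trans (FC (S n w)).
by rewrite ler_piMr// cos_max.
Qed.

Let intg_test' F t c : test F -> intg P' (fun w => F (S' w) * cos (\sum_k t k * S' w k + c)).
Proof.
move=> [_ mF [C FC] _]; apply: (@intg_bounded _ _ _ P' _ C).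
  by apply: measurable_funM.
move=> w; rewrite normrM; apply: le_trans (FC (S' w)).
by rewrite ler_piMr// cos_max.
Qed.

Lemma test_cst a : test (fun=> a).
Proof.
split=> [n|||t c]; [exact: measurable_cst|exact: measurable_cst|by exists (`|a|)|].
rewrite EE_Z; last by apply: (@intg_bounded _ _ _ P' _ 1) => // w; exact: cos_max.
rewrite (_ : (fun n => _) = (fun n => a * \int[P]_w cos (\sum_k t k * S n w k + c))); last first.
  by apply/funext => n; rewrite EE_Z//; apply: (@intg_bounded _ _ _ P _ 1) => // w; exact: cos_max.
by apply: cvgM; [exact: cvg_cst|exact: cvg_cos].
Qed.

Lemma testD F G : test F -> test G -> test (fun x => F x + G x).
Proof.
move=> tF tG; have [mF mF' [C FC] cF] := tF; have [mG mG' [D GD] cG] := tG.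
split=> [n|||t c]; [exact: measurable_funD|exact: measurable_funD|exists (C + D) => x|].
  by apply: le_trans (ler_normD _ _) _; exact: lerD.
have -> : \int[P']_w ((F (S' w) + G (S' w)) * cos (\sum_k t k * S' w k + c)) =
   \int[P']_w (F (S' w) * cos (\sum_k t k * S' w k + c)) +
   \int[P']_w (G (S' w) * cos (\sum_k t k * S' w k + c)).
  by rewrite -EE_D; [apply: eq_Rintegral => w _; rewrite mulrDl|exact: intg_test'|exact: intg_test'].
apply: cvg_trans (cvgD (cF t c) (cG t c)); apply: near_eq_cvg; apply: nearW => n.
rewrite [LHS]/GRing.add /= -EE_D; [|exact: intg_test|exact: intg_test].
by apply: eq_Rintegral => w _; rewrite mulrDl.
Qed.

Lemma test_shift F (i : 'I_m) (a d : R) : test F ->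
  forall (t : 'I_m -> R) c,
  \int[P]_w (F (S n w) * cos (\sum_k t k * S n w k + c + a * S n w i + d)) @[n --> \oo] -->
  \int[P']_w (F (S' w) * cos (\sum_k t k * S' w k + c + a * S' w i + d)).
Proof.
move=> [mF mF' [C FC] cF] t c.
pose t' k := t k + a * (k == i)%:R.
have E (x : 'I_m -> R) : \sum_k t k * x k + c + a * x i + d = \sum_k t' k * x k + (c + d).
  rewrite (_ : \sum_k t' k * x k = \sum_k t k * x k + a * x i); first by ring.
  rewrite /t'; under eq_bigr do rewrite mulrDl.
  rewrite big_split /=; congr (_ + _).
  rewrite (bigD1 i)//= eqxx mulr1 big1 ?addr0// => j ji.
  by rewrite (negbTE ji) mulr0 mul0r.
under eq_fun => n do under eq_Rintegral => w _ do rewrite E.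
under eq_Rintegral => w _ do rewrite E.
exact: cF.
Qed.

(** A product of a sine and a cosine is a sum of two cosines. *)
Lemma test_sin F (i : 'I_m) a al be : test F ->
  test (fun x => (al + be * sin (a * x i)) * F x).
Proof.
move=> tF; have [mF mF' [C FC] cF] := tF.
split=> [n|||t c].
- apply: measurable_funM => //; apply: measurable_funD => //; apply: measurable_funM => //.
  apply: measurableT_comp; first exact: continuous_measurable_fun (@continuous_sin R).
  by apply: measurable_funM.
- apply: measurable_funM => //; apply: measurable_funD => //; apply: measurable_funM => //.
  apply: measurableT_comp; first exact: continuous_measurable_fun (@continuous_sin R).
  by apply: measurable_funM.
- exists ((`|al| + `|be|) * C) => x; rewrite normrM; apply: ler_pM => //.
  apply: le_trans (ler_normD _ _) _; rewrite lerD2l normrM ler_piMr//; exact: sin_max.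
have E (f l p : R) : (al + be * sin p) * f * cos l =
    al * (f * cos (l + 0 * p + 0)) +
   (be / 2 * (f * cos (l + p + (- (pi / 2)))) - be / 2 * (f * cos (l + - p + (- (pi / 2))))).
  by rewrite !cosBpihalf mul0r !addr0 sinD sinB; field.
have i1 n (b d : R) : intg P (fun w => F (S n w) * cos (\sum_k t k * S n w k + c + b * S n w i + d)).
  apply: (@intg_bounded _ _ _ P _ C) => [|w].
    apply: measurable_funM => //; apply: measurable_cosD; apply: measurable_funD.
      apply: measurable_funD => //; apply: measurable_sum => k.
      by apply: measurable_funM.
    by apply: measurable_funM.
  by rewrite normrM; apply: le_trans (FC (S n w)); rewrite ler_piMr// cos_max.
have i2 (b d : R) : intg P' (fun w => F (S' w) * cos (\sum_k t k * S' w k + c + b * S' w i + d)).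
  apply: (@intg_bounded _ _ _ P' _ C) => [|w].
    apply: measurable_funM => //; apply: measurable_cosD; apply: measurable_funD.
      apply: measurable_funD => //; apply: measurable_sum => k.
      by apply: measurable_funM.
    by apply: measurable_funM.
  by rewrite normrM; apply: le_trans (FC (S' w)); rewrite ler_piMr// cos_max.
have s1 b d := @test_shift F i b d tF t c.
pose U n b d := \int[P]_w (F (S n w) * cos (\sum_k t k * S n w k + c + b * S n w i + d)).
pose U' b d := \int[P']_w (F (S' w) * cos (\sum_k t k * S' w k + c + b * S' w i + d)).
have lim : al * U n 0 0 + (be / 2 * U n a (- (pi / 2)) - be / 2 * U n (- a) (- (pi / 2)))
    @[n --> \oo] -->
    al * U' 0 0 + (be / 2 * U' a (- (pi / 2)) - be / 2 * U' (- a) (- (pi / 2))).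
  apply: cvgD; first by apply: cvgM; [exact: cvg_cst|exact: s1].
  by apply: cvgB; (apply: cvgM; [exact: cvg_cst|exact: s1]).
rewrite (_ : \int[P']_w _ = al * U' 0 0 + (be / 2 * U' a (- (pi / 2)) - be / 2 * U' (- a) (- (pi / 2)))); last first.
  rewrite /U' -!EE_Z// -EE_B//; [|exact: intgZ|exact: intgZ].
  rewrite -EE_D//; [|exact: intgZ|apply: intgB; exact: intgZ].
  by apply: eq_Rintegral => w _; rewrite E mulNr !mul0r.
apply: cvg_trans lim; apply: near_eq_cvg; apply: nearW => n /=.
rewrite /U -!EE_Z// -EE_B//; [|exact: intgZ|exact: intgZ].
rewrite -EE_D//; [|exact: intgZ|apply: intgB; exact: intgZ].
by apply: eq_Rintegral => w _; rewrite E mulNr !mul0r.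
Qed.

Lemma test_bernstein (T : R) (s : seq 'I_m) (G : ('I_m -> nat) -> R) (k : 'I_m -> nat) :
  test (fun x => bernstein s (fun i => (1 + sin (T^-1 * x i)) / 2) G k).
Proof.
elim: s k => [|i s IH] k /=; first exact: test_cst.
have h1 := test_sin i T^-1 2^-1 2^-1 (IH (incr i k)).
have h2 := test_sin i T^-1 2^-1 (- 2^-1) (IH k).
have := testD h1 h2; congr test; apply/funext => x.
by congr (_ * _ + _ * _); field.
Qed.

Lemma cvg_test F : test F ->
  \int[P]_w F (S n w) @[n --> \oo] --> \int[P']_w F (S' w).
Proof.
move=> [_ _ _ /(_ (fun=> 0) 0)].
rewrite (_ : \int[P']_w (_ * _) = \int[P']_w F (S' w)); last first.
  by apply: eq_Rintegral => w _; rewrite big1 ?addr0 ?cos0 ?mulr1// => k _; rewrite mul0r.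
apply: cvg_trans; apply: near_eq_cvg; apply: nearW => n.
by apply: eq_Rintegral => w _; rewrite big1 ?addr0 ?cos0 ?mulr1// => k _; rewrite mul0r.
Qed.
End trigonometric_tests.

Section uniform_modulus.
Context {R : realType}.

Lemma measurable_continuous_rV m (f : 'rV[R]_m -> R) : continuous f ->
  measurable_fun setT (f : borel_rV R m -> R).
Proof.
move=> cf; apply: (@measurability _ _ (borel_rV R m) R setT _ _ (RGenOInfty.measurableE R)) => _ [_ [a ->] <-].
rewrite setTI; apply: sub_sigma_algebra.
by apply: open_comp => [x _|]; [exact: cf|exact: interval_open].
Qed.

(** Compactness of the box; [y] need not belong to it. *)
Lemma uniform_modulus m (f : 'rV[R]_m.+1 -> R) (T e : R) : continuous f -> 0 < e ->
  exists2 d : R, 0 < d & forall x y : 'rV[R]_m.+1,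
    (forall k, `|x 0 k| <= T) -> (forall k, `|x 0 k - y 0 k| <= d) -> `|f x - f y| <= e.
Proof.
move=> cf e0.
pose K := [set v : 'rV[R]_m.+1 | forall i, `[- T, T]%classic (v 0 i)].
have cK : compact K := rV_compact (fun _ : 'I_m.+1 => @segment_compact R (- T) T).
have FF : Filter (0 : R)^'+ by exact: _.
have := (compact_near_coveringP K).1 cK R (0^'+)
  (fun d x => forall y : 'rV[R]_m.+1, (forall k, `|x 0 k - y 0 k| <= d) -> `|f x - f y| <= e) FF.
move=> cov; lapply cov; clear cov; last first.
  move=> x _.
  have e2 : 0 < e / 2 by lra.
  have /cvgrPdist_lt/(_ _ e2)/nbhs_rVP[r r0 hr] := cf x.
  exists (([set z : 'rV[R]_m.+1 | forall k, `|x 0 k - z 0 k| < r / 2]), [set d : R | 0 < d < r / 2]) => /=.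
    split; first by apply/nbhs_rVP; exists (r / 2); rewrite ?divr_gt0.
    near=> d; apply/andP; split; near: d; [exact: nbhs_right_gt|apply: nbhs_right_lt; lra].
  move=> [z d] [/= xz /andP[d0 dr]] y zy.
  have h1 : `|f x - f z| < e / 2 by apply: hr => k; have := xz k; lra.
  have h2 : `|f x - f y| < e / 2.
    apply: hr => k; have := ler_distD (z 0 k) (x 0 k) (y 0 k).
    have := xz k; have := zy k; lra.
  by rewrite distrC in h1; have := ler_distD (f x) (f z) (f y); lra.
move=> h; near (0 : R)^'+ => d; exists d; first by near: d; exact: nbhs_right_gt.
have hd : K `<=` (fun x => forall y : 'rV[R]_m.+1, (forall k, `|x 0 k - y 0 k| <= d) -> `|f x - f y| <= e).
  by near: d.
move=> x y hx; apply: hd => i /=; rewrite in_itv /= -ler_norml; exact: hx.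
Unshelve. all: by end_near. Qed.

(** The derivative of the sine is at least 1/2 on [-1, 1]. *)
Lemma sin_expansive (a b : R) : a <= b -> - 1 <= a -> b <= 1 -> b - a <= 2 * (sin b - sin a).
Proof.
rewrite le_eqVlt => /orP[/eqP->|ab] a1 b1; first by rewrite !subrr mulr0.
have [c] := MVT ab (fun x _ => is_derive_sin x) (continuous_subspaceT (@continuous_sin R)).
rewrite in_itv /= => /andP[ac cb] ->.
have cc : 1 / 2 <= cos c.
  have c1 : `|c| <= 1 by rewrite ler_norml; lra.
  have := cos_ge_quadratic (normr_ge0 c); rewrite cos_norm.
  have : `|c| ^+ 2 <= 1 by rewrite expr_le1.
  lra.
have ba : 0 <= b - a by lra.
by rewrite mulrA ler_peMl//; lra.
Qed.

(** The coordinate [(1 + sin (x / T)) / 2] determines [x] in the box, with a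
    Lipschitz inverse; values outside the range are clamped first. *)
Lemma sine_grid (T : R) : 0 < T -> exists psi : R -> R, forall z x, `|x| <= T ->
  `|psi z - x| <= 4 * T * `|z - (1 + sin (T^-1 * x)) / 2|.
Proof.
move=> T0.
suff h z : exists t, forall x, `|x| <= T -> `|t - x| <= 4 * T * `|z - (1 + sin (T^-1 * x)) / 2|.
  by have [psi hpsi] := choice h; exists psi.
have s11 : sin (-1) <= sin 1 :> R.
  have := sin_le_id (ler01 : 0 <= 1 :> R); have := sin_ge_cubic (ler01 : 0 <= 1 :> R).
  by rewrite sinN expr1n; lra.
pose v := Num.max (sin (-1)) (Num.min (2 * z - 1) (sin 1)).
have v1 : sin (-1) <= v by rewrite /v le_max lexx.
have v2 : v <= sin 1 by rewrite /v ge_max s11 ge_min lexx orbT.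
have [||c] := @IVT R sin (-1) 1 v _ (continuous_subspaceT (@continuous_sin R)).
- lra.
- by rewrite (min_idPl s11) (max_idPr s11) v1.
rewrite in_itv /= -ler_norml => c1 sc; exists (T * c) => x xT.
have x1 : `|T^-1 * x| <= 1 by rewrite normrM gtr0_norm ?invr_gt0// mulrC ler_pdivrMr// mul1r.
have -> : T * c - x = T * (c - T^-1 * x) by rewrite mulrBr mulrA divff ?mul1r ?gt_eqF.
rewrite normrM gtr0_norm// -mulrA mulrCA ler_wpM2l ?(ltW T0)//.
move: (c1) (x1); rewrite !ler_norml => /andP[c1l c1r] /andP[x1l x1r].
set x0 := T^-1 * x in x1 x1l x1r *.
have y1 : sin (-1) <= sin x0 by have := sin_expansive x1l (lexx _) x1r; lra.
have y2 : sin x0 <= sin 1 by have := sin_expansive x1r x1l (lexx _); lra.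
have hv : `|v - sin x0| <= 2 * `|z - (1 + sin x0) / 2|.
  have -> : 2 * `|z - (1 + sin x0) / 2| = `|2 * z - 1 - sin x0|.
    have e2 : `|2 : R| = 2 by rewrite ger0_norm.
    by rewrite -{1}e2 -normrM; congr `|_|; field.
  rewrite /v !ler_norml; have := ler_norm (2 * z - 1 - sin x0).
  have := ler_norm (- (2 * z - 1 - sin x0)); rewrite normrN.
  move=> k1 k2; case: (leP (2 * z - 1) (sin 1)) => h1; [case: (leP (sin (-1)) (2 * z - 1)) => h2|case: (leP (sin (-1)) (sin 1)) => h2]; apply/andP; split; lra.
have : `|c - x0| <= 2 * `|v - sin x0|.
  rewrite -sc; have [cx|xc] := leP c x0.
    rewrite distrC (distrC (sin c)) ger0_norm ?subr_ge0//.
    by apply: le_trans (sin_expansive cx c1l x1r) _; rewrite ler_pM2l// ler_norm.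
  rewrite (ger0_norm (_ : 0 <= c - x0)); last by rewrite subr_ge0 ltW.
  by apply: le_trans (sin_expansive (ltW xc) x1l c1r) _; rewrite ler_pM2l// ler_norm.
rewrite -ler_norml; lra.
Qed.
End uniform_modulus.

Section convergence_in_distribution.
Context {R : realType} {dO} {Omega : measurableType dO} (P : probability Omega R)
  {dO'} {Omega' : measurableType dO'} (P' : probability Omega' R) {m : nat}
  (S : nat -> Omega -> 'I_m.+1 -> R) (S' : Omega' -> 'I_m.+1 -> R).
Hypothesis mS : forall n k, measurable_fun setT (fun w => S n w k).
Hypothesis mS' : forall k, measurable_fun setT (fun w => S' w k).
Hypothesis cvg_cos : forall (t : 'I_m.+1 -> R) c,
  \int[P]_w cos (\sum_k t k * S n w k + c) @[n --> \oo] -->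
  \int[P']_w cos (\sum_k t k * S' w k + c).
Variable B : R.
Hypothesis second_moment : \forall n \near \oo, forall k,
  intg P (fun w => S n w k ^+ 2) /\ \int[P]_w (S n w k ^+ 2) <= B.
Hypothesis second_moment' : forall k,
  intg P' (fun w => S' w k ^+ 2) /\ \int[P']_w (S' w k ^+ 2) <= B.

Let row (x : 'I_m.+1 -> R) : 'rV[R]_m.+1 := \row_k x k.

(** The Bernstein polynomial in the variables [(1 + sin (x i / T)) / 2] is a
    trigonometric polynomial, hence bounded everywhere, and close to [f] in the
    box. *)
Lemma bernstein_test (f : 'rV[R]_m.+1 -> R) (K e T : R) : continuous f ->
  (forall x, `|f x| <= K) -> 0 < e -> 0 < T -> exists F, [/\ test P P' S S' F,
     forall x, `|F x| <= K &
     forall x, (forall k, `|x k| <= T) -> `|F x - f (row x)| <= e].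
Proof.
move=> cf fK e0 T0; have [psi hpsi] := sine_grid T0.
have K0 : 0 <= K by apply: le_trans (fK 0).
have e2 : 0 < e / 2 by lra.
have [d d0 hd] := uniform_modulus T cf e2.
pose C := 2 * K * (4 * T / d) ^+ 2.
have C0 : 0 <= C by rewrite /C mulr_ge0 ?sqr_ge0//; lra.
pose N := (Num.trunc (m.+1%:R * C / (e / 2))).+1.
have NR : m.+1%:R * C / N%:R <= e / 2.
  rewrite ler_pdivrMr ?ltr0n// [leRHS]mulrC -ler_pdivrMr//; apply: ltW.
  exact: truncnS_gt.
pose G (k : 'I_m.+1 -> nat) := f (row (fun i => psi ((k i)%:R / N%:R))).
pose y (x : 'I_m.+1 -> R) i := (1 + sin (T^-1 * x i)) / 2.
have y01 x i : 0 <= y x i <= 1.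
  have := sin_geN1 (T^-1 * x i); have := sin_le1 (T^-1 * x i).
  by rewrite /y => a b; apply/andP; split; lra.
exists (fun x => bernstein (flatten (nseq N (enum 'I_m.+1))) (y x) G (fun=> 0%N)).
split=> [|x|x xT].
- exact: test_bernstein.
- by apply: bernstein_bounded => // k; exact: fK.
have := @bernstein_approx R _ N (y x) G (f (row x)) (e / 2) C _ (y01 x) C0.
move=> h; apply: le_trans (h _ _) _ => // [k|]; last lra.
have [near_x|] := boolP [forall i, `|psi ((k i)%:R / N%:R) - x i| <= d].
  have h1 : `|G k - f (row x)| <= e / 2.
    rewrite distrC; apply: hd => i; rewrite !mxE//.
    by rewrite distrC; move/forallP: near_x; exact.
  by apply: le_trans h1 _; rewrite lerDl sumr_ge0// => i _; rewrite mulr_ge0// sqr_ge0.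
rewrite negb_forall => /existsP[i]; rewrite -ltNge => far.
have h1 : `|G k - f (row x)| <= 2 * K.
  by have := ler_normB (G k) (f (row x)); have := fK (row x); have := fK (row (fun i => psi ((k i)%:R / N%:R))); rewrite -/(G k); lra.
apply: le_trans h1 _; rewrite (bigD1 i)//=.
set rest := \sum_(_ | _) _.
have r0 : 0 <= rest by apply: sumr_ge0 => j _; rewrite mulr_ge0// sqr_ge0.
have h2 := hpsi ((k i)%:R / N%:R) (x i) (xT i); rewrite -/(y x i) in h2.
have h3 : 1 <= (4 * T / d) ^+ 2 * ((k i)%:R / N%:R - y x i) ^+ 2.
  rewrite -exprMn -real_normK ?num_real// normrM.
  rewrite (ger0_norm (_ : 0 <= 4 * T / d)); last by rewrite divr_ge0// ?mulr_ge0// ltW.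
  rewrite -[X in X <= _](expr1n _ 2) ler_sqr ?nnegrE//; last first.
    by rewrite mulr_ge0// divr_ge0// ?mulr_ge0// ltW.
  rewrite mulrAC ler_pdivlMr// mul1r.
  exact: le_trans (ltW far) h2.
have : 2 * K <= C * ((k i)%:R / N%:R - y x i) ^+ 2.
  by rewrite /C -mulrA ler_peMr//; lra.
lra.
Qed.

(** Outside the box both functions are bounded, and Chebyshev's inequality
    bounds the probability. *)
Lemma truncation_error (d : measure_display) (W : measurableType d) (Q : probability W R)
  (Z : W -> 'I_m.+1 -> R) (F : ('I_m.+1 -> R) -> R) (f : 'rV[R]_m.+1 -> R) (K e T : R) :
  (forall k, measurable_fun setT (fun w => Z w k)) ->
  (forall k, intg Q (fun w => Z w k ^+ 2) /\ \int[Q]_w (Z w k ^+ 2) <= B) ->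
  continuous f -> (forall x, `|f x| <= K) -> measurable_fun setT (fun w => F (Z w)) ->
  (forall x, `|F x| <= K) -> 0 <= e -> 0 < T ->
  (forall x, (forall k, `|x k| <= T) -> `|F x - f (row x)| <= e) ->
  [/\ intg Q (fun w => f (row (Z w))) &
   `|\int[Q]_w F (Z w) - \int[Q]_w f (row (Z w))| <= e + 2 * K * m.+1%:R * B / T ^+ 2].
Proof.
move=> mZ mom cf fK mF FK e0 T0 hF.
have K0 : 0 <= K by apply: le_trans (fK 0).
have mrow : measurable_fun setT (fun w => row (Z w) : borel_rV R m.+1).
  apply: measurable_rV => k; rewrite (_ : (fun t => _) = (fun w => Z w k)) //.
  by apply/funext => w; rewrite mxE.
have mf : measurable_fun setT (fun w => f (row (Z w))).
  exact: measurableT_comp (measurable_continuous_rV cf) mrow.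
have i1 : intg Q (fun w => f (row (Z w))) by apply: (@intg_bounded _ _ _ Q _ K).
have i2 : intg Q (fun w => F (Z w)) by apply: (@intg_bounded _ _ _ Q _ K).
split => //; rewrite -EE_B//.
have i3 : intg Q (fun w => \sum_k Z w k ^+ 2).
  by apply: intg_sum => k; exact: (mom k).1.
apply: (@le_trans _ _ (\int[Q]_w (e + 2 * K / T ^+ 2 * \sum_k Z w k ^+ 2))).
  apply: EE_norm_le; [exact: measurable_funB|by apply: intgD; [exact: intg_cst|exact: intgZ]|].
  move=> w; have T2 : 0 < T ^+ 2 by rewrite exprn_gt0.
  have c0 : 0 <= 2 * K / T ^+ 2 by rewrite divr_ge0 ?mulr_ge0// ltW.
  have s0 : 0 <= \sum_k Z w k ^+ 2 by apply: sumr_ge0 => k _; exact: sqr_ge0.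
  have [/forallP small|] := boolP [forall k, `|Z w k| <= T].
    by apply: le_trans (hF _ small) _; rewrite lerDl mulr_ge0.
  rewrite negb_forall => /existsP[i]; rewrite -ltNge => big.
  have h1 : `|F (Z w) - f (row (Z w))| <= 2 * K.
    by have := ler_normB (F (Z w)) (f (row (Z w))); have := fK (row (Z w)); have := FK (Z w); lra.
  apply: le_trans h1 _.
  have h2 : T ^+ 2 <= \sum_k Z w k ^+ 2.
    rewrite (bigD1 i)//=; apply: (@le_trans _ _ (Z w i ^+ 2)); last first.
      by rewrite lerDl; apply: sumr_ge0 => k _; exact: sqr_ge0.
    by rewrite -[leRHS]real_normK ?num_real// ler_sqr ?nnegrE// ltW.
  apply: (@le_trans _ _ (2 * K / T ^+ 2 * T ^+ 2)); first by rewrite divfK// gt_eqF.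
  apply: le_trans (ler_wpM2l c0 h2) _; rewrite lerDr//.
rewrite EE_D ?EE_cst ?EE_Z ?EE_sum//; [|by move=> k; exact: (mom k).1|exact: intg_cst|exact: intgZ].
rewrite lerD2l.
have -> : 2 * K * m.+1%:R * B / T ^+ 2 = 2 * K / T ^+ 2 * \sum_(k < m.+1) B.
  by rewrite sumr_const card_ord -[X in _ = _ * X]mulr_natl; ring.
apply: ler_wpM2l; first by rewrite divr_ge0 ?sqr_ge0// mulr_ge0.
by apply: ler_sum => k _; exact: (mom k).2.
Qed.

(** Tightness by second moments reduces the problem to a box, where continuous
    functions are approximated by trigonometric polynomials. *)
Theorem cvg_expectation_of_cos (f : 'rV[R]_m.+1 -> R) (K : R) : continuous f ->
  (forall x, `|f x| <= K) ->
  \int[P]_w f (row (S n w)) @[n --> \oo] --> \int[P']_w f (row (S' w)).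
Proof.
move=> cf fK; apply/cvgrPdist_le => e e0.
have K0 : 0 <= K by apply: le_trans (fK 0).
have B0 : 0 <= B.
  by apply: le_trans (second_moment' ord0).2; apply: EE_ge0 => w; exact: sqr_ge0.
pose D := 2 * K * m.+1%:R * B.
have D0 : 0 <= D by rewrite /D !mulr_ge0.
pose T := 1 + D / (e / 6).
have T0 : 1 <= T by rewrite /T lerDl divr_ge0//; lra.
have DT : D / T ^+ 2 <= e / 6.
  have T2 : T <= T ^+ 2 by rewrite expr2 ler_peMr//; lra.
  rewrite ler_pdivrMr; last by rewrite exprn_gt0//; lra.
  rewrite mulrC -ler_pdivrMr; last lra.
  by apply: le_trans T2; rewrite /T; lra.
have e6 : 0 < e / 6 by lra.
have T0' : 0 < T by lra.
have [F [tF FK hF]] := bernstein_test cf fK e6 T0'.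
have [mF mF' _ _] := tF.
have [_ E'] := truncation_error mS' second_moment' cf fK mF' FK (ltW e6) T0' hF.
rewrite -/D in E'.
have /cvgrPdist_le/(_ _ e6) cF := cvg_test tF.
near=> n.
have mom : forall k, intg P (fun w => S n w k ^+ 2) /\ \int[P]_w (S n w k ^+ 2) <= B.
  by near: n.
have [_ En] := truncation_error (mS n) mom cf fK (mF n) FK (ltW e6) T0' hF.
rewrite -/D in En.
have EF : `|\int[P']_w F (S' w) - \int[P]_w F (S n w)| <= e / 6 by near: n.
move: E' En EF; rewrite !ler_norml => /andP[? ?] /andP[? ?] /andP[? ?].
by apply/andP; split; lra.
Unshelve. all: by end_near. Qed.
End convergence_in_distribution.

(** * Expectations of functions of scaled blocks *)

Section exponent_limit.
Context {R : realType} {dO} {Omega : measurableType dO} {P : probability Omega R}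
  {dE} {E : measurableType dE} {Pi : R.-pker E ~> E} {Y : int -> {RV P >-> E}}
  {g : {mfun E >-> R}} {X : int -> {RV P >-> R}} {alpha : R}
  {nu : forall i, {measure set (borel_punctured R i) -> \bar R}}
  {V : {mfun E >-> R}} {q0 : R} {u : nat -> R}.
Hypothesis drift : drift_assumption Pi Y g X alpha nu V q0 u.
Hypothesis u0 : forall n, 0 < u n.
Hypothesis ndu : nondecreasing_seq u.
Hypothesis uoo : u n @[n --> \oo] --> +oo.
Hypothesis aoo : n%:R * survival X (u n) @[n --> \oo] --> +oo.
Local Notation F n := (survival X (u n)).
Local Notation Z i := (scaled_block (X := X) u i).

Lemma tail_power_sum_block i s n w :
  tail_power_sum q0 s (Z i n w) = \sum_(k < i.+1) excess (g := g) (q0 := q0) (u := u) s n (Y (k : nat)%:Z w).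
Proof.
apply: eq_bigr => k _; rewrite /excess /scaled_block !mxE (drift_observable drift).
by rewrite add0r.
Qed.

Lemma intg_tail_power_sum i s n : 0 < s -> intg P (fun w => tail_power_sum q0 s (Z i n w)).
Proof.
move=> s0; under eq_fun do rewrite tail_power_sum_block.
by apply: intg_sum => k; exact: (intg_excess drift u0 ndu).
Qed.

Lemma EE_tail_power_sum i s : 0 < s -> exists2 K, 0 <= K & \forall n \near \oo,
  \int[P]_w tail_power_sum q0 s (Z i n w) <= K * F n.
Proof.
move=> s0; have [K K0 hK] := EE_excess drift u0 ndu aoo s0.
exists (i.+1%:R * K); first by rewrite mulr_ge0.
apply: filterS hK => n hn.
under eq_Rintegral do rewrite tail_power_sum_block.
rewrite EE_sum; last by move=> k; exact: (intg_excess drift u0 ndu).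
apply: (@le_trans _ _ (\sum_(k < i.+1) \int[P]_w excess (g := g) (q0 := q0) (u := u) s n (Y 0 w))).
  by apply: ler_sum => k _; rewrite (EE_stationary (drift_stationary drift)) //; exact: measurable_excess.
by rewrite sumr_const card_ord -[leLHS]mulr_natl -mulrA ler_wpM2l.
Qed.

(** Markov's inequality: far from the origin some coordinate carries an excess
    that is bounded below. *)
Lemma far_probability i s : 0 < s -> exists2 C, 0 <= C & \forall n \near \oo,
  forall A : set Omega, measurable A ->
  A `<=` [set w | exists k, s <= `|Z i n w 0 k|] -> fine (P A) <= C * F n.
Proof.
move=> s0; have s2 : 0 < s / 2 by lra.
have [K K0 hK] := EE_tail_power_sum i s2.
have q00 : 0 < q0 by have /andP[] := drift_q0 drift.
exists ((s `^ q0)^-1 * K); first by rewrite mulr_ge0// invr_ge0 powR_ge0.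
apply: filterS hK => n hn A mA Afar.
have -> : fine (P A) = \int[P]_w \1_A w.
  by rewrite /Rintegral /= integral_indic// setIT.
have sq : 0 < s `^ q0 by rewrite powR_gt0.
rewrite -mulrA; apply: le_trans (ler_wpM2l _ hn); last by rewrite invr_ge0 ltW.
rewrite -EE_Z; last exact: intg_tail_power_sum.
apply: EE_le; [|by apply: intgZ; exact: intg_tail_power_sum|move=> w].
  apply: (@intg_bounded _ _ _ P _ 1); first exact: measurable_indic.
  by move=> w; rewrite indicE; case: (_ \in _); rewrite ?normr1 ?normr0.
have S0 : 0 <= tail_power_sum q0 (s / 2) (Z i n w).
  by apply: sumr_ge0 => k _; rewrite mulr_ge0 ?powR_ge0//; case: ifP.
rewrite indicE; case: (boolP (w \in A)) => wA /=; last first.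
  by rewrite mulr_ge0// invr_ge0 ltW.
rewrite mulrC ler_pdivlMr// mul1r.
have [k hk] := Afar w (set_mem wA).
rewrite /tail_power_sum (bigD1 k)//=; apply: (@le_trans _ _ (tail_power q0 (s / 2) (Z i n w 0 k))).
  rewrite /tail_power ifT; last by apply: lt_le_trans hk; lra.
  by rewrite mulr1 ge0_ler_powR// ?nnegrE// ltW.
by rewrite lerDl; apply: sumr_ge0 => j _; rewrite mulr_ge0 ?powR_ge0//; case: ifP.
Qed.

(** The moment of order [1 + kap] gives the uniform integrability. *)
Theorem exponent_limit i (psi : 'rV[R]_i.+1 -> R) (C s kap : R) :
  measurable_fun setT (psi : borel_rV R i.+1 -> R) -> 0 < C -> 0 < s -> 0 < kap ->
  (forall x, `|psi x| <= C * tail_power_sum q0 s x) ->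
  (forall x, `|psi x| `^ (1 + kap) <= C * tail_power_sum q0 s x) ->
  @ae_continuous R nu i psi ->
  \int[P]_w psi (Z i n w) / F n @[n --> \oo] -->
  \int[nu i]_(x in @finite_points R i) psi (real_coords x).
Proof.
move=> mpsi C0 s0 k0 b1 b2 cpsi.
have [K K0 hK] := EE_tail_power_sum i s0.
have [C' C'0 hC'] := far_probability i s0.
have mZ n : measurable_fun setT (fun w => psi (Z i n w)).
  exact: measurableT_comp mpsi (measurable_scaled_block u n).
have ipsi n : intg P (fun w => psi (Z i n w)).
  apply: (intg_le0 (mZ n) (g := fun w => C * tail_power_sum q0 s (Z i n w))) => //.
  by apply: intgZ; exact: intg_tail_power_sum.
have S0 x : 0 <= tail_power_sum q0 s x :> R.
  by apply: sumr_ge0 => k _; rewrite mulr_ge0 ?powR_ge0//; case: ifP.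
apply: (exponent_expectation (drift_regvar drift) u0 uoo (survival_gt0_near aoo) s0 hC' (C' := C * K)) => //.
- move=> x xs; apply/eqP; rewrite -normr_le0; apply: le_trans (b1 x) _.
  rewrite /tail_power_sum big1 ?mulr0// => k _.
  by rewrite /tail_power ifF ?mulr0//; apply/negbTE; rewrite -leNgt ltW.
split => //.
  apply: filterS hK => n hn; rewrite -mulrA.
  apply: le_trans (ler_wpM2l (ltW C0) hn); rewrite -EE_Z; last exact: intg_tail_power_sum.
  by apply: EE_le => //; [exact: intg_norm|apply: intgZ; exact: intg_tail_power_sum].
move=> kappa kappa0.
pose L := (C * (K + 1) / kappa) `^ kap^-1.
exists L; first exact: powR_ge0.
near=> n.
have L0 : 0 < L by rewrite powR_gt0// divr_gt0// mulr_gt0//; lra.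
have LE : L `^ kap = C * (K + 1) / kappa.
  by rewrite -powRrM mulVf ?gt_eqF// powRr1// divr_ge0 ?mulr_ge0 ?ltW//; lra.
have pw w : `|psi (Z i n w)| * (if L < `|psi (Z i n w)| then 1 else 0) <=
    (kappa / (K + 1)) * tail_power_sum q0 s (Z i n w).
  case: ifP => h; last by rewrite mulr0 mulr_ge0// divr_ge0// ?ltW//; lra.
  rewrite mulr1; have p0 : 0 < `|psi (Z i n w)| by apply: lt_trans h.
  have h2 := b2 (Z i n w); rewrite powRD in h2; last by apply/implyP => _; rewrite gt_eqF.
  rewrite powRr1// in h2.
  have h3 : L `^ kap <= `|psi (Z i n w)| `^ kap by rewrite ge0_ler_powR// ?nnegrE ltW.
  have h4 : `|psi (Z i n w)| * L `^ kap <= C * tail_power_sum q0 s (Z i n w).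
    by apply: le_trans h2; rewrite ler_pM2l.
  rewrite LE in h4.
  rewrite mulrAC ler_pdivlMr; last lra.
  rewrite -(ler_pM2l C0); have := ler_wpM2r (ltW kappa0) h4.
  have -> : `|psi (Z i n w)| * (C * (K + 1) / kappa) * kappa = C * (`|psi (Z i n w)| * (K + 1)).
    by field; exact: lt0r_neq0.
  by rewrite -mulrA [_ * kappa]mulrC.
apply: (@le_trans _ _ (\int[P]_w (kappa / (K + 1) * tail_power_sum q0 s (Z i n w)))).
  apply: EE_le => //; last by apply: intgZ; exact: intg_tail_power_sum.
  apply: (intg_le0 _ (g := fun w => kappa / (K + 1) * tail_power_sum q0 s (Z i n w))) => //.
  - apply: measurable_funM; first exact: measurableT_comp.
    apply: measurable_fun_ifT => //.
    by apply: measurable_fun_ltr => //; exact: measurableT_comp.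
  - move=> w; rewrite ger0_norm; first exact: pw.
    by rewrite mulr_ge0//; case: ifP.
  - by apply: intgZ; exact: intg_tail_power_sum.
rewrite EE_Z; last exact: intg_tail_power_sum.
apply: (@le_trans _ _ (kappa / (K + 1) * (K * F n))).
  apply: ler_wpM2l; first by rewrite divr_ge0 ?(ltW kappa0)//; lra.
  by near: n.
rewrite mulrA ler_wpM2r ?(survival_ge0 (X := X))// mulrAC ler_pdivrMr; last lra.
by rewrite ler_wpM2l ?(ltW kappa0)//; lra.
Unshelve. all: by end_near. Qed.
End exponent_limit.

(** * Marginals of exponent measures *)

Section rectangles.
Context {R : realType} {m : nat}.

Definition rectangle (a : 'I_m.+1 -> R) : set (borel_rV R m.+1) := [set x : 'rV[R]_m.+1 | forall k, a k < x 0 k].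

Lemma measurable_coord_rV k : measurable_fun setT ((fun x : 'rV[R]_m.+1 => x 0 k) : borel_rV R m.+1 -> R).
Proof. by apply: measurable_continuous_rV; exact: coord_continuous. Qed.

Lemma measurable_rectangle a : measurable (rectangle a).
Proof.
have -> : rectangle a = \bigcap_(k in [set: 'I_m.+1]) ((fun x : borel_rV R m.+1 => (x : 'rV[R]_m.+1) 0 k) @^-1` `]a k, +oo[%classic).
  apply/seteqP; split => x h k; first by move=> _; rewrite /= in_itv /= andbT; exact: h.
  by have := h k I; rewrite /= in_itv /= andbT.
apply: fin_bigcap_measurable => // k _.
by rewrite -[X in measurable X]setTI; apply: measurable_coord_rV.
Qed.

(** A half space in the coordinate [k] is the union of the rectangles whose other
    bounds are [- n]. *)
Lemma rectangle_generates :
  (@measurable _ (borel_rV R m.+1)) = <<s [set A | exists a, A = rectangle a] >>.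
Proof.
apply/seteqP; split => [A mA|]; last first.
  apply: smallest_sub; first exact: sigma_algebra_measurable.
  by move=> _ [a ->]; exact: measurable_rectangle.
pose T := g_sigma_algebraType [set A : set 'rV[R]_m.+1 | exists a, A = rectangle a].
suff mid : measurable_fun setT (id : T -> borel_rV R m.+1).
  by have := mid measurableT A mA; rewrite setTI.
apply: (@measurable_rV R m.+1 _ T (fun x => x)) => k.
apply: (@measurability _ _ T R setT _ _ (RGenOInfty.measurableE R)) => _ [_ [b ->] <-].
rewrite setTI (_ : _ @^-1` _ = \bigcup_n rectangle (fun j => if j == k then b else - n%:R)).
  apply: bigcupT_measurable => n; apply: sub_sigma_algebra; by eexists; reflexivity.
apply/seteqP; split => x /=; rewrite in_itv /= andbT.
  move=> bx; exists (Num.trunc (\sum_j `|(x : 'rV[R]_m.+1) 0 j|)).+1 => // j.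
  case: eqP => [->//|_].
  have h := truncnS_gt (\sum_j `|(x : 'rV[R]_m.+1) 0 j|).
  have h2 : `|(x : 'rV[R]_m.+1) 0 j| <= \sum_j `|(x : 'rV[R]_m.+1) 0 j|.
    by rewrite (bigD1 j)//= lerDl sumr_ge0.
  have := ler_norm (- (x : 'rV[R]_m.+1) 0 j); rewrite normrN; lra.
by move=> [n _ /(_ k)]; rewrite eqxx.
Qed.

Lemma rectangleI a b : rectangle a `&` rectangle b = rectangle (fun k => Num.max (a k) (b k)).
Proof.
apply/seteqP; split => [x [xa xb] k|x h]; first by rewrite gt_max xa xb.
by split => k; have := h k; rewrite gt_max => /andP[].
Qed.

(** Continuous functions increasing to the indicator of the part of a
    rectangle at distance more than s from the origin. *)
Definition ramp (n : nat) (t : R) : R := Num.min 1 (n%:R * Num.max 0 t).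

Definition bump s a n (x : 'rV[R]_m.+1) : R :=
  ramp n (\sum_k Num.max 0 (`|x 0 k| - s)) * \prod_k ramp n (x 0 k - a k).

Lemma ramp01 n t : 0 <= ramp n t <= 1.
Proof. by rewrite /ramp ge_min lexx le_min ler01 mulr_ge0// le_max lexx. Qed.

Lemma ramp_le0 n t : t <= 0 -> ramp n t = 0.
Proof. by move=> t0; rewrite /ramp (max_idPl t0) mulr0 (min_idPr ler01). Qed.

Lemma ramp_homo t : {homo ramp ^~ t : n p / (n <= p)%N >-> n <= p}.
Proof.
move=> n p np; rewrite /ramp le_min ge_min lexx/= ge_min; apply/orP; right.
by rewrite ler_wpM2r ?ler_nat// le_max lexx.
Qed.

Lemma ramp_near1 t : 0 < t -> \forall n \near \oo, ramp n t = 1.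
Proof.
move=> t0; near=> n; rewrite /ramp (max_idPr (ltW t0)); apply/min_idPl.
rewrite -ler_pdivrMr// mul1r; near: n; exact: nbhs_infty_ger.
Unshelve. all: by end_near. Qed.

Let max0_continuous : continuous (fun t : R => Num.max 0 t).
Proof.
have -> : (fun t : R => Num.max 0 t) = (fun t => 2^-1 * (t + `|t|)).
  by apply/funext => t; rewrite maxr_absE add0r sub0r normrN mulrC.
move=> t; apply: cvgM; first exact: cvg_cst.
by apply: cvgD; [exact: cvg_id|exact: norm_continuous].
Qed.

Lemma ramp_continuous n : continuous (ramp n).
Proof.
have -> : ramp n = (fun t => 2^-1 * (1 + n%:R * Num.max 0 t - `|1 - n%:R * Num.max 0 t|)).
  by apply/funext => t; rewrite /ramp minr_absE mulrC.
have c1 : continuous (fun t : R => n%:R * Num.max 0 t).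
  by move=> t; apply: cvgM; [exact: cvg_cst|exact: max0_continuous].
move=> t; apply: cvgM; first exact: cvg_cst.
apply: cvgB; first by apply: cvgD; [exact: cvg_cst|exact: c1].
have c2 : (1 - n%:R * Num.max 0 x) @[x --> t] --> 1 - n%:R * Num.max 0 t.
  by apply: cvgB; [exact: cvg_cst|exact: c1].
exact: cvg_norm c2.
Qed.

Lemma continuous_big_sum (T : topologicalType) (I : Type) (r : seq I) (f : I -> T -> R) :
  (forall k, continuous (f k)) -> continuous (fun x => \sum_(k <- r) f k x).
Proof.
move=> cf; elim: r => [|k r IH].
  rewrite (_ : (fun x => _) = fun=> 0); first exact: cst_continuous.
  by apply/funext => y; rewrite big_nil.
rewrite (_ : (fun x => _) = fun x => f k x + \sum_(k <- r) f k x); last first.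
  by apply/funext => y; rewrite big_cons.
by move=> x; apply: cvgD; [exact: cf|exact: IH].
Qed.

Lemma continuous_big_prod (T : topologicalType) (I : Type) (r : seq I) (f : I -> T -> R) :
  (forall k, continuous (f k)) -> continuous (fun x => \prod_(k <- r) f k x).
Proof.
move=> cf; elim: r => [|k r IH].
  rewrite (_ : (fun x => _) = fun=> 1); first exact: cst_continuous.
  by apply/funext => y; rewrite big_nil.
rewrite (_ : (fun x => _) = fun x => f k x * \prod_(k <- r) f k x); last first.
  by apply/funext => y; rewrite big_cons.
by move=> x; apply: cvgM; [exact: cf|exact: IH].
Qed.

Lemma bump_continuous s a n : continuous (bump s a n).
Proof.
have cc k : continuous (fun x : 'rV[R]_m.+1 => x 0 k) by exact: coord_continuous.
have cr (f : 'rV[R]_m.+1 -> R) : continuous f -> continuous (fun x => ramp n (f x)).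
  by move=> cf x; apply: (continuous_comp (cf x)); exact: ramp_continuous.
have c1 : continuous (fun x : 'rV[R]_m.+1 => ramp n (\sum_k Num.max 0 (`|x 0 k| - s))).
  apply: cr; apply: continuous_big_sum => k x.
  have h : (`|y 0 k| - s) @[y --> x] --> `|x 0 k| - s.
    by apply: cvgB; [apply: cvg_norm; exact: cc|exact: cvg_cst].
  exact: (continuous_comp h (@max0_continuous _)).
have c2 : continuous (fun x : 'rV[R]_m.+1 => \prod_k ramp n (x 0 k - a k)).
  apply: continuous_big_prod => k; apply: cr => x.
  have h : ((y : 'rV[R]_m.+1) 0 k - a k) @[y --> x] --> x 0 k - a k.
    exact: (cvgB (cc k x) (cvg_cst _)).
  exact: h.
by move=> x; exact: (cvgM (c1 x) (c2 x)).
Qed.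

Lemma bump01 s a n x : 0 <= bump s a n x <= 1.
Proof.
have /andP[r0 r1] := ramp01 n (\sum_k Num.max 0 (`|x 0 k| - s)).
have p01 : 0 <= \prod_k ramp n (x 0 k - a k) <= 1.
  by rewrite prodr_ge0 ?prodr_ile1// => k _; case/andP: (ramp01 n (x 0 k - a k)) => // -> ->.
case/andP: p01 => p0 p1; by rewrite mulr_ge0//= mulr_ile1.
Qed.

Definition far_rV s : set (borel_rV R m.+1) := [set x : 'rV[R]_m.+1 | exists k, s < `|x 0 k|].

Lemma bump_eq0 s a n x : ~ (far_rV s `&` rectangle a) x -> bump s a n x = 0.
Proof.
move=> nx; have [fx|fx] := pselect (far_rV s x).
  have : ~ rectangle a x by move=> rx; apply: nx.
  move=> /existsNP[k /negP]; rewrite -leNgt => xk.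
  have p0 : \prod_k ramp n ((x : 'rV[R]_m.+1) 0 k - a k) = 0.
    by rewrite (bigD1 k)//= ramp_le0 ?mul0r// subr_le0.
  by rewrite /bump p0 mulr0.
rewrite /bump ramp_le0 ?mul0r// big1// => k _; apply/max_idPl; rewrite subr_le0 leNgt.
by apply/negP => h; apply: fx; exists k.
Qed.

Lemma bump_near1 s a x : (far_rV s `&` rectangle a) x -> \forall n \near \oo, bump s a n x = 1.
Proof.
move=> [[j xj] rx].
have h1 : \forall n \near \oo, ramp n (\sum_k Num.max 0 (`|x 0 k| - s)) = 1.
  apply: ramp_near1; rewrite (bigD1 j)//=; apply: ltr_pwDl.
    by rewrite lt_max subr_gt0 xj orbT.
  by apply: sumr_ge0 => k _; rewrite le_max lexx.
have h2 : \forall n \near \oo, forall k, ramp n (x 0 k - a k) = 1.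
  by apply: filter_forall => k; apply: ramp_near1; rewrite subr_gt0.
by apply: filterS2 h1 h2 => n e1 e2; rewrite /bump e1 big1 ?mulr1.
Qed.

Lemma bump_homo s a x : {homo (fun n => bump s a n x) : n p / (n <= p)%N >-> n <= p}.
Proof.
move=> n p np; apply: ler_pM; last first.
- by apply: ler_prod => k _; rewrite ramp_homo// andbT; case/andP: (ramp01 n (x 0 k - a k)).
- exact: ramp_homo.
- by apply: prodr_ge0 => k _; case/andP: (ramp01 n (x 0 k - a k)).
- by case/andP: (ramp01 n (\sum_k Num.max 0 (`|x 0 k| - s))).
Qed.
End rectangles.

Section marginals.
Context {R : realType} {dO} {Omega : measurableType dO} {P : probability Omega R}
  {dE} {E : measurableType dE} {Pi : R.-pker E ~> E} {Y : int -> {RV P >-> E}}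
  {g : {mfun E >-> R}} {X : int -> {RV P >-> R}} {alpha : R}
  {nu : forall i, {measure set (borel_punctured R i) -> \bar R}}
  {V : {mfun E >-> R}} {q0 : R} {u : nat -> R}.
Hypothesis drift : drift_assumption Pi Y g X alpha nu V q0 u.
Hypothesis u0 : forall n, 0 < u n.
Hypothesis ndu : nondecreasing_seq u.
Hypothesis uoo : u n @[n --> \oo] --> +oo.
Hypothesis aoo : n%:R * survival X (u n) @[n --> \oo] --> +oo.
Variable h : nat.

Local Notation D i := (@finite_points R i).

Section one_map.
Variables (i : nat) (W : borel_punctured R i -> borel_rV R h.+1) (s : R).
Hypothesis mW : measurable_fun setT W.
Hypothesis s0 : 0 < s.
Hypothesis Wfar : forall x, finite_points x -> far_rV s (W x) -> far s x.

Lemma measurable_far_rV : measurable (far_rV s : set (borel_rV R h.+1)).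
Proof.
have -> : far_rV s = \bigcup_(k in [set: 'I_h.+1])
   ((fun x : borel_rV R h.+1 => (x : 'rV[R]_h.+1) 0 k) @^-1` [set t | s < `|t|]).
  by apply/seteqP; split => x /= [k]; [exists k|move=> _; exists k].
apply: fin_bigcup_measurable => // k _.
rewrite -[X in measurable X]setTI; apply: measurable_coord_rV => //.
have -> : [set t : R | s < `|t|] = (@Num.norm R R) @^-1` `]s, +oo[%classic.
  by apply/seteqP; split => t /=; rewrite in_itv /= andbT.
by rewrite -[X in measurable X]setTI; exact: normr_measurable.
Qed.

Definition far_points : set (borel_punctured R i) := D i `&` W @^-1` far_rV s.

Lemma measurable_far_points : measurable far_points.
Proof.
apply: measurableI; first exact: measurable_finite_points.
by rewrite -[X in measurable X]setTI; apply: mW => //; exact: measurable_far_rV.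
Qed.

Lemma far_points_lty : (nu i far_points < +oo)%E.
Proof.
apply: le_lt_trans (rv_radon (drift_regvar drift) (compact_far s0)).
apply: le_measure; rewrite ?inE.
- exact: measurable_far_points.
- rewrite -[X in measurable X]setCK; apply: measurableC; apply: sub_sigma_algebra.
  exact/closed_openC/closed_far.
- by move=> x [fx wx]; exact: Wfar.
Qed.

Let bW a n x := (bump s a n (W x))%:E.

Let mbW a n : measurable_fun setT (bW a n).
Proof.
apply/measurable_EFinP; apply: measurableT_comp mW.
exact: measurable_continuous_rV (@bump_continuous _ _ s a n).
Qed.

Lemma bump_integral_fin_num a n : (\int[nu i]_(x in D i) bW a n x \is a fin_num)%E.
Proof.
have b0 x : (0 <= bW a n x)%E by rewrite lee_fin; case/andP: (bump01 s a n (W x)).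
rewrite ge0_fin_numE; last exact: integral_ge0.
apply: le_lt_trans far_points_lty.
rewrite -[leRHS]mul1e -integral_cst; last exact: measurable_far_points.
rewrite [leRHS]integral_mkcond [leLHS]integral_mkcond.
have m1 : measurable_fun setT (bW a n \_ (D i) : borel_punctured R i -> \bar R).
  apply/(measurable_restrictT _ _).1; first exact: measurable_finite_points.
  exact: measurable_funTS.
have m2 : measurable_fun setT (cst 1%E \_ far_points : borel_punctured R i -> \bar R).
  by apply/(measurable_restrictT _ _).1; [exact: measurable_far_points|exact: measurable_cst].
apply: ge0_le_integral; [exact: measurableT|by move=> x _; rewrite patchE; case: ifP|exact: m1|exact: m2|].
move=> x _; rewrite !patchE; case: ifPn => fx; last by case: ifP.
case: ifPn => wx; first by rewrite lee_fin; case/andP: (bump01 s a n (W x)).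
rewrite /bW bump_eq0// => -[h1 h2]; move/negP: wx; apply; rewrite inE; split => //.
by move: fx; rewrite inE.
Qed.

(** Monotone convergence. *)
Lemma bump_integral_cvg a : (\int[nu i]_(x in D i) bW a n x)%E @[n --> \oo] -->
  nu i (far_points `&` W @^-1` rectangle a).
Proof.
have mA : measurable (W @^-1` (far_rV s `&` rectangle a)).
  rewrite -[X in measurable X]setTI; apply: mW => //; apply: measurableI; first exact: measurable_far_rV.
  exact: measurable_rectangle.
have -> : nu i (far_points `&` W @^-1` rectangle a) =
   (\int[nu i]_(x in D i) (\1_(W @^-1` (far_rV s `&` rectangle a)) x)%:E)%E.
  rewrite integral_indic//; last exact: measurable_finite_points.
  by congr (nu i _); apply/seteqP; split => x /= [[? ?] ?].
have mono := @cvg_monotone_convergence _ _ R (nu i) (D i) (@measurable_finite_points R i) (bW a).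
have lim : forall x, limn (bW a ^~ x) = (\1_(W @^-1` (far_rV s `&` rectangle a)) x)%:E.
  move=> x; apply/cvg_lim => //; rewrite indicE; case: (boolP (x \in _)) => xA.
    move: xA; rewrite inE /= => xA; apply: cvg_near_cst.
    by apply: filterS (bump_near1 xA) => n; rewrite /bW => ->.
  apply: cvg_near_cst; apply: nearW => n; rewrite /bW bump_eq0//.
  by move: xA; rewrite notin_setE.
under eq_integral do rewrite -lim.
apply: mono.
- by move=> n; exact: measurable_funTS.
- by move=> n x _; rewrite lee_fin; case/andP: (bump01 s a n (W x)).
- by move=> x _ n p np; rewrite lee_fin; exact: bump_homo.
Qed.
End one_map.

Lemma continuous_window i a : continuous (fun x : 'rV[R]_i.+1 => window a h x).
Proof.
move=> x U /nbhs_rVP[e e0 eU]; apply/nbhs_rVP; exists e => // y xy.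
by apply: eU => k; rewrite !mxE.
Qed.

Lemma measurable_window i a :
  measurable_fun setT ((fun x : 'rV[R]_i.+1 => window a h x) : borel_rV R i.+1 -> borel_rV R h.+1).
Proof.
apply: measurable_rV => k.
rewrite (_ : (fun _ => _) = (fun x : borel_rV R i.+1 => (x : 'rV[R]_i.+1) 0 (inord (a + k)))).
  exact: measurable_coord_rV.
by apply/funext => x; rewrite mxE.
Qed.

Let far_limit i (psi : 'rV[R]_i.+1 -> R) (s : R) : 0 < s -> continuous psi ->
  (forall x, 0 <= psi x <= 1) -> (forall x, ~ far_rV s x -> psi x = 0) ->
  \int[P]_w psi (scaled_block (X := X) u i n w) / survival X (u n) @[n --> \oo] -->
  \int[nu i]_(x in D i) psi (real_coords x).
Proof.
move=> s0 cpsi p01 pfar.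
have sq : 0 < s `^ q0 by rewrite powR_gt0.
have q00 : 0 < q0 by have /andP[] := drift_q0 drift.
have S0 x : 0 <= tail_power_sum q0 s x :> R by apply: sumr_ge0 => k _; exact: tail_power_ge0.
have b x : psi x <= (s `^ q0)^-1 * tail_power_sum q0 s x.
  have [[k sk]|nf] := pselect (far_rV s x); last by rewrite pfar// mulr_ge0// invr_ge0 ltW.
  apply: (@le_trans _ _ 1); first by case/andP: (p01 x).
  rewrite mulrC ler_pdivlMr// mul1r /tail_power_sum (bigD1 k)//=.
  apply: (@le_trans _ _ (tail_power q0 s (x 0 k))).
    by rewrite /tail_power ifT// mulr1 ge0_ler_powR// ?nnegrE// ltW.
  by rewrite lerDl; apply: sumr_ge0 => j _; exact: tail_power_ge0.
apply: (exponent_limit drift u0 ndu uoo aoo (C := (s `^ q0)^-1) (s := s) (kap := 1)) => //.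
- exact: measurable_continuous_rV.
- by rewrite invr_gt0.
- by move=> x; rewrite ger0_norm//; case/andP: (p01 x).
- move=> x; have /andP[p0 p1] := p01 x; apply: le_trans (b x).
  by rewrite ger0_norm// -[1 + 1]/(2%:R) powR_mulrn// expr2 ler_piMl.
- by apply: aeW => x _; exact: cpsi.
Qed.

Lemma window_scaled_block i n w : (h <= i)%N ->
  window 0 h (scaled_block (X := X) u i n w) = scaled_block (X := X) u h n w.
Proof.
move=> hi; apply/rowP => k; rewrite /scaled_block !mxE !add0r; congr (_ * X _ w).
have ki : (k < i.+1)%N by rewrite ltnS (leq_trans _ hi)// -ltnS.
by rewrite add0n inordK.
Qed.

Variables (i : nat) (hi : (h <= i)%N).
Let W (x : borel_punctured R i) : borel_rV R h.+1 := window 0 h (real_coords x).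
Let rc (x : borel_punctured R h) : borel_rV R h.+1 := real_coords x.
Let mW : measurable_fun setT W.
Proof. by have := measurableT_comp (@measurable_window i 0) (@measurable_real_coords R i); exact. Qed.
Let mrc : measurable_fun setT rc. Proof. exact: measurable_real_coords. Qed.

Let far_real s j (x : punctured R j) k : finite_points x -> s < `|real_coords x 0 k| -> far s x.
Proof.
move=> fx sx; exists k; rewrite -(fineK (fx k)) lee_fin ltW//.
by move: sx; rewrite mxE.
Qed.

Let Wfar s x : finite_points x -> far_rV s (W x) -> far s x.
Proof. by move=> fx [k]; rewrite mxE => /far_real; exact. Qed.
Let rcfar s x : finite_points x -> far_rV s (rc x) -> far s x.
Proof. by move=> fx [k] /far_real; exact. Qed.

Let same_integral s a n : 0 < s ->
  (\int[nu i]_(x in D i) (bump s a n (W x))%:E =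
   \int[nu h]_(x in D h) (bump s a n (rc x))%:E)%E.
Proof.
move=> s0.
rewrite -(fineK (bump_integral_fin_num mW s0 (Wfar (s := s)) a n)).
rewrite -(fineK (bump_integral_fin_num mrc s0 (rcfar (s := s)) a n)); congr EFin.
have cb := @bump_continuous R h s a n.
have h1 := @far_limit h (bump s a n) s s0 cb (fun x => bump01 s a n x) _.
have h2 := @far_limit i (fun x => bump s a n (window 0 h x)) s s0 _ (fun x => bump01 s a n _) _.
have e : (fun p => \int[P]_w bump s a n (window 0 h (scaled_block (X := X) u i p w)) / survival X (u p)) =
    (fun p => \int[P]_w bump s a n (scaled_block (X := X) u h p w) / survival X (u p)).
  apply/funext => p; congr (_ / _); apply: eq_Rintegral => w _.
  by rewrite window_scaled_block.
rewrite e in h2; apply: (cvg_unique _ (h2 _ _) (h1 _)) => //.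
- by move=> x; exact: (continuous_comp (@continuous_window i 0 x) (cb _)).
- move=> x nf; apply: bump_eq0 => -[[k sk] _]; apply: nf.
  by exists (inord (0 + k)); rewrite mxE in sk.
- by move=> x nf; apply: bump_eq0 => -[].
Qed.

(** Both integrals of a bump are the limit of the same expectation, because the
    window of a scaled block is a scaled block. So the two measures agree on
    rectangles, which form a pi-system that generates the Borel sets. *)
Lemma marginal_measure s (A : set (borel_rV R h.+1)) : 0 < s -> measurable A ->
  nu i (far_points W s `&` W @^-1` A) = nu h (far_points rc s `&` rc @^-1` A).
Proof.
move=> s0 mA.
have mf1 := measurable_far_points s mW.
have mf2 := measurable_far_points s mrc.
pose m1 := pushforward (mrestr (nu i) mf1) W.
pose m2 := pushforward (mrestr (nu h) mf2) rc.
pose G : set (set (borel_rV R h.+1)) := [set A | exists a, A = rectangle a].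
have cover : \bigcup_(n in [set: nat]) rectangle (fun _ : 'I_h.+1 => - n%:R : R) = setT.
  apply/seteqP; split => x // _.
  exists (Num.trunc (\sum_j `|(x : 'rV[R]_h.+1) 0 j|)).+1 => // j.
  have h1 := truncnS_gt (\sum_j `|(x : 'rV[R]_h.+1) 0 j|).
  have h2 : `|(x : 'rV[R]_h.+1) 0 j| <= \sum_j `|(x : 'rV[R]_h.+1) 0 j|.
    by rewrite (bigD1 j)//= lerDl sumr_ge0.
  have := ler_norm (- (x : 'rV[R]_h.+1) 0 j); rewrite normrN; lra.
have eqG A' : G A' -> m1 A' = m2 A'.
  move=> [a ->]; rewrite /m1 /m2 /pushforward /mrestr setIC [X in _ = nu h X]setIC.
  have c1 : (\int[nu i]_(x in D i) (bump s a n (W x))%:E)%E @[n --> \oo] -->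
      nu i (far_points W s `&` W @^-1` rectangle a) by exact: bump_integral_cvg.
  have c2 : (\int[nu h]_(x in D h) (bump s a n (rc x))%:E)%E @[n --> \oo] -->
      nu h (far_points rc s `&` rc @^-1` rectangle a) by exact: bump_integral_cvg.
  rewrite (_ : (fun n => _) = (fun n => \int[nu h]_(x in D h) (bump s a n (rc x))%:E)%E) in c1.
    exact: cvg_unique c1 c2.
  by apply/funext => n; exact: same_integral.
have fin n : (m1 (rectangle (fun _ : 'I_h.+1 => - (n%:R : R))%R) < +oo)%E.
  apply: le_lt_trans (far_points_lty mW s0 (Wfar (s := s))).
  apply: le_measure; rewrite ?inE //.
  by apply: measurableI => //; rewrite -[X in measurable X]setTI; apply: mW => //; exact: measurable_rectangle.
have GI : setI_closed G.
  by move=> _ _ [a ->] [b ->]; rewrite rectangleI; eexists.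
have Gr n : G (rectangle (fun _ : 'I_h.+1 => - n%:R : R)) by eexists.
have := @measure_unique _ R (borel_rV R h.+1) G _ rectangle_generates GI Gr cover m1 m2 eqG fin A mA.
move=> /(_ mW mrc).
by rewrite /m1 /m2 /pushforward /mrestr setIC [X in _ = nu h X]setIC.
Qed.

Lemma open_far_rV s (z : 'rV[R]_h.+1) : far_rV s z -> \forall y \near z, far_rV s y.
Proof.
move=> [k sk]; apply/nbhs_rVP; exists (`|z 0 k| - s); first by rewrite subr_gt0.
move=> y zy; exists k; have := zy k; have := ler_normD (y 0 k) (z 0 k - y 0 k).
rewrite addrC subrK; lra.
Qed.

Lemma nbhs_of_finite_coords j (x : punctured R j) (U : set (punctured R j)) :
  finite_points x -> nbhs x U -> exists2 e : R, 0 < e &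
  forall y, finite_points y -> (forall k, `|real_coords x 0 k - real_coords y 0 k| < e) -> U y.
Proof.
move=> fx; rewrite nbhsE => -[B [[V' oV VB] Bx] BU].
have nV : nbhs (coords x) V' by apply: open_nbhs_nbhs; split => //; rewrite -VB in Bx.
have [Q hQ QV] := nV.
have ex k : exists2 e : R, 0 < e & forall t, `|real_coords x 0 k - t| < e -> Q ord0 k t%:E.
  have := hQ ord0 k; rewrite (_ : coords x ord0 k = (real_coords x 0 k)%:E); last first.
    by rewrite mxE fineK.
  by rewrite /nbhs /= => /nbhs_ballP[e /= e0 he]; exists e => // t; exact: he.
have ex' k : exists e : R, 0 < e /\ forall t, `|real_coords x 0 k - t| < e -> Q ord0 k t%:E.
  by have [e e0 he] := ex k; exists e.
have [ee eeP] := choice ex'.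
exists (\big[Num.min/1]_k ee k).
  by apply: lt_bigmin => // k _; case: (eeP k).
move=> y fy xy; apply: BU; rewrite -VB; apply: QV => a k; rewrite (ord1 a).
rewrite -(fineK (fy k)); apply: (eeP k).2.
have := xy k; rewrite [real_coords y 0 k]mxE => h1; apply: lt_le_trans h1 _.
exact: bigmin_le_cond.
Qed.

(** Away from the origin the finite points are the real vectors, up to a Borel
    isomorphism. So a null set of the punctured space becomes a Borel set of
    vectors, to which the equality of the marginals applies. *)
Lemma ae_marginal (s : R) (Q : 'rV[R]_h.+1 -> Prop) : 0 < s ->
  (forall z, ~ far_rV s z -> Q z) ->
  {ae nu h, forall x : punctured R h, finite_points x -> Q (real_coords x)} ->
  {ae nu i, forall x : punctured R i, finite_points x -> Q (window 0 h (real_coords x))}.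
Proof.
move=> s0 near0 [N [mN N0 NQ]].
have exl z : exists x : punctured R h, far_rV s z -> coords x = map_mx EFin z.
  have [[k sk]|nf] := pselect (far_rV s z); last by exists point.
  have [|x ex] := @punctured_lift R h (map_mx EFin z) k; last by exists x.
  by rewrite mxE eqe -normr_gt0 (lt_trans s0).
have [e eP] := choice exl.
have fe z : far_rV s z -> finite_points (e z) /\ real_coords (e z) = z.
  move=> fz; split; first by move=> k; rewrite (eP z fz) mxE.
  by apply/rowP => k; rewrite mxE (eP z fz) mxE.
have mF := @measurable_far_rV s.
have me : measurable_fun (far_rV s) (e : borel_rV R h.+1 -> borel_punctured R h).
  apply: (@measurability _ _ (borel_rV R h.+1) (borel_punctured R h) (far_rV s) e (@open (punctured R h))) => // _ [U oU <-].
  apply: sub_sigma_algebra; rewrite openE => z [fz Uz].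
  have [fez rez] := fe z fz.
  have [d d0 dU] := nbhs_of_finite_coords fez (open_nbhs_nbhs (conj oU Uz)).
  have n1 := open_far_rV fz.
  have n2 : \forall y \near z, forall k, `|z 0 k - (y : 'rV[R]_h.+1) 0 k| < d by apply/nbhs_rVP; exists d.
  apply: filterS2 n1 n2 => y fy zy; split => //.
  have [fey rey] := fe y fy; apply: dU => // k; rewrite rez rey; exact: zy.
pose B := far_rV s `&` e @^-1` N.
have mB : measurable B by exact: me.
exists (far_points W s `&` W @^-1` B); split.
- apply: measurableI; first exact: measurable_far_points.
  by rewrite -[X in measurable X]setTI; exact: mW.
- rewrite marginal_measure//; apply/eqP; rewrite eq_le measure_ge0 andbT -N0.
  apply: le_measure; rewrite ?inE //.
    apply: measurableI; first exact: measurable_far_points.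
    by rewrite -[X in measurable X]setTI; exact: mrc.
  move=> x [[fx sx] [_ /= Nx]]; suff <- : e (rc x) = x by [].
  apply: coords_inj; rewrite (eP _ sx); apply/rowP => k; rewrite !mxE fineK//; exact: fx.
move=> x nQ; have [fx nQx] : finite_points x /\ ~ Q (window 0 h (real_coords x)).
  by move: nQ => /= /not_implyP.
have fz : far_rV s (W x) by apply: contrapT => nf; apply: nQx; exact: near0.
split; first by split.
split => //=; apply: NQ => /= hh; apply: nQx.
by have [f1 f2] := fe _ fz; have := hh f1; rewrite f2.
Qed.
End marginals.

(** * The spaces of test functions and the limit covariances *)

Section test_functions.
Context {R : realType} {h : nat}
  {nu : forall i, {measure set (borel_punctured R i) -> \bar R}} {N : 'rV[R]_h.+1 -> R}.
Hypothesis nN : is_norm N.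

Lemma calL_le q q' phi : 0 <= q -> q <= q' -> calL nu N q phi -> calL nu N q' phi.
Proof.
move=> q0 qq' [mphi [e e0 b] cphi]; split => //; exists e => // x.
apply: le_trans (b x) _; rewrite ler_wpM2r//; first by case: ifP.
apply: ler_wpM2l; first by rewrite invr_ge0 ltW.
rewrite ge_max le_max [1 <= _]le_max lexx orbT andbT.
have [N1|N1] := leP 1 (N x); first by rewrite ler_powR.
have e1 : (1 : R) `^ q = 1 by rewrite powR1.
apply/orP; right; rewrite -[leRHS]e1 ge0_ler_powR ?nnegrE ?(ltW N1)//.
exact: is_norm_ge0.
Qed.

Lemma calL0 q : calL nu N q (fun=> 0).
Proof.
split; first exact: measurable_cst.
  exists 1 => // x; rewrite normr0 invr1 mul1r mulr_ge0//; last by case: ifP.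
by move=> j; apply: aeW => x _; exact: cst_continuous.
Qed.

(** A smaller [eps] both enlarges the constant and the support. *)
Lemma calLD q phi psi a : calL nu N q phi -> calL nu N q psi ->
  calL nu N q (fun x => phi x + a * psi x).
Proof.
move=> [m1 [e1 e10 b1] c1] [m2 [e2 e20 b2] c2]; split.
- by apply: measurable_funD => //; apply: measurable_funM => //; exact: measurable_cst.
- pose C := e1^-1 + `|a| * e2^-1.
  have C0 : 0 < C by rewrite ltr_wpDr ?mulr_ge0 ?invr_gt0// invr_ge0 ltW.
  pose e := Num.min C^-1 (Num.min e1 e2).
  have e0 : 0 < e by rewrite !lt_min invr_gt0 C0 e10.
  have eC : C <= e^-1 by rewrite -[C]invrK lef_pV2 ?posrE ?invr_gt0// /e ge_min lexx.
  have ee1 : e <= e1 by rewrite /e !ge_min lexx orbT.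
  have ee2 : e <= e2 by rewrite /e !ge_min lexx !orbT.
  exists e => // x; set M := Num.max _ _.
  have M0 : 0 <= M by rewrite /M le_max ler01 orbT.
  have ind e' : e <= e' -> (if e' < N x then 1 else 0 : R) <= (if e < N x then 1 else 0 : R).
    by move=> le; case: ifP => [h1|_]; [rewrite (le_lt_trans le h1)|case: ifP].
  set I := (X in _ <= _ * X).
  have I0 : 0 <= I by rewrite /I; case: ifP.
  have k1 : `|phi x| <= e1^-1 * M * I.
    by apply: le_trans (b1 x) _; rewrite ler_wpM2l ?ind// mulr_ge0// invr_ge0 ltW.
  have k2 : `|psi x| <= e2^-1 * M * I.
    by apply: le_trans (b2 x) _; rewrite ler_wpM2l ?ind// mulr_ge0// invr_ge0 ltW.
  apply: le_trans (ler_normD _ _) _; rewrite normrM.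
  apply: le_trans (lerD k1 (ler_wpM2l (normr_ge0 a) k2)) _.
  have -> : e1^-1 * M * I + `|a| * (e2^-1 * M * I) = C * M * I by rewrite /C; ring.
  by rewrite ler_wpM2r// ler_wpM2r.
- move=> j; apply: negligibleS (negligibleU (c1 j) (c2 j)) => x nQ.
  apply: contrapT => /not_orP[/contrapT h1 /contrapT h2]; apply: nQ => fx.
  exact: (cvgD (h1 fx) (cvgM (cvg_cst a) (h2 fx))).
Qed.

Lemma calL_sum q (I : Type) (r : seq I) (t : I -> R) (phi : I -> 'rV[R]_h.+1 -> R) :
  (forall k, calL nu N q (phi k)) -> calL nu N q (fun x => \sum_(k <- r) t k * phi k x).
Proof.
move=> hphi; elim: r => [|k r IH].
  rewrite (_ : (fun x => _) = fun=> 0); first exact: calL0.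
  by apply/funext => x; rewrite big_nil.
rewrite (_ : (fun x => _) = fun x => \sum_(k <- r) t k * phi k x + t k * phi k x).
  exact: calLD.
by apply/funext => x; rewrite big_cons addrC.
Qed.
End test_functions.

Section limit_covariances.
Context {R : realType} {dO} {Omega : measurableType dO} {P : probability Omega R}
  {dE} {E : measurableType dE} {Pi : R.-pker E ~> E} {Y : int -> {RV P >-> E}}
  {g : {mfun E >-> R}} {X : int -> {RV P >-> R}} {alpha : R}
  {nu : forall i, {measure set (borel_punctured R i) -> \bar R}}
  {V : {mfun E >-> R}} {q0 : R} {u : nat -> R}.
Hypothesis drift : drift_assumption Pi Y g X alpha nu V q0 u.
Hypothesis u0 : forall n, 0 < u n.
Hypothesis ndu : nondecreasing_seq u.
Hypothesis uoo : u n @[n --> \oo] --> +oo.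
Hypothesis aoo : n%:R * survival X (u n) @[n --> \oo] --> +oo.
Local Notation F n := (survival X (u n)).
Local Notation Z i := (scaled_block (X := X) u i).
Context {h : nat} {N : 'rV[R]_h.+1 -> R}.
Hypothesis nN : is_norm N.
Variables q delta : R.
Hypothesis q_ge0 : 0 <= q.
Hypothesis delta0 : 0 < delta.
Hypothesis qd : q * (2 + delta) <= q0.

Let q00 : 0 < q0. Proof. by have /andP[] := drift_q0 drift. Qed.

(** The summands of the limit variance; the entry 0 is its first term. *)
Definition window_corr (phi : 'rV[R]_h.+1 -> R) (d : nat) : R :=
  \int[nu (d + h)%N]_(x in @finite_points R (d + h))
    (phi (window 0 h (real_coords x)) * phi (window d h (real_coords x))).

Lemma window_id (x : 'rV[R]_h.+1) : window 0 h x = x.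
Proof. by apply/rowP => k; rewrite mxE add0n inord_val. Qed.

Lemma tail_power_sum_window i a s (x : 'rV[R]_i.+1) :
  tail_power_sum q0 s (window a h x) <= h.+1%:R * tail_power_sum q0 s x.
Proof.
rewrite [X in X <= _]/tail_power_sum.
apply: (@le_trans _ _ (\sum_(k < h.+1) tail_power_sum q0 s x)).
  apply: ler_sum => k _; rewrite mxE /tail_power_sum (bigD1 (inord (a + k)))//= lerDl.
  by apply: sumr_ge0 => j _; exact: tail_power_ge0.
by rewrite sumr_const card_ord -[leLHS]mulr_natl.
Qed.

Lemma pair_phi_window phi n d w :
  pair_phi (g := g) (u := u) phi n (path_from Y 0 (d + h) w) =
  phi (window 0 h (Z (d + h) n w)) * phi (window d h (Z (d + h) n w)).
Proof.
have E1 a : path_phi (g := g) (u := u) phi n (subpath h a (path_from Y 0 (d + h) w)) =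
    phi (window a h (Z (d + h) n w)).
  rewrite /path_phi; congr phi; apply/rowP => k; rewrite !mxE !tnth_mktuple.
  by rewrite (drift_observable drift).
by rewrite /pair_phi !E1.
Qed.

(** The continuity condition concerns the last [h + 1] coordinates of each
    exponent measure. For the first ones it is transferred from the exponent
    measure of a single block; near the origin [phi] vanishes. *)
Lemma ae_continuous_window phi d : calL nu N q phi ->
  {ae nu (d + h)%N, forall x : punctured R (d + h), finite_points x ->
      {for window 0 h (real_coords x), continuous phi}}.
Proof.
move=> Lphi.
have [C [s [C0 s0 hb]]] := growth_tail_power nN q00 q_ge0 delta0 qd (calL_growth Lphi).
have s2 : 0 < s / 2 by lra.
apply: (ae_marginal drift u0 ndu uoo aoo (leq_addl d h) (s := s / 2) (Q := fun z => {for z, continuous phi}) s2).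
  move=> z nz.
  have zs k : `|z 0 k| <= s / 2 by rewrite leNgt; apply/negP => hz; apply: nz; exists k.
  have phi0 y : (forall k, `|(y : 'rV[R]_h.+1) 0 k| <= s) -> phi y = 0.
    move=> ys; have [_ _ b] := hb y; apply/eqP; rewrite -normr_le0; apply: le_trans b _.
    rewrite /tail_power_sum big1 ?mulr0// => k _.
    by rewrite /tail_power ltNge ys mulr0.
  apply: (@near_cst_continuous _ _ 0).
  have : \forall y \near z, forall k, `|z 0 k - (y : 'rV[R]_h.+1) 0 k| < s / 2.
    by apply/nbhs_rVP; exists (s / 2).
  apply: filterS => y zy; apply: phi0 => k.
  have := zy k; have := zs k; have := ler_normB (z 0 k) (z 0 k - y 0 k).
  rewrite opprB addrCA subrr addr0; lra.
apply: negligibleS (calL_continuity Lphi 0) => x nQ hP; apply: nQ => fx.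
have := hP fx; rewrite (_ : (fun z => phi _) = phi)//.
by apply/funext => z; rewrite window_id.
Qed.

(** The product of two blocks inherits from [phi] the domination by tail powers
    and, with the exponent [1 + delta / 2], the moment of order [2 + delta]. *)
Theorem pair_limit phi d : calL nu N q phi ->
  \int[P]_w pair_phi (g := g) (u := u) phi n (path_from Y 0 (d + h) w) / F n
     @[n --> \oo] --> window_corr phi d.
Proof.
move=> Lphi.
have [C [s [C0 s0 hb]]] := growth_tail_power nN q00 q_ge0 delta0 qd (calL_growth Lphi).
pose psi (x : 'rV[R]_(d + h).+1) := phi (window 0 h x) * phi (window d h x).
have -> : (fun n => \int[P]_w pair_phi (g := g) (u := u) phi n (path_from Y 0 (d + h) w) / F n) =
   (fun n => \int[P]_w psi (Z (d + h) n w) / F n).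
  by apply/funext => n; congr (_ / _); apply: eq_Rintegral => w _; rewrite pair_phi_window.
have bnd a x : [/\ `|phi (window a h x)| `^ (2 + delta) <= C * h.+1%:R * tail_power_sum q0 s x &
    phi (window a h x) ^+ 2 <= C * h.+1%:R * tail_power_sum q0 s (x : 'rV[R]_(d + h).+1)].
  have [b1 b2 _] := hb (window a h x).
  have b3 := ler_wpM2l (ltW C0) (tail_power_sum_window a s x).
  by rewrite -!mulrA; split; [exact: le_trans b1 _|exact: le_trans b2 _].
have d2 : 0 < delta / 2 by rewrite divr_gt0.
apply: (exponent_limit drift u0 ndu uoo aoo (psi := psi) (C := C * h.+1%:R) (s := s) (kap := delta / 2)) => //.
- apply: measurable_funM; apply: (measurableT_comp (calL_measurable Lphi)); exact: measurable_window.
- by rewrite mulr_gt0.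
- move=> x; have [_ k1] := bnd 0%N x; have [_ k2] := bnd d x.
  rewrite /psi normrM; have := sqr_ge0 (`|phi (window 0 h x)| - `|phi (window d h x)|).
  rewrite sqrrB !real_normK ?num_real//; lra.
- move=> x; have [k1 _] := bnd 0%N x; have [k2 _] := bnd d x.
  have key (a b : R) : 0 <= a -> a <= b -> (a * b) `^ (1 + delta / 2) <= b `^ (2 + delta).
    move=> a0 ab; have b0 : 0 <= b by exact: le_trans ab.
    have -> : b `^ (2 + delta) = (b ^+ 2) `^ (1 + delta / 2).
      by rewrite -powR_mulrn// -powRrM; congr (_ `^ _); field.
    apply: ge0_ler_powR; rewrite ?nnegrE ?sqr_ge0 ?(mulr_ge0 a0 b0)//.
      by rewrite addr_ge0// ltW.
    by rewrite expr2 ler_wpM2r.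
  rewrite /psi normrM; have [le|le] := leP `|phi (window 0 h x)| `|phi (window d h x)|.
    exact: le_trans (key _ _ (normr_ge0 _) le) k2.
  by rewrite mulrC; exact: le_trans (key _ _ (normr_ge0 _) (ltW le)) k1.
have c1 := ae_continuous_window d Lphi; have c2 := calL_continuity Lphi d.
apply: negligibleS (negligibleU c1 c2) => x nQ.
apply: contrapT => /not_orP[/contrapT h1 /contrapT h2]; apply: nQ => fx.
have c := continuous_comp (@continuous_window R h _ 0 (real_coords x)) (h1 fx).
exact: (cvgM c (h2 fx)).
Qed.
End limit_covariances.

(** * Finite-dimensional limits *)

Lemma cvg_finite_sum (R : realType) (I : Type) (r : seq I) (f : nat -> I -> R) (l : I -> R) :
  (forall k, f n k @[n --> \oo] --> l k) ->
  \sum_(k <- r) f n k @[n --> \oo] --> \sum_(k <- r) l k.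
Proof.
move=> fl; elim: r => [|k r IH].
  rewrite big_nil (_ : (fun n => _) = fun=> 0); first exact: cvg_cst.
  by apply/funext => n; rewrite big_nil.
rewrite big_cons (_ : (fun n => _) = fun n => f n k + \sum_(j <- r) f n j).
  by apply: cvgD.
by apply/funext => n; rewrite big_cons.
Qed.

Section tail_process_limit.
Context {R : realType} {dO} {Omega : measurableType dO} {P : probability Omega R}
  {dE} {E : measurableType dE} {Pi : R.-pker E ~> E} {Y : int -> {RV P >-> E}}
  {g : {mfun E >-> R}} {X : int -> {RV P >-> R}} {alpha : R}
  {nu : forall i, {measure set (borel_punctured R i) -> \bar R}}
  {V : {mfun E >-> R}} {q0 : R} {u : nat -> R}.
Hypothesis drift : drift_assumption Pi Y g X alpha nu V q0 u.
Hypothesis u0 : forall n, 0 < u n.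
Hypothesis ndu : nondecreasing_seq u.
Hypothesis uoo : u n @[n --> \oo] --> +oo.
Hypothesis aoo : n%:R * survival X (u n) @[n --> \oo] --> +oo.
Local Notation F n := (survival X (u n)).
Context {h : nat} {N : 'rV[R]_h.+1 -> R}.
Hypothesis nN : is_norm N.
Variables q delta eta : R.
Hypothesis q_ge0 : 0 <= q.
Hypothesis delta0 : 0 < delta.
Hypothesis qd : q * (2 + delta) <= q0.
Hypothesis eta0 : 0 < eta.
Hypothesis logF : ln n%:R `^ (1 + eta) * F n @[n --> \oo] --> (0 : R).

Let q00 : 0 < q0. Proof. by have /andP[] := drift_q0 drift. Qed.
Local Notation wc := (window_corr (nu := nu) (h := h)).
Local Notation xi phi := (block_phi (P := P) (X := X) (u := u) phi).
Local Notation mean phi n := (\int[P]_w path_phi (g := g) (u := u) phi n (path_from Y 0 h w)).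

Definition block_sum (phi : 'rV[R]_h.+1 -> R) n (w : Omega) : R :=
  psum (normalized (xi phi n) (mean phi n) (Num.sqrt (n%:R * F n))) n w.

Lemma intg_calL_sqr phi n j : calL nu N q phi -> intg P (fun w => xi phi n j w ^+ 2).
Proof.
move=> Lphi.
have [C [s [C0 s0 hb]]] := growth_tail_power nN q00 q_ge0 delta0 qd (calL_growth Lphi).
apply: (intg_block_phi_sqr drift u0 ndu (calL_measurable Lphi) C0 (s := s)).
by move=> x; have [] := hb x.
Qed.

Lemma measurable_calL phi n j : calL nu N q phi -> measurable_fun setT (xi phi n j).
Proof. by move=> Lphi; exact: (measurable_block_phi drift (calL_measurable Lphi)). Qed.

Lemma intg_calL phi n j : calL nu N q phi -> intg P (xi phi n j).
Proof. by move=> L; apply: intg_of_sqr; [exact: measurable_calL|exact: intg_calL_sqr]. Qed.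

Lemma window_corr0 phi : wc phi 0 = \int[nu h]_(x in @finite_points R h) (phi (real_coords x) ^+ 2).
Proof. by apply: eq_Rintegral => x _; rewrite !window_id expr2. Qed.

Lemma sigma2E phi : sigma2 nu phi = wc phi 0 + 2 * \big[+%R/0]_(1 <= j <oo) wc phi j.
Proof. by rewrite window_corr0. Qed.

Lemma block_sum_clt phi : calL nu N q phi ->
  [/\ exists M, \forall n \near \oo, \int[P]_w (block_sum phi n w ^+ 2) <= M,
      cvgn (fun n => \sum_(1 <= j < n) wc phi j) &
      forall x, \int[P]_w cos (block_sum phi n w + x) @[n --> \oo] -->
        expR (- (sigma2 nu phi / 2)) * cos x].
Proof.
move=> Lphi.
have [C [s [C0 s0 hb]]] := growth_tail_power nN q00 q_ge0 delta0 qd (calL_growth Lphi).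
have [h1 h2 h3] := block_clt drift u0 ndu aoo eta0 logF (calL_measurable Lphi) C0 s0 delta0 hb
  (fun d => pair_limit drift u0 ndu uoo aoo nN q_ge0 delta0 qd Lphi).
have e : sigma2 nu phi / 2 = 2^-1 * wc phi 0 + \big[+%R/0]_(1 <= j <oo) wc phi j.
  by rewrite sigma2E; field.
by rewrite e.
Qed.

(** The limit covariance is defined by polarization, so its bilinearity has to be
    proved. At finite [n] the correlations are quadratic forms in the test
    function and satisfy the polarization identity exactly. It passes to the
    limit in [n], and then in the number of terms of the series. *)
Section combination.
Variables (m : nat) (phi : 'I_m -> 'rV[R]_h.+1 -> R) (t : 'I_m -> R).
Hypothesis Lphi : forall k, calL nu N q (phi k).
Let comb x := \sum_k t k * phi k x.

Let Lcomb : calL nu N q comb. Proof. exact: calL_sum. Qed.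
Let LD k l : calL nu N q (phi k \+ phi l).
Proof.
have := calLD 1 (Lphi k) (Lphi l); congr calL.
by apply/funext => x; rewrite mul1r.
Qed.

Let polarized (Q : ('rV[R]_h.+1 -> R) -> R) :=
  \sum_k \sum_l t k * t l * (2^-1 * (Q (phi k \+ phi l) - Q (phi k) - Q (phi l))).

Let cvg_polarized (Q : nat -> ('rV[R]_h.+1 -> R) -> R) (L : ('rV[R]_h.+1 -> R) -> R) :
  (forall f, calL nu N q f -> Q n f @[n --> \oo] --> L f) ->
  polarized (Q n) @[n --> \oo] --> polarized L.
Proof.
move=> QL; apply: cvg_finite_sum => k; apply: cvg_finite_sum => l.
apply: cvgM; first exact: cvg_cst.
apply: cvgM; first exact: cvg_cst.
by apply: cvgB; [apply: cvgB|]; exact: QL.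
Qed.

Let window_corr_comb d : wc comb d = polarized (fun f => wc f d).
Proof.
pose Q n (f : 'rV[R]_h.+1 -> R) := \int[P]_w (xi f n 0 w * xi f n d w) / F n.
have QL f : calL nu N q f -> Q n f @[n --> \oo] --> wc f d.
  move=> Lf; have := pair_limit (d := d) drift u0 ndu uoo aoo nN q_ge0 delta0 qd Lf.
  apply: cvg_trans; apply: near_eq_cvg; apply: nearW => n.
  by rewrite /Q -(EE_block_phi_pair drift (calL_measurable Lf) n 0 d).
have h1 := QL _ Lcomb; have h2 := cvg_polarized QL.
suff e : (fun n => Q n comb) = (fun n => polarized (Q n)) by rewrite e in h1; exact: cvg_unique h1 h2.
have im f f' n i j : calL nu N q f -> calL nu N q f' -> intg P (fun w => xi f n i w * xi f' n j w).
  by move=> L1 L2; apply: intgM_sqr; (try exact: measurable_calL); exact: intg_calL_sqr.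
apply/funext => n; rewrite /Q /polarized.
under [RHS]eq_bigr => k _ do under eq_bigr => l _ do rewrite -!mulrBl mulrA mulrA.
under [RHS]eq_bigr => k _ do rewrite -mulr_suml.
rewrite -mulr_suml; congr (_ / _).
transitivity (\int[P]_w (\sum_k \sum_l t k * t l * 2^-1 *
   (xi (phi k \+ phi l) n 0 w * xi (phi k \+ phi l) n d w - xi (phi k) n 0 w * xi (phi k) n d w
     - xi (phi l) n 0 w * xi (phi l) n d w))); last first.
  rewrite EE_sum => [|k]; last first.
    by apply: intg_sum => l; apply: intgZ; apply: intgB; [apply: intgB|]; exact: im.
  apply: eq_bigr => k _; rewrite EE_sum => [|l]; last first.
    by apply: intgZ; apply: intgB; [apply: intgB|]; exact: im.
  apply: eq_bigr => l _; rewrite EE_Z; last by apply: intgB; [apply: intgB|]; exact: im.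
  by rewrite !EE_B//; try exact: im; apply: intgB; exact: im.
apply: eq_Rintegral => w _; rewrite /block_phi /comb /=.
set a := (u n)^-1 *: block X h 1 w; set b := (u n)^-1 *: block X h (d.+1)%:Z w.
transitivity (\sum_k \sum_l t k * t l * (phi k a * phi l b)).
  rewrite mulr_suml; apply: eq_bigr => k _; rewrite mulr_sumr; apply: eq_bigr => l _; ring.
transitivity (2^-1 * (\sum_k \sum_l t k * t l * (phi k a * phi l b)) +
   2^-1 * (\sum_k \sum_l t k * t l * (phi l a * phi k b))).
  rewrite [X in _ = _ + 2^-1 * X]exchange_big /=.
  rewrite (_ : \sum_(j < m) \sum_(i < m) t i * t j * (phi j a * phi i b) =
     \sum_k \sum_l t k * t l * (phi k a * phi l b)); first by field.
  by apply: eq_bigr => k _; apply: eq_bigr => l _; rewrite [t l * _]mulrC.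
rewrite !mulr_sumr -big_split /=; apply: eq_bigr => k _.
rewrite !mulr_sumr -big_split /=; apply: eq_bigr => l _.
ring.
Qed.

Lemma sigma2_combination : sigma2 nu comb = \sum_k \sum_l t k * t l * limit_cov nu (phi k) (phi l).
Proof.
pose Q n f := wc f 0 + 2 * \sum_(1 <= j < n) wc f j.
have QL f : calL nu N q f -> Q n f @[n --> \oo] --> sigma2 nu f.
  move=> Lf; have [_ cs _] := block_sum_clt Lf; rewrite sigma2E.
  apply: cvgD; first exact: cvg_cst.
  by apply: cvgM; [exact: cvg_cst|exact: cs].
have h1 := QL _ Lcomb; have h2 := cvg_polarized QL.
suff e : (fun n => Q n comb) = (fun n => polarized (Q n)) by rewrite e in h1; exact: cvg_unique h1 h2.
apply/funext => n; rewrite /Q window_corr_comb.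
under eq_bigr do rewrite window_corr_comb.
rewrite /polarized [X in 2 * X]exchange_big mulr_sumr -big_split /=; apply: eq_bigr => k _.
rewrite [X in 2 * X]exchange_big mulr_sumr -big_split /=; apply: eq_bigr => l _.
rewrite -!mulr_sumr !sumrB; ring.
Qed.

Lemma block_sum_combination n w : block_sum comb n w = \sum_k t k * block_sum (phi k) n w.
Proof.
have xiE j w' : xi comb n j w' = \sum_k t k * xi (phi k) n j w' by [].
have meanE : mean comb n = \sum_k t k * mean (phi k) n.
  rewrite -(EE_block_phi drift (calL_measurable Lcomb) n 0).
  under eq_Rintegral do rewrite xiE.
  rewrite EE_sum => [|k]; last by apply: intgZ; exact: intg_calL.
  apply: eq_bigr => k _; rewrite EE_Z ?(EE_block_phi drift (calL_measurable (Lphi k)))//.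
  exact: intg_calL.
rewrite /block_sum /psum; under [RHS]eq_bigr do rewrite mulr_sumr.
rewrite [RHS]exchange_big /=; apply: eq_bigr => j _.
rewrite /normalized meanE xiE -sumrB mulr_sumr; apply: eq_bigr => k _; ring.
Qed.
End combination.

Lemma measurable_block_sum phi n : calL nu N q phi -> measurable_fun setT (block_sum phi n).
Proof.
move=> L; apply: measurable_psum => j; apply: measurable_funM; first exact: measurable_cst.
by apply: measurable_funB; [exact: measurable_calL|exact: measurable_cst].
Qed.

Lemma intg_block_sum_sqr phi n : calL nu N q phi -> intg P (fun w => block_sum phi n w ^+ 2).
Proof.
move=> L; pose Zn j := normalized (xi phi n) (mean phi n) (Num.sqrt (n%:R * F n)) j.
have mZ j : measurable_fun setT (Zn j).
  apply: measurable_funM; first exact: measurable_cst.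
  by apply: measurable_funB; [exact: measurable_calL|exact: measurable_cst].
have iZ j : intg P (fun w => Zn j w ^+ 2).
  by apply: intg_normalized_sqr => i; [exact: measurable_calL|exact: intg_calL_sqr].
have -> : (fun w => block_sum phi n w ^+ 2) =
    (fun w => \sum_(0 <= i < n) \sum_(0 <= j < n) Zn i w * Zn j w).
  apply/funext => w; rewrite expr2 /block_sum /psum mulr_suml.
  by apply: eq_bigr => i _; rewrite mulr_sumr.
by apply: intg_sum => i; apply: intg_sum => j; exact: intgM_sqr.
Qed.

Lemma tail_process_block_sum phi : calL nu N q phi ->
  \forall n \near \oo, forall w, tail_process X u phi n w = block_sum phi n w.
Proof.
move=> L; have pos : \forall n \near \oo, 0 < n%:R * F n by move/cvgryPgt : aoo => /(_ 0).
near=> n => w; have a0 : 0 < n%:R * F n by near: n.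
have n0 : n%:R != 0 :> R by move: a0; apply: contraTneq => ->; rewrite mul0r ltxx.
have Tn w' : tail_average X u phi n w' = (n%:R * F n)^-1 * \sum_(0 <= i < n) xi phi n i w'.
  by rewrite /tail_average big_add1.
have iT : intg P (fun w' => \sum_(0 <= i < n) xi phi n i w').
  by apply: intg_sum => i; exact: intg_calL.
have ET : fine 'E_P[tail_average X u phi n] = (n%:R * F n)^-1 * (n%:R * mean phi n).
  rewrite unlock (_ : tail_average X u phi n = fun w' => (n%:R * F n)^-1 * \sum_(0 <= i < n) xi phi n i w'); last exact/funext.
  rewrite integral_EFin_EE; last exact: intgZ.
  rewrite /= EE_Z// EE_sum => [|i]; last exact: intg_calL.
  congr (_ * _); under eq_bigr do rewrite (EE_block_phi drift (calL_measurable L)).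
  by rewrite sumr_const_nat subn0 mulr_natl.
rewrite /tail_process ET Tn -mulrBr mulrA.
have -> : Num.sqrt (n%:R * F n) / (n%:R * F n) = (Num.sqrt (n%:R * F n))^-1.
  rewrite -{2}(sqr_sqrtr (ltW a0)) expr2 invfM mulrA divff ?mul1r//.
  by rewrite gt_eqF// sqrtr_gt0.
rewrite /block_sum /psum /normalized -mulr_sumr sumrB sumr_const_nat subn0.
by rewrite -[X in _ = _ * (_ - X)]mulr_natl.
Unshelve. all: by end_near. Qed.

Section gaussian_limit.
Context {dO'} {Omega' : measurableType dO'} {P' : probability Omega' R}
  {M : ('rV[R]_h.+1 -> R) -> {RV P' >-> R}}.
Hypothesis gM : centered_gaussian_process (calL nu N (q0 / 2)) (limit_cov nu) M.

Let calLq phi : calL nu N q phi -> calL nu N (q0 / 2) phi.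
Proof.
apply: (calL_le nN q_ge0); rewrite ler_pdivlMr//; apply: le_trans qd.
by rewrite ler_wpM2l// lerDl ltW.
Qed.

Lemma centered_limit phi : calL nu N q phi -> \int[P']_w M phi w = 0.
Proof.
move=> /calLq L; have := cgp_centered gM L.
by rewrite unlock /Rintegral => ->.
Qed.

Lemma intg_limit_sqr phi : calL nu N q phi -> intg P' (fun w => M phi w ^+ 2).
Proof.
move=> L; have G := @cgp_gaussian _ _ _ _ _ _ _ _ gM 1 (fun=> phi) (fun=> 1) (fun=> calLq L).
have e : (fun w => \sum_(k < 1) 1 * M phi w) = M phi.
  by apply/funext => w; rewrite big_ord1 mul1r.
rewrite e in G; have [] := gaussian_characterization _ G (centered_limit L) => //.
Qed.

Lemma covariance_limit phi psi : calL nu N q phi -> calL nu N q psi ->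
  \int[P']_w (M phi w * M psi w) = limit_cov nu phi psi.
Proof.
move=> L1 L2; have := cgp_covariance gM (calLq L1) (calLq L2).
have E0 f : calL nu N q f -> fine 'E_P'[M f] = 0.
  by move=> L; rewrite (cgp_centered gM (calLq L)).
rewrite unlock E0// E0// unlock /Rintegral => h0.
rewrite -[RHS]/(fine (limit_cov nu phi psi)%:E) -h0; congr fine.
apply: eq_integral => w _.
by rewrite -[((_ \- _) * _) w]/((M phi w - 0) * (M psi w - 0)) !subr0.
Qed.

(** A linear combination of the limit variables is a centered Gaussian variable,
    so its characteristic function depends on its variance only. *)
Lemma cos_limit m (phi : 'I_m -> 'rV[R]_h.+1 -> R) (t : 'I_m -> R) c :
  (forall k, calL nu N q (phi k)) ->
  \int[P']_w cos (\sum_k t k * M (phi k) w + c) =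
  expR (- ((\sum_k \sum_l t k * t l * limit_cov nu (phi k) (phi l)) / 2)) * cos c.
Proof.
move=> L; have G := cgp_gaussian gM t (fun k => calLq (L k)).
have mM f : measurable_fun setT (M f) by exact: measurable_funP.
have iM k : intg P' (M (phi k)) by apply: intg_of_sqr => //; exact: intg_limit_sqr.
have mS : measurable_fun setT (fun w => \sum_k t k * M (phi k) w).
  by apply: measurable_sum => k; apply: measurable_funM.
have mean0 : \int[P']_w (\sum_k t k * M (phi k) w) = 0.
  rewrite EE_sum => [|k]; last exact: intgZ.
  by rewrite big1// => k _; rewrite EE_Z// centered_limit// mulr0.
have [_ ->] := gaussian_characterization mS G mean0.
congr (expR (- (_ / 2)) * _).
have im k l : intg P' (fun w => t k * t l * (M (phi k) w * M (phi l) w)).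
  by apply: intgZ; apply: intgM_sqr => //; exact: intg_limit_sqr.
transitivity (\int[P']_w \sum_k \sum_l t k * t l * (M (phi k) w * M (phi l) w)).
  apply: eq_Rintegral => w _; rewrite expr2 mulr_suml; apply: eq_bigr => k _.
  by rewrite mulr_sumr; apply: eq_bigr => l _; ring.
rewrite EE_sum => [|k]; last exact: intg_sum.
apply: eq_bigr => k _; rewrite EE_sum => [|l]; last exact: im.
apply: eq_bigr => l _; rewrite EE_Z ?covariance_limit//.
by apply: intgM_sqr => //; exact: intg_limit_sqr.
Qed.

(** Linear combinations of the sums are the sums for the combined test function,
    hence their cosines converge to those of the Gaussian limit. *)
Theorem finite_dimensional_limit m (phi : 'I_m.+1 -> 'rV[R]_h.+1 -> R) :
  (forall k, calL nu N q (phi k)) ->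
  cvg_in_distribution P P'
    (fun n w => \row_(k < m.+1) tail_process X u (phi k) n w)
    (fun w => \row_(k < m.+1) M (phi k) w).
Proof.
move=> L f cf [K fK].
pose S n w k := block_sum (phi k) n w; pose S' w k := M (phi k) w.
have mS n k : measurable_fun setT (fun w => S n w k) by exact: measurable_block_sum.
have mS' k : measurable_fun setT (fun w => S' w k) by exact: measurable_funP.
have bnd k : exists B, \forall n \near \oo, \int[P]_w (block_sum (phi k) n w ^+ 2) <= B.
  by have [] := block_sum_clt (L k).
have [B hB] := choice bnd.
pose B' := \sum_k (`|B k| + \int[P']_w (M (phi k) w ^+ 2)).
have BB k : `|B k| + \int[P']_w (M (phi k) w ^+ 2) <= B'.
  rewrite /B' (bigD1 k)//= lerDl; apply: sumr_ge0 => j _; rewrite addr_ge0//.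
  by apply: EE_ge0 => w; exact: sqr_ge0.
have E0 k : 0 <= \int[P']_w (M (phi k) w ^+ 2) by apply: EE_ge0 => w; exact: sqr_ge0.
have cc (t : 'I_m.+1 -> R) c : \int[P]_w cos (\sum_k t k * S n w k + c) @[n --> \oo] -->
    \int[P']_w cos (\sum_k t k * S' w k + c).
  rewrite cos_limit// -sigma2_combination//.
  have Lc : calL nu N q (fun x => \sum_k t k * phi k x) by exact: calL_sum.
  have [_ _ h3] := block_sum_clt Lc.
  have := h3 c; apply: cvg_trans; apply: near_eq_cvg; apply: nearW => n.
  by apply: eq_Rintegral => w _; rewrite block_sum_combination.
have mom : \forall n \near \oo, forall k, intg P (fun w => S n w k ^+ 2) /\ \int[P]_w (S n w k ^+ 2) <= B'.
  apply: filter_forall => k; apply: filterS (hB k) => n hn; split; first exact: intg_block_sum_sqr.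
  by have := BB k; have := E0 k; have := ler_norm (B k); rewrite /S; lra.
have mom' k : intg P' (fun w => S' w k ^+ 2) /\ \int[P']_w (S' w k ^+ 2) <= B'.
  split; first exact: intg_limit_sqr.
  by have := BB k; have := normr_ge0 (B k); rewrite /S'; lra.
have lim := cvg_expectation_of_cos mS mS' cc mom mom' cf fK.
have mrow n : measurable_fun setT (fun w => f (\row_k S n w k)).
  apply: measurableT_comp (measurable_continuous_rV cf) _.
  apply: measurable_rV => k; rewrite (_ : (fun w => _) = (fun w => S n w k)) //.
  by apply/funext => w; rewrite mxE.
have mrow' : measurable_fun setT (fun w => f (\row_k S' w k)).
  apply: measurableT_comp (measurable_continuous_rV cf) _.
  apply: measurable_rV => k; rewrite (_ : (fun w => _) = (fun w => S' w k)) //.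
  by apply/funext => w; rewrite mxE.
rewrite [X in _ --> X](_ : _ = (\int[P']_w f (\row_k S' w k))%:E); last first.
  by rewrite unlock -integral_EFin_EE//; apply: (@intg_bounded _ _ _ P' _ K).
have same : \forall n \near \oo, 'E_P[f \o (fun w => \row_k tail_process X u (phi k) n w)]%E =
    (\int[P]_w f (\row_k S n w k))%:E.
  have all : \forall n \near \oo, forall k w, tail_process X u (phi k) n w = S n w k.
    by apply: filter_forall => k; exact: tail_process_block_sum.
  apply: filterS all => n hn; rewrite unlock -integral_EFin_EE; last exact: (@intg_bounded _ _ _ P _ K).
  apply: eq_integral => w _; congr (f _)%:E; apply/rowP => k; by rewrite !mxE hn.
apply: cvg_trans; first by apply: near_eq_cvg; apply: filterS same => n ->; reflexivity.
by apply: cvg_EFin; [exact: nearW|exact: lim].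
Qed.
End gaussian_limit.
End tail_process_limit.

Theorem theorem2p3 (R : realType)
  (dO : measure_display) (Omega : measurableType dO) (P : probability Omega R)
  (dE : measure_display) (E : measurableType dE)
  (Pi : R.-pker E ~> E) (Y : int -> {RV P >-> E}) (g : {mfun E >-> R})
  (X : int -> {RV P >-> R}) (alpha : R)
  (nu : forall i, {measure set (borel_punctured R i) -> \bar R})
  (V : {mfun E >-> R}) (q0 : R) (u : nat -> R)
  (h : nat) (N : 'rV[R]_h.+1 -> R) (eta q : R)
  (dO' : measure_display) (Omega' : measurableType dO')
  (P' : probability Omega' R) (M : ('rV[R]_h.+1 -> R) -> {RV P' >-> R}) :
  is_norm N ->
  (forall n, 0 < u n) ->
  nondecreasing_seq u ->
  u n @[n --> \oo] --> +oo ->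
  n%:R * survival X (u n) @[n --> \oo] --> +oo ->
  0 < eta ->
  ln n%:R `^ (1 + eta) * survival X (u n) @[n --> \oo] --> (0 : R) ->
  drift_assumption Pi Y g X alpha nu V q0 u ->
  0 <= q ->
  (q = 0 \/ exists delta : R, [/\ 0 < delta, q * (2 + delta) <= q0 &
     ln n%:R `^ (1 + eta) / (n%:R * survival X (u n)) `^ (delta / 2)
       @[n --> \oo] --> (0 : R)]) ->
  centered_gaussian_process (calL nu N (q0 / 2)) (limit_cov nu) M ->
  forall (m : nat) (phi : 'I_m -> 'rV[R]_h.+1 -> R),
    (1 <= m)%N -> (forall k, calL nu N q (phi k)) ->
    cvg_in_distribution P P'
      (fun n w => \row_(k < m) tail_process X u (phi k) n w)
      (fun w => \row_(k < m) M (phi k) w).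
Proof.
move=> nN u0 ndu uoo aoo eta0 logF drift q_ge0 qd gM [//|m] phi _ Lphi.
have [delta [d0 qd0]] : exists delta : R, 0 < delta /\ q * (2 + delta) <= q0.
  case: qd => [->|[delta [d0 qd0 _]]]; last by exists delta.
  by exists 1; split => //; rewrite mul0r; have /andP[/ltW] := drift_q0 drift.
exact: (finite_dimensional_limit drift u0 ndu uoo aoo nN q_ge0 d0 qd0 eta0 logF gM).
Qed.
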